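(* Let $0<p<\infty$ and let $k,n\in\mathbb Z$ satisfy $0\le k<n$. Let $g\in H(\mathbb D)$ be such that $T_g^{n,k}:H^2\to H^2$ is bounded. Then $T_g^{n,k}\in\mathcal S_p(H^2)$ if and only if $g\in B_{p,n-k}$.
   Context: $\mathbb D$ is the open unit disk in $\mathbb C$, $H(\mathbb D)$ is the space of all analytic functions on $\mathbb D$, and $dA$ is the normalized Lebesgue area measure on $\mathbb D$. $H^2$ is the Hardy space of analytic functions $f(z)=\sum_{j\ge0}\hat f_jz^j$ on $\mathbb D$ with inner product $\langle f,h\rangle_{H^2}=\sum_{j=0}^\infty\hat f_j\overline{\hat h_j}$. For $g\in H(\mathbb D)$ and integers $0\le k<n$, the generalized Volterra operator is $T_g^{n,k}f=I^n\left(f^{(k)}g^{(n-k)}\right)$ for $f\in H(\mathbb D)$, where $I^n$ is the $n$-th iterate of the integration operator $If(z)=\int_0^zf(t)\,dt$. For a positive integer $m$ and $p>0$, the Besov type space $B_{p,m}$ consists of all $f\in H(\mathbb D)$ such that $$\int_{\mathbb D}|f^{(m)}(z)|^p(1-|z|)^{mp}\frac{dA(z)}{(1-|z|)^2}<\infty.$$ For a Hilbert space $H$ and $0<p<\infty$, $\mathcal S_p(H)$ is the Schatten $p$-class of compact operators on $H$ whose singular value sequence is in $\ell^p$. *)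

(* Defs.v *)
From mathcomp Require Import all_boot all_order all_algebra.
From mathcomp Require Import complex.
From mathcomp Require Import all_classical all_reals all_analysis.
Set Implicit Arguments.
Unset Strict Implicit.
Unset Printing Implicit Defensive.
Import Order.TTheory GRing.Theory Num.Theory.
Import numFieldNormedType.Exports.
Import ComplexField.Normc.
Local Open Scope classical_set_scope.
Local Open Scope complex_scope.
Local Open Scope ring_scope.

Section HilbertSpaceOperators.
Variable R : realType.
Local Notation C := (R[i]).

(* A Hilbert space is given by its carrier, a set [H] of vectors of an ambient
   C-vector space [V], and its inner product [ip], linear in the first
   argument; operators on [H] are maps [V -> V], looked at on [H] only. *)
Variables (V : lmodType C) (H : set V) (ip : V -> V -> C).

Definition ipnorm (f : V) : R := Num.sqrt (complex.Re (ip f f)).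

Definition bounded_operator (T : V -> V) : Prop :=
  [/\ {homo T : f / H f},
      forall (a : C) (f h : V), H f -> H h -> T (a *: f + h) = a *: T f + T h
    & exists M : R, forall f : V, H f -> ipnorm (T f) <= M * ipnorm f].

Definition compact_operator (T : V -> V) : Prop :=
  bounded_operator T /\
  forall u : nat -> V,
    (forall j, H (u j)) -> (exists M : R, forall j, ipnorm (u j) <= M) ->
    exists (phi : nat -> nat) (h : V),
      [/\ {homo phi : i j / (i < j)%N}, H h
        & (fun j => ipnorm (T (u (phi j)) - h)) @ \oo --> (0 : R)].

Definition adjoint_operator (T S : V -> V) : Prop :=
  bounded_operator S /\
  forall f h : V, H f -> H h -> ip (T f) h = ip f (S h).

Definition has_basis (E : set V) (d : nat) (e : 'I_d -> V) : Prop :=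
  [/\ forall i, E (e i),
      forall c : 'I_d -> C, \sum_i c i *: e i = 0 -> forall i, c i = 0
    & forall f, E f -> exists c : 'I_d -> C, f = \sum_i c i *: e i].

Definition has_dimension (E : set V) (d : nat) : Prop :=
  exists e : 'I_d -> V, has_basis E e.

Definition eigenspace_on (A : V -> V) (mu : C) : set V :=
  [set f | H f /\ A f = mu *: f].

(* [s] lists the square roots of the eigenvalues of T^* T in nonincreasing
   order, each positive one repeated according to its multiplicity; if there
   are only finitely many positive ones, [s] is completed by zeros. *)
Definition singular_value_sequence (T : V -> V) (s : nat -> R) : Prop :=
  [/\ forall j, 0 <= s j,
      {homo s : i j / (i <= j)%N >-> j <= i}
    & exists2 S : V -> V, adjoint_operator T S &
      forall t : R, 0 < t -> exists2 d : nat,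
        has_dimension (eigenspace_on (S \o T) (t ^+ 2)%:C) d &
        ([set j | s j = t] #= `I_d)%card].

Definition schatten_class (p : R) (T : V -> V) : Prop :=
  compact_operator T /\
  exists2 s : nat -> R, singular_value_sequence T s &
    (\sum_(0 <= j <oo) (s j `^ p)%:E < +oo)%E.

End HilbertSpaceOperators.

Section AnalyticFunctionsOnDisk.
Variable R : realType.
Local Notation C := (R[i]).

Definition unit_disk : set C := [set z | normc z < 1].

(* The topology and the C-module structure of C are those of the regular
   module R[i]^o: [cderiv j f] is the j-th complex derivative of [f]. *)
Definition cderivable (f : C -> C) (z : C) : Prop :=
  derivable (f : R[i]^o -> R[i]^o) z 1.

Definition cderiv (j : nat) (f : C -> C) : C -> C :=
  derive1n j (f : R[i]^o -> R[i]^o).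

(* A function on the disk is represented by its extension by 0, so that
   equality on the disk is Leibniz equality and analytic functions sit in the
   C-vector space of all maps from C to C. *)
Definition analytic_disk : set (C -> C) :=
  [set f | (forall z, unit_disk z -> cderivable f z) /\
           (forall z, ~ unit_disk z -> f z = 0)].

Definition taylor_coef (f : C -> C) (j : nat) : C := cderiv j f 0 / j`!%:R.

Definition hardy2 : set (C -> C) :=
  [set f | analytic_disk f /\
    (\sum_(0 <= j <oo) (normc (taylor_coef f j) ^+ 2)%:E < +oo)%E].

Definition hardy2_ip (f h : C -> C) : C :=
  limn (series (fun j => taylor_coef f j * (taylor_coef h j)^*) : R[i]^o ^nat).

Definition cintegral01 (F : R -> C) : C :=
  (\int[lebesgue_measure]_(t in `[0%R, 1%R]) complex.Re (F t))
  +i* (\int[lebesgue_measure]_(t in `[0%R, 1%R]) complex.Im (F t)).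

(* integral of [f] along the segment t |-> t z, 0 <= t <= 1 *)
Definition integration (f : C -> C) (z : C) : C :=
  cintegral01 (fun t => f (t%:C * z) * z).

Definition volterra (g : C -> C) (n k : nat) (f : C -> C) : C -> C :=
  patch (fun=> 0) unit_disk
    (iter n integration (fun z => cderiv k f z * cderiv (n - k) g z)).

(* integral over the disk against the area measure normalized to 1 *)
Definition disk_integral (F : C -> \bar R) : \bar R :=
  ((pi^-1)%:E *
   \int[lebesgue_measure \x lebesgue_measure]_(w in
     [set w : R * R | unit_disk (w.1 +i* w.2)]) F (w.1 +i* w.2))%E.

Definition besov (p : R) (m : nat) : set (C -> C) :=
  [set f | analytic_disk f /\
    (disk_integral (fun z =>
       (normc (cderiv m f z) `^ p * (1 - normc z) `^ (m%:R * p)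
        / (1 - normc z) ^+ 2)%:E) < +oo)%E].

End AnalyticFunctionsOnDisk.

(* Main.v *)
(* Sample the derivatives on a dyadic polar grid of points z_v,l. A function in H^2 whose first
   Taylor coefficients vanish is controlled by the samples of its n-th derivative, and the n-th
   derivative of T f is f^(k) g^(n-k), so T is dominated by a weighted tree operator acting on
   the increments of f^(k) along the tree. For sufficiency, the subspace of codimension equal to
   the number of nodes with a large weighted ancestor sum is mapped with small norm, which bounds
   the singular numbers by the decreasing rearrangement of those sums. For necessity, the sum of
   s_j^p dominates the diagonal entries of T on the derivative kernels at the grid. *)

Require Import Defs.
From mathcomp Require Import all_boot all_order all_algebra.
From mathcomp Require Import complex.
From mathcomp Require Import all_classical all_reals all_analysis.
From mathcomp Require Import measurable_realfun.
From mathcomp Require Import ring lra zify.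

Set Implicit Arguments.
Unset Strict Implicit.
Unset Printing Implicit Defensive.
Import Order.TTheory GRing.Theory Num.Theory.
Import numFieldNormedType.Exports.
Import ComplexField.Normc.
Local Open Scope classical_set_scope.
Local Open Scope complex_scope.
Local Open Scope ring_scope.

(** Since p runs over all positive reals, duality and trace inequalities do not cover every case.
    Both directions compare counting functions instead: the number of nodes whose weight exceeds tau
    against the number of singular values above a multiple of tau. Necessity has to make the matrix
    of T on kernels diagonally dominant, hence the splitting of the grid into finitely many sparse
    families. Only row sums come out small directly; columns are gained by discarding at most half
    of a family. In the sufficiency, samples of f^(k) with their natural weight are not
    square-summable when k = 0, while their differences between neighbouring nodes are; this forces
    the increments. Sampling compares scales: on a grid of density K the mean over rotations is of
    size K, and moving the nodes costs an amount independent of K. Mean value inequalities for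
    |g^(n-k)|^p are replaced by the choice of the point in its cell: a near maximum when the
    integral is to be bounded, a near minimum when it is given. *)

Section ComplexModulus.
Variable R : realType.
Local Notation C := R[i].
Implicit Types (x y z : C) (r : R).

(** * The modulus of complex numbers *)

Lemma nc_ge0 x : 0 <= normc x.
Proof. by case: x => a b /=; rewrite sqrtr_ge0. Qed.

Lemma ncM x y : normc (x * y) = normc x * normc y.
Proof. exact: normcM. Qed.

Lemma ncD x y : normc (x + y) <= normc x + normc y.
Proof. exact: le_normcD. Qed.

Lemma ncN x : normc (- x) = normc x.
Proof. exact: normcN. Qed.

Lemma ncB x y : normc (x - y) <= normc x + normc y.
Proof. by rewrite -(ncN y); exact: ncD. Qed.

Lemma ncBC x y : normc (x - y) = normc (y - x).
Proof. by rewrite -ncN opprB. Qed.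

Lemma ncV x : normc x^-1 = (normc x)^-1.
Proof. exact: normcV. Qed.

Lemma nc1 : normc (1 : C) = 1.
Proof. exact: normc1. Qed.

Lemma nc0 : normc (0 : C) = 0.
Proof. exact: normc0. Qed.

Lemma ncX x n : normc (x ^+ n) = normc x ^+ n.
Proof. by elim: n => [|n ih]; rewrite ?expr0 ?nc1// !exprS ncM ih. Qed.

Lemma nc_real r : normc r%:C = `|r|.
Proof. by rewrite /= expr0n/= addr0 sqrtr_sqr. Qed.

Lemma nc_nat n : normc (n%:R : C) = n%:R.
Proof. by rewrite -(rmorph_nat (real_complex R)) nc_real normr_nat. Qed.

Lemma nc_conj x : normc x^* = normc x.
Proof. by case: x => a b /=; rewrite sqrrN. Qed.

Lemma nc_eq0 x : (normc x == 0) = (x == 0).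
Proof.
apply/eqP/eqP => [|->]; [exact: eq0_normc|exact: nc0].
Qed.

Lemma nc_gt0 x : (0 < normc x) = (x != 0).
Proof. by rewrite lt_def nc_ge0 andbT nc_eq0. Qed.

Lemma nc_sq x : normc x ^+ 2 = complex.Re x ^+ 2 + complex.Im x ^+ 2.
Proof. by case: x => a b /=; rewrite sqr_sqrtr// addr_ge0 ?sqr_ge0. Qed.

Lemma nc_Re x : `|complex.Re x| <= normc x.
Proof.
rewrite -(ler_pXn2r (ltn0Sn 1)) ?nnegrE ?nc_ge0// nc_sq.
by rewrite real_normK ?num_real// lerDl sqr_ge0.
Qed.

Lemma nc_Im x : `|complex.Im x| <= normc x.
Proof.
rewrite -(ler_pXn2r (ltn0Sn 1)) ?nnegrE ?nc_ge0// nc_sq.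
by rewrite real_normK ?num_real// lerDr sqr_ge0.
Qed.

Lemma nc_ReIm x : normc x <= `|complex.Re x| + `|complex.Im x|.
Proof.
rewrite -(ler_pXn2r (ltn0Sn 1)) ?nnegrE ?nc_ge0// ?addr_ge0// nc_sq.
rewrite sqrrD !real_normK ?num_real//.
have : 0 <= `|complex.Re x| * `|complex.Im x| by rewrite mulr_ge0.
lra.
Qed.

Lemma mulcJ x : x * x^* = (normc x ^+ 2)%:C.
Proof.
case: x => a b; apply/eqP; rewrite eq_complex /= sqr_sqrtr ?addr_ge0 ?sqr_ge0//.
by apply/andP; split; apply/eqP; ring.
Qed.

Lemma conj_real r : (r%:C : C)^* = r%:C.
Proof. exact: conjc_real. Qed.

Lemma mulJc x : x^* * x = (normc x ^+ 2)%:C.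
Proof. by rewrite mulrC mulcJ. Qed.

Lemma nc_dist (a b c : C) : normc (a - c) <= normc (a - b) + normc (b - c).
Proof. by apply: le_trans (ncD _ _); rewrite addrA subrK. Qed.

Lemma nc_sub_ge (a b : C) : normc a - normc b <= normc (a - b).
Proof. by rewrite lerBlDr; apply: le_trans (ncD _ _); rewrite subrK. Qed.

Lemma nc_add_ge (a b : C) : normc a - normc b <= normc (a + b).
Proof. by have := nc_sub_ge a (- b); rewrite opprK ncN. Qed.

Lemma nc_sum (I : Type) (s : seq I) (P : pred I) (F : I -> C) :
  normc (\sum_(i <- s | P i) F i) <= \sum_(i <- s | P i) normc (F i).
Proof.
elim/big_rec2: _ => [|i y1 y2 _ ih]; first by rewrite nc0.
by apply: le_trans (ncD _ _) _; rewrite lerD2l.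
Qed.

Lemma nc_normE x : `|x| = (normc x)%:C.
Proof. by []. Qed.

Lemma ReD x y : complex.Re (x + y) = complex.Re x + complex.Re y.
Proof. by case: x; case: y. Qed.
Lemma ImD x y : complex.Im (x + y) = complex.Im x + complex.Im y.
Proof. by case: x; case: y. Qed.
Lemma ReN x : complex.Re (- x) = - complex.Re x.
Proof. by case: x. Qed.
Lemma ImN x : complex.Im (- x) = - complex.Im x.
Proof. by case: x. Qed.
Lemma Re_mul x y : complex.Re (x * y) =
  complex.Re x * complex.Re y - complex.Im x * complex.Im y.
Proof. by case: x; case: y. Qed.
Lemma Im_mul x y : complex.Im (x * y) =
  complex.Re x * complex.Im y + complex.Im x * complex.Re y.
Proof. by case: x; case: y. Qed.

Lemma le_C r s : (r%:C <= s%:C :> C) = (r <= s).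
Proof. by rewrite lecE /= eqxx. Qed.
Lemma lt_C r s : (r%:C < s%:C :> C) = (r < s).
Proof. by rewrite ltcE /= eqxx. Qed.

Lemma gt0_C (e : C) : 0 < e -> exists2 r, 0 < r & e = r%:C.
Proof.
case: e => a b; rewrite ltcE /= => /andP[/eqP ->] a0; by exists a.
Qed.

Lemma nc_cvgP (T : Type) (F : set_system T) (FF : Filter F) (f : T -> R[i]^o) (l : C) :
  (f @ F --> (l : R[i]^o)) <-> (fun t => normc (f t - l)) @ F --> (0 : R).
Proof.
split.
  move/cvgrPdist_le => h; apply/cvgrPdist_le => e e0.
  have /h : 0 < e%:C :> C by rewrite lt_C.
  apply: filterS => x; rewrite nc_normE le_C.
  by rewrite sub0r normrN ger0_norm ?nc_ge0// ncBC.
move/cvgrPdist_le => h; apply/cvgrPdist_le => _ /gt0_C[r r0 ->].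
move: (h r r0); apply: filterS => x; rewrite nc_normE le_C.
by rewrite sub0r normrN ger0_norm ?nc_ge0// ncBC.
Qed.

End ComplexModulus.

Arguments cderiv : simpl never.

(** * Complex derivatives in epsilon-delta form *)

Section ComplexDerivative.
Variable R : realType.
Local Notation C := R[i].
Implicit Types (f g : C -> C) (z d : C).

(** Tolerances and distances are real and measured by [normc], so the calculus below stays away from
    the topology of the regular module; [has_cderivE] is the bridge to it. *)
Definition has_cderiv f z d := forall e : R, 0 < e ->
  exists2 dl : R, 0 < dl & forall h, normc h < dl ->
    normc (f (z + h) - f z - d * h) <= e * normc h.

Lemma has_cderivE f z d : has_cderiv f z d <->
  (fun h : C => h^-1 *: (f (h + z) - f z) : R[i]^o) @ (0 : R[i]^o)^' --> (d : R[i]^o).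
Proof.
split.
  move=> H; apply/cvgrPdist_le => _ /gt0_C[e e0 ->].
  have [dl dl0 Hd] := H e e0.
  apply/nbhs_ballP; exists dl%:C => /=; first by rewrite lt_C.
  move=> h; rewrite -ball_normE /= sub0r normrN nc_normE lt_C => hd h0.
  rewrite nc_normE le_C.
  have -> : d - h^-1 *: (f (h + z) - f z) =
            - (h^-1 * (f (z + h) - f z - d * h)).
    by rewrite /GRing.scale /= (addrC z); field.
  rewrite ncN ncM ncV mulrC ler_pdivrMr ?nc_gt0//; exact: Hd.
move/cvgrPdist_le => H e e0.
have /H : 0 < e%:C :> C by rewrite lt_C.
move=> /nbhs_ballP[_ /= /gt0_C[dl dl0 ->]] Hd; exists dl => // h hd.
have [->|h0] := eqVneq h 0.
  by rewrite addr0 mulr0 subrr subr0 nc0 mulr0.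
have /= := Hd h.
rewrite -ball_normE /= sub0r normrN nc_normE lt_C => /(_ hd h0).
rewrite nc_normE le_C.
have -> : d - h^-1 *: (f (h + z) - f z) =
            - (h^-1 * (f (z + h) - f z - d * h)).
  by rewrite /GRing.scale /= (addrC z); field.
by rewrite ncN ncM ncV mulrC ler_pdivrMr ?nc_gt0.
Qed.

Lemma has_cderiv_cderivable f z d : has_cderiv f z d -> cderivable f z.
Proof.
move/has_cderivE => H; apply/cvg_ex; exists d => /=.
rewrite (_ : (fun h : R[i]^o => _) = (fun h : C => h^-1 *: (f (h + z) - f z) : R[i]^o))//.
by apply/funext => h /=; rewrite [h *: 1]mulr1.
Qed.

Lemma has_cderiv_cderiv f z d : has_cderiv f z d -> cderiv 1 f z = d.
Proof.
move/has_cderivE => H; have E := cvg_lim (@norm_hausdorff _ _) H; exact: E.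
Qed.

Lemma cderivable_has_cderiv f z : cderivable f z -> has_cderiv f z (cderiv 1 f z).
Proof.
move=> /cvg_ex[/= l Hl].
have : has_cderiv f z l.
  apply/has_cderivE; move: Hl.
  rewrite (_ : (fun h : R[i]^o => _) = (fun h : C => h^-1 *: (f (h + z) - f z) : R[i]^o))//.
  by apply/funext => h /=; rewrite [h *: 1]mulr1.
by move=> H; rewrite (has_cderiv_cderiv H).
Qed.

Lemma cderivS j f : cderiv j.+1 f = cderiv 1 (cderiv j f).
Proof. by []. Qed.

Lemma cderivD i j f : cderiv (i + j) f = cderiv i (cderiv j f).
Proof. by rewrite /cderiv /derive1n iterD. Qed.

Lemma has_cderiv_cont f z d : has_cderiv f z d -> forall e : R, 0 < e ->
  exists2 dl : R, 0 < dl & forall w, normc (w - z) < dl -> normc (f w - f z) <= e.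
Proof.
move=> H e e0; have [dl dl0 Hd] := H 1 ltr01.
have d0 : 0 < 1 + normc d by rewrite ltr_pwDl// nc_ge0.
exists (Num.min dl (e / (1 + normc d))); first by rewrite lt_min dl0 divr_gt0.
move=> w; rewrite lt_min => /andP[w1 w2].
have := Hd _ w1; rewrite mul1r (addrC z) subrK => H1.
rewrite -(subrK (d * (w - z)) (f w - f z)).
apply: le_trans (ncD _ _) _; rewrite ncM.
move: w2; rewrite ltr_pdivlMr// => w2.
apply: le_trans (lerD H1 (lexx _)) _.
by rewrite -{1}[normc (w - z)]mul1r -mulrDl mulrC ltW.
Qed.

Lemma has_cderivM f g z a b : has_cderiv f z a -> has_cderiv g z b ->
  has_cderiv (fun w => f w * g w) z (a * g z + f z * b).
Proof.
move=> Hf Hg e e0.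
set A := normc a; set B := normc b; set F := normc (f z); set G := normc (g z).
have A0 : 0 <= A := nc_ge0 _. have B0 : 0 <= B := nc_ge0 _.
have F0 : 0 <= F := nc_ge0 _. have G0 : 0 <= G := nc_ge0 _.
(* The error of the product is u g + f v + (a h + u)(b h + v). Its terms cost G, F and (A + 1)(B +
   1) times e1 |h|; [D] exceeds the sum of these factors by 1. *)
pose D := 1 + G + F + (A + 1) * (B + 1).
have AB0 : 0 <= (A + 1) * (B + 1) by rewrite mulr_ge0// addr_ge0.
have D0 : 0 < D by rewrite /D; lra.
pose e1 := e / D.
have e10 : 0 < e1 by rewrite divr_gt0.
have [d1 d10 H1] := Hf (Num.min 1 e1) ltac:(by rewrite lt_min ltr01).
have [d2 d20 H2] := Hg (Num.min 1 e1) ltac:(by rewrite lt_min ltr01).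
exists (Num.min e1 (Num.min d1 d2)); first by rewrite !lt_min e10 d10 d20.
move=> h; rewrite !lt_min => /and3P[he h1 h2].
have := H1 h h1; set u := _ - _ - _ => Hu; have := H2 h h2; set v := (g _ - _ - _) => Hv.
have -> : f (z + h) * g (z + h) - f z * g z - (a * g z + f z * b) * h =
  u * g z + f z * v + (a * h + u) * (b * h + v) by rewrite /u /v; ring.
have H0 : 0 <= normc h := nc_ge0 _.
apply: le_trans (ncD _ _) _; apply: le_trans (lerD (ncD _ _) (lexx _)) _; rewrite !ncM -/F -/G.
have m1 x : 0 <= x -> Num.min 1 e1 * x <= x.
  by move=> x0; rewrite -[leRHS]mul1r ler_wpM2r// ge_min lexx.
have m2 x : 0 <= x -> Num.min 1 e1 * x <= e1 * x.
  by move=> x0; rewrite ler_wpM2r// ge_min lexx orbT.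
have K1 : normc (a * h + u) <= (A + 1) * normc h.
  apply: le_trans (ncD _ _) _; rewrite ncM mulrDl lerD2l mul1r.
  exact: le_trans Hu (m1 _ _).
have K2 : normc (b * h + v) <= (B + 1) * e1.
  have : normc (b * h + v) <= (B + 1) * normc h.
    apply: le_trans (ncD _ _) _; rewrite ncM mulrDl lerD2l mul1r.
    exact: le_trans Hv (m1 _ _).
  by move=> /le_trans; apply; rewrite ler_wpM2l ?addr_ge0// ltW.
have K4 := ler_pM (nc_ge0 _) (nc_ge0 _) K1 K2.
have K5 : normc u * G <= e1 * normc h * G.
  by rewrite ler_wpM2r//; exact: le_trans Hu (m2 _ _).
have K6 : F * normc v <= F * (e1 * normc h).
  by rewrite ler_wpM2l//; exact: le_trans Hv (m2 _ _).
apply: le_trans (lerD (lerD K5 K6) K4) _.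
have -> : e1 * normc h * G + F * (e1 * normc h) + (A + 1) * normc h * ((B + 1) * e1)
  = e1 * normc h * (D - 1) by rewrite /D; ring.
have -> : e * normc h = e1 * normc h * D by rewrite /e1; field; rewrite gt_eqF.
by apply: ler_wpM2l; [rewrite mulr_ge0// ltW|rewrite lerBlDr lerDl].
Qed.

Lemma has_cderivD f g z a b : has_cderiv f z a -> has_cderiv g z b ->
  has_cderiv (fun w => f w + g w) z (a + b).
Proof.
move=> Hf Hg e e0; have e20 : 0 < e / 2 by rewrite divr_gt0.
have [d1 d10 H1] := Hf _ e20; have [d2 d20 H2] := Hg _ e20.
exists (Num.min d1 d2); first by rewrite lt_min d10.
move=> h; rewrite lt_min => /andP[h1 h2].
have -> : f (z + h) + g (z + h) - (f z + g z) - (a + b) * h =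
  (f (z + h) - f z - a * h) + (g (z + h) - g z - b * h) by ring.
apply: le_trans (ncD _ _) _; apply: le_trans (lerD (H1 _ h1) (H2 _ h2)) _.
by rewrite -mulrDl -splitr.
Qed.

Lemma has_cderiv_cst (c : C) z : has_cderiv (fun=> c) z 0.
Proof.
move=> e e0; exists 1 => // h _.
by rewrite subrr mul0r subr0 nc0 mulr_ge0 ?nc_ge0// ltW.
Qed.

Lemma has_cderiv_near f g z d (r : R) : 0 < r ->
  (forall w, normc (w - z) < r -> f w = g w) ->
  has_cderiv f z d -> has_cderiv g z d.
Proof.
move=> r0 fg Hf e e0; have [d1 d10 H1] := Hf _ e0.
exists (Num.min d1 r); first by rewrite lt_min d10.
move=> h; rewrite lt_min => /andP[h1 h2].
by rewrite -!fg ?subrr ?nc0//; [exact: H1|rewrite addrC addKr].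
Qed.

Lemma cderiv_near f g z (r : R) : 0 < r ->
  (forall w, normc (w - z) < r -> f w = g w) ->
  cderivable f z -> cderiv 1 g z = cderiv 1 f z.
Proof.
move=> r0 fg /cderivable_has_cderiv /(has_cderiv_near r0 fg).
exact: has_cderiv_cderiv.
Qed.

Lemma disk_nbhd z : normc z < 1 -> exists2 r : R, 0 < r &
  forall w, normc (w - z) < r -> normc w < 1.
Proof.
move=> z1; exists (1 - normc z); first by rewrite subr_gt0.
by move=> w; rewrite ltrBrDr => /(le_lt_trans _); apply; rewrite -{1}(subrK z w) ncD.
Qed.

(** The induction works because the derivatives of order j agree on a neighbourhood of each point of
    the disk, not only at the point. *)
Lemma cderiv_disk j f g :
  (forall w, normc w < 1 -> f w = g w) ->
  (forall i w, (i < j)%N -> normc w < 1 -> cderivable (cderiv i f) w) ->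
  forall w, normc w < 1 -> cderiv j f w = cderiv j g w.
Proof.
move=> fg; elim: j => [|j ih] D w w1; first exact: fg.
have [r r0 Hr] := disk_nbhd w1.
rewrite 2!(cderivS j); apply/esym/(cderiv_near r0); last exact: D.
by move=> v /Hr; apply: ih => i u ij; apply: D; rewrite ltnW.
Qed.

End ComplexDerivative.

(** * Extraction of convergent subsequences *)

Section CoefficientExtraction.
Variable R : realType.
Local Notation C := R[i].

Lemma real_subseq (u : nat -> R) (B : R) : (forall n, `|u n| <= B) ->
  exists (f : nat -> nat) (l : R), {homo f : i j / (i < j)%N} /\ (u \o f) @ \oo --> l.
Proof.
move=> uB; have bu : bounded_fun u.
  exists B; split; first exact: num_real.
  by move=> x Bx n _; apply: le_trans (uB n) (ltW Bx).
have [f incf /cvg_ex[/= l fl]] := bolzano_weierstrass bu.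
exists f, l; split; last exact: fl.
by move=> i j ij; have /= := leW_mono incf i j; rewrite !ltEnat /= => ->.
Qed.

Lemma subseq_cvg (T : topologicalType) (u : nat -> T) (f : nat -> nat) (l : T) :
  {homo f : i j / (i < j)%N} -> u @ \oo --> l -> (u \o f) @ \oo --> l.
Proof.
move=> hf ul; apply: cvg_comp ul => A [N _ HN]; exists N => // n /= Nn.
apply: HN => /=; apply: leq_trans Nn _.
by elim: n => // n ih; exact: leq_ltn_trans ih (hf _ _ (ltnSn n)).
Qed.

Lemma complex_subseq (u : nat -> C) (B : R) : (forall n, normc (u n) <= B) ->
  exists (f : nat -> nat) (l : C), {homo f : i j / (i < j)%N} /\
    (fun n => normc (u (f n) - l)) @ \oo --> (0 : R).
Proof.
move=> uB.
have [f [a [hf fa]]] := @real_subseq (fun n => complex.Re (u n)) B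
  (fun n => le_trans (nc_Re _) (uB n)).
have [g [b [hg gb]]] := @real_subseq (fun n => complex.Im (u (f n))) B
  (fun n => le_trans (nc_Im _) (uB _)).
exists (f \o g), (a +i* b); split; first by move=> i j ij /=; exact/hf/hg.
have ra := subseq_cvg hg fa.
have : (fun n => `|complex.Re (u (f (g n))) - a| + `|complex.Im (u (f (g n))) - b|) @ \oo --> (0:R).
  rewrite -[X in _ --> X](addr0 0); apply: cvgD.
    have := cvg_norm (cvgB ra (cvg_cst a)); rewrite subrr normr0; exact.
  have := cvg_norm (cvgB gb (cvg_cst b)); rewrite subrr normr0; exact.
apply: squeeze_cvgr; last exact: cvg_cst.
near=> n; rewrite nc_ge0 /=; apply: le_trans (nc_ReIm _) _.
by rewrite ReD ImD ReN ImN.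
Unshelve. all: by end_near.
Qed.

(** Diagonal extraction: [phi j.+1] refines [phi j] so that coefficient j converges, and for n > j
    the diagonal value [phi n n] is a value of [phi j.+1] at an argument at least n. *)
Lemma coef_subseq (u : nat -> nat -> C) (B : nat -> R) :
  (forall n j, normc (u n j) <= B j) ->
  exists (f : nat -> nat) (l : nat -> C), {homo f : i j / (i < j)%N} /\
    forall j, (fun n => normc (u (f n) j - l j)) @ \oo --> (0 : R).
Proof.
move=> uB.
have step (j : nat) (f : nat -> nat) : exists gl : (nat -> nat) * C,
    {homo gl.1 : i j / (i < j)%N} /\
    (fun n => normc (u (f (gl.1 n)) j - gl.2)) @ \oo --> (0 : R).
  have [g [l [hg gl]]] := @complex_subseq (fun n => u (f n) j) (B j) (fun n => uB _ _).
  by exists (g, l).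
pose G j f := projT1 (cid (step j f)).
pose phi := fix phi j := if j is j'.+1 then phi j' \o (G j' (phi j')).1 else id.
pose l j := (G j (phi j)).2.
have Gh j : {homo (G j (phi j)).1 : i j / (i < j)%N}.
  by rewrite /G; case: cid => -[g ll] /= [].
have Gl j : (fun n => normc (u (phi j.+1 n) j - l j)) @ \oo --> (0 : R).
  by rewrite /l /= /G; case: cid => -[g ll] /= [].
have hphi j : {homo phi j : i j / (i < j)%N}.
  by elim: j => [//|j ih] a b ab /=; exact/ih/Gh.
have ge_id (h : nat -> nat) : {homo h : i j / (i < j)%N} -> forall n, (n <= h n)%N.
  by move=> hh; elim=> // n ih; exact: leq_ltn_trans ih (hh _ _ (ltnSn n)).
have tail j d : exists2 h : nat -> nat, {homo h : i j / (i < j)%N} & phi (j + d)%N = phi j \o h.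
  elim: d => [|d [h hh E]]; first by exists id; rewrite ?addn0.
  exists (h \o (G (j + d)%N (phi (j + d)%N)).1); first by move=> a b ab /=; exact/hh/Gh.
  rewrite addnS; apply/funext => x /=.
  exact: (congr1 (fun f => f ((G (j + d)%N (phi (j + d)%N)).1 x)) E).
exists (fun n => phi n n), l; split.
  apply: (@homo_ltn _ (fun n => phi n n) (fun a b => (a < b)%N)); first (by move=> a b c; exact: ltn_trans).
  move=> n /=; apply: hphi; exact: leq_ltn_trans (ge_id _ (Gh n) n) (Gh n _ _ (ltnSn n)).
move=> j; apply/cvgrPdist_le => e e0; move/cvgrPdist_le : (Gl j) => /(_ e e0) [N _ HN].
exists (maxn N j.+1) => // n /=; rewrite geq_max => /andP[Nn jn].
have [h hh E] := tail j.+1 (n - j.+1)%N.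
have -> : phi n n = phi j.+1 (h n) by rewrite -(subnKC jn) E /= subnKC.
by apply: HN => /=; apply: leq_trans Nn (ge_id _ hh _).
Qed.

End CoefficientExtraction.

(** * Integrals of continuous functions over [0, 1] *)

Section UnitIntervalIntegral.
Variable R : realType.
Local Notation C := R[i].
Local Notation mu := (@lebesgue_measure R).

(** The point [s] ranges over a neighbourhood in the whole line, also at the endpoints, so affine
    changes of variable preserve the property without a case distinction. *)
Definition cont01 (phi : R -> R) := forall t : R, 0 <= t <= 1 ->
  forall e : R, 0 < e -> exists2 d : R, 0 < d &
  forall s, `|s - t| < d -> `|phi s - phi t| <= e.

Lemma cont01_within phi : cont01 phi -> {within `[0, 1]%classic, continuous phi}.
Proof.
move=> H; apply: continuous_in_subspaceT => t; rewrite inE /= in_itv /= => t01.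
apply/cvgrPdist_le => e e0; have [d d0 Hd] := H t t01 e e0.
apply/nbhs_ballP; exists d => //= s; rewrite /ball /= => ts.
by rewrite distrC; apply: Hd; rewrite distrC.
Qed.

Lemma cont01_integrable phi : cont01 phi -> mu.-integrable `[0, 1]%classic (EFin \o phi).
Proof.
by move=> /cont01_within H; apply: continuous_compact_integrable H; exact: segment_compact.
Qed.

Local Notation I phi := (\int[mu]_(t in `[0%R, 1%R]) phi t).

Lemma I_cst (r : R) : I (fun=> r) = r.
Proof.
rewrite Rintegral_cst//; have := lebesgue_measure_itv (`[0%R,1%R] : interval R).
by rewrite /= lte_fin ltr01 oppr0 adde0 => ->; rewrite mulr1.
Qed.

Lemma I_D f g : cont01 f -> cont01 g -> I (fun t => f t + g t) = I f + I g.
Proof. by move=> /cont01_integrable ? /cont01_integrable ?; rewrite RintegralD. Qed.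

Lemma I_Z r f : cont01 f -> I (fun t => r * f t) = r * I f.
Proof. by move=> /cont01_integrable ?; rewrite RintegralZl. Qed.

Lemma I_ext f g : (forall t, 0 <= t <= 1 -> f t = g t) -> I f = I g.
Proof. by move=> fg; apply: eq_Rintegral => t; rewrite inE /= in_itv /= => /fg. Qed.

Lemma cont01D f g : cont01 f -> cont01 g -> cont01 (fun t => f t + g t).
Proof.
move=> Hf Hg t t01 e e0; have e2 : 0 < e / 2 by rewrite divr_gt0.
have [d1 d10 H1] := Hf t t01 _ e2; have [d2 d20 H2] := Hg t t01 _ e2.
exists (Num.min d1 d2); first by rewrite lt_min d10.
move=> s; rewrite lt_min => /andP[s1 s2].
rewrite opprD addrACA (splitr e); apply: le_trans (ler_normD _ _) _.
by rewrite lerD ?H1 ?H2.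
Qed.

Lemma cont01Z r f : cont01 f -> cont01 (fun t => r * f t).
Proof.
move=> Hf t t01 e e0; have e2 : 0 < e / (1 + `|r|) by rewrite divr_gt0// ltr_pwDl.
have [d1 d10 H1] := Hf t t01 _ e2; exists d1 => // s /H1 h.
rewrite -mulrBr normrM; apply: le_trans (ler_wpM2l (normr_ge0 _) h) _.
rewrite mulrCA ler_piMr ?(ltW e0)// ler_pdivrMr ?ltr_pwDl// mul1r.
by rewrite lerDr.
Qed.

Lemma cont01_cst r : cont01 (fun=> r).
Proof. by move=> t t01 e e0; exists 1 => // s _; rewrite subrr normr0 ltW. Qed.

Lemma I_le f g : cont01 f -> cont01 g -> (forall t, 0 <= t <= 1 -> f t <= g t) -> I f <= I g.
Proof.
move=> /cont01_integrable ? /cont01_integrable ? fg; apply: le_Rintegral => // t; rewrite /= in_itv /= => /fg.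
Qed.

Lemma I_bound f B : cont01 f -> (forall t, 0 <= t <= 1 -> `|f t| <= B) -> `|I f| <= B.
Proof.
move=> cf fB; rewrite ler_norml; apply/andP; split.
  rewrite -[leLHS]I_cst; apply: I_le => //; first exact: cont01_cst.
  by move=> t /fB; rewrite ler_norml => /andP[].
rewrite -[leRHS]I_cst; apply: I_le => //; first exact: cont01_cst.
by move=> t /fB; rewrite ler_norml => /andP[].
Qed.

Lemma I_rev f : cont01 f -> I f = I (fun t => f (1 - t)).
Proof.
move=> cf; rewrite (@Rintegration_by_substitution_onem _ f 1) ?lexx ?ler01//.
  by rewrite /unstable.onem subrr.
exact: cont01_within.
Qed.

Lemma I_sub_half f (s : R) : s = 0 \/ s = 1 -> cont01 f ->
  \int[mu]_(t in `[s / 2, (s + 1) / 2]) f t = 2^-1 * I (fun t => f ((t + s) / 2)).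
Proof.
move=> s01 cf; pose F (t : R) := (t + s) / 2.
have dF (x : R) : is_derive x (1 : R) (F : R -> R) (2^-1 : R).
  rewrite /F; have -> : (fun t => (t + s) / 2) = (fun t : R => 2^-1 *: (id t + s)).
    by apply/funext => t; rewrite mulrC.
  by apply: is_derive_eq; rewrite addr0 /GRing.scale /= mulr1.
have dFE : F^`()%classic = cst (2^-1).
  by apply/funext => x; rewrite derive1E; exact: derive_val.
have cF : continuous F.
  by move=> x; apply: differentiable_continuous; apply/derivable1_diffP; exact: ex_derive.
have F0 : F 0 = s / 2 by rewrite /F add0r.
have F1 : F 1 = (s + 1) / 2 by rewrite /F addrC.
have cw : {within `[F 0, F 1]%classic, continuous f}.
  apply: continuous_subspaceW (cont01_within cf) => x /=; rewrite !in_itv /= F0 F1.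
  by case: s01 => -> /andP[a b]; apply/andP; split; lra.
have := @integration_by_substitution_increasing R F f 0 1 ler01.
rewrite dFE F0 F1 in cw * => /(_ _ _ _ _ _ cw) H.
rewrite /Rintegral H.
- rewrite -[RHS]I_Z; last first.
    move=> t t01 e e0; have t01' : 0 <= F t <= 1.
      by rewrite /F; case: s01 t01 => -> /andP[? ?]; apply/andP; split; lra.
    have [d d0 Hd] := cf _ t01' e e0; exists d => // v vt; apply: Hd.
    apply: le_lt_trans vt; rewrite /F -mulrBl opprD addrACA subrr addr0 normrM.
    by rewrite ler_piMr// ger0_norm//; lra.
  rewrite /Rintegral; congr fine; apply: eq_integral => x _ /=.
  by rewrite mulrC.
- by move=> x y _ _ xy; rewrite /F ltr_pM2r// ltrD2r.
- by move=> x _; exact: cvg_cst.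
- by apply: is_cvg_cst.
- by apply: is_cvg_cst.
- split; first by move=> x _; exact: ex_derive.
  + by apply: cvg_at_right_filter; exact: cF.
  + by apply: cvg_at_left_filter; exact: cF.
Qed.

Lemma I_split f : cont01 f ->
  I f = 2^-1 * I (fun t => f (t / 2)) + 2^-1 * I (fun t => f ((t + 1) / 2)).
Proof.
move=> cf.
have -> : (fun t => f (t / 2)) = (fun t => f ((t + 0) / 2)).
  by apply/funext => t; rewrite addr0.
rewrite -!I_sub_half; [|by right| by []|by left|by []].
rewrite mul0r add0r.
have /eqP := @Rintegral_itvB R f (BLeft 0) (BRight 1) (1 / 2) (cont01_integrable cf)
  ltac:(by rewrite bnd_simp; lra) ltac:(by rewrite bnd_simp; lra).
rewrite subr_eq => /eqP ->; rewrite addrC; congr (_ + _).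
have -> : ((1 + 1) / 2 : R) = 1 by lra.
apply: Rintegral_itv_obnd_cbnd.
apply: integrableS (cont01_integrable cf) => //.
by apply: subset_itv; rewrite bnd_simp; lra.
Qed.

End UnitIntervalIntegral.

(** * Integrals along segments in the disk *)

Section SegmentIntegral.
Variable R : realType.
Local Notation C := R[i].
Local Notation mu := (@lebesgue_measure R).

Definition ccont01 (phi : R -> C) := forall t : R, 0 <= t <= 1 ->
  forall e : R, 0 < e -> exists2 d : R, 0 < d &
  forall s, `|s - t| < d -> normc (phi s - phi t) <= e.

Lemma ccont01_Re phi : ccont01 phi -> cont01 (fun t => complex.Re (phi t)).
Proof.
move=> H t t01 e e0; have [d d0 Hd] := H t t01 e e0; exists d => // s /Hd.
by apply: le_trans; rewrite -ReN -ReD nc_Re.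
Qed.

Lemma ccont01_Im phi : ccont01 phi -> cont01 (fun t => complex.Im (phi t)).
Proof.
move=> H t t01 e e0; have [d d0 Hd] := H t t01 e e0; exists d => // s /Hd.
by apply: le_trans; rewrite -ImN -ImD nc_Im.
Qed.

Lemma ccont01D f g : ccont01 f -> ccont01 g -> ccont01 (fun t => f t + g t).
Proof.
move=> Hf Hg t t01 e e0; have e2 : 0 < e / 2 by rewrite divr_gt0.
have [d1 d10 H1] := Hf t t01 _ e2; have [d2 d20 H2] := Hg t t01 _ e2.
exists (Num.min d1 d2); first by rewrite lt_min d10.
move=> s; rewrite lt_min => /andP[s1 s2].
rewrite opprD addrACA (splitr e); apply: le_trans (ncD _ _) _.
by rewrite lerD ?H1 ?H2.
Qed.

Lemma ccont01Z c f : ccont01 f -> ccont01 (fun t => c * f t).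
Proof.
move=> Hf t t01 e e0; have p : 0 < 1 + normc c by rewrite ltr_pwDl// nc_ge0.
have e2 : 0 < e / (1 + normc c) by rewrite divr_gt0.
have [d1 d10 H1] := Hf t t01 _ e2; exists d1 => // s /H1 h.
rewrite -mulrBr ncM; apply: le_trans (ler_wpM2l (nc_ge0 _) h) _.
by rewrite mulrCA ler_piMr ?(ltW e0)// ler_pdivrMr// mul1r lerDr.
Qed.

Lemma ccont01_cst c : ccont01 (fun=> c).
Proof. by move=> t t01 e e0; exists 1 => // s _; rewrite subrr nc0 ltW. Qed.

Lemma ccont01_id : ccont01 (fun t => t%:C).
Proof. by move=> t t01 e e0; exists e => // s /ltW; rewrite -raddfB nc_real. Qed.

Local Notation J := (@cintegral01 R).

Lemma J_D f g : ccont01 f -> ccont01 g -> J (fun t => f t + g t) = J f + J g.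
Proof.
move=> cf cg; rewrite /cintegral01.
under I_ext do rewrite ReD.
under [X in _ +i* X]I_ext do rewrite ImD.
by rewrite !I_D//; [exact: ccont01_Im|exact: ccont01_Im|exact: ccont01_Re|exact: ccont01_Re].
Qed.

Lemma J_Z c f : ccont01 f -> J (fun t => c * f t) = c * J f.
Proof.
move=> cf; rewrite /cintegral01; have rf := ccont01_Re cf; have imf := ccont01_Im cf.
have mc : cont01 (fun t => - complex.Im c * complex.Im (f t)) by exact: cont01Z.
rewrite (@I_ext _ _ (fun t => complex.Re c * complex.Re (f t) + - complex.Im c * complex.Im (f t))); last first.
  by move=> t _; rewrite Re_mul mulNr.
rewrite (@I_ext _ (fun t => complex.Im _) (fun t => complex.Re c * complex.Im (f t) + complex.Im c * complex.Re (f t))); last first.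
  by move=> t _; rewrite Im_mul.
rewrite !I_D ?I_Z//; try exact: cont01Z.
by apply/eqP; rewrite eq_complex; case: c {mc} => a b /=; rewrite mulNr !eqxx.
Qed.

Lemma J_cst c : J (fun=> c) = c.
Proof. by rewrite /cintegral01 !I_cst; case: c. Qed.

Lemma J_ext f g : (forall t, 0 <= t <= 1 -> f t = g t) -> J f = J g.
Proof. by move=> fg; rewrite /cintegral01; congr (_ +i* _); apply: I_ext => t /fg ->. Qed.

(** The factor 2 comes from bounding the real and the imaginary part separately; it propagates to
    all later segment estimates. *)
Lemma J_bound f B : ccont01 f -> (forall t, 0 <= t <= 1 -> normc (f t) <= B) ->
  normc (J f) <= 2 * B.
Proof.
move=> cf fB; apply: le_trans (nc_ReIm _) _; rewrite mulr_natl mulr2n lerD//=.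
  by apply: I_bound => [|t /fB]; [exact: ccont01_Re|apply: le_trans; exact: nc_Re].
by apply: I_bound => [|t /fB]; [exact: ccont01_Im|apply: le_trans; exact: nc_Im].
Qed.

Lemma J_rev f : ccont01 f -> J f = J (fun t => f (1 - t)).
Proof.
move=> cf; rewrite /cintegral01; congr (_ +i* _).
  exact: (I_rev (ccont01_Re cf)).
exact: (I_rev (ccont01_Im cf)).
Qed.

Lemma J_split f : ccont01 f ->
  J f = 2^-1 * (J (fun t => f (t / 2)) + J (fun t => f ((t + 1) / 2))).
Proof.
move=> cf; rewrite /cintegral01 (I_split (ccont01_Re cf)) (I_split (ccont01_Im cf)).
have -> : (2^-1 : C) = (2^-1)%:C by rewrite fmorphV rmorph_nat.
by apply/eqP; rewrite eq_complex /= !mul0r subr0 addr0 !mulrDr !eqxx.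
Qed.

(** By the symmetry t -> 1 - t the integral equals 1 minus itself. *)
Lemma J_id : J (fun t => t%:C) = 2^-1.
Proof.
have H := J_rev ccont01_id.
have E : J (fun t => (1 - t)%:C) = 1 + (-1) * J (fun t => t%:C).
  rewrite (@J_ext _ (fun t => 1 + (-1) * t%:C)); last by move=> t _; rewrite raddfB /= mulN1r.
  have c1 := @ccont01_cst 1; have c2 := ccont01Z (-1) ccont01_id.
  by rewrite (J_D c1 c2) J_cst (J_Z _ ccont01_id).
have H2 : 2 * J (fun t => t%:C) = 1.
  by rewrite {1}(mulr_natl _ 2) mulr2n {1}H E; ring.
by apply: (mulfI (_ : (2:C) != 0)); rewrite ?pnatr_eq0// H2 divff// pnatr_eq0.
Qed.

Implicit Types (f : C -> C) (a b c z : C).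

Definition spath (a b : C) (t : R) : C := a + t%:C * (b - a).

Definition seg f a b := (b - a) * J (fun t => f (spath a b t)).

Definition cont_disk f := forall z, normc z < 1 -> forall e : R, 0 < e ->
  exists2 dl : R, 0 < dl & forall w, normc (w - z) < dl -> normc (f w - f z) <= e.

Lemma path_norm a b (r : R) t : normc a <= r -> normc b <= r -> 0 <= t <= 1 ->
  normc (spath a b t) <= r.
Proof.
move=> ar br /andP[t0 t1].
have -> : spath a b t = (1 - t)%:C * a + t%:C * b by rewrite /spath raddfB /=; ring.
apply: le_trans (ncD _ _) _; rewrite !ncM !nc_real !ger0_norm ?subr_ge0//.
have := ler_wpM2l t0 br; have := ler_wpM2l (_ : 0 <= 1 - t) ar.
by rewrite subr_ge0 => /(_ t1); lra.
Qed.

Lemma ccont01_path f a b : cont_disk f -> normc a < 1 -> normc b < 1 ->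
  ccont01 (fun t => f (spath a b t)).
Proof.
move=> cf a1 b1 t t01 e e0.
have p1 : normc (spath a b t) < 1.
  apply: le_lt_trans (path_norm (r := Num.max (normc a) (normc b)) _ _ t01) _.
  - by rewrite le_max lexx.
  - by rewrite le_max lexx orbT.
  - by rewrite gt_max a1.
have [d d0 Hd] := cf _ p1 e e0.
have p : 0 < 1 + normc (b - a) by rewrite ltr_pwDl// nc_ge0.
exists (d / (1 + normc (b - a))); first by rewrite divr_gt0.
move=> s; rewrite ltr_pdivlMr// => st; apply: Hd.
rewrite /spath opprD addrACA subrr add0r -mulrBl -raddfB ncM nc_real.
by apply: le_lt_trans st; rewrite ler_wpM2l// lerDr.
Qed.

Section Segments.
Variables (f : C -> C) (cf : cont_disk f).

Lemma seg_rev a b : normc a < 1 -> normc b < 1 -> seg f b a = - seg f a b.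
Proof.
move=> a1 b1; rewrite /seg [in RHS]J_rev; last exact: ccont01_path.
rewrite -mulNr opprB; congr (_ * _); apply: J_ext => t _.
by congr f; rewrite /spath raddfB /=; ring.
Qed.

Lemma seg_mid a b : normc a < 1 -> normc b < 1 ->
  seg f a b = seg f a ((a + b) / 2) + seg f ((a + b) / 2) b.
Proof.
move=> a1 b1; rewrite /seg [LHS](congr1 _ (J_split (ccont01_path cf a1 b1))).
have -> : J (fun t => f (spath a b (t / 2))) = J (fun t => f (spath a ((a + b) / 2) t)).
  apply: J_ext => t _; congr f; rewrite /spath rmorphM fmorphV rmorph_nat.
  by field.
have -> : J (fun t => f (spath a b ((t + 1) / 2))) = J (fun t => f (spath ((a + b) / 2) b t)).
  apply: J_ext => t _; congr f; rewrite /spath rmorphM rmorphD rmorph1 fmorphV rmorph_nat.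
  by field.
by field.
Qed.

Lemma seg_bound a b (B : R) : normc a < 1 -> normc b < 1 ->
  (forall t, 0 <= t <= 1 -> normc (f (spath a b t)) <= B) ->
  normc (seg f a b) <= 2 * B * normc (b - a).
Proof.
move=> a1 b1 fB; rewrite ncM mulrC ler_wpM2r ?nc_ge0//.
exact: J_bound (ccont01_path cf a1 b1) fB.
Qed.

(* Subtracting the affine part leaves the remainder at an arbitrary point *)
Lemma seg_affine a b (u v : C) : normc a < 1 -> normc b < 1 ->
  seg (fun z => f z - (u + v * z)) a b = seg f a b - (u * (b - a) + v * (b ^+ 2 - a ^+ 2) / 2).
Proof.
move=> a1 b1; rewrite /seg.
have -> : J (fun t => f (spath a b t) - (u + v * spath a b t)) =
   J (fun t => f (spath a b t) + ((- u - v * a) + (- v * (b - a)) * t%:C)).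
  by apply: J_ext => t _; rewrite /spath; ring.
have c1 := ccont01_path cf a1 b1.
have c2 := @ccont01_cst (- u - v * a); have c3 := ccont01Z (- v * (b - a)) ccont01_id.
rewrite J_D ?(J_D c2 c3) ?J_cst ?(J_Z _ ccont01_id) ?J_id//; last exact: ccont01D.
by field.
Qed.

End Segments.

End SegmentIntegral.

(** * Goursat's lemma for triangles *)

Section Goursat.
Variable R : realType.
Local Notation C := R[i].
Implicit Types (f : C -> C) (a b c z : C).

Definition holo f := forall z, normc z < 1 -> cderivable f z.

Lemma holo_cont f : holo f -> cont_disk f.
Proof. by move=> hf z /hf /cderivable_has_cderiv /has_cderiv_cont. Qed.

Lemma holo_affine f u v : holo f -> holo (fun z => f z - (u + v * z)).
Proof.
move=> hf z z1; have H := cderivable_has_cderiv (hf z z1).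
have L : has_cderiv (fun z => - (u + v * z)) z (- v).
  move=> e e0; exists 1 => // h _.
  have -> : - (u + v * (z + h)) - - (u + v * z) - - v * h = 0 by ring.
  by rewrite nc0 mulr_ge0 ?nc_ge0// ltW.
exact: has_cderiv_cderivable (has_cderivD H L).
Qed.

Definition tri f a b c := seg f a b + seg f b c + seg f c a.

Lemma disk_mid a b (r : R) : normc a <= r -> normc b <= r -> normc ((a + b) / 2) <= r.
Proof.
move=> ar br; rewrite ncM ncV nc_nat ler_pdivrMr//.
by apply: le_trans (ncD _ _) _; rewrite mulr_natr mulr2n lerD.
Qed.

Lemma tri_split f a b c : cont_disk f -> normc a < 1 -> normc b < 1 -> normc c < 1 ->
  let ab := (a + b) / 2 in let bc := (b + c) / 2 in let ca := (c + a) / 2 in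
  tri f a b c = tri f a ab ca + tri f ab b bc + tri f ca bc c + tri f ab bc ca.
Proof.
move=> cf a1 b1 c1 ab bc ca.
have m (x y : C) : normc x < 1 -> normc y < 1 -> normc ((x + y) / 2) < 1.
  move=> x1 y1; pose r := Num.max (normc x) (normc y).
  have xr : normc x <= r by rewrite le_max lexx.
  have yr : normc y <= r by rewrite le_max lexx orbT.
  by apply: le_lt_trans (disk_mid xr yr) _; rewrite gt_max x1.
have ab1 := m a b a1 b1; have bc1 := m b c b1 c1; have ca1 := m c a c1 a1.
rewrite /tri (seg_mid cf a1 b1) (seg_mid cf b1 c1) (seg_mid cf c1 a1) -/ab -/bc -/ca.
rewrite (seg_rev cf bc1 ab1) (seg_rev cf ca1 bc1) (seg_rev cf ab1 ca1).
by ring.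
Qed.

Definition perim a b c : R := normc (a - b) + normc (b - c) + normc (c - a).

Record triangle := Triangle { ta : C; tb : C; tc : C }.

Definition tri3 f (t : triangle) := tri f (ta t) (tb t) (tc t).
Definition perim3 (t : triangle) := perim (ta t) (tb t) (tc t).
Definition inball (r : R) (t : triangle) :=
  [/\ normc (ta t) <= r, normc (tb t) <= r & normc (tc t) <= r].

(** The inner edges cancel in [tri_split], so one of the four midpoint triangles carries at least a
    quarter of the integral. The loss of a factor 4 is matched later by an error that is quadratic
    in the halved perimeter. *)
Lemma tri_step f (r : R) (t : triangle) : cont_disk f -> r < 1 -> inball r t ->
  exists t' : triangle, [/\ inball r t', perim3 t' = perim3 t / 2,
    normc (ta t' - ta t) <= perim3 t & normc (tri3 f t) <= 4 * normc (tri3 f t')].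
Proof.
case: t => a b c cf r1 [/= ar br cr].
have ab := disk_mid ar br; have bc := disk_mid br cr; have ca := disk_mid cr ar.
have half (x : C) : normc (x / 2) = normc x / 2 by rewrite ncM ncV nc_nat.
have P0 (x : C) : 0 <= normc x / 2 by rewrite divr_ge0// nc_ge0.
have [pa pb pc] : [/\ 0 <= normc (a - b), 0 <= normc (b - c) & 0 <= normc (c - a)].
  by split; exact: nc_ge0.
pose t1 := Triangle a ((a + b) / 2) ((c + a) / 2).
pose t2 := Triangle ((a + b) / 2) b ((b + c) / 2).
pose t3 := Triangle ((c + a) / 2) ((b + c) / 2) c.
pose t4 := Triangle ((a + b) / 2) ((b + c) / 2) ((c + a) / 2).
have e1 : normc (a - (a + b) / 2) = normc (a - b) / 2.
  by rewrite -half; congr normc; field.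
have e2 : normc ((a + b) / 2 - b) = normc (a - b) / 2.
  by rewrite -half; congr normc; field.
have e3 : normc (b - (b + c) / 2) = normc (b - c) / 2.
  by rewrite -half; congr normc; field.
have e4 : normc ((b + c) / 2 - c) = normc (b - c) / 2.
  by rewrite -half; congr normc; field.
have e5 : normc (c - (c + a) / 2) = normc (c - a) / 2.
  by rewrite -half; congr normc; field.
have e6 : normc ((c + a) / 2 - a) = normc (c - a) / 2.
  by rewrite -half; congr normc; field.
have e7 : normc ((a + b) / 2 - (b + c) / 2) = normc (c - a) / 2.
  by rewrite -half ncBC; congr normc; field.
have e8 : normc ((b + c) / 2 - (c + a) / 2) = normc (a - b) / 2.
  by rewrite -half ncBC; congr normc; field.
have e9 : normc ((c + a) / 2 - (a + b) / 2) = normc (b - c) / 2.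
  by rewrite -half ncBC; congr normc; field.
have e1' : normc ((a + b) / 2 - a) = normc (a - b) / 2 by rewrite -e1; exact: ncBC.
have e9' : normc ((a + b) / 2 - (c + a) / 2) = normc (b - c) / 2 by rewrite -e9; exact: ncBC.
have e8' : normc ((c + a) / 2 - (b + c) / 2) = normc (a - b) / 2 by rewrite -e8; exact: ncBC.
have e3' : normc ((b + c) / 2 - b) = normc (b - c) / 2 by rewrite -e3; exact: ncBC.
have e7' : normc ((b + c) / 2 - (a + b) / 2) = normc (c - a) / 2 by rewrite -e7; exact: ncBC.
have T := tri_split cf (le_lt_trans ar r1) (le_lt_trans br r1) (le_lt_trans cr r1).
have : [|| normc (tri f a b c) <= 4 * normc (tri3 f t1),
  normc (tri f a b c) <= 4 * normc (tri3 f t2), normc (tri f a b c) <= 4 * normc (tri3 f t3)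
  | normc (tri f a b c) <= 4 * normc (tri3 f t4)].
  rewrite -[X in is_true X]negbK !negb_or -!ltNge; apply/negP => /and4P[h1 h2 h3 h4].
  have : normc (tri f a b c) <= normc (tri3 f t1) + normc (tri3 f t2) + normc (tri3 f t3)
     + normc (tri3 f t4).
    rewrite [X in normc X]T; apply: le_trans (ncD _ _) _; rewrite lerD2r.
    by apply: le_trans (ncD _ _) _; rewrite lerD2r; exact: ncD.
  by lra.
case/or4P => h; [exists t1|exists t2|exists t3|exists t4]; (split; [by split; rewrite /=| | |exact: h]);
  rewrite /perim3 /perim /= ?subrr ?nc0 ?e1 ?e2 ?e3 ?e4 ?e5 ?e6 ?e7 ?e8 ?e9 ?e1' ?e9' ?e8' ?e3' ?e7'; lra.
Qed.


End Goursat.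

Section GoursatTheorem.
Variable R : realType.
Local Notation C := R[i].
Implicit Types (f : C -> C) (a b c z : C).

Lemma goursat f a b c : holo f -> normc a < 1 -> normc b < 1 -> normc c < 1 ->
  tri f a b c = 0.
Proof.
move=> hf a1 b1 c1; have cf := holo_cont hf.
pose r := Num.max (normc a) (Num.max (normc b) (normc c)).
have r1 : r < 1 by rewrite !gt_max a1 b1.
pose T0 := Triangle a b c.
have T0r : inball r T0 by split; rewrite !le_max lexx ?orbT.
pose nxt t := if pselect (inball r t) is left h then projT1 (cid (tri_step cf r1 h)) else t.
pose T n := iter n nxt T0.
have TS n : inball r (T n) -> [/\ inball r (T n.+1), perim3 (T n.+1) = perim3 (T n) / 2,
    normc (ta (T n.+1) - ta (T n)) <= perim3 (T n)
  & normc (tri3 f (T n)) <= 4 * normc (tri3 f (T n.+1))].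
  move=> h; rewrite /T iterS -/(T n) /nxt; case: pselect => // h'.
  by case: cid => t' /= [].
have Tr n : inball r (T n) by elim: n => [|n /TS[]].
have TP n : perim3 (T n) = perim3 T0 / 2 ^+ n.
  elim: n => [|n ih]; first by rewrite expr0 divr1.
  by have [_ -> _ _] := TS n (Tr n); rewrite ih exprS invfM mulrA mulrAC.
have TT n : normc (tri f a b c) <= 4 ^+ n * normc (tri3 f (T n)).
  elim: n => [|n ih]; first by rewrite expr0 mul1r.
  apply: le_trans ih _; have [_ _ _ h] := TS n (Tr n).
  by rewrite exprSr -mulrA ler_wpM2l// exprn_ge0.
set P := perim3 T0 in TP.
have P0 : 0 <= P by rewrite /P /perim3 /perim !addr_ge0// nc_ge0.
have p2 n : 0 < 2 ^+ n :> R by rewrite exprn_gt0.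
(* Telescoped form of the geometric series of perimeters; dropping the subtracted term gives a bound
   uniform in [d], hence the distance to the limit point. *)
have Tm n d : normc (ta (T (n + d)%N) - ta (T n)) <= 2 * P / 2 ^+ n - 2 * P / 2 ^+ (n + d).
  elim: d => [|d ih]; first by rewrite addn0 !subrr nc0.
  have [_ _ h _] := TS (n + d)%N (Tr _); rewrite TP in h; rewrite addnS.
  apply: le_trans (nc_dist _ (ta (T (n + d)%N)) _) _; apply: le_trans (lerD h ih) _.
  rewrite exprS; set q := 2 ^+ (n + d); have q0 : q != 0 by rewrite /q gt_eqF.
  have -> : 2 * P / (2 * q) = P / q by field.
  by lra.
have [phi [z0 [hphi Hz]]] := @complex_subseq R (fun n => ta (T n)) r (fun n => let: And3 h _ _ := Tr n in h).
have ge_id n : (n <= phi n)%N by elim: n => // n ih; exact: leq_ltn_trans ih (hphi _ _ (ltnSn n)).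
have Tz n : normc (ta (T n) - z0) <= 2 * P / 2 ^+ n.
  apply/ler_addgt0Pr => e e0; move/cvgrPdist_le : Hz => /(_ e e0)[N _ HN].
  have := HN (maxn N n) (leq_maxl _ _); rewrite sub0r normrN ger0_norm ?nc_ge0// => h.
  have nphi : (n <= phi (maxn N n))%N by apply: leq_trans (leq_maxr N n) _.
  apply: le_trans (nc_dist _ (ta (T (phi (maxn N n)))) _) _.
  apply: lerD => //; rewrite ncBC -(subnKC nphi); apply: le_trans (Tm _ _) _.
  by rewrite gerBl mulr_ge0 ?invr_ge0 ?(ltW (p2 _))// mulr_ge0.
have z0r : normc z0 < 1.
  apply: (le_lt_trans _ r1); apply/ler_addgt0Pr => e e0.
  move/cvgrPdist_le : Hz => /(_ e e0)[N _ /(_ N (leqnn N))].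
  rewrite sub0r normrN ger0_norm ?nc_ge0// => h.
  have [h1 _ _] := Tr (phi N); rewrite -[z0](subKr (ta (T (phi N)))).
  by apply: le_trans (ncB _ _) _; rewrite lerD.
have Hd := cderivable_has_cderiv (hf _ z0r); set d := cderiv 1 f z0 in Hd.
apply/eqP; rewrite -nc_eq0; apply/eqP/le_anti; rewrite nc_ge0 andbT.
apply/ler_addgt0Pr => e e0; rewrite add0r.
(* The factor 6 is the 2 of [seg_bound] times 3: a point of the n-th triangle is within P / 2^n of
   its first vertex, which is within 2 P / 2^n of [z0]. *)
pose ep := e / (6 * (P + 1) ^+ 2).
have P1 : 0 < (P + 1) ^+ 2 by rewrite exprn_gt0// ltr_pwDr.
have ep0 : 0 < ep by rewrite divr_gt0// mulr_gt0.
have [dl dl0 Hdl] := Hd ep ep0.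
have [n Hn] : exists n, 3 * (P + 1) / 2 ^+ n < dl.
  have [n _ /(_ n (leqnn n))] : \forall n \near \oo, `|0 - 2^-1 ^+ n : R| < dl / (3 * (P + 1)).
    have := @cvg_expr R 2^-1 ltac:(by rewrite ger0_norm// invf_lt1// ltr1n).
    by move/cvgrPdist_lt; apply; rewrite divr_gt0// mulr_gt0// ltr_pwDr.
  rewrite sub0r normrN ger0_norm ?exprn_ge0// => h; exists n.
  by rewrite -exprVn mulrC -ltr_pdivlMr// mulr_gt0// ltr_pwDr.
apply: le_trans (TT n) _.
have [A1 A2 A3] := Tr n; have Tzn := Tz n; have TPn := TP n.
rewrite /tri3; move: A1 A2 A3 Tzn TPn; rewrite /perim3.
set A := ta (T n); set B := tb (T n); set D := tc (T n) => A1 A2 A3 Tzn TPn.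
(* Affine functions integrate to zero around a triangle, so [f] may be replaced by its first-order
   remainder at [z0]. *)
pose rem z := f z - ((f z0 - d * z0) + d * z).
have hrem : holo rem by exact: holo_affine.
have crem := holo_cont hrem.
have A1' := le_lt_trans A1 r1; have A2' := le_lt_trans A2 r1; have A3' := le_lt_trans A3 r1.
have -> : tri f A B D = tri rem A B D.
  by rewrite /tri !seg_affine//; field.
have Q0 : 0 <= P / 2 ^+ n by rewrite divr_ge0// ltW.
have [q1 q2 q3] : [/\ 0 <= normc (A - B), 0 <= normc (B - D) & 0 <= normc (D - A)].
  by split; exact: nc_ge0.
move: TPn; rewrite /perim => TPn.
have far z : normc (z - A) <= P / 2 ^+ n -> normc (rem z) <= ep * (3 * (P / 2 ^+ n)).
  move=> zA.
  have zz : normc (z - z0) <= 3 * (P / 2 ^+ n).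
    by apply: le_trans (nc_dist _ A _) _; rewrite -mulrA in Tzn; lra.
  have : normc (z - z0) < dl.
    apply: le_lt_trans zz _; apply: le_lt_trans Hn.
    by rewrite mulrA ler_pM2r ?invr_gt0// ler_pM2l// lerDl.
  move=> /Hdl; rewrite [z0 + _]addrC subrK => h.
  have -> : rem z = f z - f z0 - d * (z - z0) by rewrite /rem; ring.
  by apply: le_trans h _; rewrite ler_pM2l.
have onseg X Y : normc X < 1 -> normc Y < 1 -> normc (X - A) <= P / 2 ^+ n -> normc (Y - A) <= P / 2 ^+ n ->
   normc (Y - X) <= P / 2 ^+ n ->
   normc (seg rem X Y) <= 2 * (ep * (3 * (P / 2 ^+ n))) * normc (Y - X).
  move=> X1 Y1 XA YA XY; apply: seg_bound => // t t01; apply: far.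
  have -> : spath X Y t - A = spath (X - A) (Y - A) t by rewrite /spath; ring.
  exact: path_norm.
have S1 : normc (seg rem A B) <= 2 * (ep * (3 * (P / 2 ^+ n))) * normc (A - B).
  by rewrite (ncBC A B); apply: onseg; rewrite // ?subrr ?nc0// ncBC; lra.
have S2 : normc (seg rem B D) <= 2 * (ep * (3 * (P / 2 ^+ n))) * normc (B - D).
  by rewrite (ncBC B D); apply: onseg; rewrite // ncBC -?(ncBC D A); lra.
have S3 : normc (seg rem D A) <= 2 * (ep * (3 * (P / 2 ^+ n))) * normc (D - A).
  by rewrite (ncBC D A); apply: onseg; rewrite // ?subrr ?nc0// ncBC -?(ncBC D A); lra.
have : normc (tri rem A B D) <= 2 * (ep * (3 * (P / 2 ^+ n))) * (P / 2 ^+ n).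
  rewrite -[X in _ <= _ * X]TPn !mulrDr.
  apply: le_trans (ncD _ _) _; rewrite lerD//.
  by apply: le_trans (ncD _ _) _; rewrite lerD.
move=> H; apply: le_trans (ler_wpM2l (exprn_ge0 _ (ler0n _ 4)) H) _.
have -> : 4 ^+ n * (2 * (ep * (3 * (P / 2 ^+ n))) * (P / 2 ^+ n)) = 6 * ep * P ^+ 2.
  have -> : (4 : R) = 2 * 2 by rewrite -natrM.
  rewrite exprMn; move: (p2 n); set q := 2 ^+ n => q0.
  by field; rewrite gt_eqF.
rewrite /ep; have -> : 6 * (e / (6 * (P + 1) ^+ 2)) * P ^+ 2 = e * (P ^+ 2 / (P + 1) ^+ 2).
  by field; rewrite gt_eqF// ltr_pwDr.
rewrite ler_piMr ?(ltW e0)// ler_pdivrMr// mul1r.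
have PP : 0 <= P + 1 by rewrite addr_ge0.
by apply: lerXn2r; rewrite ?nnegrE// lerDl.
Qed.

End GoursatTheorem.

(** * Primitives in the disk *)

Section Integration.
Variable R : realType.
Local Notation C := R[i].
Implicit Types (f : C -> C) (a b c z : C).

(* the segment from 0 is the one used by [integration] *)
Lemma integrationE f z : cont_disk f -> normc z < 1 -> integration f z = seg f 0 z.
Proof.
move=> cf z1; rewrite /integration /seg subr0.
have n0 : normc (0 : C) < 1 by rewrite nc0.
rewrite -J_Z; last exact: ccont01_path.
by apply: J_ext => t _; rewrite /spath subr0 add0r mulrC.
Qed.

Lemma integration_seg f a b : holo f -> normc a < 1 -> normc b < 1 ->
  integration f b - integration f a = seg f a b.
Proof.
move=> hf a1 b1; have cf := holo_cont hf.
have n0 : normc (0 : C) < 1 by rewrite nc0.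
have := goursat hf n0 a1 b1; rewrite /tri (seg_rev cf n0 b1) !integrationE//.
set x := seg _ 0 a; set y := seg _ a b; set w := seg _ 0 b => H.
transitivity (y - (x + y - w)); first by ring.
by rewrite H subr0.
Qed.

Lemma integration_cderiv f z : holo f -> normc z < 1 -> has_cderiv (integration f) z (f z).
Proof.
move=> hf z1 e e0; have cf := holo_cont hf.
have e2 : 0 < e / 2 by rewrite divr_gt0.
have [d d0 Hd] := cf z z1 _ e2; have [r r0 Hr] := disk_nbhd z1.
exists (Num.min d r); first by rewrite lt_min d0.
move=> h; rewrite lt_min => /andP[hd hr].
have zh1 : normc (z + h) < 1 by apply: Hr; rewrite addrC addKr.
rewrite integration_seg//.
have -> : seg f z (z + h) - f z * h = seg (fun w => f w - (f z + 0 * w)) z (z + h).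
  by rewrite seg_affine//; field.
have -> : e * normc h = 2 * (e / 2) * normc (z + h - z) by rewrite [z + h]addrC addrK; field.
apply: seg_bound => // [|t t01]; first exact/holo_cont/holo_affine.
rewrite mul0r addr0; apply: Hd; apply: le_lt_trans hd.
have -> : spath z (z + h) t - z = t%:C * h by rewrite /spath; ring.
by case/andP: t01 => t0 t1; rewrite ncM nc_real ger0_norm// ler_piMl// nc_ge0.
Qed.

End Integration.

(** * Complex series and termwise differentiation *)

Section ComplexSeries.
Variable R : realType.
Local Notation C := R[i].
Implicit Types (u v a : nat -> C) (z l : C).

Definition cconv u l := (fun n => normc (u n - l)) @ \oo --> (0 : R).

Definition has_csum a l := cconv (fun N => \sum_(j < N) a j) l.

Lemma cconvP u l : cconv u l <-> forall e : R, 0 < e ->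
  exists N, forall n, (N <= n)%N -> normc (u n - l) <= e.
Proof.
split.
  move/cvgrPdist_le => H e e0; have [N _ HN] := H e e0; exists N => n /HN.
  by rewrite sub0r normrN ger0_norm ?nc_ge0.
move=> H; apply/cvgrPdist_le => e e0; have [N HN] := H e e0; exists N => // n /HN.
by rewrite sub0r normrN ger0_norm ?nc_ge0.
Qed.

Lemma cconv_uniq u l1 l2 : cconv u l1 -> cconv u l2 -> l1 = l2.
Proof.
move=> /cconvP H1 /cconvP H2; apply/eqP; rewrite -subr_eq0 -nc_eq0; apply/eqP/le_anti.
rewrite nc_ge0 andbT; apply/ler_addgt0Pr => e e0; rewrite add0r.
have e2 : 0 < e / 2 by rewrite divr_gt0.
have [N1 h1] := H1 _ e2; have [N2 h2] := H2 _ e2.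
apply: le_trans (nc_dist _ (u (maxn N1 N2)) _) _; rewrite (splitr e) lerD//.
  by rewrite ncBC h1// leq_maxl.
by rewrite h2// leq_maxr.
Qed.

Lemma cconv_lim u l : cconv u l -> limn (u : R[i]^o ^nat) = l.
Proof.
move=> H; have /nc_cvgP HH := H; have E := cvg_lim (@norm_hausdorff _ _) HH; exact: E.
Qed.

Lemma cconvD u v l m : cconv u l -> cconv v m -> cconv (fun n => u n + v n) (l + m).
Proof.
move=> /cconvP H1 /cconvP H2; apply/cconvP => e e0.
have e2 : 0 < e / 2 by rewrite divr_gt0.
have [N1 h1] := H1 _ e2; have [N2 h2] := H2 _ e2.
exists (maxn N1 N2) => n; rewrite geq_max => /andP[n1 n2].
rewrite opprD addrACA (splitr e); apply: le_trans (ncD _ _) _.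
by rewrite lerD ?h1 ?h2.
Qed.

Lemma cconvZ c u l : cconv u l -> cconv (fun n => c * u n) (c * l).
Proof.
move=> /cconvP H; apply/cconvP => e e0.
have p : 0 < 1 + normc c by rewrite ltr_pwDl// nc_ge0.
have e2 : 0 < e / (1 + normc c) by rewrite divr_gt0.
have [N h] := H _ e2; exists N => n /h hn.
rewrite -mulrBr ncM; apply: le_trans (ler_wpM2l (nc_ge0 _) hn) _.
by rewrite mulrCA ler_piMr ?(ltW e0)// ler_pdivrMr// mul1r lerDr.
Qed.

Lemma cconv_cst c : cconv (fun=> c) c.
Proof. by apply/cconvP => e e0; exists 0%N => n _; rewrite subrr nc0 ltW. Qed.

Lemma cconv_conj u l : cconv u l -> cconv (fun n => (u n)^*) (l^*).
Proof.
move=> /cconvP H; apply/cconvP => e /H[N h]; exists N => n /h.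
by rewrite -rmorphB nc_conj.
Qed.

Lemma cconv_eq u v l : (forall n, u n = v n) -> cconv u l -> cconv v l.
Proof. by move=> uv; rewrite (_ : v = u)//; apply/funext => n. Qed.

Lemma cconv_shift u l m : cconv u l -> cconv (fun n => u (n + m)%N) l.
Proof.
move=> /cconvP H; apply/cconvP => e /H[N h]; exists N => n Nn.
by apply: h; apply: leq_trans Nn (leq_addr _ _).
Qed.

Lemma cconv_sum (I : Type) (s : seq I) (P : pred I) (u : I -> nat -> C) (l : I -> C) :
  (forall i, P i -> cconv (u i) (l i)) ->
  cconv (fun n => \sum_(i <- s | P i) u i n) (\sum_(i <- s | P i) l i).
Proof.
move=> H; elim: s => [|i s ih].
  by rewrite big_nil; apply: (@cconv_eq (fun=> 0)) (cconv_cst _) => n; rewrite big_nil.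
rewrite big_cons; case: ifPn => Pi.
  by apply: (cconv_eq _ (cconvD (H _ Pi) ih)) => n; rewrite big_cons Pi.
by apply: (cconv_eq _ ih) => n; rewrite big_cons (negbTE Pi).
Qed.

Lemma cconv_norm_le u l (B : R) : (exists N, forall n, (N <= n)%N -> normc (u n) <= B) ->
  cconv u l -> normc l <= B.
Proof.
move=> [N hB] /cconvP H; apply/ler_addgt0Pr => e e0; have [M h] := H e e0.
rewrite -[l](subKr (u (maxn N M))); apply: le_trans (ncB _ _) _.
by rewrite lerD ?hB ?h ?leq_maxl ?leq_maxr.
Qed.

Lemma has_csumD a b l m : has_csum a l -> has_csum b m -> has_csum (fun j => a j + b j) (l + m).
Proof. by move=> H1 H2; apply: (cconv_eq _ (cconvD H1 H2)) => n; rewrite big_split. Qed.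

Lemma has_csumZ c a l : has_csum a l -> has_csum (fun j => c * a j) (c * l).
Proof. by move=> H; apply: (cconv_eq _ (cconvZ c H)) => n; rewrite mulr_sumr. Qed.

Lemma has_csum_shift a l m : has_csum a l ->
  has_csum (fun j => a (j + m)%N) (l - \sum_(j < m) a j).
Proof.
move=> H; apply: (cconv_eq _ (cconvD (cconv_shift m H) (cconv_cst (- \sum_(j < m) a j)))) => n /=.
rewrite addnC big_split_ord /= addrAC subrr add0r; apply: eq_bigr => i _.
by rewrite addnC.
Qed.

Lemma has_csum_abs a (B : R) : (forall N, \sum_(j < N) normc (a j) <= B) ->
  exists l, has_csum a l.
Proof.
move=> H.
have K (p : C -> R) : (forall z, `|p z| <= normc z) -> cvgn (series (fun j => p (a j))).
  move=> pn; apply: normed_cvg.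
  apply: nondecreasing_is_cvgn.
    by apply: nondecreasing_series => n _ _; exact: normr_ge0.
  exists B => _ [n _ <-]; change (\sum_(0 <= j < n) `|p (a j)| <= B); rewrite big_mkord.
  by apply: le_trans (H n); apply: ler_sum => i _; exact: pn.
have /cvg_ex[/= x Hx] := K _ (@nc_Re R); have /cvg_ex[/= y Hy] := K _ (@nc_Im R).
exists (x +i* y); apply/cconvP => e e0; have e2 : 0 < e / 2 by rewrite divr_gt0.
move/cvgrPdist_le : Hx => /(_ _ e2)[N1 _ h1]; move/cvgrPdist_le : Hy => /(_ _ e2)[N2 _ h2].
exists (maxn N1 N2) => n; rewrite geq_max => /andP[/h1 /= k1 /h2 /= k2].
apply: le_trans (nc_ReIm _) _; rewrite (splitr e) lerD//.
  rewrite ReD ReN /= distrC; apply: le_trans k1; rewrite seriesEord /=.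
  by rewrite (big_morph (@complex.Re R) (@ReD R) (erefl : complex.Re (0 : C) = 0)).
rewrite ImD ImN /= distrC; apply: le_trans k2; rewrite seriesEord /=.
by rewrite (big_morph (@complex.Im R) (@ImD R) (erefl : complex.Im (0 : C) = 0)).
Qed.

Lemma has_csum_le a l (B : R) : has_csum a l ->
  (forall N, \sum_(j < N) normc (a j) <= B) -> normc l <= B.
Proof.
move=> H aB; apply: cconv_norm_le H; exists 0%N => n _.
exact: le_trans (nc_sum _ _ _) (aB n).
Qed.

Lemma geo_sumE (q : R) N : (1 - q) * \sum_(j < N) q ^+ j = 1 - q ^+ N.
Proof. by rewrite -opprB mulNr -subrX1 opprB. Qed.

Lemma geo_sum_le (q : R) N : 0 <= q < 1 -> \sum_(j < N) q ^+ j <= (1 - q)^-1.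
Proof.
move=> /andP[q0 q1]; have p : 0 < 1 - q by rewrite subr_gt0.
by rewrite -[leRHS]mul1r ler_pdivlMr// mulrC geo_sumE gerBl exprn_ge0.
Qed.

(** Each of the powers of exponent 0, ..., j is at least q^j, so j + 1 copies of q^j are below the
    geometric sum. *)
Lemma linear_geo_le (q : R) j : 0 <= q < 1 -> j.+1%:R * q ^+ j <= (1 - q)^-1.
Proof.
move=> q01; apply: le_trans (geo_sum_le j.+1 q01); case/andP: q01 => q0 q1.
rewrite mulr_natl -[X in _ *+ X]card_ord -sumr_const; apply: ler_sum => i _.
by rewrite ler_wiXn2l// ?(ltW q1)// -ltnS.
Qed.

(** Radius of convergence at least [r0], expressed by bounded terms; in this form it passes to
    derived sequences, products and limits of coefficients. *)
Definition subexp (r0 : R) a := forall r : R, 0 < r < r0 ->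
  exists B : R, forall j, normc (a j) * r ^+ j <= B.

Definition der a : nat -> C := fun j => j.+1%:R * a j.+1.

Lemma subexp_der r0 a : subexp r0 a -> subexp r0 (der a).
Proof.
move=> Ha r /andP[rp rr]; pose s := (r + r0) / 2.
have rs : r < s by rewrite /s; lra.
have s0 : 0 < s by exact: lt_trans rs.
have [B HB] := Ha s ltac:(by rewrite s0 /s /=; lra).
have q01 : 0 <= r / s < 1 by rewrite divr_ge0 ?ltW//= ltr_pdivrMr// mul1r.
have B0 : 0 <= B by apply: le_trans (HB 0%N); rewrite mulr_ge0 ?nc_ge0.
exists (B / s * (1 - r / s)^-1) => j.
have := HB j.+1; rewrite /der ncM nc_nat => h.
have -> : j.+1%:R * normc (a j.+1) * r ^+ j =
  (normc (a j.+1) * s ^+ j.+1) / s * (j.+1%:R * (r / s) ^+ j).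
  clearbody s; rewrite expr_div_n (exprS s); move: (exprn_gt0 j s0).
  by set u := s ^+ j; set v := r ^+ j => u0; field; rewrite !gt_eqF.
have H2 := linear_geo_le j q01.
apply: ler_pM H2; rewrite ?mulr_ge0 ?invr_ge0 ?nc_ge0 ?exprn_ge0 ?ler0n ?(ltW s0)//.
  by case/andP: q01.
by rewrite ler_pM2r ?invr_gt0.
Qed.

Lemma subexp_abs r0 a (r : R) : subexp r0 a -> 0 <= r < r0 ->
  exists B : R, forall N, \sum_(j < N) normc (a j) * r ^+ j <= B.
Proof.
move=> Ha /andP[rp rr]; pose s := (r + r0) / 2.
have rs : r < s by rewrite /s; lra.
have s0 : 0 < s by exact: le_lt_trans rs.
have [B HB] := Ha s ltac:(by rewrite s0 /s /=; lra).
have q01 : 0 <= r / s < 1 by rewrite divr_ge0 ?(ltW s0)//= ltr_pdivrMr// mul1r.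
have B0 : 0 <= B by apply: le_trans (HB 0%N); rewrite mulr_ge0 ?nc_ge0.
exists (B * (1 - r / s)^-1) => N.
apply: le_trans (ler_wpM2l B0 (geo_sum_le N q01)); rewrite mulr_sumr; apply: ler_sum => j _.
have -> : r ^+ j = s ^+ j * (r / s) ^+ j by rewrite -exprMn mulrC divfK// gt_eqF.
by rewrite mulrA ler_wpM2r ?exprn_ge0//; case/andP: q01.
Qed.

Lemma subexp_csum r0 a z : subexp r0 a -> normc z < r0 ->
  exists l, has_csum (fun j => a j * z ^+ j) l.
Proof.
move=> Ha z0; have [|B HB] := @subexp_abs r0 a (normc z) Ha; first by rewrite nc_ge0.
apply: (@has_csum_abs _ B) => N.
by under eq_bigr do rewrite ncM ncX; exact: HB.
Qed.

Lemma subexp_csum0 a : has_csum (fun j => a j * 0 ^+ j) (a 0%N).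
Proof.
apply/cconvP => e e0; exists 1%N => -[//|n] _.
rewrite big_ord_recl /= expr0 mulr1 big1 ?addr0 ?subrr ?nc0 ?ltW// => i _.
by rewrite expr0n mulr0.
Qed.

(** The second-order remainder of a power is h^2 times a polynomial in z and h with nonnegative
    coefficients, hence dominated by its value at (r, d) once (|h| / d)^2 is factored out. *)
Lemma expr_remainder z h (r d : R) j : normc z <= r -> 0 < d -> normc h <= d ->
  normc ((z + h) ^+ j - z ^+ j - j%:R * z ^+ j.-1 * h) <=
  (normc h / d) ^+ 2 * ((r + d) ^+ j - r ^+ j - j%:R * r ^+ j.-1 * d).
Proof.
move=> zr d0 hd; have r0 : 0 <= r := le_trans (nc_ge0 _) zr.
elim: j => [|j ih]; first by rewrite !expr0 mulr0n !mul0r !subr0 !subrr nc0 mulr0.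
have -> : (z + h) ^+ j.+1 - z ^+ j.+1 - j.+1%:R * z ^+ j * h =
  (z + h) * ((z + h) ^+ j - z ^+ j - j%:R * z ^+ j.-1 * h) + j%:R * z ^+ j.-1 * h ^+ 2.
  case: j {ih} => [|j] /=; first by rewrite !expr1 !expr0; ring.
  by rewrite -(natr1 j.+1) !exprS; ring.
have -> : (r + d) ^+ j.+1 - r ^+ j.+1 - j.+1%:R * r ^+ j * d =
  (r + d) * ((r + d) ^+ j - r ^+ j - j%:R * r ^+ j.-1 * d) + j%:R * r ^+ j.-1 * d ^+ 2.
  case: j {ih} => [|j] /=; first by rewrite !expr1 !expr0; ring.
  by rewrite -(natr1 j.+1) !exprS; ring.
rewrite [X in _ <= X]mulrDr; apply: le_trans (ncD _ _) _; apply: lerD.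
  rewrite ncM mulrCA; apply: ler_pM; rewrite ?nc_ge0//.
  by apply: le_trans (ncD _ _) _; exact: lerD.
rewrite !ncM !ncX nc_nat.
have -> : (normc h / d) ^+ 2 * (j%:R * r ^+ j.-1 * d ^+ 2) = j%:R * r ^+ j.-1 * normc h ^+ 2.
  by field; rewrite gt_eqF.
rewrite -expr2 ler_wpM2r ?exprn_ge0 ?nc_ge0// ler_wpM2l//.
by apply: lerXn2r; rewrite ?nnegrE ?nc_ge0.
Qed.

Lemma pseries_deriv r0 a (f f' : C -> C) z : subexp r0 a -> normc z < r0 ->
  (forall w, normc w < r0 -> has_csum (fun j => a j * w ^+ j) (f w)) ->
  has_csum (fun j => der a j * z ^+ j) (f' z) ->
  has_cderiv f z (f' z).
Proof.
move=> Ha z0 Hf Hf' e e0.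
pose d := (r0 - normc z) / 2; have d0 : 0 < d by rewrite divr_gt0// subr_gt0.
have [|B HB] := @subexp_abs r0 a (normc z + d) Ha.
  by rewrite addr_ge0 ?nc_ge0 ?(ltW d0)//= /d; lra.
have B0 : 0 <= B by have := HB 0%N; rewrite big_ord0.
have Bp : 0 < B + 1 by lra.
have ed : 0 < e * d ^+ 2 by rewrite mulr_gt0 ?exprn_gt0.
exists (Num.min d (e * d ^+ 2 / (B + 1))); first by rewrite lt_min d0 divr_gt0.
move=> h; rewrite lt_min => /andP[hd hB].
have zh : normc (z + h) < r0.
  by apply: le_lt_trans (ncD _ _) _; move: hd; rewrite /d; lra.
have Hs : has_csum (fun j => a j * (z + h) ^+ j + (-1) * (a j * z ^+ j) +
   (- h) * (a j * (j%:R * z ^+ j.-1))) (f (z + h) - f z - f' z * h).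
  (* The term j = 0 vanishes through its factor 0, so the truncated exponent [0.-1 = 0] is
     harmless. *)
  have H1 : has_csum (fun j => a j * (j%:R * z ^+ j.-1)) (f' z).
    apply/cconvP => t /(proj1 (cconvP _ _) Hf')[N HN]; exists N.+1 => -[//|n] Nn.
    rewrite big_ord_recl /= mul0r mulr0 add0r.
    apply: le_trans (HN n Nn); rewrite le_eqVlt; apply/orP; left; apply/eqP.
    congr (normc (_ - _)); apply: eq_bigr => i _; rewrite /der /bump /=; ring.
  have := has_csumD (has_csumD (Hf _ zh) (has_csumZ (-1) (Hf _ z0))) (has_csumZ (- h) H1).
  by rewrite mulN1r mulNr (mulrC h).
have hd2 : 0 <= (normc h / d) ^+ 2 by rewrite exprn_ge0// divr_ge0 ?nc_ge0// ltW.
have bnd : normc (f (z + h) - f z - f' z * h) <= (normc h / d) ^+ 2 * B.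
  apply: (has_csum_le Hs) => N; apply: le_trans (ler_wpM2l hd2 (HB N)).
  rewrite mulr_sumr; apply: ler_sum => j _.
  have -> : a j * (z + h) ^+ j + -1 * (a j * z ^+ j) + - h * (a j * (j%:R * z ^+ j.-1)) =
    a j * ((z + h) ^+ j - z ^+ j - j%:R * z ^+ j.-1 * h) by ring.
  rewrite ncM mulrCA; apply: ler_wpM2l; first exact: nc_ge0.
  apply: le_trans (expr_remainder _ (lexx (normc z)) d0 (ltW hd)) _.
  apply: ler_wpM2l => //.
  have : 0 <= j%:R * normc z ^+ j.-1 * d.
    by rewrite mulr_ge0 ?(ltW d0)// mulr_ge0 ?exprn_ge0 ?nc_ge0.
  by have := exprn_ge0 j (nc_ge0 z); lra.
clearbody d; apply: le_trans bnd _.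
have -> : (normc h / d) ^+ 2 * B = (normc h * B / d ^+ 2) * normc h.
  by field; rewrite gt_eqF.
rewrite ler_wpM2r ?nc_ge0// ler_pdivrMr ?exprn_gt0//.
have : normc h * (B + 1) <= e * d ^+ 2.
  by rewrite -ler_pdivlMr ?ltr_pwDr// ltW.
by apply: le_trans; rewrite ler_wpM2l ?nc_ge0// lerDl.
Qed.

End ComplexSeries.

(** * Functions defined by power series *)

Section PowerSeriesFunctions.
Variable R : realType.
Local Notation C := R[i].
Implicit Types (a : nat -> C) (f : C -> C) (z w : C).

Lemma subexp_iter_der r0 a m : subexp r0 a -> subexp r0 (iter m (@der R) a).
Proof. by move=> Ha; elim: m => //= m; exact: subexp_der. Qed.


Lemma ffact_shift j m : (j.+1 * (j.+1 + m) ^_ m = (j + m.+1) ^_ m.+1)%N.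
Proof.
have H1 := @ffact_fact (j.+1 + m) m (leq_addl _ _).
have H2 := @ffact_fact (j + m.+1) m.+1 (leq_addl _ _).
rewrite addnK in H1; rewrite addnK -addSnnS in H2.
have : (j.+1 * (j.+1 + m) ^_ m * j`! == (j.+1 + m) ^_ m.+1 * j`!)%N.
  by rewrite H2 -H1 factS mulnCA mulnA.
by rewrite eqn_pmul2r ?fact_gt0// => /eqP ->; rewrite addSnnS.
Qed.

Lemma iter_derE a m j : iter m (@der R) a j = ((j + m) ^_ m)%:R * a (j + m)%N.
Proof.
elim: m j => [|m ih] j; first by rewrite addn0 ffactn0 mul1r.
by rewrite iterS /der ih mulrA -natrM ffact_shift addSnnS.
Qed.

Section Sum.
Variables (r0 : R) (a : nat -> C) (f : C -> C).
Hypotheses (Ha : subexp r0 a)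
  (Hf : forall w, normc w < r0 -> has_csum (fun j => a j * w ^+ j) (f w)).

Lemma pseries_cderiv m w : normc w < r0 ->
  has_csum (fun j => iter m (@der R) a j * w ^+ j) (cderiv m f w) /\
  has_cderiv (cderiv m f) w (cderiv m.+1 f w).
Proof.
have step b g : subexp r0 b ->
    (forall w, normc w < r0 -> has_csum (fun j => b j * w ^+ j) (g w)) ->
    forall w, normc w < r0 -> has_csum (fun j => der b j * w ^+ j) (cderiv 1 g w) /\
      has_cderiv g w (cderiv 1 g w).
  move=> Hb Hg v vr; have [l Hl] := subexp_csum (subexp_der Hb) vr.
  have H := @pseries_deriv R r0 b g (fun=> l) v Hb vr Hg Hl.
  by rewrite (has_cderiv_cderiv H).
have IH : forall v, normc v < r0 ->
    has_csum (fun j => iter m (@der R) a j * v ^+ j) (cderiv m f v).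
  elim: m => [|m ih] v vr; first exact: Hf.
  by have [] := step _ _ (subexp_iter_der m Ha) ih v vr.
move=> wr; split; first exact: IH.
by have [] := step _ _ (subexp_iter_der m Ha) IH w wr.
Qed.

Lemma pseries_taylor m : 0 < r0 -> taylor_coef f m = a m.
Proof.
move=> r00; have [|H _] := @pseries_cderiv m 0; first by rewrite nc0.
rewrite /taylor_coef (cconv_uniq H (@subexp_csum0 _ _)) iter_derE add0n ffactnn.
by rewrite mulrAC divff ?mul1r// pnatr_eq0 -lt0n fact_gt0.
Qed.

End Sum.

Definition psum a z : C := xget 0 [set l | has_csum (fun j => a j * z ^+ j) l].

Lemma psumP r0 a z : subexp r0 a -> normc z < r0 -> has_csum (fun j => a j * z ^+ j) (psum a z).
Proof.
move=> Ha zr; rewrite /psum; case: xgetP => // H.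
by have [l Hl] := subexp_csum Ha zr; have := H l; rewrite /= => /(_ Hl).
Qed.

Definition pfun a : C -> C := patch (fun=> 0) (@unit_disk R) (psum a).

Lemma pfunE a z : normc z < 1 -> pfun a z = psum a z.
Proof. by move=> z1; rewrite /pfun /patch mem_set. Qed.

Lemma pfun_csum a : subexp 1 a -> forall w, normc w < 1 -> has_csum (fun j => a j * w ^+ j) (pfun a w).
Proof. by move=> Ha w w1; rewrite pfunE//; exact: psumP Ha w1. Qed.

Lemma pfun_analytic a : subexp 1 a -> analytic_disk (pfun a).
Proof.
move=> Ha; split => z.
  by move=> /(pseries_cderiv Ha (pfun_csum Ha) 0) [_] /has_cderiv_cderivable.
by move=> z1; rewrite /pfun /patch memNset.
Qed.

Lemma taylor_pfun a j : subexp 1 a -> taylor_coef (pfun a) j = a j.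
Proof. by move=> Ha; apply: pseries_taylor Ha (pfun_csum Ha) _ _. Qed.

End PowerSeriesFunctions.

(** * Boundedness and uniform continuity on smaller disks *)

Section UniformContinuity.
Variable R : realType.
Local Notation C := R[i].
Implicit Types (f : C -> C) (z w : C).

Lemma limit_in_ball (u : nat -> C) z (r : R) : (forall n, normc (u n) <= r) -> cconv u z -> normc z <= r.
Proof. by move=> ur; apply: cconv_norm_le; exists 0%N => n _. Qed.

Lemma cont_disk_bounded f (r : R) : cont_disk f -> r < 1 ->
  exists B, forall z, normc z <= r -> normc (f z) <= B.
Proof.
move=> cf r1; apply: contrapT => /forallNP H.
have K n : exists z, normc z <= r /\ n%:R < normc (f z).
  have /existsNP[z /not_implyP[zr /negP]] := H n%:R.
  by rewrite -ltNge => fz; exists z.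
pose u n := projT1 (cid (K n)).
have uP n : normc (u n) <= r /\ n%:R < normc (f (u n)) := projT2 (cid (K n)).
have [phi [z [hphi Hz]]] := complex_subseq (fun n => (uP n).1).
have zr : normc z <= r by apply: limit_in_ball (fun n => (uP (phi n)).1) Hz.
have [d d0 Hd] := cf z (le_lt_trans zr r1) 1 ltr01.
have d20 : 0 < d / 2 by rewrite divr_gt0.
have [N HN] := (cconvP _ _).1 Hz _ d20.
have ge_id n : (n <= phi n)%N by elim: n => // n ih; exact: leq_ltn_trans ih (hphi _ _ (ltnSn n)).
pose m := maxn N (Num.bound (1 + normc (f z))).
have h1 : normc (f (u (phi m)) - f z) <= 1.
  by apply: Hd; apply: le_lt_trans (HN m (leq_maxl _ _)) _; rewrite ltr_pdivrMr// ltr_pMr// ltr1n.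
have h2 := (uP (phi m)).2.
have h3 : 1 + normc (f z) < (phi m)%:R.
  apply: (lt_le_trans (archi_boundP _)); first by rewrite addr_ge0 ?nc_ge0.
  by rewrite ler_nat; apply: leq_trans (ge_id m); exact: leq_maxr.
have := nc_sub_ge (f (u (phi m))) (f z); lra.
Qed.

Lemma cont_disk_unif f (r e : R) : cont_disk f -> r < 1 -> 0 < e ->
  exists2 d, 0 < d & forall z w, normc z <= r -> normc w <= r -> normc (z - w) <= d ->
    normc (f z - f w) <= e.
Proof.
move=> cf r1 e0; apply: contrapT => /forall2NP H.
have K n : exists zw : C * C, [/\ normc zw.1 <= r, normc zw.2 <= r,
    normc (zw.1 - zw.2) <= n.+1%:R^-1 & e < normc (f zw.1 - f zw.2)].
  have [|/existsNP[z /existsNP[w /not_implyP[zr /not_implyP[wr /not_implyP[zw /negP]]]]]] := H n.+1%:R^-1.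
    by rewrite invr_gt0 ltr0Sn.
  by rewrite -ltNge => h; exists (z, w).
pose u n := projT1 (cid (K n)).
have uP n : [/\ normc (u n).1 <= r, normc (u n).2 <= r,
    normc ((u n).1 - (u n).2) <= n.+1%:R^-1 & e < normc (f (u n).1 - f (u n).2)] := projT2 (cid (K n)).
have ur n : normc (u n).1 <= r by case: (uP n).
have [phi [z [hphi Hz]]] := complex_subseq ur.
have zr : normc z <= r by apply: limit_in_ball (fun n => ur (phi n)) Hz.
have e20 : 0 < e / 2 by rewrite divr_gt0.
have [d d0 Hd] := cf z (le_lt_trans zr r1) _ e20.
have d20 : 0 < d / 2 by rewrite divr_gt0.
have [N HN] := (cconvP _ _).1 Hz _ d20.
have ge_id n : (n <= phi n)%N by elim: n => // n ih; exact: leq_ltn_trans ih (hphi _ _ (ltnSn n)).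
have dd : d / 2 < d by rewrite ltr_pdivrMr// ltr_pMr// ltr1n.
pose m := maxn N (Num.bound (2 / d)).
have [_ _ h3 h4] := uP (phi m).
have h1 : normc ((u (phi m)).1 - z) <= d / 2 := HN m (leq_maxl _ _).
have h5 : (phi m).+1%:R^-1 < d / 2.
  rewrite -[d / 2]invrK ltf_pV2 ?posrE ?invr_gt0 ?ltr0Sn// invf_div.
  apply: (lt_le_trans (archi_boundP _)); first by rewrite divr_ge0// ltW.
  by rewrite ler_nat; apply/leqW/(leq_trans (leq_maxr N _))/ge_id.
have k1 : normc (f (u (phi m)).1 - f z) <= e / 2 by apply: Hd; exact: le_lt_trans h1 dd.
have k2 : normc (f (u (phi m)).2 - f z) <= e / 2.
  apply: Hd; apply: le_lt_trans (nc_dist _ (u (phi m)).1 _) _.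
  rewrite (ncBC (u (phi m)).1 (u (phi m)).2) in h3; have h35 := le_lt_trans h3 h5; lra.
have := nc_dist (f (u (phi m)).1) (f z) (f (u (phi m)).2).
by rewrite (ncBC (f z)); lra.
Qed.

End UniformContinuity.

(** * The circle and roots of unity *)

Section RootsOfUnity.
Variable R : realType.
Local Notation C := R[i].

Definition cexp (t : R) : C := cos t +i* sin t.

Lemma cexpD s t : cexp (s + t) = cexp s * cexp t.
Proof.
apply/eqP; rewrite eq_complex /= cosD sinD; apply/andP; split; apply/eqP; ring.
Qed.

Lemma cexp0 : cexp 0 = 1.
Proof. by rewrite /cexp cos0 sin0. Qed.

Lemma nc_cexp t : normc (cexp t) = 1.
Proof. by rewrite /= cos2Dsin2 sqrtr1. Qed.

Lemma cexpX t n : cexp t ^+ n = cexp (n%:R * t).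
Proof.
elim: n => [|n ih]; first by rewrite mul0r cexp0.
by rewrite exprS ih -cexpD -natr1 mulrDl mul1r addrC.
Qed.

Lemma abs_sin_le (t : R) : `|sin t| <= `|t|.
Proof.
wlog t0 : t / 0 <= t.
  move=> H; have [/H//|/ltW t0] := leP 0 t.
  by rewrite -normrN -sinN -[leRHS]normrN; apply: H; rewrite oppr_ge0.
have [c _ E] := @MVT_segment R (@sin R) (@cos R) 0 t t0 (fun x _ => is_derive_sin x)
  (continuous_subspaceT (@continuous_sin R)).
rewrite -[sin t]subr0 -{1}(@sin0 R) E subr0 normrM ler_piMl//.
by rewrite ler_norml cos_geN1 cos_le1.
Qed.

Lemma abs_cos_le (t : R) : `|cos t - 1| <= `|t|.
Proof.
wlog t0 : t / 0 <= t.
  move=> H; have [/H//|/ltW t0] := leP 0 t.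
  by rewrite -cosN -[leRHS]normrN; apply: H; rewrite oppr_ge0.
have [c _ E] := @MVT_segment R (@cos R) (fun x => - sin x) 0 t t0 (fun x _ => is_derive_cos x)
  (continuous_subspaceT (@continuous_cos R)).
rewrite -(@cos0 R) E subr0 normrM normrN ler_piMl//.
by rewrite ler_norml sin_geN1 sin_le1.
Qed.

Lemma cexp_sub1 t : normc (cexp t - 1) <= 2 * `|t|.
Proof.
apply: le_trans (nc_ReIm _) _; rewrite /= subr0 mulr_natl mulr2n.
by rewrite lerD ?abs_cos_le ?abs_sin_le.
Qed.

Lemma cexp_2pi : cexp (2 * pi) = 1.
Proof.
rewrite mulr_natl mulr2n cexpD /cexp cospi sinpi.
by apply/eqP; rewrite eq_complex /= !mulr0 !mul0r subr0 addr0 mulrNN mulr1 !eqxx.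
Qed.

(** The double angle formula gives cos t = 1 - 2 sin(t/2)^2, and sin(t/2) is positive on this
    range. *)
Lemma cexp_neq1 t : 0 < t < 2 * pi -> cexp t != 1.
Proof.
move=> /andP[t0 t2]; apply/eqP => H.
have s0 : 0 < sin (t / 2) by apply: sin_gt0_pi; apply/andP; split; lra.
have : cos t = 1 by move: H => [].
rewrite (_ : t = t / 2 + t / 2); last by lra.
rewrite cosD; have := cos2Dsin2 (t / 2); have := exprn_gt0 2 s0; rewrite !expr2; lra.
Qed.

Definition om (M : nat) : C := cexp (2 * pi / M%:R).

Lemma nc_om M : normc (om M) = 1. Proof. exact: nc_cexp. Qed.

Lemma om_neq0 M : om M != 0.
Proof. by rewrite -nc_eq0 nc_om oner_eq0. Qed.

Lemma nc_omX M l : normc (om M ^+ l) = 1.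
Proof. by rewrite ncX nc_om expr1n. Qed.

Lemma omM M : (0 < M)%N -> om M ^+ M = 1.
Proof.
by move=> M0; rewrite /om cexpX mulrCA divff ?mulr1 ?cexp_2pi// pnatr_eq0 -lt0n.
Qed.

Lemma om_sub1 M : normc (om M - 1) <= 4 * pi / M%:R.
Proof.
apply: le_trans (cexp_sub1 _) _; rewrite ger0_norm; last by rewrite divr_ge0// mulr_ge0// pi_ge0.
by rewrite mulrA mulrA -natrM.
Qed.

Lemma omX_neq1 M s : (0 < s < M)%N -> om M ^+ s != 1.
Proof.
move=> /andP[s0 sM]; rewrite /om cexpX; apply: cexp_neq1.
have M0 : 0 < M%:R :> R by rewrite ltr0n (leq_trans _ sM).
have p0 := pi_gt0 R; apply/andP; split.
  by rewrite mulr_gt0 ?ltr0n// divr_gt0// mulr_gt0.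
by rewrite mulrCA gtr_pMr ?mulr_gt0// ltr_pdivrMr// mul1r ltr_nat.
Qed.

Lemma om_sum M s : (0 < s < M)%N -> \sum_(l < M) (om M ^+ s) ^+ l = 0.
Proof.
move=> sM; have := subrX1 (om M ^+ s) M.
rewrite exprAC omM ?expr1n ?subrr; last by case/andP: sM; case: M.
by move/esym/eqP; rewrite mulf_eq0 subr_eq0 (negbTE (omX_neq1 sM)) => /eqP.
Qed.

End RootsOfUnity.

(** * Interpolation of a primitive at scaled roots of unity *)

Section Interpolation.
Variable R : realType.
Local Notation C := R[i].
Implicit Types (f : C -> C) (z w : C).
Local Notation J := (@cintegral01 R).

Lemma ccont01_sum n (F : nat -> R -> C) : (forall l, ccont01 (F l)) ->
  ccont01 (fun t => \sum_(l < n) F l t).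
Proof.
move=> cF; elim: n => [|n ih].
  by rewrite (_ : (fun t => _) = (fun=> 0)); [exact: ccont01_cst|apply/funext => t; rewrite big_ord0].
rewrite (_ : (fun t => _) = (fun t => (\sum_(l < n) F l t) + F n t)); first exact: ccont01D.
by apply/funext => t; rewrite big_ord_recr.
Qed.

Lemma J_sum n (F : nat -> R -> C) : (forall l, ccont01 (F l)) ->
  J (fun t => \sum_(l < n) F l t) = \sum_(l < n) J (F l).
Proof.
move=> cF; elim: n => [|n ih].
  by rewrite big_ord0 -[RHS](@J_cst R 0); congr J; apply/funext => t; rewrite big_ord0.
rewrite big_ord_recr /= -ih -(J_D (ccont01_sum n cF) (cF n)).
by congr J; apply/funext => t; rewrite big_ord_recr.
Qed.

Section Polygon.
Variables (f : C -> C) (hf : holo f) (M : nat) (rho : R) (z : C) (dl : R).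
Hypotheses (M2 : (1 < M)%N) (rho01 : 0 < rho < 1) (zr : normc z < rho).
Hypothesis osc : forall w w', normc w <= rho -> normc w' <= rho ->
  normc (w - w') <= normc (om R M - 1) -> normc (f w - f w') <= dl.
Local Notation w := (om R M).
Local Notation F := (integration f).

Let M0 : (0 < M)%N. Proof. exact: ltnW. Qed.
Let rho0 : 0 < rho. Proof. by case/andP: rho01. Qed.
Let rho1 : rho < 1. Proof. by case/andP: rho01. Qed.

Let p l : C := rho%:C * w ^+ l.

Let nc_p l : normc (p l) = rho.
Proof. by rewrite ncM nc_real nc_omX mulr1 gtr0_norm. Qed.

Let p_neq0 l : p l != 0.
Proof. by rewrite -nc_gt0 nc_p. Qed.

Let w1 : w - 1 != 0.
Proof. by rewrite subr_eq0; have := @omX_neq1 R M 1 M2; rewrite expr1. Qed.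

(** Up to the factor t rho (w - 1), the sum is a Riemann sum for the integral of f along the closed
    polygon with vertices [c l], whose edges are proportional to w^l. That integral is zero, and
    each edge contributes an error governed by the oscillation [dl]. *)
Lemma polygon_mean t : 0 <= t <= 1 ->
  normc (\sum_(l < M) w ^+ l * f (spath z (p l) t)) <= 2 * dl * M%:R.
Proof.
move=> /andP[t0 t1]; have [->|tn0] := eqVneq t 0.
  under eq_bigr do rewrite /spath mul0r addr0.
  have := @om_sum R M 1 M2; rewrite expr1 -mulr_suml => ->.
  rewrite mul0r nc0 mulr_ge0 ?ler0n// mulr_ge0//.
  have z1 : normc z <= rho := ltW zr.
  by have := osc z1 z1; rewrite subrr nc0 nc_ge0 subrr nc0; exact.
have tp : 0 < t by rewrite lt_def tn0.
pose c l := spath z (p l) t.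
have cr l : normc (c l) <= rho.
  by apply: path_norm; rewrite ?nc_p ?(ltW zr)// t0.
have c1 l : normc (c l) < 1 := le_lt_trans (cr l) rho1.
have cS l : c l.+1 - c l = t%:C * p l * (w - 1).
  by rewrite /c /spath /p exprS; ring.
have ncS l : normc (c l.+1 - c l) = t * rho * normc (w - 1).
  by rewrite cS ncM ncM nc_p nc_real (ger0_norm t0).
have seg_err l : normc (seg f (c l) (c l.+1) - f (c l) * (c l.+1 - c l)) <=
     2 * dl * normc (c l.+1 - c l).
  have -> : seg f (c l) (c l.+1) - f (c l) * (c l.+1 - c l) =
      seg (fun v => f v - (f (c l) + 0 * v)) (c l) (c l.+1).
    by rewrite (seg_affine (holo_cont hf))//; field.
  apply: seg_bound => // [|s s01]; first exact/holo_cont/holo_affine.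
  rewrite mul0r addr0; apply: osc => //.
    exact: path_norm.
  have -> : spath (c l) (c l.+1) s - c l = s%:C * (c l.+1 - c l) by rewrite /spath; ring.
  case/andP: s01 => s0 s1; rewrite ncM nc_real ger0_norm// ncS.
  rewrite mulrA; apply: ler_piMl; first exact: nc_ge0.
  by rewrite !mulr_ile1// ?mulr_ge0// ltW.
(* Goursat enters here: edge integrals are increments of the primitive, and the polygon closes
   because w^M = 1. *)
have tele : \sum_(l < M) seg f (c l) (c l.+1) = 0.
  under eq_bigr do rewrite -integration_seg//.
  rewrite -(big_mkord xpredT (fun l => F (c l.+1) - F (c l))) telescope_sumr//.
  by rewrite /c /p omM// expr0 subrr.
pose S := \sum_(l < M) w ^+ l * f (c l).
have ES : S * (t%:C * rho%:C * (w - 1)) =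
   - \sum_(l < M) (seg f (c l) (c l.+1) - f (c l) * (c l.+1 - c l)).
  rewrite sumrB tele sub0r opprK mulr_suml; apply: eq_bigr => l _.
  by rewrite cS /p; ring.
have q0 : 0 < t * rho * normc (w - 1) by rewrite !mulr_gt0// nc_gt0.
rewrite -(ler_pM2r q0).
have -> : normc S * (t * rho * normc (w - 1)) = normc (S * (t%:C * rho%:C * (w - 1))).
  by rewrite !ncM !nc_real (gtr0_norm tp) (gtr0_norm rho0).
rewrite ES ncN; apply: le_trans (nc_sum _ _ _) _.
apply: (@le_trans _ _ (\sum_(l < M) 2 * dl * (t * rho * normc (w - 1)))).
  by apply: ler_sum => l _; rewrite -(ncS l).
by rewrite sumr_const card_ord -mulr_natr le_eqVlt; apply/orP; left; apply/eqP; ring.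
Qed.

(** Discrete Fourier coefficients of [F] on the circle of radius rho: the coefficients of the
    polynomial interpolating [F] at the nodes [p l]. *)
Definition icoef j : C := (rho ^- j)%:C * (M%:R^-1 * \sum_(l < M) F (p l) * (w ^- (l * j))).

(** The finite geometric sums [S l] are a discrete Cauchy kernel with pole factor p_l - z. Writing
    F(p_l) - F(z) as an integral along the segment produces the same factor, which cancels the pole
    and leaves the average of [polygon_mean]. The constant 8 is 2 from [J_bound], 2 from |k| and 2
    from [polygon_mean]. *)
Lemma interpolation_error :
  normc (\sum_(j < M) icoef j * z ^+ j - F z) <= 8 * dl.
Proof.
have rn0 : rho%:C != 0 :> C by rewrite -nc_gt0 nc_real gtr0_norm.
pose x l := z / p l; pose S l := \sum_(j < M) x l ^+ j; pose k := 1 - (z / rho%:C) ^+ M.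
have ES l : (p l - z) * S l = p l * k.
  have H : (1 - x l) * S l = k.
    rewrite /S -opprB mulNr -subrX1 opprB /k /x /p invfM mulrA expr_div_n.
    by rewrite -exprM mulnC exprM omM// expr1n divr1.
  by rewrite -H mulrA; congr (_ * _); rewrite /x; field.
have Ex l j : x l ^+ j = (rho ^- j)%:C * z ^+ j * w ^- (l * j).
  rewrite /x /p exprMn exprVn exprMn invfM -exprM fmorphV rmorphXn /=.
  by rewrite mulrA [z ^+ j * _]mulrC.
have EP : \sum_(j < M) icoef j * z ^+ j = M%:R^-1 * \sum_(l < M) F (p l) * S l.
  have -> : \sum_(l < M) F (p l) * S l = \sum_(j < M) \sum_(l < M) F (p l) * x l ^+ j.
    by rewrite exchange_big; apply: eq_bigr => l _; rewrite mulr_sumr.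
  rewrite mulr_sumr; apply: eq_bigr => j _.
  transitivity (M%:R^-1 * (((rho ^- j)%:C * z ^+ j) * \sum_(l < M) F (p l) * w ^- (l * j))).
    by rewrite /icoef; ring.
  by congr (_ * _); rewrite mulr_sumr; apply: eq_bigr => l _; rewrite Ex; ring.
have Mn0 : (M%:R : C) != 0 by rewrite pnatr_eq0 -lt0n.
(* The interpolant reproduces constants: every power j with 0 < j < M averages to zero over the
   nodes. *)
have ESum : \sum_(l < M) S l = M%:R.
  rewrite exchange_big /= (bigD1 (Ordinal M0)) //= [X in _ + X]big1 ?addr0.
    by under eq_bigr do rewrite expr0; rewrite sumr_const card_ord.
  move=> j j0; under eq_bigr do rewrite Ex.
  rewrite -mulr_sumr; have jM : (0 < j < M)%N by rewrite lt0n ltn_ord andbT.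
  have y1 : w ^- j != 1 by rewrite invr_eq1 omX_neq1.
  have := subrX1 (w ^- j) M; rewrite exprVn -exprM mulnC exprM omM// expr1n invr1 subrr.
  move/esym/eqP; rewrite mulf_eq0 subr_eq0 (negbTE y1) /= => /eqP H.
  have -> : \sum_(l < M) w ^- (l * j) = \sum_(l < M) (w ^- j) ^+ l.
    by apply: eq_bigr => l _; rewrite exprVn -exprM mulnC.
  by rewrite H mulr0.
have z1 : normc z < 1 := lt_trans zr rho1.
have p1 l : normc (p l) < 1 by rewrite nc_p.
have cJ l : ccont01 (fun t => w ^+ l * f (spath z (p l) t)).
  by apply/ccont01Z/(ccont01_path (holo_cont hf)).
have main : \sum_(j < M) icoef j * z ^+ j - F z =
   M%:R^-1 * (rho%:C * k * J (fun t => \sum_(l < M) w ^+ l * f (spath z (p l) t))).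
  have -> : F z = M%:R^-1 * (F z * \sum_(l < M) S l) by rewrite ESum mulrCA mulVf ?mulr1.
  rewrite EP -mulrBr; congr (_ * _); rewrite mulr_sumr -sumrB (J_sum M cJ) mulr_sumr.
  apply: eq_bigr => l _; rewrite -mulrBl integration_seg// /seg.
  rewrite mulrAC ES (J_Z _ (ccont01_path (holo_cont hf) z1 (p1 l))) /p; ring.
rewrite main !ncM ncV nc_nat nc_real gtr0_norm//.
have k2 : normc k <= 2.
  apply: le_trans (ncB _ _) _; rewrite nc1 ncX ncM ncV nc_real gtr0_norm//.
  have : (normc z / rho) ^+ M <= 1.
    by rewrite exprn_ile1 ?divr_ge0 ?nc_ge0 ?(ltW rho0)// ler_pdivrMr// mul1r ltW.
  by have : (2 : R) = 1 + 1 by []; lra.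
have := J_bound (ccont01_sum M cJ) polygon_mean.
set Q := normc (J _) => HQ.
have Q0 : 0 <= Q := nc_ge0 _.
have MR : 0 < M%:R :> R by rewrite ltr0n.
rewrite ler_pdivrMl//.
have h1 : rho * normc k * Q <= 2 * Q.
  rewrite ler_wpM2r// -[2]mul1r; apply: ler_pM => //; [exact: ltW|exact: nc_ge0|exact: ltW].
by apply: le_trans h1 _; nra.
Qed.

Lemma icoef_bound j (B : R) : (forall v, normc v <= rho -> normc (F v) <= B) ->
  normc (icoef j) <= B / rho ^+ j.
Proof.
move=> FB; rewrite /icoef ncM nc_real ger0_norm; last by rewrite invr_ge0 exprn_ge0// ltW.
rewrite mulrC ler_wpM2r ?invr_ge0 ?exprn_ge0 ?(ltW rho0)//.
have MR : 0 < M%:R :> R by rewrite ltr0n.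
rewrite ncM ncV nc_nat ler_pdivrMl//; apply: le_trans (nc_sum _ _ _) _.
rewrite mulr_natl -[X in _ *+ X]card_ord -sumr_const; apply: ler_sum => l _.
by rewrite ncM ncV nc_omX invr1 mulr1 FB// nc_p.
Qed.

End Polygon.
End Interpolation.

(** * Power series expansion of primitives *)

Section Expansion.
Variable R : realType.
Local Notation C := R[i].
Implicit Types (f : C -> C) (z w : C).

Lemma geo_tail_sum (q : R) n m : 0 <= q < 1 -> \sum_(n <= j < m) q ^+ j <= q ^+ n / (1 - q).
Proof.
move=> q01; have [nm|mn] := leqP n m; last first.
  rewrite big_geq ?(ltnW mn)//; case/andP: q01 => q0 q1.
  by rewrite divr_ge0 ?exprn_ge0// subr_ge0 ltW.
rewrite -{1}(add0n n) big_addn big_mkord.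
under eq_bigr do rewrite exprD mulrC.
rewrite -mulr_sumr ler_wpM2l ?geo_sum_le//; by rewrite exprn_ge0//; case/andP: q01.
Qed.

Lemma primitive_expansion f (rho : R) : holo f -> 0 < rho < 1 ->
  exists a, subexp rho a /\
   forall z, normc z < rho -> has_csum (fun j => a j * z ^+ j) (integration f z).
Proof.
move=> hf rho01; have /andP[rho0 rho1] := rho01.
pose F := integration f.
have hF : holo F by move=> z z1; exact: has_cderiv_cderivable (integration_cderiv hf z1).
have [B HB] := cont_disk_bounded (holo_cont hF) rho1.
have B0 : 0 <= B by apply: le_trans (HB 0 _); rewrite ?nc_ge0// nc0 ltW.
(* At least two nodes are taken, as the polygon estimate requires. The coefficients obey a bound B /
   rho^j independent of [n], so a subsequence converges coefficientwise. *)
pose u n j : C := if (j < n.+2)%N then icoef f n.+2 rho j else 0.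
have uB n j : normc (u n j) <= B / rho ^+ j.
  rewrite /u; case: ifP => _; first exact: icoef_bound.
  by rewrite nc0 divr_ge0// exprn_ge0// ltW.
have [phi [a [hphi Ha]]] := coef_subseq uB.
have aB j : normc (a j) <= B / rho ^+ j.
  by apply: (@cconv_norm_le _ (fun n => u (phi n) j) _ _ _ (Ha j)); exists 0%N.
exists a; split.
  move=> r /andP[r0 rr]; exists B => j.
  apply: le_trans (ler_wpM2r (exprn_ge0 j (ltW r0)) (aB j)) _.
  rewrite mulrAC ler_pdivrMr ?exprn_gt0// ler_wpM2l//.
  by apply: lerXn2r; rewrite ?nnegrE ltW.
move=> z zr; set q := normc z / rho.
have q01 : 0 <= q < 1 by rewrite /q divr_ge0 ?nc_ge0 ?(ltW rho0)//= ltr_pdivrMr// mul1r.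
have tail N n : (N <= n.+2)%N -> normc (\sum_(j < n.+2) u n j * z ^+ j - \sum_(j < N) u n j * z ^+ j)
    <= B * q ^+ N / (1 - q).
  move=> Nn; rewrite -!(big_mkord xpredT (fun j => u n j * z ^+ j)).
  rewrite (big_cat_nat (n := N))//= addrAC subrr add0r; apply: le_trans (nc_sum _ _ _) _.
  rewrite -mulrA; apply: le_trans (ler_wpM2l B0 (geo_tail_sum N n.+2 q01)).
  rewrite mulr_sumr; apply: ler_sum => j _; rewrite ncM ncX /q expr_div_n mulrA.
  by rewrite mulrAC ler_wpM2r ?exprn_ge0 ?nc_ge0.
(* With [N] fixed, only finitely many coefficients pass to the limit; the rest of the interpolant is
   a geometric tail bounded uniformly in [n], and the interpolant itself approaches [F]. *)
have key N : normc (\sum_(j < N) a j * z ^+ j - F z) <= B * q ^+ N / (1 - q).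
  apply/ler_addgt0Pr => e e0.
  have e2 : 0 < e / 2 by rewrite divr_gt0.
  have e16 : 0 < e / 16 by rewrite divr_gt0.
  have [d d0 Hd] := cont_disk_unif (holo_cont hf) rho1 e16.
  have Hcv : cconv (fun n => \sum_(j < N) u (phi n) j * z ^+ j) (\sum_(j < N) a j * z ^+ j).
    apply: (@cconv_sum _ _ _ _ (fun (j : 'I_N) n => u (phi n) j * z ^+ j)) => j _.
    have Haj : cconv (fun n => u (phi n) j) (a j) := Ha j.
    by rewrite [X in cconv _ X]mulrC; apply: (cconv_eq _ (cconvZ (z ^+ j) Haj)) => n; rewrite mulrC.
  have [N1 HN1] := (cconvP _ _).1 Hcv _ e2.
  pose n := maxn N1 (maxn N (Num.bound (4 * pi / d))).
  have ge_id m : (m <= phi m)%N by elim: m => // m ih; exact: leq_ltn_trans ih (hphi _ _ (ltnSn m)).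
  have h1 := HN1 n (leq_maxl _ _).
  have Nn : (N <= (phi n).+2)%N.
    by do 2 apply: leqW; apply: leq_trans (ge_id n); rewrite /n !leq_max leqnn orbT.
  have h2 := tail _ _ Nn.
  have omd : normc (om R (phi n).+2 - 1) <= d.
    apply: le_trans (om_sub1 _ _) _; rewrite ler_pdivrMr ?ltr0Sn// [leRHS]mulrC -ler_pdivrMr//.
    have b0 : 0 <= 4 * pi / d :> R by rewrite divr_ge0 ?(ltW d0)// mulr_ge0// pi_ge0.
    apply: (le_trans (ltW (archi_boundP b0))).
    by rewrite ler_nat; do 2 apply: leqW; apply: leq_trans (ge_id n); rewrite /n !leq_max leqnn !orbT.
  have h3 : normc (\sum_(j < (phi n).+2) u (phi n) j * z ^+ j - F z) <= e / 2.
    have := @interpolation_error R f hf (phi n).+2 rho z (e / 16) isT rho01 zr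
      (fun v v' hv hv' hvv => Hd v v' hv hv' (le_trans hvv omd)).
    rewrite (_ : 8 * (e / 16) = e / 2); last by lra.
    have -> : \sum_(j < (phi n).+2) icoef f (phi n).+2 rho j * z ^+ j =
       \sum_(j < (phi n).+2) u (phi n) j * z ^+ j.
      by apply: eq_bigr => j _; rewrite /u ltn_ord.
    exact.
  apply: le_trans (nc_dist _ (\sum_(j < N) u (phi n) j * z ^+ j) _) _.
  have h4 := nc_dist (\sum_(j < N) u (phi n) j * z ^+ j) (\sum_(j < (phi n).+2) u (phi n) j * z ^+ j) (F z).
  rewrite (ncBC (\sum_(j < N) a j * z ^+ j)).
  rewrite (ncBC (\sum_(j < N) u (phi n) j * z ^+ j) (\sum_(j < (phi n).+2) u (phi n) j * z ^+ j)) in h4.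
  lra.
apply/cconvP => e e0; case/andP: (q01) => q0 q1.
have p0 : 0 < 1 - q by rewrite subr_gt0.
have [N _ HN] : \forall n \near \oo, `|0 - q ^+ n| < e * (1 - q) / (B + 1).
  have := @cvg_expr R q ltac:(by rewrite ger0_norm).
  by move/cvgrPdist_lt; apply; rewrite divr_gt0 ?mulr_gt0// ltr_pwDr.
exists N => n /HN /=; rewrite sub0r normrN ger0_norm ?exprn_ge0// => h.
apply: le_trans (key n) _; rewrite ler_pdivrMr//.
rewrite ltr_pdivlMr ?ltr_pwDr// in h; apply: le_trans (ltW h).
by rewrite mulrC ler_wpM2l ?exprn_ge0// lerDl.
Qed.

End Expansion.

(** * Holomorphic functions as sums of their Taylor series *)

Section HolomorphicExpansion.
Variable R : realType.
Local Notation C := R[i].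
Implicit Types (f g h : C -> C) (z w : C).
Local Notation tc := (@taylor_coef R).

Theorem holo_expansion f : holo f -> subexp 1 (tc f) /\
  forall w, normc w < 1 -> has_csum (fun j => tc f j * w ^+ j) (f w).
Proof.
move=> hf; pose F := integration f.
(* The coefficients found for different rho are all the Taylor coefficients of [F], which glues the
   expansions into one on the whole disk; [f] is then its termwise derivative. *)
have K (rho : R) : 0 < rho < 1 -> subexp rho (tc F) /\
    forall w, normc w < rho -> has_csum (fun j => tc F j * w ^+ j) (F w).
  move=> r01; have [a [Ha HF]] := primitive_expansion hf r01.
  suff -> : tc F = a by [].
  by apply/funext => j; apply: pseries_taylor Ha HF _ _; case/andP: r01.
have mid (r : R) : 0 <= r < 1 -> 0 < (1 + r) / 2 < 1 /\ r < (1 + r) / 2.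
  by move=> /andP[r0 r1]; split; [apply/andP; split|]; lra.
have HaF : subexp 1 (tc F).
  move=> r /andP[r0 r1]; have [|m1 m2] := mid r; first by rewrite ltW.
  by apply: (K _ m1).1; rewrite r0.
have HF w : normc w < 1 -> has_csum (fun j => tc F j * w ^+ j) (F w).
  move=> w1; have [|m1 m2] := mid (normc w); first by rewrite nc_ge0.
  exact: (K _ m1).2.
have Ha : subexp 1 (der (tc F)) := subexp_der HaF.
have Hf w : normc w < 1 -> has_csum (fun j => der (tc F) j * w ^+ j) (f w).
  move=> w1; have [H _] := pseries_cderiv HaF HF 1 w1.
  by rewrite (has_cderiv_cderiv (integration_cderiv hf w1)) in H.
suff -> : tc f = der (tc F) by [].
by apply/funext => j; apply: pseries_taylor Ha Hf _ _.
Qed.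

Lemma holo_cderiv f m w : holo f -> normc w < 1 -> has_cderiv (cderiv m f) w (cderiv m.+1 f w).
Proof. by move=> /holo_expansion[Ha Hf] w1; exact: (pseries_cderiv Ha Hf m w1).2. Qed.

Lemma holo_holo f m : holo f -> holo (cderiv m f).
Proof. by move=> hf w /(holo_cderiv m hf)/has_cderiv_cderivable. Qed.

Lemma cderiv_csum f m w : holo f -> normc w < 1 ->
  has_csum (fun j => ((j + m) ^_ m)%:R * tc f (j + m)%N * w ^+ j) (cderiv m f w).
Proof.
move=> /holo_expansion[Ha Hf] w1; have [H _] := pseries_cderiv Ha Hf m w1.
by apply: (cconv_eq _ H) => n; apply: eq_bigr => j _; rewrite iter_derE.
Qed.

Lemma taylor_cderiv f m j : taylor_coef (cderiv m f) j = ((j + m) ^_ m)%:R * tc f (j + m)%N.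
Proof.
rewrite /taylor_coef -cderivD mulrCA; congr (_ * _).
have H : ((j + m) ^_ m * j`! = (j + m)`!)%N.
  by rewrite -(@ffact_fact (j + m) m (leq_addl _ _)) addnK.
rewrite -H natrM invfM mulrA divff ?mul1r// pnatr_eq0 -lt0n ffact_gt0.
exact: leq_addl.
Qed.

Lemma analytic_holo f : analytic_disk f -> holo f.
Proof. by case=> H _ z z1; apply: H. Qed.

Lemma analytic_ext f g : analytic_disk f -> analytic_disk g ->
  (forall j, tc f j = tc g j) -> f = g.
Proof.
move=> af ag fg; apply/funext => z; have [z1|z1] := ltP (normc z) 1.
  have [_ /(_ z z1) Hf] := holo_expansion (analytic_holo af).
  have [_ /(_ z z1) Hg] := holo_expansion (analytic_holo ag).
  by apply: cconv_uniq Hf _; apply: (cconv_eq _ Hg) => n; apply: eq_bigr => j _; rewrite fg.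
have nz : ~ unit_disk z by rewrite /unit_disk /= => zz; rewrite ltNge z1 in zz.
by rewrite af.2// ag.2.
Qed.

Lemma holo_lin c f g : holo f -> holo g -> holo (fun w => c * f w + g w).
Proof.
move=> hf hg z z1; have Hf := cderivable_has_cderiv (hf z z1).
have Hg := cderivable_has_cderiv (hg z z1).
exact: has_cderiv_cderivable (has_cderivD (has_cderivM (has_cderiv_cst c z) Hf) Hg).
Qed.

Lemma taylor_lin c f g j : holo f -> holo g ->
  tc (fun w => c * f w + g w) j = c * tc f j + tc g j.
Proof.
move=> hf hg; have [Ha Hf] := holo_expansion hf; have [Hb Hg] := holo_expansion hg.
have Hc : subexp 1 (fun j => c * tc f j + tc g j).
  move=> r r01; have [A HA] := Ha r r01; have [B HB] := Hb r r01.
  exists (normc c * A + B) => i; have r0 : 0 <= r by case/andP: r01 => /ltW.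
  apply: le_trans (ler_wpM2r (exprn_ge0 i r0) (ncD _ _)) _; rewrite mulrDl lerD//.
  by rewrite ncM -mulrA ler_wpM2l ?nc_ge0.
apply: pseries_taylor Hc _ _ ltr01 => w w1.
apply: (cconv_eq _ (has_csumD (has_csumZ c (Hf w w1)) (Hg w w1))) => n.
by apply: eq_bigr => i _; rewrite mulrDl mulrA.
Qed.

End HolomorphicExpansion.

Section NonnegativeSeries.
Variable R : realType.

Lemma series_ltyP (u : nat -> R) : (forall j, 0 <= u j) ->
  (\sum_(0 <= j <oo) (u j)%:E < +oo)%E <-> exists B, forall N, \sum_(j < N) u j <= B.
Proof.
move=> u0; have u0' j : (0 <= (u j)%:E)%E by rewrite lee_fin.
split.
  move=> H; exists (fine (\sum_(0 <= j <oo) (u j)%:E)%E) => N.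
  have fin : (\sum_(0 <= j <oo) (u j)%:E)%E \is a fin_num.
    by rewrite ge0_fin_numE//; apply: nneseries_ge0 => *.
  rewrite -lee_fin fineK// -(big_mkord xpredT u) -sumEFin.
  by apply: nneseries_lim_ge => *.
move=> [B HB]; apply: (@le_lt_trans _ _ B%:E); last by rewrite ltry.
apply: lime_le; first by apply: is_cvg_nneseries => *.
by apply: nearW => N; rewrite sumEFin lee_fin big_mkord.
Qed.

End NonnegativeSeries.

(** * The Hardy space and its inner product *)

Section HardySpace.
Variable R : realType.
Local Notation C := R[i].
Implicit Types (f g h : C -> C) (z w : C).
Local Notation tc := (@taylor_coef R).
Local Notation H2 := (@hardy2 R).
Local Notation ip := (@hardy2_ip R).

Lemma hardy2P f : H2 f <-> analytic_disk f /\
  exists B : R, forall N, \sum_(j < N) normc (tc f j) ^+ 2 <= B.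
Proof.
have P := @series_ltyP R (fun j => normc (tc f j) ^+ 2) (fun j => sqr_ge0 _).
by split=> -[af] /P.
Qed.

Lemma hardy2_holo f : H2 f -> holo f.
Proof. by case=> /analytic_holo. Qed.

Lemma hardy2_lin c f g : H2 f -> H2 g -> H2 (c *: f + g).
Proof.
move=> /hardy2P[af [A HA]] /hardy2P[ag [B HB]]; apply/hardy2P.
have hf := analytic_holo af; have hg := analytic_holo ag.
have -> : c *: f + g = (fun w => c * f w + g w) by apply/funext.
split.
  split; first by move=> z z1; exact: (holo_lin hf hg).
  by move=> z z1; rewrite af.2// ag.2// mulr0 addr0.
exists (2 * (normc c ^+ 2 * A + B)) => N.
apply: (@le_trans _ _ (2 * (normc c ^+ 2 * (\sum_(j < N) normc (tc f j) ^+ 2) + \sum_(j < N) normc (tc g j) ^+ 2))).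
  rewrite mulrDr !mulr_sumr -big_split /=; apply: ler_sum => j _.
  rewrite [tc _ _](taylor_lin c j hf hg).
  have := ncD (c * tc f j) (tc g j); rewrite ncM.
  set x := normc _; set y := normc c; set u := normc (tc f j); set v := normc (tc g j) => hx.
  have : x ^+ 2 <= (y * u + v) ^+ 2 by apply: lerXn2r; rewrite ?nnegrE ?addr_ge0 ?mulr_ge0 ?nc_ge0.
  by have := sqr_ge0 (y * u - v); nra.
rewrite ler_wpM2l// lerD// ler_wpM2l//; exact: sqr_ge0.
Qed.

Lemma tc_lin c f g j : H2 f -> H2 g -> tc (c *: f + g) j = c * tc f j + tc g j.
Proof.
move=> hf hg; have -> : c *: f + g = (fun w => c * f w + g w) by apply/funext.
exact: (taylor_lin c j (hardy2_holo hf) (hardy2_holo hg)).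
Qed.

Lemma ip_csum f h : H2 f -> H2 h -> has_csum (fun j => tc f j * (tc h j)^*) (ip f h).
Proof.
move=> /hardy2P[af [A HA]] /hardy2P[ah [B HB]].
have [|l Hl] := @has_csum_abs R (fun j => tc f j * (tc h j)^*) (A + B).
  move=> N; apply: le_trans (lerD (HA N) (HB N)); rewrite -big_split; apply: ler_sum => j _ /=.
  rewrite ncM nc_conj; set x := normc _; set y := normc _.
  by have := sqr_ge0 (x - y); have := sqr_ge0 (x + y); nra.
suff -> : ip f h = l by [].
apply: cconv_lim; apply: (cconv_eq _ Hl) => n.
by rewrite seriesEord.
Qed.

Lemma ip_lin c f g h : H2 f -> H2 g -> H2 h -> ip (c *: f + g) h = c * ip f h + ip g h.
Proof.
move=> hf hg hh; apply: cconv_uniq (ip_csum (hardy2_lin c hf hg) hh) _.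
apply: (cconv_eq _ (has_csumD (has_csumZ c (ip_csum hf hh)) (ip_csum hg hh))) => n.
by apply: eq_bigr => j _; rewrite tc_lin// mulrDl mulrA.
Qed.

Lemma ip_conj f h : H2 f -> H2 h -> ip h f = (ip f h)^*.
Proof.
move=> hf hh; apply: cconv_uniq (ip_csum hh hf) _.
apply: (cconv_eq _ (cconv_conj (ip_csum hf hh))) => n.
by rewrite rmorph_sum; apply: eq_bigr => j _; rewrite rmorphM /= conjCK mulrC.
Qed.

Lemma ip_sq_cvg f : H2 f ->
  (fun N => \sum_(j < N) normc (tc f j) ^+ 2) @ \oo --> complex.Re (ip f f).
Proof.
move=> hf; have := ip_csum hf hf => /cconvP H; apply/cvgrPdist_le => e e0.
have [N HN] := H e e0; exists N => // n /HN h; rewrite distrC; apply: le_trans h.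
have -> : \sum_(j < n) tc f j * (tc f j)^* = (\sum_(j < n) normc (tc f j) ^+ 2)%:C.
  by rewrite rmorph_sum; apply: eq_bigr => j _; exact: mulcJ.
by apply: le_trans (nc_Re _); rewrite ReD ReN.
Qed.

Lemma ip_sq_ge f N : H2 f -> \sum_(j < N) normc (tc f j) ^+ 2 <= complex.Re (ip f f).
Proof.
move=> hf; have c := ip_sq_cvg hf; apply: (cvgr_to_ge c); exists N => // n /= Nn.
rewrite -(subnKC Nn) big_split_ord /= lerDl; apply: sumr_ge0 => i _; exact: sqr_ge0.
Qed.

Lemma ip_sq_le f (B : R) : H2 f -> (forall N, \sum_(j < N) normc (tc f j) ^+ 2 <= B) ->
  complex.Re (ip f f) <= B.
Proof.
move=> hf H; have c := ip_sq_cvg hf.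
by apply: (cvgr_to_le c); apply: nearW.
Qed.

Lemma ip_ge0 f : H2 f -> 0 <= complex.Re (ip f f).
Proof. by move=> hf; have := ip_sq_ge 0 hf; rewrite big_ord0. Qed.

Lemma ip_def f : H2 f -> complex.Re (ip f f) = 0 -> f = 0.
Proof.
move=> hf f0; have h0 : analytic_disk (0 : C -> C).
  by split=> // z _; exact: has_cderiv_cderivable (has_cderiv_cst 0 z).
apply: analytic_ext => //; first exact: hf.1.
move=> j; have z : forall i, tc f i = 0.
  move=> i; have := ip_sq_ge i.+1 hf; rewrite f0 big_ord_recr /= => h.
  have : 0 <= \sum_(j < i) normc (tc f j) ^+ 2 by apply: sumr_ge0 => *; exact: sqr_ge0.
  have s := sqr_ge0 (normc (tc f i)) => h'.
  by apply/eqP; rewrite -nc_eq0 -sqrf_eq0; apply/eqP/le_anti; rewrite s andbT; lra.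
rewrite z; apply/esym.
have := taylor_lin (-1) j (hardy2_holo hf) (hardy2_holo hf).
rewrite z mulr0 addr0 => <-; congr (tc _ j); apply/funext => w.
by rewrite mulN1r addNr.
Qed.

Lemma hardy2_pfun (a : nat -> C) (B : R) : (forall N, \sum_(j < N) normc (a j) ^+ 2 <= B) ->
  [/\ H2 (pfun a), forall j, tc (pfun a) j = a j & subexp 1 a].
Proof.
move=> HB; have B0 : 0 <= B by have := HB 0%N; rewrite big_ord0.
have aB j : normc (a j) <= B + 1.
  have := HB j.+1; rewrite big_ord_recr /=.
  have : 0 <= \sum_(i < j) normc (a i) ^+ 2 by apply: sumr_ge0 => *; exact: sqr_ge0.
  by have := sqr_ge0 (normc (a j) - 1); rewrite sqrrB expr1n mulr1; nra.
have Ha : subexp 1 a.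
  move=> r /andP[r0 r1]; exists (B + 1) => j; rewrite -[leRHS]mulr1.
  by apply: ler_pM; rewrite ?nc_ge0 ?exprn_ge0 ?(ltW r0)// exprn_ile1// ltW.
split=> //; last by move=> j; exact: taylor_pfun.
apply/hardy2P; split; first exact: pfun_analytic.
by exists B => N; under eq_bigr do rewrite taylor_pfun//; exact: HB.
Qed.

End HardySpace.

(** The axioms are algebraic: in the spectral argument below, limits of maximizing sequences are
    supplied by the compactness of the operator. *)
Record inner_product_space (R : realType) (V : lmodType R[i]) (H : set V)
    (ip : V -> V -> R[i]) : Prop := InnerProductSpace {
  ips_0 : H 0;
  ips_lin : forall (c : R[i]) f g, H f -> H g -> H (c *: f + g);
  ips_linl : forall (c : R[i]) f g h, H f -> H g -> H h ->
    ip (c *: f + g) h = c * ip f h + ip g h;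
  ips_conj : forall f h, H f -> H h -> ip h f = (ip f h)^*;
  ips_pos : forall f, H f -> 0 <= complex.Re (ip f f);
  ips_def : forall f, H f -> complex.Re (ip f f) = 0 -> f = 0
}.

(** * Compact operators and maximizing vectors *)

Section HilbertSpace.
Variables (R : realType) (V : lmodType R[i]) (H : set V) (ip : V -> V -> R[i]).
Local Notation C := R[i].
Hypothesis HS : inner_product_space H ip.
Let H_0 := ips_0 HS.
Let H_lin := ips_lin HS.
Let ip_linl := ips_linl HS.
Let ip_cj := ips_conj HS.
Let ip_pos := ips_pos HS.
Let ip_zero := ips_def HS.
Implicit Types (f g h u : V) (us : seq V).

Local Notation nrm := (ipnorm ip).

Lemma HZ c f : H f -> H (c *: f).
Proof. by move=> hf; rewrite -[_ *: _]addr0; exact: H_lin. Qed.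

Lemma HD f g : H f -> H g -> H (f + g).
Proof. by move=> hf hg; rewrite -[f]scale1r; exact: H_lin. Qed.

Lemma HN f : H f -> H (- f).
Proof. by rewrite -scaleN1r; exact: HZ. Qed.

Lemma HB f g : H f -> H g -> H (f - g).
Proof. by move=> hf /HN; exact: HD. Qed.

Lemma Hsum (I : Type) (s : seq I) (P : pred I) (F : I -> V) :
  (forall i, H (F i)) -> H (\sum_(i <- s | P i) F i).
Proof. by move=> HF; elim/big_ind: _ => // ? ?; exact: HD. Qed.

Lemma ip0l h : H h -> ip 0 h = 0.
Proof.
move=> hh; have := @ip_linl 1 0 0 h H_0 H_0 hh.
by rewrite scaler0 addr0 mul1r => /(congr1 (fun x => x - ip 0 h)); rewrite subrr addrK.
Qed.

Lemma ipZl c f h : H f -> H h -> ip (c *: f) h = c * ip f h.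
Proof. by move=> hf hh; rewrite -[c *: f]addr0 ip_linl// ip0l// addr0. Qed.

Lemma ipDl f g h : H f -> H g -> H h -> ip (f + g) h = ip f h + ip g h.
Proof. by move=> hf hg hh; rewrite -[f]scale1r ip_linl// mul1r scale1r. Qed.

Lemma ipBl f g h : H f -> H g -> H h -> ip (f - g) h = ip f h - ip g h.
Proof.
by move=> hf hg hh; rewrite ipDl//; [rewrite -scaleN1r ipZl// mulN1r|exact: HN].
Qed.

Lemma ipZr c f h : H f -> H h -> ip h (c *: f) = c^* * ip h f.
Proof.
by move=> hf hh; rewrite (ip_cj (HZ c hf) hh) ipZl// rmorphM/= -ip_cj.
Qed.

Lemma ipDr f g h : H f -> H g -> H h -> ip h (f + g) = ip h f + ip h g.
Proof.
by move=> hf hg hh; rewrite (ip_cj (HD hf hg) hh) ipDl// rmorphD/= -!ip_cj.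
Qed.

Lemma ip0r h : H h -> ip h 0 = 0.
Proof. by move=> hh; rewrite (ip_cj H_0 hh) ip0l// conjC0. Qed.

Lemma ipBr f g h : H f -> H g -> H h -> ip h (f - g) = ip h f - ip h g.
Proof.
by move=> hf hg hh; rewrite (ip_cj (HB hf hg) hh) ipBl// rmorphB/= -!ip_cj.
Qed.

Lemma ip_suml (I : Type) (s : seq I) (F : I -> V) h : (forall i, H (F i)) -> H h ->
  ip (\sum_(i <- s) F i) h = \sum_(i <- s) ip (F i) h.
Proof.
move=> HF hh; elim: s => [|i s ih]; first by rewrite !big_nil ip0l.
by rewrite !big_cons ipDl ?ih//; exact: Hsum.
Qed.

Lemma ip_sumr (I : Type) (s : seq I) (F : I -> V) h : (forall i, H (F i)) -> H h ->
  ip h (\sum_(i <- s) F i) = \sum_(i <- s) ip h (F i).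
Proof.
move=> HF hh; elim: s => [|i s ih]; first by rewrite !big_nil ip0r.
by rewrite !big_cons ipDr ?ih//; exact: Hsum.
Qed.

Lemma nrm_ge0 f : 0 <= nrm f.
Proof. exact: sqrtr_ge0. Qed.

Lemma nrm_sq f : H f -> nrm f ^+ 2 = complex.Re (ip f f).
Proof. by move=> hf; rewrite sqr_sqrtr// ip_pos. Qed.

Lemma ip_self f : H f -> ip f f = (nrm f ^+ 2)%:C.
Proof.
move=> hf; rewrite nrm_sq//; have := ip_cj hf hf.
case: (ip f f) => a b /= [] hb; apply/eqP; rewrite eq_complex /= eqxx /=.
by apply/eqP; lra.
Qed.

Lemma nrm_eq0 f : H f -> nrm f = 0 -> f = 0.
Proof. by move=> hf f0; apply: ip_zero => //; rewrite -nrm_sq// f0 expr0n. Qed.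

Lemma nrm0 : nrm 0 = 0.
Proof. by rewrite /ipnorm ip0l// sqrtr0. Qed.

Lemma nrm_sqB (c : C) f g : H f -> H g ->
  nrm (f - c *: g) ^+ 2 = nrm f ^+ 2 - 2 * complex.Re (c^* * ip f g) + normc c ^+ 2 * nrm g ^+ 2.
Proof.
move=> hf hg; have hcg := HZ c hg; rewrite nrm_sq ?ipBl ?ipBr//; try exact: HB.
rewrite (ipZr c hg hf) (ipZr c hg hcg) (ipZl c hg hf) (ipZl c hg hg) (ip_cj hf hg) !ip_self//.
rewrite nc_sq; case: c {hcg} => a b; case: (ip f g) => x y /=; ring.
Qed.

Lemma ip_CS f g : H f -> H g -> normc (ip f g) <= nrm f * nrm g.
Proof.
move=> hf hg; have [g0|g0] := eqVneq (nrm g) 0.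
  by rewrite (nrm_eq0 hg g0) ip0r// nc0 nrm0 mulr0.
have gp : 0 < nrm g by rewrite lt_def g0 nrm_ge0.
have g20 : 0 < nrm g ^+ 2 by rewrite exprn_gt0.
pose k := (nrm g ^+ 2)^-1.
have := sqr_ge0 (nrm (f - (k%:C * ip f g) *: g)); rewrite nrm_sqB//.
have -> : complex.Re ((k%:C * ip f g)^* * ip f g) = k * normc (ip f g) ^+ 2.
  by rewrite rmorphM /= conj_real -mulrA mulJc -rmorphM.
rewrite ncM nc_real (ger0_norm (_ : 0 <= k)) ?invr_ge0 ?(ltW g20)// => h.
rewrite -(ler_pXn2r (ltn0Sn 1)) ?nnegrE ?nc_ge0 ?mulr_ge0 ?nrm_ge0// exprMn -ler_pdivrMr//.
move: h; rewrite exprMn -/k; set x := normc _ ^+ 2; set y := nrm g ^+ 2.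
have -> : k ^+ 2 * x * y = k * x by rewrite /k -/y; field; rewrite gt_eqF.
by rewrite [x * k]mulrC; lra.
Qed.

Lemma nrmZ c f : H f -> nrm (c *: f) = normc c * nrm f.
Proof.
move=> hf; apply/eqP; rewrite -(@eqrXn2 _ 2)// ?nrm_ge0 ?mulr_ge0 ?nc_ge0 ?nrm_ge0//.
have hc := HZ c hf; rewrite exprMn nrm_sq// ipZr// ipZl// ip_self// mulrA mulJc.
by rewrite -rmorphM.
Qed.

Lemma nrmN f : H f -> nrm (- f) = nrm f.
Proof. by move=> hf; rewrite -scaleN1r nrmZ// ncN nc1 mul1r. Qed.

Lemma nrm_sqD f g : H f -> H g ->
  nrm (f + g) ^+ 2 = nrm f ^+ 2 + 2 * complex.Re (ip f g) + nrm g ^+ 2.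
Proof.
move=> hf hg; have := @nrm_sqB (-1) f g hf hg.
rewrite scaleN1r opprK => ->; rewrite ncN nc1 expr1n mul1r rmorphN /= conjC1 mulN1r ReN; ring.
Qed.

Lemma nrmD f g : H f -> H g -> nrm (f + g) <= nrm f + nrm g.
Proof.
move=> hf hg; rewrite -(ler_pXn2r (ltn0Sn 1)) ?nnegrE ?addr_ge0 ?nrm_ge0// nrm_sqD// sqrrD.
have := le_trans (le_trans (ler_norm _) (nc_Re (ip f g))) (ip_CS hf hg).
by lra.
Qed.

Lemma nrmB f g : H f -> H g -> nrm (f - g) <= nrm f + nrm g.
Proof. by move=> hf hg; rewrite -(nrmN hg); apply: nrmD => //; exact: HN. Qed.

Lemma nrmBC f g : H f -> H g -> nrm (f - g) = nrm (g - f).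
Proof. by move=> hf hg; rewrite -nrmN ?opprB//; exact: HB. Qed.

Section Operator.
Variables (T S : V -> V).
Hypothesis (Tc : compact_operator H ip T) (TS : adjoint_operator H ip T S).

Let Tb : bounded_operator H ip T := Tc.1.
Let Sb : bounded_operator H ip S := TS.1.

Lemma op_H (U : V -> V) f : bounded_operator H ip U -> H f -> H (U f).
Proof. by case=> h _ _; exact: h. Qed.

Lemma op_lin (U : V -> V) c f g : bounded_operator H ip U -> H f -> H g ->
  U (c *: f + g) = c *: U f + U g.
Proof. by case=> _ h _; exact: h. Qed.

Lemma op_0 (U : V -> V) : bounded_operator H ip U -> U 0 = 0.
Proof.
move=> Ub; have := op_lin 1 Ub H_0 H_0.
by rewrite scaler0 addr0 scale1r => /(congr1 (fun x => x - U 0)); rewrite subrr addrK.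
Qed.

Lemma op_Z (U : V -> V) c f : bounded_operator H ip U -> H f -> U (c *: f) = c *: U f.
Proof. by move=> Ub hf; rewrite -[c *: f]addr0 op_lin// op_0// addr0. Qed.

Lemma op_D (U : V -> V) f g : bounded_operator H ip U -> H f -> H g -> U (f + g) = U f + U g.
Proof. by move=> Ub hf hg; rewrite -[f]scale1r op_lin// !scale1r. Qed.

Lemma op_B (U : V -> V) f g : bounded_operator H ip U -> H f -> H g -> U (f - g) = U f - U g.
Proof.
by move=> Ub hf hg; rewrite op_D//; [rewrite -scaleN1r op_Z// scaleN1r|exact: HN].
Qed.

Lemma op_sum (U : V -> V) (I : Type) (s : seq I) (F : I -> V) : bounded_operator H ip U ->
  (forall i, H (F i)) -> U (\sum_(i <- s) F i) = \sum_(i <- s) U (F i).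
Proof.
move=> Ub HF; elim: s => [|i s ih]; first by rewrite !big_nil op_0.
by rewrite !big_cons op_D ?ih//; exact: Hsum.
Qed.

Lemma op_bound (U : V -> V) : bounded_operator H ip U ->
  exists2 M, 0 <= M & forall f, H f -> nrm (U f) <= M * nrm f.
Proof.
case=> _ _ [M HM]; exists (Num.max M 0); first by rewrite le_max lexx orbT.
by move=> f hf; apply: le_trans (HM f hf) _; rewrite ler_wpM2r ?nrm_ge0// le_max lexx.
Qed.

Lemma adj f h : H f -> H h -> ip (T f) h = ip f (S h).
Proof. exact: TS.2. Qed.

Lemma adj' f h : H f -> H h -> ip (S h) f = ip h (T f).
Proof.
move=> hf hh; have hT := op_H Tb hf; have hS := op_H Sb hh.
by rewrite (ip_cj hf hS) -adj// -ip_cj.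
Qed.

Definition perp us f := H f /\ forall u, u \in us -> ip f u = 0.

Definition eigs us := forall u, u \in us -> H u /\ exists c : C, S (T u) = c *: u.

Lemma perp_ST us f : eigs us -> perp us f -> perp us (S (T f)).
Proof.
move=> eu [hf pf]; split; first exact/op_H/op_H.
move=> u uin; have [hu [c Ec]] := eu u uin.
have hT := op_H Tb hf; have hTu := op_H Tb hu.
by rewrite (adj' hu hT) (adj hf hTu) Ec ipZr// pf// mulr0.
Qed.

Definition ovals us := [set x | exists f, [/\ perp us f, nrm f <= 1 & x = nrm (T f)]].
(** The norm of [T] on the orthogonal complement of [us]. *)
Definition osup us := sup (ovals us).

Lemma perp0 us : (forall u, u \in us -> H u) -> perp us 0.
Proof. by move=> hu; split=> // u /hu; exact: ip0l. Qed.

Lemma eigs_H us : eigs us -> forall u, u \in us -> H u.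
Proof. by move=> eu u /eu[]. Qed.

Lemma ovals_ub us x : ovals us x -> exists2 M, 0 <= M & x <= M.
Proof.
have [M M0 HM] := op_bound Tb; move=> [f [[hf _] f1 ->]]; exists M => //.
by apply: le_trans (HM _ hf) _; rewrite ler_piMr.
Qed.

Lemma ovals_sup us : eigs us -> has_sup (ovals us).
Proof.
move=> eu; split.
  exists 0, 0; split; [exact/perp0/eigs_H|by rewrite nrm0|].
  by rewrite op_0// nrm0.
have [M M0 HM] := op_bound Tb; exists M => x [f [[hf _] f1 ->]].
by apply: le_trans (HM _ hf) _; rewrite ler_piMr.
Qed.

Lemma perpZ us c f : (forall u, u \in us -> H u) -> perp us f -> perp us (c *: f).
Proof.
move=> hu [hf pf]; split; first exact: HZ.
by move=> u uin; rewrite ipZl ?pf ?mulr0//; exact: hu.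
Qed.

Lemma osup_le us f : eigs us -> perp us f -> nrm (T f) <= osup us * nrm f.
Proof.
move=> eu pf; have hf := pf.1; have [f0|f0] := eqVneq (nrm f) 0.
  by rewrite (nrm_eq0 hf f0) op_0// nrm0 mulr0.
have fp : 0 < nrm f by rewrite lt_def f0 nrm_ge0.
pose c : C := (nrm f)^-1%:C.
have ncc : normc c = (nrm f)^-1 by rewrite nc_real gtr0_norm ?invr_gt0.
have : ovals us (nrm (T (c *: f))).
  exists (c *: f); split=> //; first exact/perpZ/pf/eigs_H.
  by rewrite nrmZ// ncc mulVf.
move=> /(ub_le_sup (ovals_sup eu).2); rewrite op_Z// nrmZ; last exact: op_H.
by rewrite ncc mulrC ler_pdivrMr.
Qed.

Lemma osup_ge0 us : eigs us -> 0 <= osup us.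
Proof.
move=> eu; apply: (ub_le_sup (ovals_sup eu).2).
by exists 0; split; [exact/perp0/eigs_H|rewrite nrm0|rewrite op_0// nrm0].
Qed.

(** Near-maximizers are near-eigenvectors of S T. The complement of [us] is invariant under S T, so
    |S T f| <= m |T f| <= m^2, and expanding the square leaves 2 m^2 (m^2 - |T f|^2). *)
Lemma osup_resid us f : eigs us -> perp us f -> nrm f <= 1 ->
  nrm (S (T f) - (osup us ^+ 2)%:C *: f) ^+ 2 <=
  2 * osup us ^+ 2 * (osup us ^+ 2 - nrm (T f) ^+ 2).
Proof.
move=> eu pf f1; set m := osup us; have hf := pf.1.
have m0 : 0 <= m := osup_ge0 eu.
have hT := op_H Tb hf; have hA := op_H Sb hT.
have pA := perp_ST eu pf.
have n1 : nrm (S (T f)) <= m * nrm (T f).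
  have [->|A0] := eqVneq (nrm (S (T f))) 0; first by rewrite mulr_ge0 ?nrm_ge0.
  have Ap : 0 < nrm (S (T f)) by rewrite lt_def A0 nrm_ge0.
  rewrite -(ler_pM2r Ap).
  have : nrm (S (T f)) ^+ 2 <= nrm (T f) * nrm (T (S (T f))).
    rewrite nrm_sq// (adj' hA hT).
    by apply: le_trans (le_trans (ler_norm _) (nc_Re _)) _; apply: ip_CS => //; exact: op_H.
  have := ler_wpM2l (nrm_ge0 (T f)) (osup_le eu pA); rewrite -/m expr2; nra.
have t1 : nrm (T f) <= m.
  by apply: le_trans (osup_le eu pf) _; rewrite ler_piMr.
rewrite nrm_sqB//.
have -> : complex.Re (((m ^+ 2)%:C)^* * ip (S (T f)) f) = m ^+ 2 * nrm (T f) ^+ 2.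
  by rewrite (adj' hf hT) conj_real ip_self// -rmorphM.
rewrite nc_real ger0_norm ?exprn_ge0//.
have a1 : nrm (S (T f)) ^+ 2 <= (m ^+ 2) ^+ 2.
  apply: lerXn2r; rewrite ?nnegrE ?nrm_ge0 ?exprn_ge0//.
  by apply: le_trans n1 _; rewrite expr2 ler_wpM2l.
have a2 : nrm f ^+ 2 <= 1 by rewrite exprn_ile1 ?nrm_ge0.
have a3 := exprn_ge0 2 (exprn_ge0 2 m0).
by nra.
Qed.

(** For a maximizing sequence, compactness gives T x_j -> v along a subsequence; the residual
    estimate gives m^2 x_j - S T x_j -> 0. So x_j itself converges, to u = m^-2 S v, and u inherits
    all the properties. *)
Lemma osup_attained us : eigs us -> 0 < osup us ->
  exists u, [/\ perp us u, nrm u = 1 & S (T u) = (osup us ^+ 2)%:C *: u].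
Proof.
move=> eu; set m := osup us => mp.
have hu := eigs_H eu.
have K j : exists f, [/\ perp us f, nrm f <= 1 & m - j.+1%:R^-1 < nrm (T f)].
  have [|_ [f [pf f1 ->]] h] := @sup_adherent R (ovals us) j.+1%:R^-1 _ (ovals_sup eu).
    by rewrite invr_gt0 ltr0Sn.
  by exists f; split.
pose x j := projT1 (cid (K j)).
have xP j : [/\ perp us (x j), nrm (x j) <= 1 & m - j.+1%:R^-1 < nrm (T (x j))] := projT2 (cid (K j)).
have xH j : H (x j) by case: (xP j) => -[].
have [|phi [v [hphi hv cv]]] := Tc.2 x xH.
  by exists 1 => j; case: (xP j).
pose mm : C := (m ^+ 2)^-1%:C.
pose u := mm *: S v.
have hSv := op_H Sb hv; have hu0 : H u by exact: HZ.
have [MS MS0 HMS] := op_bound Sb; have [MT MT0 HMT] := op_bound Tb.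
have ge_id n : (n <= phi n)%N by elim: n => // n ih; exact: leq_ltn_trans ih (hphi _ _ (ltnSn n)).
(* x (phi j) --> u *)
have conv e : 0 < e -> exists j, nrm (x (phi j) - u) <= e /\ m - e <= nrm (T (x (phi j))).
  move=> e0; have m20 : 0 < m ^+ 2 by rewrite exprn_gt0.
  pose e1 := e * m ^+ 2 / 2; have e10 : 0 < e1 by rewrite divr_gt0// mulr_gt0.
  have e2p : 0 < e1 / (MS + 1) by rewrite divr_gt0// ltr_pwDr.
  move/cvgrPdist_le : cv => /(_ _ e2p)[N1 _ HN1].
  (* If |T x| >= m - e3, the residual squared is at most 2 m^2 times 2 m e3, and the second bound on
     [e3] makes this at most e1^2. *)
  pose e3 := Num.min e (e1 ^+ 2 / (4 * m ^+ 3)).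
  have e3p : 0 < e3 by rewrite lt_min e0 divr_gt0 ?mulr_gt0 ?exprn_gt0.
  pose j := maxn N1 (Num.bound e3^-1); exists j.
  have h1 : nrm (T (x (phi j)) - v) <= e1 / (MS + 1).
    have := HN1 j (leq_maxl _ _); rewrite /= sub0r normrN ger0_norm ?nrm_ge0//.
  have [pj xj1 xjm] := xP (phi j); have hx := xH (phi j).
  have hj : (phi j).+1%:R^-1 <= e3.
    rewrite -[e3]invrK lef_pV2 ?posrE ?invr_gt0 ?ltr0Sn//.
    apply: ltW; apply: lt_le_trans (archi_boundP _) _; first by rewrite invr_ge0 ltW.
    by rewrite ler_nat; apply/leqW/(leq_trans (leq_maxr N1 _))/ge_id.
  have xjm' : m - e3 <= nrm (T (x (phi j))).
    by apply: le_trans (ltW xjm); rewrite lerD2l lerN2.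
  split; last first.
    have : e3 <= e by rewrite ge_min lexx.
    by lra.
  have hT := op_H Tb hx.
  have r1 : nrm (S (T (x (phi j))) - (m ^+ 2)%:C *: x (phi j)) <= e1.
    rewrite -(ler_pXn2r (ltn0Sn 1)) ?nnegrE ?nrm_ge0 ?(ltW e10)//.
    apply: le_trans (osup_resid eu pj xj1) _; rewrite -/m.
    have t0 := nrm_ge0 (T (x (phi j))).
    have tm : nrm (T (x (phi j))) <= m.
      by apply: le_trans (osup_le eu pj) _; rewrite ler_piMr// ltW.
    have : m ^+ 2 - nrm (T (x (phi j))) ^+ 2 <= 2 * m * e3.
      have : m - nrm (T (x (phi j))) <= e3 by rewrite lerBlDr addrC -lerBlDr.
      by rewrite subr_sqr; nra.
    move=> h; apply: le_trans (ler_wpM2l _ h) _; first by rewrite mulr_ge0// ltW.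
    have : e3 * (4 * m ^+ 3) <= e1 ^+ 2.
      by rewrite -ler_pdivlMr ?mulr_gt0 ?exprn_gt0// ge_min lexx orbT.
    by apply: le_trans; rewrite le_eqVlt; apply/orP; left; apply/eqP; ring.
  have r2 : nrm (S (T (x (phi j))) - S v) <= e1.
    rewrite -op_B//; apply: le_trans (HMS _ (HB hT hv)) _.
    apply: le_trans (ler_wpM2l MS0 h1) _; rewrite mulrCA ler_piMr ?(ltW e10)//.
    by rewrite ler_pdivrMr ?ltr_pwDr// mul1r lerDl.
  have -> : x (phi j) - u = mm *: (((m ^+ 2)%:C *: x (phi j) - S (T (x (phi j)))) + (S (T (x (phi j))) - S v)).
    rewrite addrA subrK scalerBr scalerA /u /mm -rmorphM mulVf ?gt_eqF// rmorph1 scale1r //.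
  have hm := HZ (m ^+ 2)%:C hx; have hST := op_H Sb hT.
  rewrite nrmZ; last by apply: HD; exact: HB.
  rewrite nc_real gtr0_norm ?invr_gt0// ler_pdivrMl//.
  apply: le_trans (nrmD (HB hm hST) (HB hST hSv)) _.
  rewrite (nrmBC hm hST); apply: le_trans (lerD r1 r2) _.
  by rewrite /e1; lra.
have pu : perp us u.
  split=> // w win; apply/eqP; rewrite -nc_eq0; apply/eqP/le_anti; rewrite nc_ge0 andbT.
  have hw := hu w win.
  apply/ler_addgt0Pr => e e0; rewrite add0r.
  have wp : 0 < nrm w + 1 by rewrite ltr_pwDr// nrm_ge0.
  have [j [cj _]] := conv (e / (nrm w + 1)) (divr_gt0 e0 wp).
  have [[hx px] _ _] := xP (phi j).
  have -> : ip u w = - ip (x (phi j) - u) w by rewrite ipBl// px// sub0r opprK.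
  rewrite ncN; apply: le_trans (ip_CS (HB hx hu0) hw) _.
  apply: le_trans (ler_wpM2r (nrm_ge0 w) cj) _.
  by rewrite mulrAC ler_pdivrMr// ler_wpM2l ?(ltW e0)// lerDl.
have u1 : nrm u <= 1.
  apply/ler_addgt0Pr => e e0; have [j [cj _]] := conv e e0.
  have [[hx px] x1 _] := xP (phi j).
  have -> : u = x (phi j) - (x (phi j) - u) by rewrite subKr.
  by apply: le_trans (nrmB hx (HB hx hu0)) _; lra.
have Tu : m <= nrm (T u).
  apply/ler_addgt0Pr => e e0.
  have Mp : 0 < MT + 2 by lra.
  have [j [cj mj]] := conv (e / (MT + 2)) (divr_gt0 e0 Mp).
  have hx := xH (phi j).
  have h1 : nrm (T (x (phi j)) - T u) <= MT * (e / (MT + 2)).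
    rewrite -op_B//; apply: le_trans (HMT _ (HB hx hu0)) _; exact: ler_wpM2l.
  have h2 : nrm (T (x (phi j))) <= nrm (T u) + nrm (T (x (phi j)) - T u).
    rewrite -[X in nrm X <= _](subrK (T u)) addrC; apply: nrmD; first exact: op_H.
    by apply: HB; exact: op_H.
  have : MT * (e / (MT + 2)) + e / (MT + 2) <= e.
    have -> : MT * (e / (MT + 2)) + e / (MT + 2) = e * ((MT + 1) / (MT + 2)).
      by field; rewrite gt_eqF.
    by rewrite ler_piMr ?(ltW e0)// ler_pdivrMr// mul1r; lra.
  by lra.
exists u; split=> //.
  apply/le_anti; rewrite u1 /= -(ler_pM2l mp) mulr1.
  exact: le_trans Tu (osup_le eu pu).
have hA : H (S (T u)) by exact/op_H/op_H.
have hmu := HZ (m ^+ 2)%:C hu0.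
apply/eqP; rewrite -subr_eq0; apply/eqP/nrm_eq0; first exact: HB.
apply/eqP; rewrite -sqrf_eq0; apply/eqP/le_anti; rewrite sqr_ge0 andbT.
apply: le_trans (osup_resid eu pu u1) _; rewrite -/m.
have : m ^+ 2 <= nrm (T u) ^+ 2 by apply: lerXn2r; rewrite ?nnegrE ?nrm_ge0 ?(ltW mp).
by have := exprn_ge0 2 (ltW mp); nra.
Qed.

End Operator.
End HilbertSpace.

Lemma card_eq_seq (s : seq nat) : uniq s -> ([set j | j \in s] #= `I_(size s))%card.
Proof.
move=> us; apply/card_set_bijP; exists (fun j => index j s); split.
- by move=> j /=; rewrite index_mem.
- by move=> i j /set_mem /= hi /set_mem /= hj; exact: index_inj.
- by move=> i /= hi; exists (nth 0%N s i); [exact: mem_nth|exact: index_uniq].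
Qed.

Lemma card_filter_iota (T : eqType) (s : nat -> T) (t : T) r d :
  (forall j, s j = t -> (j < r)%N) -> ([set j | s j = t] #= `I_d)%card ->
  d = size [seq j <- iota 0 r | s j == t].
Proof.
move=> sr; have -> : [set j | s j = t] = [set j | j \in [seq j <- iota 0 r | s j == t]].
  apply/seteqP; split=> j /=; rewrite mem_filter mem_iota /= add0n.
    by move=> st; rewrite st eqxx sr.
  by case/andP => /eqP.
move=> h; apply/card_eq_II; apply: card_eq_trans (card_eq_seq _); last exact/filter_uniq/iota_uniq.
by rewrite card_eq_sym.
Qed.

Lemma exists_left_kernel (F : fieldType) m n (A : 'M[F]_(n, m)) : (m < n)%N ->
  exists2 c : 'rV[F]_n, c != 0 & c *m A = 0.
Proof.
move=> mn; have : kermx A != 0.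
  rewrite -mxrank_eq0 mxrank_ker subn_eq0 -ltnNge.
  exact: leq_ltn_trans (rank_leq_col A) mn.
by case/rowV0Pn => c /sub_kermxP cA c0; exists c.
Qed.

(** * Singular values: given sequences and a greedy construction *)

Section SingularValues.
Variables (R : realType) (V : lmodType R[i]) (H : set V) (ip : V -> V -> R[i]).
Local Notation C := R[i].
Hypothesis HS : inner_product_space H ip.
Variables (T S : V -> V).
Hypothesis (Tc : compact_operator H ip T) (TS : adjoint_operator H ip T S).
Implicit Types (f g h u : V) (us : seq V).

Local Notation nrm := (ipnorm ip).
Local Notation perp := (perp H ip).
Local Notation osup := (osup H ip T).
Local Notation eigs := (eigs H T S).
Let Tb : bounded_operator H ip T := Tc.1.
Let Sb : bounded_operator H ip S := TS.1.

Section GivenSequence.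
Variable s : nat -> R.
Hypothesis (s_ge0 : forall j, 0 <= s j) (s_dec : {homo s : i j / (i <= j)%N >-> j <= i}).
Hypothesis s_dim : forall t : R, 0 < t -> exists2 d : nat,
  has_dimension (eigenspace_on H (S \o T) (t ^+ 2)%:C) d & ([set j | s j = t] #= `I_d)%card.

(** The vectors are bases of the eigenspaces for the values above t among the first r terms. If T
    were larger than t on their complement, [osup_attained] would produce a unit eigenvector for
    such a value, lying in the span of the listed vectors and orthogonal to them. *)
Lemma eigs_above (t : R) r : 0 <= t -> s r <= t ->
  exists us, [/\ eigs us, (size us <= r)%N & osup us <= t].
Proof.
move=> t0 srt; pose vals := undup [seq x <- [seq s j | j <- iota 0 r] | t < x].
have lt_r v : t < v -> forall j, s j = v -> (j < r)%N.
  move=> tv j sj; rewrite ltnNge; apply/negP => /s_dec; rewrite sj => vr.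
  by have := le_trans vr srt; rewrite leNgt tv.
pose cnt v := size [seq j <- iota 0 r | s j == v].
have bas v : t < v -> exists e : 'I_(cnt v) -> V,
    has_basis (eigenspace_on H (S \o T) (v ^+ 2)%:C) e.
  move=> tv; have [d [e he] cd] := s_dim (le_lt_trans t0 tv).
  have E := card_filter_iota (lt_r v tv) cd; rewrite /cnt -E; by exists e.
pose bs v : seq V := if pselect (t < v) is left h then
   [seq projT1 (cid (bas v h)) i | i <- enum 'I_(cnt v)] else [::].
pose us := flatten [seq bs v | v <- vals].
have bsE v (h : t < v) : exists e : 'I_(cnt v) -> V,
    has_basis (eigenspace_on H (S \o T) (v ^+ 2)%:C) e /\ bs v = [seq e i | i <- enum 'I_(cnt v)].
  rewrite /bs; case: pselect => // h'; exists (projT1 (cid (bas v h'))); split=> //.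
  by case: cid.
have valst v : v \in vals -> t < v by rewrite mem_undup mem_filter => /andP[].
have eu : eigs us.
  move=> u /flatten_mapP[v /valst vt]; have [e [[he _ _] ->]] := bsE v vt.
  by case/mapP => i _ ->; have [h1 h2] := he i; split=> //; exists (v ^+ 2)%:C.
exists us; split=> //.
  rewrite size_flatten /shape -map_comp sumnE big_map.
  (* Double counting: every index j < r accounts for at most one of the distinct values in
     [vals]. *)
  have -> : (\sum_(v <- vals) (size \o bs) v = \sum_(v <- vals) \sum_(j <- iota 0 r) (s j == v))%N.
    apply: eq_big_seq => v /valst vt /=; have [e [_ ->]] := bsE v vt.
    rewrite size_map size_enum_ord /cnt size_filter -sum1_count big_mkcond.
    by apply: eq_bigr => j _; case: eqP.
  rewrite exchange_big /=; apply: (@leq_trans (\sum_(j <- iota 0 r) 1)%N).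
    apply: leq_sum => j _.
    have -> : (\sum_(v <- vals) (s j == v) = count_mem (s j) vals)%N.
      rewrite -sum1_count [RHS]big_mkcond; apply: eq_bigr => v _ /=.
      by rewrite eq_sym; case: eqP.
    by rewrite count_uniq_mem ?undup_uniq// leq_b1.
  by rewrite sum1_size size_iota.
rewrite leNgt; apply/negP => lt_os; have os0 := le_lt_trans t0 lt_os.
have [u [pu u1 Eu]] := osup_attained HS Tc TS eu os0.
have [d [e he] cd] := s_dim os0.
(* A value not taken by [s] has multiplicity 0, so its eigenspace would have an empty basis and
   could not contain the unit vector [u]. *)
have [j sj] : exists j, s j = osup us.
  apply: contrapT => /forallNP nos; have d0 : d = 0%N.
    rewrite (card_filter_iota (lt_r _ lt_os) cd); apply/eqP.
    rewrite size_filter -leqn0 leqNgt -has_count; apply/negP => /hasP[j _ /eqP sj].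
    exact: nos sj.
  subst d; have [_ _ /(_ u)[]] := he; first by split; [exact: pu.1|exact: Eu].
  move=> c; rewrite big_ord0 => u0; move: u1; rewrite u0 (nrm0 HS) => /esym/eqP.
  by rewrite oner_eq0.
have vin : osup us \in vals.
  rewrite mem_undup mem_filter lt_os -sj map_f// mem_iota /= add0n.
  exact: lt_r lt_os _ sj.
have [e' [[he'1 _ he'3] Ebs]] := bsE _ lt_os.
have [c uE] := he'3 u (conj pu.1 Eu).
have : ip u u = 0.
  rewrite {2}uE (ip_sumr HS); [|move=> i; apply: (HZ HS); exact: (he'1 i).1|exact: pu.1].
  apply: big1 => i _; rewrite (ipZr HS); [|exact: (he'1 i).1|exact: pu.1].
  rewrite pu.2 ?mulr0//; apply/flatten_mapP; exists (osup us) => //.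
  by rewrite Ebs map_f// mem_enum.
rewrite (ip_self HS pu.1) u1 expr1n => /eqP; rewrite oner_eq0 //.
Qed.

(* With at most r singular values above t, more than r vectors admit a
   combination on which the adjoint is bounded by t. *)
Lemma adjoint_small_combination (t : R) r N (l : 'I_N -> V) : 0 <= t -> s r <= t -> (r < N)%N ->
  (forall i, H (l i)) ->
  exists2 c : 'I_N -> C, (exists i, c i != 0) &
    nrm (S (\sum_i c i *: l i)) <= t * nrm (\sum_i c i *: l i).
Proof.
move=> t0 srt rN hl; have [us [eu ur ot]] := eigs_above t0 srt.
have hu := eigs_H eu.
(* The combination f is made orthogonal to every T u with u in [us], which puts S f in the
   complement of [us]; then |S f|^2 = <f, T S f> <= |f| t |S f|. *)
have [c c0 cA] := exists_left_kernel (\matrix_(i < N, j < size us) ip (l i) (T us`_j)) (leq_ltn_trans ur rN).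
exists (fun i => c 0 i).
  by apply/existsP; apply: contraNT c0 => /existsPn h; apply/eqP/rowP => i; rewrite mxE; apply/eqP/negPn/h.
set f := \sum_i _.
have hcl i : H (c 0 i *: l i) by exact: (HZ HS).
have hf : H f by exact: (Hsum HS).
have hSf := op_H Sb hf.
have pS : perp us (S f).
  split=> // u uin; have hTu := op_H Tb (hu u uin).
  rewrite (adj' HS Tc TS (hu u uin) hf) /f (ip_suml HS)//.
  have uI : (index u us < size us)%N by rewrite index_mem.
  have h := congr1 (fun M : 'rV[C]_(size us) => M 0 (Ordinal uI)) cA; rewrite !mxE in h.
  rewrite -[RHS]h.
  by apply: eq_bigr => i _; rewrite mxE /= nth_index// (ipZl HS).
have [Sf0|Sf0] := eqVneq (nrm (S f)) 0; first by rewrite Sf0 mulr_ge0// nrm_ge0.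
have Sp : 0 < nrm (S f) by rewrite lt_def Sf0 nrm_ge0.
rewrite -(ler_pM2r Sp) -expr2 (nrm_sq HS)// (adj' HS Tc TS hSf hf).
apply: le_trans (le_trans (ler_norm _) (nc_Re _)) _.
apply: le_trans (ip_CS HS hf (op_H Tb hSf)) _.
have h1 : nrm (T (S f)) <= t * nrm (S f).
  apply: le_trans (osup_le HS Tc eu pS) _; rewrite ler_wpM2r// nrm_ge0 //.
apply: le_trans (ler_wpM2l (nrm_ge0 ip f) h1) _.
by rewrite mulrA [nrm f * t]mulrC.
Qed.

End GivenSequence.

Section ConstructedSequence.

(** The default 0 takes over once [T] vanishes on the complement. It still satisfies the eigenvector
    equation, so the chain can be continued indefinitely. *)
Definition pick us : V := if pselect (eigs us /\ 0 < osup us) is left h then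
  projT1 (cid (osup_attained HS Tc TS h.1 h.2)) else 0.

Fixpoint chain (n : nat) : seq V :=
  if n is m.+1 then rcons (chain m) (pick (chain m)) else [::].

Definition svec n : V := pick (chain n).
Definition sval n : R := osup (chain n).

Lemma pick_eig us : H (pick us) /\ exists c : C, S (T (pick us)) = c *: pick us.
Proof.
rewrite /pick; case: pselect => [h|_]; last first.
  split; first exact: ips_0 HS.
  by exists 0; rewrite (op_0 HS Tb) (op_0 HS Sb) scaler0.
case: cid => u /= [pu _ ->]; split; first exact: pu.1.
by exists (osup us ^+ 2)%:C.
Qed.

Lemma chain_eigs n : eigs (chain n).
Proof.
elim: n => [//|n ih] u; rewrite /= mem_rcons inE => /predU1P[->|/ih//].
exact: pick_eig.
Qed.

Lemma svec_H n : H (svec n). Proof. exact: (pick_eig _).1. Qed.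

Lemma mem_chain n u : u \in chain n <-> exists2 j, (j < n)%N & u = svec j.
Proof.
elim: n => [|n ih]; first by split=> // -[].
rewrite /= mem_rcons inE; split.
  by move=> /predU1P[->|/ih[j jn ->]]; [exists n|exists j; rewrite // ltnW].
move=> [j jn uj]; move: jn; rewrite ltnS leq_eqVlt => /predU1P[E|jn]; first by rewrite uj E eqxx.
by apply/orP; right; apply/ih; exists j.
Qed.

Lemma sval_ge0 n : 0 <= sval n.
Proof. exact: (osup_ge0 HS Tc (@chain_eigs n)). Qed.

Lemma svecP n : 0 < sval n -> [/\ perp (chain n) (svec n), nrm (svec n) = 1 &
  S (T (svec n)) = (sval n ^+ 2)%:C *: svec n].
Proof.
move=> h; rewrite /svec /pick; case: pselect => [h'|[]]; last by split=> //; exact: chain_eigs.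
by case: cid.
Qed.

Lemma svec0 n : sval n = 0 -> svec n = 0.
Proof.
move=> h; rewrite /svec /pick; case: pselect => // h'.
by exfalso; have := h'.2; rewrite -/(sval n) h ltxx.
Qed.

Lemma svecST n : S (T (svec n)) = (sval n ^+ 2)%:C *: svec n.
Proof.
have := sval_ge0 n; rewrite le_eqVlt => /predU1P[/esym h|/svecP[_ _ ->//]].
by rewrite (svec0 h) (op_0 HS Tb) (op_0 HS Sb) scaler0.
Qed.

Lemma sval_dec : {homo sval : i j / (i <= j)%N >-> j <= i}.
Proof.
move=> i j ij; apply: le_sup.
- move=> x [f [pf f1 ->]]; apply/downP; exists (nrm (T f)) => //.
  exists f; split=> //; split; first exact: pf.1.
  move=> u /mem_chain[k ki ->]; apply: pf.2; apply/mem_chain; exists k => //.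
  exact: leq_trans ki ij.
- by have [] := ovals_sup HS Tc (@chain_eigs j).
- exact: (ovals_sup HS Tc (@chain_eigs i)).
Qed.

Lemma svec_orth i j : i != j -> ip (svec i) (svec j) = 0.
Proof.
move=> ij; wlog lij : i j ij / (j < i)%N.
  move=> W; case: (ltngtP i j) => [h|h|h]; last by rewrite h eqxx in ij.
    by rewrite (ips_conj HS (svec_H j) (svec_H i)) W ?conjC0// eq_sym.
  exact: W.
have := sval_ge0 i; rewrite le_eqVlt => /predU1P[/esym h|/svecP[[_ p] _ _]].
  by rewrite (svec0 h) (ip0l HS)//; exact: svec_H.
by apply: p; apply/mem_chain; exists j.
Qed.

Lemma svec_nrm n : 0 < sval n -> nrm (svec n) = 1.
Proof. by case/svecP. Qed.

Lemma ipT_svec i f : H f -> ip (T (svec i)) (T f) = (sval i ^+ 2)%:C * ip (svec i) f.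
Proof.
move=> hf; have hT := op_H Tb (svec_H i).
by rewrite -(adj' HS Tc TS hf hT) svecST (ipZl HS)//; exact: svec_H.
Qed.

(** Otherwise the singular vectors would be orthonormal with orthogonal images of norm at least e,
    and no subsequence of these images converges. *)
Lemma sval_small e : 0 < e -> exists r, sval r < e.
Proof.
move=> e0; apply: contrapT => /forallNP Hn.
have big n : e <= sval n by rewrite leNgt; apply/negP/Hn.
have pos n : 0 < sval n := lt_le_trans e0 (big n).
have [|phi [h [hphi hh]]] := Tc.2 svec svec_H.
  by exists 1 => j; rewrite svec_nrm.
have e2 : 0 < e / 2 by rewrite divr_gt0.
move/cvgrPdist_le => /(_ _ e2)[N _ HN].
have := HN N (leqnn N); have := HN N.+1 (leqnSn N).
rewrite /= !sub0r !normrN !ger0_norm ?nrm_ge0// => h1 h2.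
set a := svec (phi N) in h2; set b := svec (phi N.+1) in h1.
have [ha hb] : H a /\ H b by split; exact: svec_H.
have [hTa hTb] : H (T a) /\ H (T b) by split; exact: (op_H Tb).
have : nrm (T a - T b) <= e.
  have -> : T a - T b = (T a - h) - (T b - h) by rewrite opprB addrA subrK.
  by apply: le_trans (nrmB HS (HB HS hTa hh) (HB HS hTb hh)) _; lra.
have ab : ip (T a) (T b) = 0.
  rewrite ipT_svec// svec_orth ?mulr0//; apply/eqP => E.
  by have := hphi _ _ (ltnSn N); rewrite E ltnn.
have : nrm (T a - T b) ^+ 2 = nrm (T a) ^+ 2 + nrm (T b) ^+ 2.
  have := nrm_sqB HS 1 hTa hTb; rewrite scale1r ab mulr0 nc1 expr1n mul1r => ->.
  by rewrite mulr0 subr0.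
have n2 n : nrm (T (svec n)) ^+ 2 = sval n ^+ 2.
  have hs := svec_H n; have := ipT_svec n hs.
  rewrite (ip_self HS hs) (ip_self HS (op_H Tb hs)) svec_nrm// expr1n mulr1 => -[] //.
rewrite /a /b !n2 => E le.
have : nrm (T (svec (phi N)) - T (svec (phi N.+1))) ^+ 2 <= e ^+ 2.
  by apply: lerXn2r; rewrite ?nnegrE ?nrm_ge0 ?(ltW e0).
rewrite E; have f1 : e ^+ 2 <= sval (phi N) ^+ 2 by apply: lerXn2r; rewrite ?nnegrE ?sval_ge0 ?(ltW e0).
have f2 : e ^+ 2 <= sval (phi N.+1) ^+ 2 by apply: lerXn2r; rewrite ?nnegrE ?sval_ge0 ?(ltW e0).
by have := exprn_gt0 2 e0; lra.
Qed.

(** The point is that chain vectors with value t span the whole eigenspace: an eigenvector minus its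
    projection onto them is orthogonal to the chain up to a rank where the norm of [T] is below t,
    yet [T] multiplies its norm by t. *)
Lemma sval_singular : singular_value_sequence H ip T sval.
Proof.
split; [exact: sval_ge0|exact: sval_dec|exists S => // t t0].
have [r rt] := sval_small t0.
have lt_r j : sval j = t -> (j < r)%N.
  by move=> sj; rewrite ltnNge; apply/negP => /sval_dec; rewrite sj leNgt rt.
pose idx := [seq j <- iota 0 r | sval j == t].
have Eset : [set j | sval j = t] = [set j | j \in idx].
  apply/seteqP; split=> j /=; rewrite mem_filter mem_iota /= add0n.
    by move=> st; rewrite st eqxx lt_r.
  by case/andP => /eqP.
have uidx : uniq idx by exact/filter_uniq/iota_uniq.
exists (size idx); last by rewrite Eset; exact: card_eq_seq.
pose e (i : 'I_(size idx)) := svec (nth 0%N idx i).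
have et i : sval (nth 0%N idx (i : 'I_(size idx))) = t.
  by have := mem_nth 0%N (ltn_ord i); rewrite mem_filter => /andP[/eqP].
have eH i : H (e i) by exact: svec_H.
have ce c i : H (c *: e i) by exact: (HZ HS).
have ipe i j : ip (e i) (e j) = (i == j)%:R.
  have [->|ij] := eqVneq i j.
    by rewrite (ip_self HS)// svec_nrm ?expr1n// et.
  by apply: svec_orth; rewrite nth_uniq.
have ipsum (c : 'I_(size idx) -> C) j : ip (\sum_i c i *: e i) (e j) = c j.
  rewrite (ip_suml HS)// (bigD1 j)//= (ipZl HS)// ipe eqxx mulr1 big1 ?addr0// => i ij.
  by rewrite (ipZl HS)// ipe (negbTE ij) mulr0.
exists e; split.
- by move=> i; split; [exact: eH|rewrite /= /e svecST et].
- by move=> c c0 i; rewrite -(ipsum c i) c0 (ip0l HS).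
move=> f [hf Ef]; exists (fun i => ip f (e i)).
set g := \sum_i _; have hg : H g by exact: (Hsum HS).
have hfg := HB HS hf hg; have hT := op_H Tb hfg.
have Eg : S (T g) = (t ^+ 2)%:C *: g.
  rewrite /g (op_sum HS _ Tb)// (op_sum HS _ Sb); last by move=> i; exact: (op_H Tb).
  rewrite scaler_sumr; apply: eq_bigr => i _.
  rewrite (op_Z HS _ Tb)// (op_Z HS _ Sb) ?svecST; last exact: (op_H Tb).
  by rewrite et !scalerA mulrC.
have Efg : S (T (f - g)) = (t ^+ 2)%:C *: (f - g).
  rewrite (op_B HS Tb)// (op_B HS Sb) ?scalerBr ?Eg; [|exact: (op_H Tb)|exact: (op_H Tb)].
  by move: Ef => /= ->.
have pfg : perp (chain r) (f - g).
  split=> // u /mem_chain[j jr ->]; have hj := svec_H j.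
  have [st|st] := eqVneq (sval j) t.
    have jin : j \in idx by rewrite mem_filter st eqxx mem_iota.
    have ji : (index j idx < size idx)%N by rewrite index_mem.
    have ej : e (Ordinal ji) = svec j by rewrite /e /= nth_index.
    by rewrite (ipBl HS)// -ej ipsum subrr.
  have : (t ^+ 2)%:C * ip (f - g) (svec j) = (sval j ^+ 2)%:C * ip (f - g) (svec j).
    rewrite -(ipZl HS _ hfg hj) -Efg (adj' HS Tc TS hj hT) (TS.2 _ _ hfg (op_H Tb hj)).
    by rewrite svecST (ipZr HS _ hj hfg) conj_real.
  move/eqP; rewrite -subr_eq0 -mulrBl mulf_eq0 => /orP[|/eqP//].
  rewrite -rmorphB /= => /eqP[] /eqP; rewrite subr_sqr mulf_eq0 subr_eq0 eq_sym (negbTE st) /=.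
  by rewrite addrC paddr_eq0 ?sval_ge0 ?(ltW t0)// (gt_eqF t0) andbF.
have tn : t * nrm (f - g) <= sval r * nrm (f - g).
  apply: le_trans (osup_le HS Tc (@chain_eigs r) pfg).
  rewrite -(ler_pXn2r (ltn0Sn 1)) ?nnegrE ?mulr_ge0 ?nrm_ge0 ?(ltW t0)// exprMn.
  rewrite (nrm_sq HS hT) -(adj' HS Tc TS hfg hT) Efg (ipZl HS _ hfg hfg) (ip_self HS hfg) -rmorphM /=.
  by rewrite lexx.
apply/eqP; rewrite -subr_eq0; apply/eqP/(nrm_eq0 HS hfg)/le_anti; rewrite nrm_ge0 andbT.
by have := nrm_ge0 ip (f - g); nra.
Qed.

(* Courant-Fischer: m linear conditions forcing |T h| <= t |h| bound the m-th
   singular value (counted from 0) by t. *)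
Lemma sval_le_codim (t : R) m (L : 'I_m -> V -> C) :
  (forall j (c : C) f g, H f -> H g -> L j (c *: f + g) = c * L j f + L j g) ->
  0 <= t -> (forall h, H h -> (forall j, L j h = 0) -> nrm (T h) <= t * nrm h) -> sval m <= t.
Proof.
move=> Llin t0 HL; rewrite leNgt; apply/negP => tm.
have pos i : (i <= m)%N -> 0 < sval i.
  by move=> im; apply: lt_le_trans (sval_dec im); exact: le_lt_trans t0 tm.
have L0 j : L j 0 = 0.
  have := Llin j 1 0 0 (ips_0 HS) (ips_0 HS).
  by rewrite scaler0 addr0 mul1r => /(congr1 (fun x => x - L j 0)); rewrite subrr addrK.
have LZ j c f : H f -> L j (c *: f) = c * L j f.
  by move=> hf; have := Llin j c f 0 hf (ips_0 HS); rewrite addr0 L0 addr0.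
have LD j f g : H f -> H g -> L j (f + g) = L j f + L j g.
  by move=> hf hg; have := Llin j 1 f g hf hg; rewrite scale1r mul1r.
have Lsum j (F : 'I_m.+1 -> V) : (forall i, H (F i)) -> L j (\sum_i F i) = \sum_i L j (F i).
  move=> HF; elim: (index_enum _) => [|i r ih]; first by rewrite !big_nil.
  by rewrite !big_cons LD ?ih//; exact: (Hsum HS).
(* Among m + 1 singular vectors some nontrivial combination meets the m conditions, and [T] expands
   it by at least [sval m]. *)
have [c c0 cA] := exists_left_kernel (\matrix_(i < m.+1, j < m) L j (svec i)) (ltnSn m).
pose e (i : 'I_m.+1) := svec i.
have eH i : H (e i) by exact: svec_H.
have ce i : H (c 0 i *: e i) by exact: (HZ HS).
set h := \sum_i c 0 i *: e i; have hh : H h by exact: (Hsum HS).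
have Lh j : L j h = 0.
  rewrite /h Lsum//; have E := congr1 (fun M : 'rV[C]_m => M 0 j) cA; rewrite !mxE in E; rewrite -[RHS]E.
  by apply: eq_bigr => i _; rewrite mxE LZ.
have ipe i j : ip (e i) (e j) = (i == j)%:R.
  have [->|ij] := eqVneq i j.
    by rewrite (ip_self HS)// svec_nrm ?expr1n//; apply: pos; rewrite -ltnS.
  exact: svec_orth.
have iph j : ip h (e j) = c 0 j.
  rewrite (ip_suml HS)// (bigD1 j)//= (ipZl HS)// ipe eqxx mulr1 big1 ?addr0// => i ij.
  by rewrite (ipZl HS)// ipe (negbTE ij) mulr0.
have nh : nrm h ^+ 2 = \sum_i normc (c 0 i) ^+ 2.
  have : ip h h = (\sum_i normc (c 0 i) ^+ 2)%:C.
    rewrite {2}/h (ip_sumr HS)// rmorph_sum; apply: eq_bigr => i _.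
    by rewrite (ipZr HS)// iph mulJc.
  by rewrite (ip_self HS hh) => -[].
have nTh : nrm (T h) ^+ 2 = \sum_(i < m.+1) sval i ^+ 2 * normc (c 0 i) ^+ 2.
  have hT := op_H Tb hh.
  have : ip (T h) (T h) = (\sum_(i < m.+1) sval i ^+ 2 * normc (c 0 i) ^+ 2)%:C.
    have hTc i : H (T (c 0 i *: e i)) := op_H Tb (ce i).
    have ETh : T h = \sum_i T (c 0 i *: e i) by rewrite /h (op_sum HS _ Tb).
    rewrite {1}ETh (ip_suml HS _ hTc hT) rmorph_sum; apply: eq_bigr => i _.
    rewrite (op_Z HS _ Tb (eH i)) (ipZl HS _ (op_H Tb (eH i)) hT).
    rewrite [ip _ _](ipT_svec i hh) (ips_conj HS hh (eH i)).
    rewrite iph mulrCA mulcJ -rmorphM //.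
  by rewrite (ip_self HS hT) => -[].
have hp : 0 < nrm h.
  rewrite lt_def nrm_ge0 andbT; apply: contraNneq c0 => h0.
  apply/eqP/rowP => i; rewrite mxE -iph (nrm_eq0 HS hh h0) (ip0l HS)//.
have := HL h hh Lh; apply/negP; rewrite -ltNge.
apply: (lt_le_trans (y := sval m * nrm h)); first by rewrite ltr_pM2r.
rewrite -(ler_pXn2r (ltn0Sn 1)) ?nnegrE ?mulr_ge0 ?nrm_ge0 ?sval_ge0// exprMn nh nTh mulr_sumr.
apply: ler_sum => i _; rewrite ler_wpM2r ?sqr_ge0//.
by apply: lerXn2r; rewrite ?nnegrE ?sval_ge0// sval_dec// -ltnS.
Qed.

End ConstructedSequence.
End SingularValues.

(** * Kernels reproducing derivatives *)

Section HardyKernels.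
Variable R : realType.
Local Notation C := R[i].
Implicit Types (f g h : C -> C) (z w : C).
Local Notation tc := (@taylor_coef R).
Local Notation H2 := (@hardy2 R).
Local Notation ip := (@hardy2_ip R).

Lemma hardy2_0 : H2 0.
Proof.
have a0 : analytic_disk (0 : C -> C).
  by split=> // z _; exact: has_cderiv_cderivable (has_cderiv_cst 0 z).
have t0 j : tc 0 j = 0.
  have h0 := analytic_holo a0; have := taylor_lin (-1) j h0 h0.
  rewrite mulN1r addNr => <-; congr (tc _ j); apply/funext => w.
  by rewrite mulN1r addNr.
apply/hardy2P; split=> //; exists 0 => N; rewrite big1// => j _.
by rewrite t0 nc0 expr0n.
Qed.

Lemma hardy2_ips : inner_product_space H2 ip.
Proof.
split; [exact: hardy2_0|exact: hardy2_lin|exact: ip_lin|exact: ip_conj|exact: ip_ge0|exact: ip_def].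
Qed.

(** Taylor coefficients of the kernel that reproduces f^(m)(z), as [ip_hker] shows. *)
Definition kcoef m z (j : nat) : C := if (j < m)%N then 0 else (j ^_ m)%:R * (z^*) ^+ (j - m).

Definition hker m z : C -> C := pfun (kcoef m z).

Lemma subexp_cst (c : C) : subexp 1 (fun=> c).
Proof.
move=> r /andP[r0 r1]; exists (normc c) => j.
by rewrite ler_piMr ?nc_ge0// exprn_ile1// ltW.
Qed.

(** The radius r is shared out as sqrt r times sqrt r, and sqrt r is still below 1. *)
Lemma subexpM (a b : nat -> C) : subexp 1 a -> subexp 1 b -> subexp 1 (fun j => a j * b j).
Proof.
move=> Ha Hb r /andP[r0 r1]; have sr0 : 0 < Num.sqrt r by rewrite sqrtr_gt0.
have sr1 : 0 < Num.sqrt r < 1 by rewrite sr0 /= -(@sqrtr1 R) ltr_sqrt.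
have [A HA] := Ha _ sr1; have [B HB] := Hb _ sr1; exists (A * B) => j.
have -> : normc (a j * b j) * r ^+ j = (normc (a j) * Num.sqrt r ^+ j) * (normc (b j) * Num.sqrt r ^+ j).
  by rewrite ncM -{1}(sqr_sqrtr (ltW r0)) -exprM mul2n -addnn exprD; ring.
by apply: ler_pM; rewrite ?mulr_ge0 ?nc_ge0 ?exprn_ge0 ?(ltW sr0).
Qed.

Lemma ffact_split a b c : (a ^_ (b + c) = a ^_ b * (a - b) ^_ c)%N.
Proof.
elim: c => [|c ih]; first by rewrite addn0 ffactn0 muln1.
by rewrite addnS !ffactnSr ih -mulnA subnDA.
Qed.

Lemma kcoef_shift m z l : kcoef m z (l + m) = ((l + m) ^_ m)%:R * (z^*) ^+ l.
Proof. by rewrite /kcoef ltnNge leq_addl addnK. Qed.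

Lemma kcoef_bounded m z : normc z < 1 ->
  exists B : R, forall N, \sum_(j < N) normc (kcoef m z j) ^+ 2 <= B.
Proof.
move=> z1; pose s := (1 + normc z) / 2.
have s01 : 0 < s < 1 by have := nc_ge0 z; rewrite /s; move=> ?; apply/andP; split; lra.
have zs : normc z < s by rewrite /s; lra.
have [B HB] := subexp_iter_der m (subexp_cst 1) s01.
have {}HB l : ((l + m) ^_ m)%:R * s ^+ l <= B.
  by have := HB l; rewrite iter_derE mulr1 nc_nat.
clearbody s; case/andP: s01 => s0 s1; pose q := normc z / s.
have q01 : 0 <= q < 1 by rewrite /q divr_ge0 ?nc_ge0 ?(ltW s0)//= ltr_pdivrMr// mul1r.
exists (B ^+ 2 * (1 - q)^-1) => N.
have step l : normc (kcoef m z (l + m)) ^+ 2 <= B ^+ 2 * q ^+ l.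
  case/andP: q01 => q0 q1; rewrite kcoef_shift ncM nc_nat ncX nc_conj.
  have -> : normc z ^+ l = s ^+ l * q ^+ l by rewrite -exprMn /q mulrC divfK// gt_eqF.
  rewrite mulrA exprMn; apply: ler_pM.
  - exact: sqr_ge0.
  - exact/exprn_ge0/exprn_ge0.
  - have h0 : 0 <= ((l + m) ^_ m)%:R * s ^+ l by rewrite mulr_ge0// exprn_ge0// ltW.
    by apply: lerXn2r; rewrite ?nnegrE// (le_trans h0).
  - by rewrite -exprM ler_wiXn2l// ?(ltW q1)// muln2 -addnn leq_addr.
apply: (@le_trans _ _ (\sum_(j < m + N) normc (kcoef m z j) ^+ 2)).
  rewrite addnC big_split_ord /= lerDl; apply: sumr_ge0 => i _; exact: sqr_ge0.
rewrite big_split_ord /= big1 ?add0r; last by move=> i _; rewrite /kcoef ltn_ord nc0 expr0n.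
apply: le_trans (ler_wpM2l (sqr_ge0 B) (geo_sum_le N q01)); rewrite mulr_sumr.
by apply: ler_sum => l _; rewrite addnC.
Qed.

Lemma hker_H2 m z : normc z < 1 -> H2 (hker m z).
Proof. by move=> /(kcoef_bounded m)[B HB]; have [] := hardy2_pfun HB. Qed.

Lemma tc_hker m z j : normc z < 1 -> tc (hker m z) j = kcoef m z j.
Proof. by move=> /(kcoef_bounded m)[B HB]; have [_ ->] := hardy2_pfun HB. Qed.

Lemma ip_hker m z f : H2 f -> normc z < 1 -> ip f (hker m z) = cderiv m f z.
Proof.
move=> hf z1; have := has_csum_shift m (ip_csum hf (hker_H2 m z1)).
rewrite big1 ?subr0; last first.
  by move=> i _; rewrite tc_hker// /kcoef ltn_ord conjC0 mulr0.
move=> H; apply: cconv_uniq H _; apply: (cconv_eq _ (cderiv_csum m (hardy2_holo hf) z1)) => n.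
apply: eq_bigr => j _; rewrite tc_hker// kcoef_shift rmorphM /= rmorph_nat rmorphXn /= conjCK.
by ring.
Qed.

(* the common form of the derivatives of the kernels at points of the disk *)
Lemma cderiv_hker n k z w : (k <= n)%N -> normc z < 1 -> normc w < 1 ->
  exists2 s, has_csum (fun l => (((l + n) ^_ k * (l + n) ^_ n)%:R) * (z^* * w) ^+ l) s &
    cderiv k (hker n z) w = w ^+ (n - k) * s.
Proof.
move=> kn z1 w1.
have H := cderiv_csum k (hardy2_holo (hker_H2 n z1)) w1.
have := has_csum_shift (n - k) H; rewrite big1 ?subr0; last first.
  move=> i _; rewrite tc_hker// /kcoef (_ : (i + k < n)%N); last by rewrite addnC -ltn_subRL.
  by rewrite mulr0 mul0r.
move=> H2'.
have zw : normc (z^* * w) < 1.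
  rewrite ncM nc_conj; apply: le_lt_trans (_ : normc z * 1 < 1); last by rewrite mulr1.
  by rewrite ler_wpM2l ?nc_ge0// ltW.
have Hs : subexp 1 (fun l => ((l + n) ^_ k * (l + n) ^_ n)%:R : C).
  have S1 m (mn : (m <= n)%N) : subexp 1 (fun l => ((l + n) ^_ m)%:R : C).
    have S := subexp_iter_der n (subexp_cst 1).
    move=> r r01; have [B HB] := S r r01; exists B => j.
    apply: le_trans (HB j); rewrite ler_wpM2r ?exprn_ge0//; first by case/andP: r01 => /ltW.
    rewrite iter_derE mulr1 !nc_nat ler_nat -[X in (_ <= _ ^_ X)%N](subnKC mn) ffact_split.
    by rewrite leq_pmulr// ffact_gt0 leq_sub2r// leq_addl.
  have := subexpM (S1 k kn) (S1 n (leqnn n)).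
  by rewrite (_ : (fun l => _) = (fun l => ((l + n) ^_ k * (l + n) ^_ n)%:R))//; apply/funext => l; rewrite natrM.
have [s Hsum] := subexp_csum Hs zw; exists s => //.
apply: cconv_uniq H2' _; apply: (cconv_eq _ (has_csumZ (w ^+ (n - k)) Hsum)) => N.
apply: eq_bigr => l _; rewrite -addnA subnK// tc_hker// kcoef_shift exprMn exprD natrM.
by ring.
Qed.

End HardyKernels.

(** * Derivatives of the Volterra operator *)

Section VolterraOperator.
Variable R : realType.
Local Notation C := R[i].
Implicit Types (f g h : C -> C) (z w : C).
Local Notation tc := (@taylor_coef R).

Lemma holo_integration h : holo h -> holo (integration h).
Proof. by move=> hh z z1; exact: has_cderiv_cderivable (integration_cderiv hh z1). Qed.

Lemma holo_iter_integration h i : holo h -> holo (iter i (@integration R) h).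
Proof.
move=> hh; elim: i => [|i ih]; first exact: hh.
by rewrite iterS; exact: holo_integration ih.
Qed.

Lemma cderiv_iter_integration h i j w : holo h -> normc w < 1 ->
  cderiv j (iter (i + j) (@integration R) h) w = iter i (@integration R) h w.
Proof.
move=> hh; elim: j i w => [|j ih] i w w1; first by rewrite addn0.
rewrite cderivS; have [r r0 Hr] := disk_nbhd w1.
have hi : holo (iter i (@integration R) h) by exact: holo_iter_integration.
have E v : normc (v - w) < r -> integration (iter i (@integration R) h) v =
     cderiv j (iter (i + j.+1) (@integration R) h) v.
  by move=> /Hr v1; rewrite addnS -addSn ih.
rewrite (cderiv_near r0 E); first exact: has_cderiv_cderiv (integration_cderiv hi w1).
exact: holo_integration.
Qed.

Section Volterra.
Variables (g : C -> C) (n k : nat).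
Hypotheses (hg : holo g) (kn : (k < n)%N).
Local Notation T := (volterra g n k).

Lemma holoM f h : holo f -> holo h -> holo (fun z => f z * h z).
Proof.
move=> hf hh z z1; apply: has_cderiv_cderivable.
exact: has_cderivM (cderivable_has_cderiv (hf z z1)) (cderivable_has_cderiv (hh z z1)).
Qed.

Let prod f := fun z => cderiv k f z * cderiv (n - k) g z.

Lemma holo_prod f : holo f -> holo (prod f).
Proof. by move=> hf; apply: holoM; exact: holo_holo. Qed.

Lemma volterraE f w : normc w < 1 -> T f w = iter n (@integration R) (prod f) w.
Proof. by move=> w1; rewrite /volterra /patch mem_set. Qed.

Lemma volterra_holo f : holo f -> holo (T f).
Proof.
move=> hf z z1; have [r r0 Hr] := disk_nbhd z1.
have H : holo (iter n (@integration R) (prod f)) by exact/holo_iter_integration/holo_prod.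
apply: has_cderiv_cderivable (has_cderiv_near r0 _ (cderivable_has_cderiv (H z z1))).
by move=> w /Hr w1; rewrite volterraE.
Qed.

Lemma cderiv_volterra f j w : holo f -> (j <= n)%N -> normc w < 1 ->
  cderiv j (T f) w = iter (n - j) (@integration R) (prod f) w.
Proof.
move=> hf jn w1.
have H : holo (iter n (@integration R) (prod f)) by exact/holo_iter_integration/holo_prod.
have E := @cderiv_iter_integration (prod f) (n - j) j w (holo_prod hf) w1.
rewrite (subnK jn) in E; rewrite -E.
have V v : normc v < 1 -> T f v = iter n (@integration R) (prod f) v by exact: volterraE.
apply: (cderiv_disk V) w1 => i v _ v1.
exact: (holo_holo (volterra_holo hf) v1).
Qed.

Lemma cderiv_volterra_n f w : holo f -> normc w < 1 ->
  cderiv n (T f) w = cderiv k f w * cderiv (n - k) g w.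
Proof. by move=> hf w1; rewrite (cderiv_volterra hf (leqnn n) w1) subnn. Qed.

(** An integral from 0 vanishes at 0. This puts T f among the functions that the sampling theorem
    controls by their n-th derivative. *)
Lemma tc_volterra f j : holo f -> (j < n)%N -> tc (T f) j = 0.
Proof.
move=> hf jn; have n0 : normc (0 : C) < 1 by rewrite nc0.
rewrite /taylor_coef (cderiv_volterra hf (ltnW jn) n0).
rewrite -(subnSK jn) iterS /integration /cintegral01.
under I_ext do rewrite mulr0.
under [X in _ +i* X]I_ext do rewrite mulr0.
by rewrite !I_cst mul0r.
Qed.

End Volterra.
End VolterraOperator.

(** * Power series with polynomial coefficients *)

Section FiniteDifferences.
Variable R : realType.
Local Notation C := R[i].
Implicit Types (u v : nat -> R).

(** The d-th finite difference vanishes: [u] is a polynomial sequence of degree less than d. *)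
Fixpoint pgrow d u : Prop :=
  if d is d'.+1 then pgrow d' (fun l => u l.+1 - u l) else forall l, u l = 0.

Lemma pgrow_ext d u v : (forall l, u l = v l) -> pgrow d u -> pgrow d v.
Proof. by move=> uv; rewrite (_ : v = u)//; apply/funext => l. Qed.

Lemma pgrowD d u v : pgrow d u -> pgrow d v -> pgrow d (fun l => u l + v l).
Proof.
elim: d u v => [|d ih] u v /= hu hv; first by move=> l; rewrite hu hv addr0.
by apply: pgrow_ext (ih _ _ hu hv) => l; ring.
Qed.

Lemma pgrowS d u : pgrow d u -> pgrow d.+1 u.
Proof.
by elim: d u => [|d ih] u /= hu; [move=> l; rewrite !hu subrr|exact: ih].
Qed.

Lemma pgrow_linear d u c : pgrow d u -> pgrow d.+1 (fun l => (l%:R + c) * u l).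
Proof.
elim: d u c => [|d ih] u c hu; first by move=> l /=; rewrite !hu !mulr0 subrr.
have H1 := ih _ (c + 1) hu.
by apply: pgrow_ext (pgrowD H1 (hu : pgrow d.+1 u)) => l; rewrite -natr1; ring.
Qed.

Lemma pgrow_ffact d u n k : (k <= n)%N -> pgrow d u ->
  pgrow (d + k) (fun l => ((l + n) ^_ k)%:R * u l).
Proof.
move=> kn hu; elim: k kn => [|k ih] kn.
  by rewrite addn0; apply: pgrow_ext hu => l; rewrite ffactn0 mul1r.
rewrite addnS; apply: pgrow_ext (pgrow_linear (n - k)%:R (ih (ltnW kn))) => l.
by rewrite ffactnSr natrM -addnBA ?(ltnW kn)// natrD; ring.
Qed.

(** Multiplying the series by 1 - x replaces its coefficients by their differences, up to the
    constant u(0); after d multiplications only bounded terms are left. *)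
Lemma pgrow_bound d u : pgrow d u -> exists2 B, 0 <= B & forall (x s : C), normc x < 1 ->
  has_csum (fun l => (u l)%:C * x ^+ l) s -> normc s * normc (1 - x) ^+ d <= B.
Proof.
elim: d u => [|d ih] u hu.
  exists 0 => // x s x1 H; suff -> : s = 0 by rewrite nc0 mul0r.
  apply: cconv_uniq H _; apply: (cconv_eq _ (cconv_cst 0)) => n.
  by rewrite big1// => l _; rewrite hu mul0r.
have [B B0 HB] := ih _ hu.
exists (`|u 0%N| * 2 ^+ d + B) => [|x s x1 H]; first by rewrite addr_ge0// mulr_ge0// exprn_ge0.
have b2 : normc (1 - x) <= 2 by apply: le_trans (ncB _ _) _; rewrite nc1; have : (2 : R) = 1 + 1 by []; lra.
have b2d : normc (1 - x) ^+ d <= 2 ^+ d by apply: lerXn2r; rewrite ?nnegrE ?nc_ge0.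
have [x0|x0] := eqVneq x 0.
  have -> : s = (u 0%N)%:C.
    apply: cconv_uniq H _; rewrite x0; exact: (@subexp_csum0 R (fun l => (u l)%:C)).
  rewrite nc_real x0 subr0 nc1 expr1n mulr1; apply: le_trans (_ : `|u 0%N| * 2 ^+ d <= _); last by rewrite lerDl.
  by rewrite ler_peMr// exprn_ege1// ler1n.
have Hs := has_csum_shift 1 H; rewrite big_ord1 expr0 mulr1 in Hs.
pose s' := x^-1 * (s - (u 0%N)%:C + - x * s).
have Hd : has_csum (fun l => (u l.+1 - u l)%:C * x ^+ l) s'.
  apply: (cconv_eq _ (has_csumZ x^-1 (has_csumD Hs (has_csumZ (-x) H)))) => n.
  by apply: eq_bigr => l _; rewrite addn1 exprS raddfB /=; field.
have := HB x s' x1 Hd => h.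
have E : s * (1 - x) = (u 0%N)%:C + x * s' by rewrite /s'; field.
rewrite exprSr mulrA mulrAC -ncM E.
apply: le_trans (ler_wpM2r (exprn_ge0 d (nc_ge0 _)) (ncD _ _)) _; rewrite mulrDl lerD//.
  by rewrite nc_real ler_wpM2l.
rewrite ncM -mulrA; apply: le_trans h; rewrite ler_piMl ?mulr_ge0 ?exprn_ge0 ?nc_ge0// ltW//.
Qed.

End FiniteDifferences.

(** * Diagonal dominance and a lower bound for the adjoint *)

Section RieszTest.
Variables (R : realType) (V : lmodType R[i]) (H : set V) (ip : V -> V -> R[i]).
Local Notation C := R[i].
Hypothesis HS : inner_product_space H ip.
Variables (T S : V -> V).
Hypothesis (Tb : bounded_operator H ip T) (TS : adjoint_operator H ip T S).
Local Notation nrm := (ipnorm ip).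

(** From 2 x y <= x^2 + y^2: the row sums of K pay for the x terms, the column sums for the y
    terms. *)
Lemma schur_sym (N : nat) (x y : 'I_N -> R) (K : 'I_N -> 'I_N -> R) (A B : R) :
  (forall a b, 0 <= K a b) ->
  (forall a, \sum_b K a b <= A) -> (forall b, \sum_a K a b <= B) ->
  \sum_a \sum_b x a * y b * K a b <= (A * (\sum_a x a ^+ 2) + B * (\sum_b y b ^+ 2)) / 2.
Proof.
move=> K0 hA hB.
apply: (@le_trans _ _ (\sum_a \sum_b ((x a ^+ 2 * K a b) / 2 + (y b ^+ 2 * K a b) / 2))).
  apply: ler_sum => a _; apply: ler_sum => b _; rewrite -!mulrDl -mulrA mulrCA.
  have := mulr_ge0 (sqr_ge0 (x a - y b)) (K0 a b).
  by rewrite sqrrB; lra.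
under eq_bigr do rewrite big_split /=.
rewrite big_split /= mulrDl lerD//.
  rewrite mulrC mulr_sumr mulr_sumr; apply: ler_sum => a _.
  by rewrite -mulr_suml -mulr_sumr [leRHS]mulrC ler_wpM2r// mulrC ler_wpM2r// sqr_ge0.
rewrite exchange_big /= mulrC mulr_sumr mulr_sumr; apply: ler_sum => b _.
by rewrite -mulr_suml -mulr_sumr [leRHS]mulrC ler_wpM2r// mulrC ler_wpM2r// sqr_ge0.
Qed.

Variables (N : nat) (l : 'I_N -> V) (C1 : R).
Hypothesis hl : forall a, H (l a).
Hypothesis gram : forall a, \sum_b normc (ip (l a) (l b)) <= C1.

Lemma comb_H (c : 'I_N -> C) : H (\sum_a c a *: l a).
Proof. by apply: (Hsum HS) => a; exact: (HZ HS). Qed.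

Lemma bessel_synthesis (c : 'I_N -> C) :
  nrm (\sum_a c a *: l a) ^+ 2 <= C1 * \sum_a normc (c a) ^+ 2.
Proof.
have hc a : H (c a *: l a) by exact: (HZ HS).
have hs := comb_H c; rewrite (nrm_sq HS hs).
apply: le_trans (le_trans (ler_norm _) (nc_Re _)) _.
rewrite (ip_suml HS _ hc hs); under eq_bigr do rewrite (ip_sumr HS _ hc (hc _)).
apply: le_trans (nc_sum _ _ _) _.
apply: (@le_trans _ _ (\sum_a \sum_b normc (c a) * normc (c b) * normc (ip (l a) (l b)))).
  apply: ler_sum => a _; apply: le_trans (nc_sum _ _ _) _; apply: ler_sum => b _.
  by rewrite (ipZl HS _ (hl a) (hc b)) (ipZr HS _ (hl b) (hl a)) !ncM nc_conj mulrA.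
have gram' b : \sum_a normc (ip (l a) (l b)) <= C1.
  apply: le_trans (gram b); apply: ler_sum => a _.
  by rewrite (ips_conj HS (hl b) (hl a)) nc_conj.
apply: le_trans (schur_sym _ _ _ gram gram') _; first by move=> a b; exact: nc_ge0.
by rewrite -mulrDl; lra.
Qed.

Variables (G : 'I_N -> R) (kap : 'I_N -> 'I_N -> R) (tau t k0 dl : R) (c : 'I_N -> C).
Hypothesis (tau0 : 0 < tau) (t0 : 0 <= t) (k00 : 0 < k0) (C10 : 0 <= C1).
Hypothesis Gtau : forall a, tau <= G a.
Hypothesis kap0 : forall a b, 0 <= kap a b.
Hypothesis XE : forall a b, normc (ip (T (l b)) (l a)) = G a * kap a b.
Hypothesis kdiag : forall a, k0 <= kap a a.
Hypothesis krow : forall a, \sum_(b | b != a) kap a b <= dl.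
Hypothesis kcol : forall b, \sum_(a | a != b) kap a b <= dl.
Hypothesis c0 : exists a, c a != 0.
Hypothesis Sf : nrm (S (\sum_a c a *: l a)) <= t * nrm (\sum_a c a *: l a).

(** S f is tested against a combination w of the same vectors. From below, the diagonal wins: |<S f,
    w>| >= (k0 - dl) Q. From above, |S f| |w| <= t C1 sqrt(P Q), and P <= Q / tau^2 because all
    weights [G] are at least tau. *)
Lemma riesz_test : (k0 - dl) * tau <= t * C1.
Proof.
set f := \sum_a c a *: l a; have hf : H f := comb_H c.
have hT b : H (T (l b)) by exact: (op_H Tb).
have hSf : H (S f) := op_H TS.1 hf.
have hc a : H (c a *: l a) by exact: (HZ HS).
pose X a b := ip (T (l b)) (l a).
pose d a := normc (c a) * G a.
have G0 a : 0 < G a := lt_le_trans tau0 (Gtau a).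
have kp a : 0 < kap a a := lt_le_trans k00 (kdiag a).
have d0 a : 0 <= d a by rewrite mulr_ge0 ?nc_ge0 ?(ltW (G0 a)).
(* The phase makes every diagonal term of <S f, w> nonnegative, and the size |b_a| = |c_a| G_a
   balances the weights in the off-diagonal terms. *)
pose b a := c a * (X a a)^* / (kap a a)%:C.
have nb a : normc (b a) = d a.
  rewrite /b !ncM ncV nc_conj nc_real (gtr0_norm (kp a)) XE /d.
  by field; rewrite gt_eqF.
pose Q := \sum_a d a ^+ 2; pose P := \sum_a normc (c a) ^+ 2.
have Q0 : 0 < Q.
  have [a ca] := c0; rewrite /Q (bigD1 a)//= ltr_pwDl ?sumr_ge0// => [|*]; last exact: sqr_ge0.
  by rewrite exprn_gt0// mulr_gt0// nc_gt0.
have PQ : tau ^+ 2 * P <= Q.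
  rewrite /P mulr_sumr; apply: ler_sum => a _; rewrite /d exprMn mulrC ler_wpM2l ?sqr_ge0//.
  by apply: lerXn2r; rewrite ?nnegrE ?(ltW tau0)// ltW.
have P0 : 0 <= P by apply: sumr_ge0 => *; exact: sqr_ge0.
pose w := \sum_a b a *: l a; have hw : H w := comb_H b.
have ipE : ip (S f) w = \sum_j \sum_i (b j)^* * (c i * (X i j)^*).
  rewrite /w (ip_sumr HS) => [|a|//]; last exact: (HZ HS).
  apply: eq_bigr => j _; rewrite (ipZr HS _ (hl j) hSf) -mulr_sumr; congr (_ * _).
  have -> : ip (S f) (l j) = ip f (T (l j)).
    by rewrite (ips_conj HS (hl j) hSf) -(TS.2 _ _ (hl j) hf) -(ips_conj HS (hT j) hf).
  rewrite /f (ip_suml HS _ hc (hT j)); apply: eq_bigr => i _.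
  by rewrite (ipZl HS _ (hl i) (hT j)) (ips_conj HS (hT j) (hl i)).
have low : (k0 - dl) * Q <= normc (ip (S f) w).
  rewrite ipE; pose Dg := \sum_j (b j)^* * (c j * (X j j)^*).
  pose Of := \sum_j \sum_(i | i != j) (b j)^* * (c i * (X i j)^*).
  have -> : \sum_j \sum_i (b j)^* * (c i * (X i j)^*) = Dg + Of.
    by rewrite -big_split; apply: eq_bigr => j _; rewrite (bigD1 j).
  have DgE : Dg = (\sum_j d j ^+ 2 * kap j j)%:C.
    rewrite rmorph_sum; apply: eq_bigr => j _.
    have -> : (b j)^* * (c j * (X j j)^*) = ((c j)^* * c j) * (X j j * (X j j)^*) / (kap j j)%:C.
      by rewrite /b !rmorphM fmorphV /= conjCK conj_real; ring.
    rewrite mulJc mulcJ XE -fmorphV -!rmorphM /=; congr (_%:C); rewrite /d.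
    by field; rewrite gt_eqF.
  have nOf : normc Of <= dl * Q.
    apply: le_trans (nc_sum _ _ _) _.
    apply: (@le_trans _ _ (\sum_j \sum_i d j * d i * (if i != j then kap i j else 0))).
      apply: ler_sum => j _; apply: le_trans (nc_sum _ _ _) _; rewrite big_mkcond /=.
      apply: ler_sum => i _; case: ifP => _; last by rewrite mulr0.
      by rewrite !ncM !nc_conj nb XE /d; rewrite le_eqVlt; apply/orP; left; apply/eqP; ring.
    have r1 j : \sum_i (if i != j then kap i j else 0) <= dl by rewrite -big_mkcond; exact: kcol.
    have r2 i : \sum_j (if i != j then kap i j else 0) <= dl.
      by under eq_bigr do rewrite eq_sym; rewrite -big_mkcond; exact: krow.
    apply: le_trans (schur_sym _ _ _ r1 r2) _; first by move=> i j; case: ifP.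
    by rewrite -/Q; lra.
  have nDg : k0 * Q <= normc Dg.
    rewrite DgE nc_real ger0_norm; last by apply: sumr_ge0 => j _; rewrite mulr_ge0 ?sqr_ge0.
    rewrite mulr_sumr; apply: ler_sum => j _; rewrite mulrC ler_wpM2l ?sqr_ge0//.
  by have := nc_add_ge Dg Of; lra.
have up : normc (ip (S f) w) ^+ 2 <= t ^+ 2 * C1 ^+ 2 * P * Q.
  have h1 := bessel_synthesis c; have h2 := bessel_synthesis b.
  have E2 : \sum_a normc (b a) ^+ 2 = Q by apply: eq_bigr => a _; rewrite nb.
  rewrite E2 -/P -/f -/w in h1 h2.
  have h3 := ip_CS HS hSf hw.
  have h4 : normc (ip (S f) w) ^+ 2 <= (t * nrm f * nrm w) ^+ 2.
    apply: lerXn2r; rewrite ?nnegrE ?nc_ge0 ?mulr_ge0 ?nrm_ge0//.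
    by apply: le_trans h3 _; rewrite ler_wpM2r ?nrm_ge0.
  apply: le_trans h4 _; rewrite !exprMn.
  have -> : t ^+ 2 * C1 ^+ 2 * P * Q = t ^+ 2 * ((C1 * P) * (C1 * Q)) by ring.
  by rewrite -mulrA ler_wpM2l ?sqr_ge0// ler_pM ?sqr_ge0.
have [neg|pos] := ltP (k0 - dl) 0.
  by apply: le_trans (_ : 0 <= _); [rewrite mulr_le0_ge0// ltW|rewrite mulr_ge0].
rewrite -(ler_pXn2r (ltn0Sn 1)) ?nnegrE ?mulr_ge0 ?(ltW tau0)// !exprMn.
have : ((k0 - dl) * Q) ^+ 2 <= t ^+ 2 * C1 ^+ 2 * P * Q.
  by apply: le_trans up; apply: lerXn2r; rewrite ?nnegrE ?mulr_ge0 ?nc_ge0 ?(ltW Q0).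
rewrite exprMn => h.
have Q2 : 0 < Q ^+ 2 by rewrite exprn_gt0.
rewrite -(ler_pM2r Q2); apply: (@le_trans _ _ (tau ^+ 2 * (t ^+ 2 * C1 ^+ 2 * P * Q))).
  have := ler_wpM2l (sqr_ge0 tau) h; lra.
have : t ^+ 2 * C1 ^+ 2 * Q * (tau ^+ 2 * P) <= t ^+ 2 * C1 ^+ 2 * Q * Q.
  by rewrite ler_wpM2l// !mulr_ge0 ?sqr_ge0 ?(ltW Q0).
rewrite expr2; lra.
Qed.

End RieszTest.

(** * Sums over lattices *)

Section LatticeSums.
Variable R : realType.

(** [psi] stands in for the arctangent primitive of 1 / (q^2 + x^2): it is rational on each half
    line, bounded by 1/q, and 8 times its unit increment dominates the summand. Telescoping gives 8
    times 2/q. *)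
Lemma lattice_sum (q c : R) B : 1 <= q ->
  \sum_(b < B) (q ^+ 2 + (b%:R - c) ^+ 2)^-1 <= 16 / q.
Proof.
move=> q1; have q0 : 0 < q by apply: lt_le_trans q1.
pose psi x := x / (q * (q + `|x|)) : R.
have pos (x : R) : 0 < q + `|x| by rewrite ltr_pwDl.
have psi_le x : `|psi x| <= q^-1.
  rewrite /psi normrM normfV [X in _ / X]gtr0_norm ?mulr_gt0// ler_pdivrMr ?mulr_gt0//.
  by rewrite mulrA mulVf ?gt_eqF// mul1r lerDr ltW.
have incr x : (q ^+ 2 + x ^+ 2)^-1 <= 8 * (psi (x + 1) - psi x).
  have inv2 (a b : R) : 0 < a -> 0 < b -> a <= b -> b^-1 <= a^-1.
    by move=> a0 b0 ab; rewrite lef_pV2.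
  have [x0|x0] := leP 0 x.
    have -> : psi (x + 1) - psi x = ((q + x) * (q + x + 1))^-1.
      have h1 : 0 < q + x by rewrite ltr_pwDl.
      have h2 : 0 < q + x + 1 by rewrite addr_gt0.
      rewrite /psi !ger0_norm ?addr_ge0//; field.
      by rewrite !gt_eqF//; rewrite addrA.
    have -> : 8 * ((q + x) * (q + x + 1))^-1 = ((q + x) * (q + x + 1) / 8)^-1.
      by rewrite invf_div mulrC.
    by apply: inv2; nra.
  have [x1|x1] := leP x (-1).
    have -> : psi (x + 1) - psi x = ((q - x - 1) * (q - x))^-1.
      have h1 : 0 < q - x - 1 by lra.
      have h2 : 0 < q - x by lra.
      have e1 : `|x + 1| = - (x + 1) by rewrite ler0_norm//; lra.
      rewrite /psi e1 ler0_norm ?(ltW x0)//; field.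
      by rewrite !gt_eqF// (_ : q + - (x + 1) = q - x - 1)//; ring.
    have -> : 8 * ((q - x - 1) * (q - x))^-1 = ((q - x - 1) * (q - x) / 8)^-1.
      by rewrite invf_div mulrC.
    by apply: inv2; nra.
  have h1 : 0 < q + x + 1 by lra.
  have h2 : 0 < q - x by lra.
  have -> : psi (x + 1) - psi x = (x + 1) / (q * (q + x + 1)) - x / (q * (q - x)).
    rewrite /psi ger0_norm; last by lra.
    by rewrite ler0_norm ?(ltW x0)// addrA.
  have k1 : (x + 1) / (q * (q + 1)) <= (x + 1) / (q * (q + x + 1)).
    apply: ler_wpM2l; first by lra.
    by apply: inv2; rewrite ?mulr_gt0//; [lra|rewrite ler_pM2l//; lra].
  have k2 : (- x) / (q * (q + 1)) <= (- x) / (q * (q - x)).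
    apply: ler_wpM2l; first by lra.
    by apply: inv2; rewrite ?mulr_gt0//; [lra|rewrite ler_pM2l//; lra].
  apply: (@le_trans _ _ (8 * (q * (q + 1))^-1)).
    have -> : 8 * (q * (q + 1))^-1 = (q * (q + 1) / 8)^-1 by rewrite invf_div mulrC.
    by apply: inv2; nra.
  rewrite ler_wpM2l//.
  apply: le_trans (_ : (x + 1) / (q * (q + 1)) + (- x) / (q * (q + 1)) <= _).
    by rewrite -mulrDl (_ : x + 1 + - x = 1) ?mul1r//; ring.
  by rewrite mulNr in k2; rewrite mulNr; rewrite mulNr in k2; lra.
apply: (@le_trans _ _ (\sum_(b < B) 8 * (psi (b.+1%:R - c) - psi (b%:R - c)))).
  apply: ler_sum => b _; have := incr (b%:R - c).
  by rewrite (_ : b%:R - c + 1 = b.+1%:R - c)// -natr1; ring.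
rewrite -mulr_sumr -(big_mkord xpredT (fun b => psi (b.+1%:R - c) - psi (b%:R - c))).
rewrite (telescope_sumr (fun b => psi (b%:R - c)))//.
have := psi_le (B%:R - c); have := psi_le (0%:R - c).
by rewrite !ler_norml => /andP[a1 a2] /andP[b1 b2]; lra.
Qed.

(** The exponent is the distance from u to u0, and each side of u0 is a geometric series starting at
    e, hence at most 2 e. *)
Lemma geo_dist_sum (e : R) U u0 : 0 <= e <= 1 / 2 ->
  \sum_(u < U | (u != u0 :> nat)) e ^+ (maxn u u0 - minn u u0) <= 4 * e.
Proof.
move=> /andP[e0 e2].
have g N : \sum_(d < N) e ^+ d.+1 <= 2 * e.
  have -> : \sum_(d < N) e ^+ d.+1 = e * \sum_(d < N) e ^+ d.
    by rewrite mulr_sumr; apply: eq_bigr => d _; rewrite exprS.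
  rewrite mulrC ler_wpM2r//.
  have e1 : e < 1 by lra.
  have E : (1 - e) * \sum_(j < N) e ^+ j = 1 - e ^+ N by rewrite -opprB mulNr -subrX1 opprB.
  have := exprn_ge0 N e0.
  have s0 : 0 <= \sum_(j < N) e ^+ j by apply: sumr_ge0 => *; exact: exprn_ge0.
  by nra.
have [Uu|uU] := leqP U u0.
  apply: (@le_trans _ _ (\sum_(u < U) e ^+ (u0 - u))).
    rewrite big_mkcond /=; apply: ler_sum => u _; case: ifP => _; last exact: exprn_ge0.
    have uu : (u < u0)%N := leq_trans (ltn_ord u) Uu.
    by rewrite (maxn_idPr (ltnW uu)) (minn_idPl (ltnW uu)).
  apply: (@le_trans _ _ (\sum_(u < u0) e ^+ (u0 - u))).
    rewrite -(subnKC Uu) big_split_ord /= lerDl; apply: sumr_ge0 => *; exact: exprn_ge0.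
  rewrite (reindex_inj rev_ord_inj) /=; apply: le_trans (le_trans _ (g u0)) _; last by lra.
  apply: ler_sum => u _; rewrite subKn ?ltn_ord//.
apply: (@le_trans _ _ (\sum_(u < u0.+1 + (U - u0.+1)) if (u != u0 :> nat) then e ^+ (maxn u u0 - minn u u0) else 0)).
  by rewrite subnKC// -big_mkcond.
rewrite big_split_ord /= big_ord_recr /= eqxx addr0.
have -> : 4 * e = 2 * e + 2 * e by lra.
rewrite lerD//.
  apply: (@le_trans _ _ (\sum_(u < u0) e ^+ (u0 - u))).
    apply: ler_sum => u _ /=; rewrite ltn_eqF// (maxn_idPr (ltnW (ltn_ord u))) (minn_idPl (ltnW (ltn_ord u))) //.
  rewrite (reindex_inj rev_ord_inj) /=; apply: le_trans (g u0).
  by apply: ler_sum => u _; rewrite subKn ?ltn_ord//.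
apply: le_trans (g (U - u0.+1)%N); apply: ler_sum => u _ /=.
have lt : (u0 < u0.+1 + u)%N by rewrite addSn ltnS leq_addr.
by rewrite gtn_eqF// (maxn_idPl (ltnW lt)) (minn_idPr (ltnW lt)) addSnnS addKn.
Qed.

End LatticeSums.

(** * Kernel estimates and row sums over sparse points *)

Section KernelEstimates.
Variable R : realType.
Local Notation C := R[i].
Implicit Types z w : C.

(** The third bound is the identity |1 - conj(z) w|^2 = |z - w|^2 + (1 - |z|^2)(1 - |w|^2). *)
Lemma disk_dist z w : normc z < 1 -> normc w < 1 ->
  [/\ 1 - normc z <= normc (1 - z^* * w), 1 - normc w <= normc (1 - z^* * w)
    & normc (z - w) <= normc (1 - z^* * w)].
Proof.
move=> z1 w1; have z0 := nc_ge0 z; have w0 := nc_ge0 w.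
have := nc_sub_ge 1 (z^* * w); rewrite nc1 ncM nc_conj => h.
split; [nra|nra|].
rewrite -(ler_pXn2r (ltn0Sn 1)) ?nnegrE ?nc_ge0//.
have -> : normc (1 - z^* * w) ^+ 2 = normc (z - w) ^+ 2 + (1 - normc z ^+ 2) * (1 - normc w ^+ 2).
  apply: (@complexI R).
  have -> : (normc (z - w) ^+ 2 + (1 - normc z ^+ 2) * (1 - normc w ^+ 2))%:C =
    (normc (z - w) ^+ 2)%:C + (1 - (normc z ^+ 2)%:C) * (1 - (normc w ^+ 2)%:C) :> C.
    have rM (a b : R) : (a * b)%:C = a%:C * b%:C :> C by rewrite rmorphM.
    have rB (a b : R) : (a - b)%:C = a%:C - b%:C :> C by rewrite raddfB.
    by rewrite raddfD /= (rM (1 - _)) !rB.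
  have cB (x y : C) : (x - y)^* = x^* - y^* by rewrite rmorphB.
  have cM : (z^* * w)^* = z * w^* by rewrite rmorphM /= conjCK.
  by rewrite -!mulcJ !cB cM rmorph1; ring.
by rewrite lerDl mulr_ge0// subr_ge0 expr_le1// ltW.
Qed.

Lemma kernel_bound n k : (k <= n)%N -> exists2 B : R, 0 <= B &
  forall z w, normc z < 1 -> normc w < 1 ->
    normc (cderiv k (hker n z) w) * normc (1 - z^* * w) ^+ (n + k).+1 <= B.
Proof.
move=> kn; pose u l : R := ((l + n) ^_ k * (l + n) ^_ n)%:R.
have hu : pgrow (n + k).+1 u.
  have h1 : pgrow 1 (fun=> 1 : R) by move=> l /=; rewrite subrr.
  have h2 := pgrow_ffact kn (pgrow_ffact (leqnn n) h1).
  by rewrite add1n addSn in h2; apply: pgrow_ext h2 => l; rewrite /u natrM mulr1.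
have [B B0 HB] := pgrow_bound hu; exists B => // z w z1 w1.
have [s Hs ->] := cderiv_hker kn z1 w1.
have x1 : normc (z^* * w) < 1.
  by rewrite ncM nc_conj; have := nc_ge0 z; have := nc_ge0 w; nra.
have Hu : has_csum (fun l => (u l)%:C * (z^* * w) ^+ l) s.
  by apply: (cconv_eq _ Hs) => N; apply: eq_bigr => l _; rewrite /u rmorph_nat.
apply: le_trans (HB _ _ x1 Hu).
rewrite ler_wpM2r ?exprn_ge0 ?nc_ge0// ncM ler_piMl ?nc_ge0// ncX exprn_ile1 ?nc_ge0 ?ltW//.
Qed.

Local Notation hf v := ((2^-1 : R) ^+ v).

Lemma hf_gt0 v : 0 < hf v. Proof. by rewrite exprn_gt0// invr_gt0. Qed.

(** The sequence starts at 1/4 and increases, since (1 - h/2)^2 >= 1 - h. *)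
Lemma hf_pow v : (1 <= v)%N -> 1 / 4 <= (1 - hf v) ^+ (2 ^ v).
Proof.
elim: v => [//|[|v] ih _]; first by rewrite expr1 expn1 expr2; lra.
have {}ih := ih isT; apply: le_trans ih _.
rewrite [(2 ^ v.+2)%N]expnS exprM.
have h0 := hf_gt0 v.+1.
have h1 : hf v.+1 <= 1 by rewrite exprn_ile1 ?invr_ge0//; lra.
rewrite lerXn2r ?nnegrE ?subr_ge0 ?sqr_ge0//.
by rewrite [hf v.+2]exprS; nra.
Qed.

Lemma ffact_ge l n k : (k <= n)%N -> (l ^ k <= (l + n) ^_ k)%N.
Proof.
elim: k => [|k ih] kn; first by rewrite expn0 ffactn0.
by rewrite expnSr ffactnSr leq_mul ?ih ?(ltnW kn)//; lia.
Qed.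

(** On the diagonal the series has nonnegative terms. The block of indices from N to 2 N with N =
    2^v suffices: there |z|^(2 l) >= |z|^(4 N) >= 1/256. The factor 2^-n bounds |z|^(n - k). *)
Lemma kernel_diag n k v z : (k <= n)%N -> (1 <= v)%N -> 1 - hf v <= normc z < 1 ->
  hf n / 256 <= hf v ^+ (n + k).+1 * normc (cderiv k (hker n z) z).
Proof.
move=> kn v1 /andP[zh z1].
have h0 := hf_gt0 v; set h := hf v in zh h0 *.
have h12 : h <= 1 / 2.
  by rewrite /h -(subnKC v1) exprD expr1 mul1r ler_piMr ?invr_ge0 ?ler0n// exprn_ile1 ?invr_ge0// invf_le1 ?ler1n.
have [s Hs ->] := cderiv_hker kn z1 z1.
have zp : 1 / 2 <= normc z by lra.
have nk : hf n <= normc z ^+ (n - k).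
  apply: le_trans (_ : (2^-1) ^+ (n - k) <= _).
    by apply: ler_wiXn2l; rewrite ?invr_ge0 ?ler0n ?invf_le1 ?ler1n// leq_subr.
  apply: lerXn2r; rewrite ?nnegrE ?nc_ge0 ?invr_ge0//; lra.
pose N := (2 ^ v)%N.
have Nh : N%:R * h = 1 by rewrite /N /h natrX -exprMn mulfV ?expr1n// pnatr_eq0.
pose a l : R := ((l + n) ^_ k * (l + n) ^_ n)%:R * (normc z ^+ 2) ^+ l.
have a0 l : 0 <= a l by rewrite mulr_ge0 ?ler0n// exprn_ge0// sqr_ge0.
have aN l : (l < N)%N -> N%:R ^+ (n + k) / 256 <= a (N + l)%N.
  move=> lN; rewrite /a; apply: ler_pM; rewrite ?exprn_ge0 ?ler0n ?invr_ge0 ?ler0n//.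
    rewrite -natrX ler_nat addnC expnD leq_mul//.
      by apply: leq_trans (ffact_ge _ kn); case: (k) => // k'; rewrite leq_exp2r// leq_addr.
    by apply: leq_trans (ffact_ge _ (leqnn n)); case: (n) => // k'; rewrite leq_exp2r// leq_addr.
  have p4 : 1 / 4 <= normc z ^+ N.
    apply: le_trans (hf_pow v1) _; apply: lerXn2r; rewrite ?nnegrE ?nc_ge0//.
    by rewrite subr_ge0 -/h; apply: le_trans h12 _; lra.
  rewrite -exprM; apply: le_trans (_ : normc z ^+ (N * 4) <= _).
    rewrite exprM; apply: le_trans (_ : (1 / 4) ^+ 4 <= _); first by rewrite !exprS expr0; lra.
    by apply: lerXn2r; rewrite ?nnegrE ?exprn_ge0 ?nc_ge0//; lra.
  by apply: ler_wiXn2l; rewrite ?nc_ge0 ?(ltW z1)//; lia.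
have low : N%:R ^+ (n + k).+1 / 256 <= normc s.
  apply/ler_addgt0Pr => e e0; have [N0 HN] := (cconvP _ _).1 Hs e e0.
  have := HN (maxn N0 (N + N)) (leq_maxl _ _).
  have -> : \sum_(j < maxn N0 (N + N)) (((j + n) ^_ k * (j + n) ^_ n)%:R : C) * (z^* * z) ^+ j =
      (\sum_(j < maxn N0 (N + N)) a j)%:C.
    rewrite rmorph_sum; apply: eq_bigr => j _; rewrite /a mulJc.
    have -> (x : R) i : x%:C ^+ i = (x ^+ i)%:C :> C by rewrite rmorphXn.
    have -> i : i%:R = (i%:R : R)%:C :> C by rewrite rmorph_nat.
    by rewrite -rmorphM.
  have : N%:R ^+ (n + k).+1 / 256 <= \sum_(j < maxn N0 (N + N)) a j.
    rewrite -(subnKC (leq_maxr N0 (N + N))) !big_split_ord /= -addrA addrC -!addrA.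
    apply: le_trans (_ : \sum_(i < N) a (N + i)%N <= _); last first.
      by rewrite lerDl addr_ge0// sumr_ge0.
    apply: le_trans (_ : \sum_(i < N) N%:R ^+ (n + k) / 256 <= _).
      by rewrite sumr_const card_ord -[leRHS]mulr_natl exprS mulrA.
    by apply: ler_sum => i _; exact: aN.
  set S := \sum_(j < _) a j => h1 h2.
  have := nc_sub_ge S%:C s; rewrite nc_real => h3.
  by have := ler_norm S; lra.
rewrite ncM ncX mulrCA ler_pM ?invr_ge0 ?ler0n ?(ltW (hf_gt0 _))//.
apply: le_trans (_ : h ^+ (n + k).+1 * (N%:R ^+ (n + k).+1 / 256) <= _).
  by rewrite mulrA -exprMn [h * _]mulrC Nh expr1n mul1r.
by rewrite ler_wpM2l// exprn_ge0// ltW.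
Qed.

Section SparseRows.
Variables (U B v0 b0 m M2 : nat) (F : {set 'I_U * 'I_B}) (z : 'I_U * 'I_B -> C) (Y : C -> R).
Local Notation I := ('I_U * 'I_B)%type.
(** The spacing is even so that the square root of the height is a constant times the u-th power of
    2^-m. *)
Definition lev (u : nat) : nat := v0 + 2 * m * u.
Local Notation h u := (hf (lev u)).
Local Notation sq u := (Num.sqrt (hf (lev u))).
Hypothesis (m1 : (1 <= m)%N) (M22 : (2 <= M2)%N).
Hypothesis Ylip : forall z w, `|Y z - Y w| <= normc (z - w).
Hypothesis hz : forall i, i \in F -> 1 - h i.1 <= normc (z i) < 1 - h i.1 / 2.
Hypothesis hY : forall i, i \in F ->
  h i.1 * (b0 + M2 * i.2)%:R <= Y (z i) + 1 < h i.1 * (b0 + M2 * i.2).+1%:R.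

(** Common majorant, up to constants, of the normalised Gram matrix and of the normalised matrix of
    the operator. It is not symmetric: the extra height is that of the column, so only rows are
    summed. *)
Definition beta (i j : I) : R := sq i.1 * sq j.1 * h j.1 / normc (1 - (z j)^* * z i) ^+ 2.

Lemma zF1 i : i \in F -> normc (z i) < 1.
Proof. by move=> /hz/andP[_ h1]; have := hf_gt0 (lev i.1); lra. Qed.

Lemma D_ge i j : i \in F -> j \in F -> [/\ h i.1 / 2 <= normc (1 - (z j)^* * z i),
  h j.1 / 2 <= normc (1 - (z j)^* * z i) & `|Y (z j) - Y (z i)| <= normc (1 - (z j)^* * z i)].
Proof.
move=> iF jF; have [a b c] := disk_dist (zF1 jF) (zF1 iF).
have /andP[_ h1] := hz iF; have /andP[_ h2] := hz jF.
by split; [lra|lra|exact: le_trans (Ylip _ _) c].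
Qed.

Lemma sqE u : sq u = Num.sqrt (hf v0) * (hf m) ^+ u.
Proof.
rewrite /lev exprD sqrtrM ?(ltW (hf_gt0 _))//; congr (_ * _).
have -> : (2 * m * u = m * u * 2)%N by lia.
rewrite exprM sqrtr_sqr ger0_norm ?exprn_ge0 ?(ltW (hf_gt0 _))// exprM//.
Qed.

Lemma sq_ge0 u : 0 <= sq u. Proof. exact: sqrtr_ge0. Qed.

Lemma sq_sq u : sq u * sq u = h u.
Proof. by rewrite -expr2 sqr_sqrtr// ltW// hf_gt0. Qed.

Lemma levE u : h u = hf v0 * (hf m) ^+ u * (hf m) ^+ u.
Proof. by rewrite -sq_sq sqE mulrACA -expr2 sqr_sqrtr ?mulrA// ltW// hf_gt0. Qed.

Lemma beta_diag i : i \in F -> beta i i <= 4.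
Proof.
move=> iF; rewrite /beta; set D := normc _; have [a _ _] := D_ge iF iF; rewrite -/D in a.
have h0 := hf_gt0 (lev i.1); rewrite sq_sq.
have D0 : 0 < D by lra.
by rewrite ler_pdivrMr ?exprn_gt0//; nra.
Qed.

Lemma sq_ratio (u u0 : nat) : sq u0 * sq u / Num.max (h u) (h u0) = hf m ^+ (maxn u u0 - minn u u0).
Proof.
have E (a b : nat) : (a <= b)%N -> sq a * sq b / Num.max (h a) (h b) = hf m ^+ (b - a).
  move=> ab; have hba : h b <= h a.
    by apply: ler_wiXn2l; rewrite ?invr_ge0 ?ler0n ?invf_le1 ?ler1n// /lev; nia.
  rewrite (max_l hba) !sqE levE -[in hf m ^+ b](subnKC ab) exprD mulrACA -expr2 sqr_sqrtr ?(ltW (hf_gt0 _))//.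
  have := hf_gt0 v0; have := exprn_gt0 a (hf_gt0 m).
  set x := hf m ^+ a; set y := hf v0; set w := hf m ^+ (b - a) => x0 y0.
  by field; rewrite !gt_eqF.
case: (leqP u u0) => uu; first by rewrite [sq u0 * _]mulrC E.
by rewrite maxC E// ltnW.
Qed.

(** Along one level the points advance in the coordinate [Y], so |1 - conj(z_j) z_i| dominates both
    the larger height H and the lattice distance; [lattice_sum] applies with q = H / h. The constant
    208 is 13 times 16. *)
Lemma far_level i (u : 'I_U) : i \in F -> u != i.1 :> nat ->
  \sum_(t < B | (u, t) \in F) beta i (u, t) <= 208 * hf m ^+ (maxn u i.1 - minn u i.1).
Proof.
move=> iF _; rewrite -sq_ratio.
set H := Num.max _ _; have hu0 := hf_gt0 (lev u).
have Hu : h u <= H by rewrite le_max lexx.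
have Hi : h i.1 <= H by rewrite le_max lexx orbT.
pose q := H / h u; have q1 : 1 <= q by rewrite ler_pdivlMr ?mul1r.
have M0 : (0 : R) < M2%:R by rewrite ltr0n; lia.
pose c : R := ((1 + Y (z i)) / h u - b0%:R) / M2%:R.
have key (t : 'I_B) : (u, t) \in F ->
    beta i (u, t) <= sq i.1 * sq u * (13 / h u * (q ^+ 2 + (t%:R - c) ^+ 2)^-1).
  move=> jF; have [a1 a2 a3] := D_ge iF jF; rewrite /beta /=.
  set D := normc _ in a1 a2 a3 *.
  have DH : H <= 2 * D by rewrite ge_max; apply/andP; split; [move: a2 => /= a2|]; lra.
  rewrite -[leLHS]mulrA ler_wpM2l ?mulr_ge0 ?sq_ge0//.
  have /andP[y1 y2] := hY jF; rewrite /= in y1 y2.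
  have D0 : 0 < D by lra.
  have q0 : 0 < q by apply: lt_le_trans q1.
  have P0 : 0 < q ^+ 2 + (t%:R - c) ^+ 2 by rewrite ltr_pwDl ?exprn_gt0 ?sqr_ge0.
  have E1 : q * h u = H by rewrite /q divfK// gt_eqF.
  pose X := h u * (b0 + M2 * t)%:R - 1 - Y (z i).
  have E2 : (t%:R - c) * h u * M2%:R = X.
    by rewrite /X /c natrD natrM; field; rewrite !gt_eqF.
  have X3 : `|X| <= 3 * D.
    have : `|X - (Y (z (u, t)) - Y (z i))| <= h u.
      by rewrite ler_norml /X; rewrite -[(b0 + M2 * t).+1%:R]natr1 mulrDr mulr1 in y2; apply/andP; split; lra.
    have := ler_normD (X - (Y (z (u, t)) - Y (z i))) (Y (z (u, t)) - Y (z i)).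
    by rewrite subrK; lra.
  have X9 : X ^+ 2 <= 9 * D ^+ 2.
    by rewrite -real_normK ?num_real//; have := normr_ge0 X; nra.
  have T2 : ((t%:R - c) * h u) ^+ 2 <= X ^+ 2.
    have -> : X ^+ 2 = ((t%:R - c) * h u) ^+ 2 * M2%:R ^+ 2 by rewrite -E2 exprMn.
    apply: ler_peMr; first exact: sqr_ge0.
    by apply: exprn_ege1; rewrite ler1n ltnW.
  (* 13 is 4 + 9, from H <= 2 D and |X| <= 3 D. *)
  have main : (q ^+ 2 + (t%:R - c) ^+ 2) * h u ^+ 2 <= 13 * D ^+ 2.
    by rewrite mulrDl -!exprMn E1; have : H ^+ 2 <= 4 * D ^+ 2; [nra|lra].
  rewrite -subr_ge0.
  have -> : 13 / h u * (q ^+ 2 + (t%:R - c) ^+ 2)^-1 - h u / D ^+ 2 =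
    (13 * D ^+ 2 - (q ^+ 2 + (t%:R - c) ^+ 2) * h u ^+ 2) / (h u * (q ^+ 2 + (t%:R - c) ^+ 2) * D ^+ 2).
    by move: P0; set P := _ + _ => P0; field; rewrite !gt_eqF.
  apply: divr_ge0; first by rewrite subr_ge0.
  apply: mulr_ge0; last exact: sqr_ge0.
  by apply: mulr_ge0; exact: ltW.
apply: le_trans (ler_sum _ key) _.
apply: le_trans (_ : \sum_(t < B) sq i.1 * sq u * (13 / h u * (q ^+ 2 + (t%:R - c) ^+ 2)^-1) <= _).
  rewrite big_mkcond /=; apply: ler_sum => t _; case: ifP => // _.
  by rewrite !mulr_ge0 ?sq_ge0 ?invr_ge0 ?addr_ge0 ?sqr_ge0 ?ler0n ?(ltW hu0).
rewrite -!mulr_sumr.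
have L := lattice_sum c B q1.
apply: le_trans (_ : sq i.1 * sq u * (13 / h u * (16 / q)) <= _).
  by rewrite ler_wpM2l ?mulr_ge0 ?sq_ge0 ?invr_ge0 ?ler0n ?(ltW hu0)// ler_wpM2l ?mulr_ge0 ?invr_ge0 ?ler0n ?(ltW hu0).
rewrite le_eqVlt; apply/orP; left; apply/eqP.
have H0 : 0 < H by apply: lt_le_trans Hu.
by rewrite /q; field; rewrite !gt_eqF.
Qed.

(** Within the level of i distinct points are [M2] strips apart, so every distance gains a factor
    [M2] and the sum a factor M2^-2; 128 is 8 times 16. *)
Lemma same_level i : i \in F ->
  \sum_(t < B | ((i.1, t) \in F) && (t != i.2)) beta i (i.1, t) <= 128 / M2%:R ^+ 2.
Proof.
move=> iF; have h0 := hf_gt0 (lev i.1).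
have M0 : (2 : R) <= M2%:R by rewrite ler_nat.
have key (t : 'I_B) : ((i.1, t) \in F) && (t != i.2) ->
    beta i (i.1, t) <= 8 / M2%:R ^+ 2 * (1 ^+ 2 + (t%:R - i.2%:R) ^+ 2)^-1.
  move=> /andP[jF ti]; have [a1 _ a3] := D_ge iF jF; rewrite /beta /= sq_sq.
  set D := normc _ in a1 a3 *.
  have /andP[y1 y2] := hY jF; have /andP[y3 y4] := hY iF; rewrite /= in y1 y2.
  have D0 : 0 < D by lra.
  pose s : R := t%:R - i.2%:R.
  have s1 : 1 <= `|s|.
    rewrite /s; have : (t : nat) != i.2 by apply: contraNneq ti => /val_inj ->.
    rewrite neq_ltn => /orP[lt|lt].
      by rewrite distrC -natrB ?ger0_norm ?ler0n ?ler1n ?subn_gt0// ltnW.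
    by rewrite -natrB ?ger0_norm ?ler0n ?ler1n ?subn_gt0// ltnW.
  have E : `|h i.1 * M2%:R * s - (Y (z (i.1, t)) - Y (z i))| <= h i.1.
    move: y1 y2 y3 y4; rewrite -![(b0 + _).+1%:R]natr1 !natrD !natrM /s ler_norml => y1 y2 y3 y4.
    by apply/andP; split; lra.
  have E2 : `|h i.1 * M2%:R * s| = h i.1 * M2%:R * `|s|.
    by rewrite normrM ger0_norm// mulr_ge0 ?(ltW h0).
  have low : h i.1 * M2%:R * `|s| <= 2 * D.
    have := ler_normD (h i.1 * M2%:R * s - (Y (z (i.1, t)) - Y (z i))) (Y (z (i.1, t)) - Y (z i)).
    rewrite subrK E2 => hh; have : 2 * h i.1 <= h i.1 * M2%:R * `|s|.
      rewrite -mulrA mulrC ler_wpM2l ?(ltW h0)//; nra.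
    by lra.
  have low2 : h i.1 ^+ 2 * M2%:R ^+ 2 * s ^+ 2 <= 4 * D ^+ 2.
    have -> : 4 * D ^+ 2 = (2 * D) ^+ 2 by rewrite exprMn; congr (_ * _); rewrite expr2; lra.
    rewrite -[s ^+ 2]real_normK ?num_real// -!exprMn lerXn2r ?nnegrE ?mulr_ge0 ?(ltW h0)//; lra.
  have s2 : 1 <= s ^+ 2 by rewrite -real_normK ?num_real// exprn_ege1.
  rewrite -/s expr1n -expr2 -subr_ge0.
  have -> : 8 / M2%:R ^+ 2 * (1 + s ^+ 2)^-1 - h i.1 ^+ 2 / D ^+ 2 =
    (8 * D ^+ 2 - h i.1 ^+ 2 * M2%:R ^+ 2 * (1 + s ^+ 2)) / (M2%:R ^+ 2 * (1 + s ^+ 2) * D ^+ 2).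
    have Mp : 0 < M2%:R :> R by apply: lt_le_trans M0.
    have Sp : 0 < 1 + s ^+ 2 by lra.
    by field; rewrite ?(gt_eqF Mp) ?(gt_eqF Sp) ?(gt_eqF D0).
  apply: divr_ge0; last first.
    by apply: mulr_ge0; [apply: mulr_ge0; [exact: sqr_ge0|lra]|exact: sqr_ge0].
  rewrite subr_ge0.
  have : h i.1 ^+ 2 * M2%:R ^+ 2 <= h i.1 ^+ 2 * M2%:R ^+ 2 * s ^+ 2.
    by rewrite ler_peMr// mulr_ge0 ?sqr_ge0.
  by rewrite mulrDr mulr1; lra.
apply: le_trans (ler_sum _ key) _.
apply: le_trans (_ : \sum_(t < B) 8 / M2%:R ^+ 2 * (1 ^+ 2 + (t%:R - i.2%:R) ^+ 2)^-1 <= _).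
  rewrite big_mkcond /=; apply: ler_sum => t _; case: ifP => // _.
  by rewrite !mulr_ge0 ?invr_ge0 ?addr_ge0 ?sqr_ge0 ?ler0n.
rewrite -mulr_sumr.
have L := lattice_sum (i.2%:R) B (lexx (1 : R)).
rewrite divr1 in L; apply: le_trans (ler_wpM2l _ L) _; first by rewrite mulr_ge0 ?invr_ge0 ?sqr_ge0.
by rewrite mulrAC ler_wpM2r ?invr_ge0 ?sqr_ge0//; lra.
Qed.

Lemma beta_row i : i \in F ->
  \sum_(j in F | j != i) beta i j <= 128 / M2%:R ^+ 2 + 832 * hf m.
Proof.
move=> iF; have b0' j : 0 <= beta i j.
  by rewrite /beta !mulr_ge0 ?sq_ge0 ?invr_ge0 ?sqr_ge0 ?(ltW (hf_gt0 _)).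
rewrite big_mkcond /=.
rewrite (eq_bigr (fun j => (fun u t => if ((u, t) \in F) && ((u, t) != i) then beta i (u, t) else 0) j.1 j.2)); last by case.
rewrite -(pair_bigA _ (fun u t => if ((u, t) \in F) && ((u, t) != i) then beta i (u, t) else 0)) /=.
rewrite (bigD1 i.1)//= lerD//.
  rewrite -big_mkcond /=; apply: le_trans (same_level iF).
  rewrite le_eqVlt; apply/orP; left; apply/eqP; apply: eq_bigl => t; congr (_ && _).
  by case: i {iF b0'} => a b /=; rewrite xpair_eqE eqxx.
apply: le_trans (_ : \sum_(u < U | u != i.1 :> nat) 208 * hf m ^+ (maxn u i.1 - minn u i.1) <= _).
  rewrite [leRHS](eq_bigl (fun u => u != i.1)) //; apply: ler_sum => u ui.
  apply: le_trans (far_level iF ui); rewrite [leRHS]big_mkcond; apply: ler_sum => t _.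
  by case: ifP => [/andP[->]//|_]; case: ifP.
rewrite -mulr_sumr; have e01 : 0 <= hf m <= 1 / 2.
  rewrite (ltW (hf_gt0 _)) /= -(subnKC m1) exprD expr1 mul1r ler_piMr ?invr_ge0 ?ler0n//.
  by rewrite exprn_ile1 ?invr_ge0 ?ler0n// invf_le1 ?ler1n.
by have := geo_dist_sum U i.1 e01; lra.
Qed.

End SparseRows.
End KernelEstimates.

(** * Decreasing rearrangements *)

Section Rearrangement.
Variable R : realType.

(** Every index is the half of exactly two integers. *)
Lemma sum_half (x : nat -> R) N : (forall j, 0 <= x j) -> {homo x : i j / (i <= j)%N >-> j <= i} ->
  \sum_(j < N) x j./2 <= 2 * \sum_(j < N) x j.
Proof.
move=> x0 xd.
have E M : \sum_(j < M.*2) x j./2 = 2 * \sum_(j < M) x j.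
  elim: M => [|M ih]; first by rewrite !big_ord0 mulr0.
  rewrite doubleS !big_ord_recr /= ih uphalf_double doubleK mulrDr; lra.
apply: (@le_trans _ _ (\sum_(j < N.*2) x j./2)).
  by rewrite -addnn big_split_ord /= lerDl sumr_ge0.
by rewrite E.
Qed.

Lemma le_powR (p a b : R) : 0 < p -> 0 <= a -> a <= b -> a `^ p <= b `^ p.
Proof.
move=> p0 a0 ab; apply: (ge0_ler_powR (ltW p0)) => //; rewrite nnegrE//.
exact: le_trans ab.
Qed.

(* [w] is sorted in nonincreasing order and compared termwise with [x]. *)
Lemma rearrangement (w : seq R) (x : nat -> R) (p : R) : 0 < p ->
  (forall a, a \in w -> 0 <= a) -> (forall j, 0 <= x j) ->
  {homo x : i j / (i <= j)%N >-> j <= i} ->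
  (forall tau r, 0 < tau -> (2 * r < count (>= tau) w)%N -> tau <= x r) ->
  \sum_(a <- w) a `^ p <= 2 * \sum_(j < size w) x j `^ p.
Proof.
move=> p0 w0 x0 xd H; pose v := sort >=%R w.
have vw : perm_eq v w by exact: permEl (perm_sort _ _).
have sv : sorted >=%R v by apply: sort_sorted => a b; exact: le_total.
rewrite -(perm_big _ vw) /= -(perm_size vw) (big_nth 0) big_mkord.
(* The first j + 1 sorted entries are at least [v]_j[, and j + 1 > 2 (j/2), so the counting
   hypothesis bounds]v[_j] by x at index j/2; the factor 2 comes from this halving. *)
apply: (@le_trans _ _ (\sum_(j < size v) x j./2 `^ p)); last first.
  apply: (@sum_half (fun j => x j `^ p)) => [j|i j ij]; first exact: powR_ge0.
  by apply: le_powR => //; exact: xd.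
apply: ler_sum => j _; have vj : v`_j \in w by rewrite -(perm_mem vw) mem_nth.
apply: le_powR => //; first exact: w0.
have [->//|vn] := eqVneq v`_j 0.
have vp : 0 < v`_j by rewrite lt_def vn w0.
apply: H => //; rewrite -(permP vw).
apply: (@leq_trans j.+1); first by rewrite ltnS mul2n; have := odd_double_half j; lia.
set P := (X in count X v).
have -> : count P v = (count P (take j.+1 v) + count P (drop j.+1 v))%N.
  by rewrite -count_cat cat_take_drop.
apply: leq_trans (leq_addr _ _).
have sz : size (take j.+1 v) = j.+1 by rewrite size_takel.
suff : all P (take j.+1 v) by rewrite all_count sz => /eqP ->.
apply/(all_nthP 0) => i; rewrite sz ltnS => ij; rewrite nth_take//.
have tr : transitive (>=%R : rel R) by move=> a b c ba cb; exact: le_trans cb ba.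
have jv : (j < size v)%N := ltn_ord j.
have iv : (i < size v)%N := leq_ltn_trans ij jv.
by have := sorted_leq_nth tr (@lexx _ R) 0 sv i j iv jv ij.
Qed.

End Rearrangement.

Lemma pred_addn n k : (0 < n)%N ->
  [/\ (n + k = (n + k).-1.+1)%N, ((n + k).-1 = k + n.-1)%N & ((n + k).-1 + 2 = (n + k).+1)%N].
Proof. by move=> n0; split; lia. Qed.

Lemma half_count a b : (2 * (a - b) <= a -> b <= a -> a <= 2 * b)%N.
Proof. lia. Qed.

Lemma half_ltn a b r : (2 * r < a -> a <= 2 * b -> r < b)%N.
Proof. lia. Qed.

Lemma sum_enum_sub (R : realType) (I : finType) (A A' : {set I}) (a : 'I_#|A|) (f : I -> R) :
  (forall i, 0 <= f i) -> A \subset A' ->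
  \sum_(b | b != a) f (enum_val b) <= \sum_(j in A' | j != enum_val a) f j.
Proof.
move=> f0 /fintype.subsetP AA'.
rewrite (eq_bigl (fun b => enum_val b != enum_val a)); last by move=> b; rewrite (inj_eq enum_val_inj).
rewrite -(big_enum_val_cond (fun j => j != enum_val a) f) big_mkcond [leRHS]big_mkcond.
by apply: ler_sum => j _ /=; case: ifP => [/andP[/AA' -> ->]//|_]; case: ifP.
Qed.

(** * Necessity: many large weights force a large singular value *)

Section NecessityCore.
Variable R : realType.
Local Notation C := R[i].
Variables (g : C -> C) (n k : nat) (S : (C -> C) -> (C -> C)) (s : nat -> R).
Local Notation T := (volterra g n k).
Local Notation H2 := (@hardy2 R).
Local Notation ip := (@hardy2_ip R).
Local Notation HS := (hardy2_ips R).
Local Notation hf v := ((2^-1 : R) ^+ v).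
Hypotheses (hg : holo g) (kn : (k < n)%N).
Hypotheses (Tc : compact_operator H2 ip T) (TS : adjoint_operator H2 ip T S).
Hypothesis (s_ge0 : forall j, 0 <= s j) (s_dec : {homo s : i j / (i <= j)%N >-> j <= i}).
Hypothesis s_dim : forall t : R, 0 < t -> exists2 d : nat,
  has_dimension (eigenspace_on H2 (S \o T) (t ^+ 2)%:C) d & ([set j | s j = t] #= `I_d)%card.

(** [Y] is a real coordinate separating the points of one level: it is cut into strips as wide as
    the height, of which one in [M2] is retained, while one level in 2 m is retained. *)
Definition sparse_family m M2 U B v0 b0 (F : {set 'I_U * 'I_B}) (z : 'I_U * 'I_B -> C) :=
  exists Y : C -> R, [/\ forall z w, `|Y z - Y w| <= normc (z - w),
    forall i, i \in F -> 1 - hf (lev v0 m i.1) <= normc (z i) < 1 - hf (lev v0 m i.1) / 2 &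
    forall i, i \in F -> hf (lev v0 m i.1) * (b0 + M2 * i.2)%:R <= Y (z i) + 1
      < hf (lev v0 m i.1) * (b0 + M2 * i.2).+1%:R].

(** The heights are at most 2 D, so n + k' - 1 of the powers of h cancel as many powers of D in the
    kernel bound, leaving the single h_j / D^2 of [beta]. *)
Lemma kernel_beta k' : (k' <= n)%N -> exists2 B : R, 0 < B &
  forall m M2 U B' v0 b0 (F : {set 'I_U * 'I_B'}) z, sparse_family m M2 v0 b0 F z ->
  forall i j, i \in F -> j \in F ->
    Num.sqrt (hf (lev v0 m i.1)) * hf (lev v0 m i.1) ^+ k' *
    (Num.sqrt (hf (lev v0 m j.1)) * hf (lev v0 m j.1) ^+ n) * normc (cderiv k' (hker n (z j)) (z i))
    <= B * beta v0 m z i j.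
Proof.
move=> kn'; have [B B0 HB] := @kernel_bound R n k' kn'.
exists (B * 2 ^+ (n + k').-1 + 1) => [|m M2 U B' v0 b0 F z [Y [Yl hz hY]] i j iF jF].
  by rewrite ltr_wpDl// mulr_ge0// exprn_ge0.
have [a1 a2 _] := D_ge Yl hz iF jF.
have z1 := zF1 hz iF; have z2 := zF1 hz jF.
have := HB _ _ z2 z1; rewrite /beta.
have := hf_gt0 R (lev v0 m i.1); have := hf_gt0 R (lev v0 m j.1).
set D := normc _ in a1 a2 *; set hi := hf _ in a1 *; set hj := hf _ in a2 *.
set K := normc _ => hj0 hi0 Kb.
have D0 : 0 < D by lra.
have s0 : 0 <= Num.sqrt hi * Num.sqrt hj by rewrite mulr_ge0 ?sqrtr_ge0.
apply: (@le_trans _ _ (Num.sqrt hi * Num.sqrt hj * (hi ^+ k' * hj ^+ n * K))).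
  by rewrite le_eqVlt; apply/orP; left; apply/eqP; ring.
rewrite [leRHS](_ : _ = Num.sqrt hi * Num.sqrt hj * ((B * 2 ^+ (n + k').-1 + 1) * (hj / D ^+ 2))); last by ring.
rewrite ler_wpM2l//.
have n0 : (0 < n)%N := leq_ltn_trans (leq0n k) kn.
have [n1 n2 n3] := pred_addn k' n0.
have p1 : hi ^+ k' * hj ^+ n.-1 <= (2 * D) ^+ (n + k').-1.
  rewrite n2 exprD ler_pM ?exprn_ge0 ?(ltW hi0) ?(ltW hj0)// lerXn2r ?nnegrE ?mulr_ge0 ?(ltW hi0) ?(ltW hj0) ?(ltW D0)//; lra.
have KD : K * D ^+ (n + k').-1 <= B / D ^+ 2.
  rewrite ler_pdivlMr ?exprn_gt0// -mulrA -exprD.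
  by rewrite n3.
have -> : hj ^+ n = hj * hj ^+ n.-1 by rewrite -exprS prednK.
apply: (@le_trans _ _ (hj * (K * (2 * D) ^+ (n + k').-1))).
  rewrite (_ : _ * K = hj * (K * (hi ^+ k' * hj ^+ n.-1))); last by ring.
  by rewrite ler_wpM2l ?(ltW hj0)// ler_wpM2l ?nc_ge0.
rewrite (_ : (_ + 1) * _ = hj * ((B * 2 ^+ (n + k').-1 + 1) / D ^+ 2)); last by ring.
rewrite ler_wpM2l ?(ltW hj0)// exprMn mulrCA.
apply: (@le_trans _ _ (2 ^+ (n + k').-1 * (B / D ^+ 2))); first by rewrite ler_wpM2l// exprn_ge0.
by rewrite mulrDl mulrA [2 ^+ _ * B]mulrC lerDl divr_ge0 ?sqr_ge0.
Qed.

Definition weight U B v0 m (z : 'I_U * 'I_B -> C) (i : 'I_U * 'I_B) : R :=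
  normc (cderiv (n - k) g (z i)) * hf (lev v0 m i.1) ^+ (n - k).

Lemma necessity_core : exists (m M2 : nat) (c : R), [/\ (1 <= m)%N, (2 <= M2)%N, 0 < c &
  forall U B v0 b0 (F : {set 'I_U * 'I_B}) z tau r, (1 <= v0)%N -> sparse_family m M2 v0 b0 F z ->
    0 < tau -> (forall i, i \in F -> tau <= weight v0 m z i) -> (2 * r < #|F|)%N -> c * tau <= s r].
Proof.
have [B1 B10 HB1] := kernel_beta (leqnn n).
have [B2 B20 HB2] := kernel_beta (ltnW kn).
pose k0 : R := hf n / 256; have k00 : 0 < k0 by rewrite divr_gt0 ?hf_gt0 ?ltr0n.
(* With m = Q + 1 and M2 = Q + 2 the row bound is at most 960 / Q, and 4 times 960 is below 4000. So
   4 dl <= k0, and a doubled column bound still leaves half of the diagonal. *)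
have [Q [Q0 QM]] : exists Q : nat, (0 < Q)%N /\ B2 * 4000 / k0 <= Q%:R.
  exists (Num.trunc (B2 * 4000 / k0)).+1; split=> //; apply/ltW.
  by rewrite truncnS_gt.
pose m := Q.+1; pose M2 := Q.+2.
pose dl : R := B2 * (128 / M2%:R ^+ 2 + 832 * hf m).
have Qp : (1 : R) <= Q%:R by rewrite ler1n.
have dk : 4 * dl <= k0.
  have h1 : 128 / M2%:R ^+ 2 <= 128 / Q%:R :> R.
    rewrite ler_wpM2l// lef_pV2 ?posrE ?exprn_gt0 ?ltr0n//.
    rewrite -natrX ler_nat -mulnn; apply: leq_trans (leq_pmulr _ (ltn0Sn _)).
    by rewrite /M2 -addn2 leq_addr.
  have h2 : hf m <= 1 / Q%:R :> R.
    rewrite exprVn mul1r lef_pV2 ?posrE ?exprn_gt0 ?ltr0n// -natrX ler_nat ltnW// /m.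
    by apply: ltn_trans (ltn_expl _ (ltnSn 1)).
  have h3 : B2 * 4000 <= Q%:R * k0 by rewrite -ler_pdivrMr.
  have h4 : dl <= B2 * (960 / Q%:R).
    rewrite ler_wpM2l ?(ltW B20)//; rewrite mul1r in h2; lra.
  apply: le_trans (_ : 4 * (B2 * (960 / Q%:R)) <= _); first by lra.
  rewrite !mulrA ler_pdivrMr ?ltr0n//; lra.
have E0 : 0 < 128 / M2%:R ^+ 2 + 832 * hf m :> R.
  apply: addr_gt0.
    by apply: divr_gt0; [rewrite ltr0n|apply: exprn_gt0; rewrite ltr0n].
  by apply: mulr_gt0; [rewrite ltr0n|exact: hf_gt0].
have dl0 : 0 < dl := mulr_gt0 B20 E0.
pose C1 : R := B1 * (4 + (128 / M2%:R ^+ 2 + 832 * hf m)).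
have four0 : (0 : R) < 4 by rewrite ltr0n.
have C10 : 0 < C1 := mulr_gt0 B10 (addr_gt0 four0 E0).
exists m, M2, (k0 / 2 / C1); split=> [//|//||]; first by apply: divr_gt0 => //; apply: divr_gt0.
move=> U B v0 b0 F z tau r v01 fam tau0 Gtau rF.
have [Y [Yl hz hY]] := fam.
pose h (i : 'I_U * 'I_B) : R := hf (lev v0 m i.1).
pose sq i := Num.sqrt (h i).
have z1 i : i \in F -> normc (z i) < 1 by exact: (zF1 hz).
have brow i : i \in F -> \sum_(j in F | j != i) beta v0 m z i j <= 128 / M2%:R ^+ 2 + 832 * hf m.
  by move=> iF; exact: (beta_row _ _ Yl hz hY iF).
pose kap i j := sq i * h i ^+ k * (sq j * h j ^+ n) * normc (cderiv k (hker n (z j)) (z i)).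
have h0 i : 0 <= h i by rewrite ltW// hf_gt0.
have kap0 i j : 0 <= kap i j.
  by rewrite /kap !mulr_ge0 ?nc_ge0 ?sqrtr_ge0 ?exprn_ge0.
have krow i : i \in F -> \sum_(j in F | j != i) kap i j <= dl.
  move=> iF; apply: le_trans (ler_wpM2l (ltW B20) (brow i iF)); rewrite mulr_sumr.
  by apply: ler_sum => j /andP[jF _]; exact: HB2 fam i j iF jF.
have kdiag i : i \in F -> k0 <= kap i i.
  move=> iF; have lv : (1 <= lev v0 m i.1)%N := leq_trans v01 (leq_addr _ _).
  have zi : 1 - hf (lev v0 m i.1) <= normc (z i) < 1.
    by have /andP[-> _] := hz i iF; rewrite z1.
  have := kernel_diag (ltnW kn) lv zi; rewrite -/k0 => /le_trans; apply.
  rewrite /kap le_eqVlt; apply/orP; left; apply/eqP.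
  have : sq i * sq i = h i by rewrite -expr2 sqr_sqrtr.
  rewrite -/(h i) => E; rewrite exprS exprD -E; ring.
(* Row sums at most dl bound the total mass by dl |F|; by Chebyshev at most half of the columns
   exceed twice that average. *)
pose F' := [set j in F | \sum_(i in F | i != j) kap i j <= 2 * dl].
have F'F j : j \in F' -> j \in F by rewrite inE => /andP[].
have cheb : (#|F| <= 2 * #|F'|)%N.
  have tot : \sum_(j in F) \sum_(i in F | i != j) kap i j <= dl * #|F|%:R.
    rewrite (exchange_big_dep (mem F)) /=; last by move=> i j _ /andP[].
    rewrite mulr_natr -sumr_const; apply: ler_sum => i iF.
    by apply: le_trans (krow i iF); rewrite le_eqVlt; apply/orP; left; apply/eqP; apply: eq_bigl => j; rewrite iF eq_sym.
  have low : 2 * dl * #|F :\: F'|%:R <= \sum_(j in F) \sum_(i in F | i != j) kap i j.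
    rewrite mulr_natr -sumr_const; apply: (@le_trans _ _ (\sum_(j in F :\: F') \sum_(i in F | i != j) kap i j)).
      by apply: ler_sum => j; rewrite !inE => /andP[+ jF]; rewrite jF /= -ltNge => /ltW.
    rewrite [leRHS](big_setID F') /= lerDr; apply: sumr_ge0 => j _; exact: sumr_ge0.
  have : 2 * #|F :\: F'|%:R <= #|F|%:R :> R.
    rewrite -(ler_pM2l dl0); apply: le_trans tot; apply: le_trans low; lra.
  rewrite -natrM ler_nat cardsD.
  have -> : F :&: F' = F' by apply/finset.setIidPr/fintype.subsetP => j /F'F.
  have le : (#|F'| <= #|F|)%N by apply/subset_leq_card/fintype.subsetP => j /F'F.
  by move=> /half_count; apply.
have rN : (r < #|F'|)%N := half_ltn rF cheb.
(* The factor h^(n + 1/2) normalises the kernels up to constants. *)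
pose l i := (sq i * h i ^+ n)%:C *: hker n (z i).
pose e (a : 'I_#|F'|) := enum_val a.
have eF' a : e a \in F' by exact: enum_valP.
have eF a : e a \in F by exact: F'F.
have hk i : i \in F -> H2 (hker n (z i)) by move=> iF; exact: hker_H2 (z1 i iF).
have hl a : H2 (l (e a)) by apply: (HZ HS); exact: hk.
have [c c0 cS] := adjoint_small_combination HS Tc TS s_dec s_dim (s_ge0 r) (lexx _) rN hl.
have ipl f a : H2 f -> ip f (l (e a)) = (sq (e a) * h (e a) ^+ n)%:C * cderiv n f (z (e a)).
  move=> hf'; by rewrite (ipZr HS _ (hk _ (eF a)) hf') conj_real (ip_hker n hf' (z1 _ (eF a))).
have dl' j i w : i \in F -> normc w < 1 -> cderiv j (l i) w = (sq i * h i ^+ n)%:C * cderiv j (hker n (z i)) w.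
  move=> iF w1; rewrite -(ip_hker j (HZ HS _ (hk i iF)) w1) (ipZl HS _ (hk i iF) (hker_H2 j w1)).
  by rewrite (ip_hker j (hk i iF) w1).
have nsq i : `|sq i * h i ^+ n| = sq i * h i ^+ n by rewrite ger0_norm// mulr_ge0 ?sqrtr_ge0 ?exprn_ge0.
have gram a : \sum_b normc (ip (l (e a)) (l (e b))) <= C1.
  have gb b : normc (ip (l (e a)) (l (e b))) <= B1 * beta v0 m z (e a) (e b).
    rewrite (ips_conj HS (hl b) (hl a)) nc_conj ipl// dl'//; last exact: z1.
    rewrite !ncM !nc_real !nsq mulrA; exact: HB1 fam (e a) (e b) (eF a) (eF b).
  apply: le_trans (ler_sum _ (fun b _ => gb b)) _; rewrite -mulr_sumr ler_wpM2l ?(ltW B10)//.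
  rewrite (bigD1 a)//= lerD//; first exact: (beta_diag Yl hz (eF a)).
  apply: le_trans (brow (e a) (eF a)).
  apply: (sum_enum_sub (A := F')) => [j|]; last by apply/fintype.subsetP.
  by rewrite /beta !mulr_ge0 ?sqrtr_ge0 ?invr_ge0 ?sqr_ge0 ?(ltW (hf_gt0 _ _)).
have F'sub : F' \subset F by apply/fintype.subsetP.
have XE a b : normc (ip (T (l (e b))) (l (e a))) = weight v0 m z (e a) * kap (e a) (e b).
  have hTb := op_H Tc.1 (hl b).
  rewrite ipl// (@cderiv_volterra_n R g n k hg _ _ (hardy2_holo (hl b)) (z1 _ (eF a))).
  rewrite dl'//; last exact: z1.
  rewrite !ncM !nc_real !nsq /weight /kap.
  have -> : h (e a) ^+ n = h (e a) ^+ k * h (e a) ^+ (n - k) by rewrite -exprD subnKC// ltnW.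
  by rewrite -/(h (e a)); ring.
have kr a : \sum_(b | b != a) kap (e a) (e b) <= 2 * dl.
  apply: le_trans (sum_enum_sub a (fun j => kap0 (e a) j) F'sub) _.
  by apply: le_trans (krow _ (eF a)) _; rewrite ler_peMl ?ler1n// ltW.
have kc b : \sum_(a | a != b) kap (e a) (e b) <= 2 * dl.
  apply: le_trans (sum_enum_sub b (fun i => kap0 i (e b)) F'sub) _.
  by have := eF' b; rewrite inE => /andP[].
have := riesz_test HS Tc.1 TS hl gram tau0 (s_ge0 r) k00 (ltW C10) (fun a => Gtau _ (eF a))
  (fun a b => kap0 (e a) (e b)) XE (fun a => kdiag _ (eF a)) kr kc c0 cS.
rewrite mulrAC ler_pdivrMr// => main; apply: le_trans main; rewrite ler_wpM2r ?(ltW tau0)//.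
rewrite -subr_ge0; have -> : k0 - 2 * dl - k0 / 2 = (k0 - 4 * dl) / 2 by field.
by apply: divr_ge0 => //; rewrite subr_ge0.
Qed.

End NecessityCore.

(** * Majorants of plane integrals *)

Section PlaneIntegrals.
Variable R : realType.
Local Notation mu := (@lebesgue_measure R \x @lebesgue_measure R)%E.

(** The integral of a nonnegative function is a supremum over the simple functions below it, and
    this set grows with the function; measurability does not enter. *)
Lemma integral_mono (d : measure_display) (T : measurableType d) (nu : {measure set T -> \bar R})
  (f h : T -> \bar R) : (forall x, 0 <= f x)%E -> (forall x, f x <= h x)%E ->
  (\int[nu]_x f x <= \int[nu]_x h x)%E.
Proof.
move=> f0 fh; have h0 x : (0 <= h x)%E := le_trans (f0 x) (fh x).
rewrite !ge0_integralTE//; apply: ge_ereal_sup => _ [u /= uf <-].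
by apply: ereal_sup_ubound; exists u => // x; exact: le_trans (uf x) (fh x).
Qed.

Definition square (a b r : R) : set (R * R) := `[a - r, a + r] `*` `[b - r, b + r].

Lemma measurable_square a b r : measurable (square a b r).
Proof. by apply: measurableX; exact: measurable_itv. Qed.

Lemma square_measure a b r : 0 <= r -> mu (square a b r) = ((2 * r) ^+ 2)%:E.
Proof.
move=> r0; rewrite product_measure1E; [|exact: measurable_itv|exact: measurable_itv].
have E (x : R) : lebesgue_measure `[x - r, x + r]%classic = (2 * r)%:E.
  rewrite lebesgue_measure_itv /= lte_fin; case: ltP => h.
    by rewrite -EFinB; congr _%:E; ring.
  by have -> : r = 0 by [lra]; rewrite mulr0.
by have := E a; have := E b; rewrite /= => -> ->; rewrite -EFinM expr2.
Qed.

Lemma integral_squares (I : Type) (s : seq I) (x y c r : I -> R) :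
  (forall q, 0 <= c q) -> (forall q, 0 <= r q) ->
  measurable_fun setT (fun w => (\sum_(q <- s) c q * \1_(square (x q) (y q) (r q)) w)%:E) /\
  (\int[mu]_w (\sum_(q <- s) c q * \1_(square (x q) (y q) (r q)) w)%:E)%E
    = (\sum_(q <- s) c q * (2 * r q) ^+ 2)%:E.
Proof.
move=> c0 r0.
have mt q : measurable_fun setT (fun w => c q * \1_(square (x q) (y q) (r q)) w : R).
  apply: measurable_funM; first exact: measurable_cst.
  exact: measurable_indic (measurable_square _ _ _).
split; first by apply/measurable_EFinP; apply: measurable_sum.
under eq_integral do rewrite -sumEFin.
have mt' q : measurable_fun setT (fun w => (c q * \1_(square (x q) (y q) (r q)) w)%:E).
  by apply/measurable_EFinP; exact: mt.
rewrite ge0_integral_sum//; last by move=> q w _; rewrite lee_fin mulr_ge0.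
rewrite -sumEFin; apply: eq_bigr => q _.
under eq_integral do rewrite EFinM.
have mi : measurable_fun setT (fun w => (\1_(square (x q) (y q) (r q)) w : R)%:E).
  by apply/measurable_EFinP; exact: measurable_indic (measurable_square _ _ _).
rewrite ge0_integralZl_EFin//.
rewrite integral_indic ?setIT//; last exact: measurable_square.
by rewrite [RHS]EFinM; congr (_ * _)%E; exact: square_measure.
Qed.

(** The integrand is dominated by a countable sum of multiples of indicators of squares; squares may
    overlap, since only an upper bound is sought. *)
Lemma majorant_integral (I : eqType) (Q : nat -> seq I) (x y c : nat -> I -> R) (r : nat -> R)
    (D : set (R * R)) (F : R * R -> \bar R) (A : R) :
  (forall w, D w -> 0 <= F w)%E ->
  (forall w, D w -> exists N q, [/\ q \in Q N, square (x N q) (y N q) (r N) w & (F w <= (c N q)%:E)%E]) ->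
  (forall N q, 0 <= c N q) -> (forall N, 0 <= r N) ->
  (forall K, \sum_(N < K) \sum_(q <- Q N) c N q * (2 * r N) ^+ 2 <= A) ->
  (\int[mu]_(w in D) F w < +oo)%E.
Proof.
move=> F0 Fc c0 r0 bound.
pose f N w : R := \sum_(q <- Q N) c N q * \1_(square (x N q) (y N q) (r N)) w.
have f0 N w : (0 <= (f N w)%:E)%E by rewrite lee_fin sumr_ge0// => q _; rewrite mulr_ge0.
have sq N := integral_squares (Q N) (x N) (y N) (c0 N) (fun=> r0 N).
have mf N : measurable_fun setT (fun w => (f N w)%:E) := (sq N).1.
have intf N : (\int[mu]_w (f N w)%:E)%E = (\sum_(q <- Q N) c N q * (2 * r N) ^+ 2)%:E := (sq N).2.
rewrite integral_mkcond.
apply: le_lt_trans (_ : (\int[mu]_w \sum_(0 <= N <oo) (f N w)%:E < +oo)%E).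
  apply: integral_mono => w; rewrite /patch; case: ifPn => //; rewrite ?inE => Dw.
  - exact: F0.
  - have [N [q [qQ wsq Fq]]] := Fc w Dw; apply: le_trans Fq _.
    apply: le_trans (_ : ((f N w)%:E <= _)%E).
      rewrite lee_fin /f (big_rem q)//= indicE mem_set// mulr1 lerDl.
      by apply: sumr_ge0 => i _; rewrite mulr_ge0.
    apply: le_trans (nneseries_lim_ge N.+1 (fun N' _ _ => f0 N' w)).
    by rewrite big_nat_recr//= leeDr// sume_ge0.
  - by apply: nneseries_ge0 => N _ _; exact: f0.
rewrite integral_nneseries//; under eq_eseriesr do rewrite intf.
apply/series_ltyP; last by exists A.
by move=> N; apply: sumr_ge0 => q _; rewrite mulr_ge0// sqr_ge0.
Qed.

Lemma sum_residues (f : nat -> R) d K : (0 < d)%N -> (forall j, 0 <= f j) ->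
  \sum_(j < K) f j <= \sum_(v < d) \sum_(u < K) f (v + d * u)%N.
Proof.
move=> d0 f0.
have E : \sum_(v < d) \sum_(u < K) f (v + d * u)%N = \sum_(j < K * d) f j.
  elim: K => [|K ih]; first by rewrite mul0n big_ord0 big1// => v _; rewrite big_ord0.
  rewrite mulSnr big_split_ord /= -ih -big_split /=; apply: eq_bigr => v _.
  by rewrite big_ord_recr /= addnC mulnC.
rewrite E -(subnKC (leq_pmulr K d0)) big_split_ord /= lerDl; exact: sumr_ge0.
Qed.

End PlaneIntegrals.

(** In the sector |y| <= x the ring keeps x above 1/3. The ring and the closeness of the y make x^2
    - x'^2 of order h, and division by x + x' >= 2/3 preserves this. *)
Lemma sector_diam (R : realType) (x y x' y' h : R) : 0 < h <= 1 / 2 -> 0 <= x -> 0 <= x' ->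
  `|y| <= x -> `|y'| <= x' -> (1 - h) ^+ 2 <= x ^+ 2 + y ^+ 2 <= (1 - h / 2) ^+ 2 ->
  (1 - h) ^+ 2 <= x' ^+ 2 + y' ^+ 2 <= (1 - h / 2) ^+ 2 -> `|y - y'| <= h -> x - x' <= 5 * h.
Proof.
move=> /andP[h0 h2] x0 x'0; rewrite !ler_norml => /andP[a1 a2] /andP[a3 a4] /andP[b1 b2] /andP[b3 b4] /andP[d1 d2].
have q (a b : R) : 0 <= a -> - a <= b -> b <= a -> (1 - h) ^+ 2 <= a ^+ 2 + b ^+ 2 -> 1 / 3 <= a.
  move=> a0 u1 u2 u3; rewrite leNgt; apply/negP => u4.
  by have : b ^+ 2 <= a ^+ 2; [nra|]; nra.
have x3 := q x y x0 a1 a2 b1; have x'3 := q x' y' x'0 a3 a4 b3.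
rewrite leNgt; apply/negP => far.
have y1 (a b : R) : a ^+ 2 + b ^+ 2 <= (1 - h / 2) ^+ 2 -> -1 <= b <= 1.
  by move=> u; apply/andP; split; nra.
have /andP[v1 v2] := y1 x y b2; have /andP[v3 v4] := y1 x' y' b4.
have p1 : (y' - y) * (y' + y) <= 2 * h by nra.
have p2 : 5 * h * (2 / 3) <= (x - x') * (x + x').
  by apply: ler_pM; [lra|lra|exact: ltW|lra].
by nra.
Qed.

(** * Necessity: from sparse sums to the Besov integral *)

Section NecessityBesov.
Variable R : realType.
Local Notation C := R[i].
Variables (g : C -> C) (n k : nat) (S : (C -> C) -> (C -> C)) (s : nat -> R).
Local Notation T := (volterra g n k).
Local Notation H2 := (@hardy2 R).
Local Notation ip := (@hardy2_ip R).
Local Notation hf v := ((2^-1 : R) ^+ v).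
Hypotheses (hga : analytic_disk g) (kn : (k < n)%N).
Hypotheses (Tc : compact_operator H2 ip T) (TS : adjoint_operator H2 ip T S).
Hypothesis (s_ge0 : forall j, 0 <= s j) (s_dec : {homo s : i j / (i <= j)%N >-> j <= i}).
Hypothesis s_dim : forall t : R, 0 < t -> exists2 d : nat,
  has_dimension (eigenspace_on H2 (S \o T) (t ^+ 2)%:C) d & ([set j | s j = t] #= `I_d)%card.
Variables (p A : R).
Hypothesis p0 : 0 < p.
Hypothesis sA : forall N, \sum_(j < N) s j `^ p <= A.

Let hg : holo g := analytic_holo hga.
Local Notation Gam := (cderiv (n - k) g).

(** Subfamilies of a sparse family are sparse, so the counting estimate holds for each superlevel
    set of the weights; this is the hypothesis of [rearrangement]. *)
Lemma sparse_sum : exists (m M2 : nat) (A1 : R), [/\ (1 <= m)%N, (2 <= M2)%N &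
  forall U B v0 b0 (F : {set 'I_U * 'I_B}) z, (1 <= v0)%N -> sparse_family m M2 v0 b0 F z ->
    \sum_(i in F) weight g n k v0 m z i `^ p <= A1].
Proof.
have [m [M2 [c [m1 M22 c0 H]]]] := necessity_core hg kn Tc TS s_ge0 s_dec s_dim.
exists m, M2, (2 * A / c `^ p); split=> // U B v0 b0 F z v01 fam.
pose wt i := weight g n k v0 m z i.
have w0 i : 0 <= wt i by rewrite /wt /weight mulr_ge0 ?nc_ge0 ?exprn_ge0 ?invr_ge0.
rewrite ler_pdivlMr ?powR_gt0// mulr_suml.
pose w := [seq c * wt i | i <- enum F].
have E : \sum_(i in F) weight g n k v0 m z i `^ p * c `^ p = \sum_(a <- w) a `^ p.
  by rewrite big_map big_enum; apply: eq_bigr => i _; rewrite powRM ?(ltW c0)// mulrC.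
rewrite E; apply: le_trans (rearrangement p0 _ s_ge0 s_dec _) _.
- by move=> a /mapP[i _ ->]; rewrite mulr_ge0 ?(ltW c0).
- move=> tau r tau0; rewrite count_map => lt.
  pose F' := [set i in F | tau <= c * wt i].
  have cF : count (preim (fun i => c * wt i) (>= tau)) (enum F) = #|F'|.
    by rewrite -sum1_count big_enum_cond sum1dep_card.
  rewrite cF in lt.
  have fam' : sparse_family m M2 v0 b0 F' z.
    have [Y [Y1 Y2 Y3]] := fam; exists Y; split=> // i; rewrite inE => /andP[iF _]; [exact: Y2|exact: Y3].
  have tc0 : 0 < tau / c by apply: divr_gt0.
  have := H U B v0 b0 F' z (tau / c) r v01 fam' tc0 _ lt.
  rewrite [c * _]mulrC divfK ?gt_eqF//; apply => i; rewrite inE => /andP[_ ti].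
  by rewrite ler_pdivrMr// mulrC.
- by rewrite ler_wpM2l.
Qed.

Definition Xc (q : bool * bool) (z : C) := if q.1 then complex.Re z else complex.Im z.
Definition Yc (q : bool * bool) (z : C) := if q.1 then complex.Im z else complex.Re z.

(** A dyadic ring cut by one of four sectors and by a strip. [q.1] tells which coordinate dominates
    in the sector and [q.2] gives its sign; the strip is taken in the other coordinate, which is the
    one playing the role of [Y]. *)
Definition cell (q : bool * bool) (N b : nat) : set C :=
  [set z | [/\ `|Yc q z| <= `|Xc q z|, (if q.2 then 0 <= Xc q z else Xc q z <= 0),
    1 - hf N.+1 <= normc z < 1 - hf N.+1 / 2 &
    hf N.+1 * b%:R <= Yc q z + 1 < hf N.+1 * b.+1%:R]].

Lemma Yc_lip q z w : `|Yc q z - Yc q w| <= normc (z - w).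
Proof.
by case: q => -[] b; rewrite /Yc /=; rewrite -?ReN -?ReD -?ImN -?ImD; [exact: nc_Im|exact: nc_Re].
Qed.

Lemma hf_half N : 0 < hf N.+1 <= 1 / 2.
Proof.
rewrite exprn_gt0 ?invr_gt0//= exprS mul1r ler_piMr ?invr_ge0//.
by rewrite exprn_ile1 ?invr_ge0// invf_le1// ler1n.
Qed.

Lemma cell_diam q N b z w : cell q N b z -> cell q N b w -> `|Xc q z - Xc q w| <= 5 * hf N.+1 /\
  `|Yc q z - Yc q w| <= 5 * hf N.+1.
Proof.
move=> [a1 a2 a3 a4] [b1 b2 b3 b4].
have hh := hf_half N; have /andP[h0 h2] := hh; move: hh h0 h2 a3 a4 b3 b4.
set h := hf N.+1 => hh h0 h2 /andP[a3 a3'] /andP[a4 a4'] /andP[b3 b3'] /andP[b4 b4'].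
have dy : `|Yc q z - Yc q w| <= h.
  rewrite -[b.+1%:R]natr1 in a4' b4'.
  by rewrite ler_norml; apply/andP; split; lra.
split; last by apply: le_trans dy _; lra.
have sq u : normc u ^+ 2 = `|Xc q u| ^+ 2 + (Yc q u) ^+ 2.
  rewrite real_normK ?num_real// nc_sq /Xc /Yc; case: (q.1) => //; exact: addrC.
have r u : 1 - h <= normc u -> normc u < 1 - h / 2 ->
    (1 - h) ^+ 2 <= `|Xc q u| ^+ 2 + (Yc q u) ^+ 2 <= (1 - h / 2) ^+ 2.
  move=> r1 r2; rewrite -sq; apply/andP; split; apply: lerXn2r; rewrite ?nnegrE ?nc_ge0 ?(ltW r2)//; lra.
have D1 := sector_diam hh (normr_ge0 _) (normr_ge0 _) a1 b1 (r z a3 a3') (r w b3 b3') dy.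
have dy' : `|Yc q w - Yc q z| <= h by rewrite distrC.
have D2 := sector_diam hh (normr_ge0 _) (normr_ge0 _) b1 a1 (r w b3 b3') (r z a3 a3') dy'.
move: a2 b2 D1 D2; case: (q.2) => a2 b2.
  by rewrite (ger0_norm a2) (ger0_norm b2) => D1 D2; rewrite ler_norml; apply/andP; split; lra.
by rewrite (ler0_norm a2) (ler0_norm b2) => D1 D2; rewrite ler_norml; apply/andP; split; lra.
Qed.

Lemma cell_cover z : 1 / 2 <= normc z < 1 -> exists N q b, (b < 2 ^ N.+2)%N /\ cell q N b z.
Proof.
move=> /andP[z2 z1].
have ex : exists v, normc z < 1 - hf v.+2.
  exists (Num.trunc (1 - normc z)^-1).
  have e0 : 0 < 1 - normc z by rewrite subr_gt0.
  rewrite ltrBrDr -ltrBrDl; set v := Num.trunc _.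
  have v1 : (1 - normc z)^-1 < v.+1%:R by exact: truncnS_gt.
  rewrite exprVn -[ltRHS]invrK ltf_pV2 ?posrE ?invr_gt0 ?exprn_gt0//.
  apply: lt_le_trans v1 _; rewrite -natrX ler_nat.
  by apply: leq_trans (ltnW (ltn_expl v.+1 (ltnSn 1))) _; rewrite leq_exp2l.
pose N := ex_minn ex; exists N.
have zN : 1 - hf N.+1 <= normc z < 1 - hf N.+1 / 2.
  rewrite /N; case: ex_minnP => v Pv minv; apply/andP; split; last first.
    by rewrite (_ : hf v.+1 / 2 = hf v.+2)// [RHS]exprSr.
  case: v Pv minv => [|v] Pv minv; first by rewrite expr1; lra.
  by rewrite leNgt; apply/negP => /minv; rewrite ltnn.
pose q1 : bool := `|complex.Im z| <= `|complex.Re z|.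
pose q2 : bool := 0 <= (if q1 then complex.Re z else complex.Im z).
exists (q1, q2); have /andP[h0 _] := hf_half N.
pose u := (Yc (q1, q2) z + 1) / hf N.+1.
have Y1 : `|Yc (q1, q2) z| <= normc z.
  by rewrite /Yc /=; case: ifP => _; [exact: nc_Im|exact: nc_Re].
have u0 : 0 <= u.
  rewrite divr_ge0 ?(ltW h0)//; move: Y1; rewrite ler_norml => /andP[c1 c2]; lra.
exists (Num.trunc u); have /andP[t1 t2] := truncn_itv u0; split.
  rewrite -(ltr_nat R); apply: le_lt_trans t1 _; rewrite ltr_pdivrMr//.
  have -> : (2 ^ N.+2)%:R * hf N.+1 = 2.
    by rewrite natrX exprS -mulrA -exprMn mulfV ?expr1n ?mulr1// pnatr_eq0.
  by move: Y1; rewrite ler_norml => /andP[c1 c2]; lra.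
split=> //.
- rewrite /Yc /Xc /= /q1; case: ifPn => //; rewrite -ltNge => /ltW//.
- by rewrite /Xc /= /q2; case: ifPn => //; rewrite -ltNge => /ltW.
- by rewrite mulrC -ler_pdivlMr// t1 mulrC -ltr_pdivrMr.
Qed.

(** The supremum need not be attained on [E]; a point with at least half of it always exists. *)
Lemma near_max (E : set C) (B : R) : (exists z, E z) -> (forall z, E z -> normc (Gam z) <= B) ->
  exists2 z, E z & forall w, E w -> normc (Gam w) <= 2 * normc (Gam z).
Proof.
move=> [z0 Ez0] HB; pose V := [set normc (Gam z) | z in E].
have hs : has_sup V.
  by split; [exists (normc (Gam z0)), z0|exists B => _ [z Ez <-]; exact: HB].
have ub w : E w -> normc (Gam w) <= sup V by move=> Ew; apply: sup_ubound; [exact: hs.2|exists w].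
have [s0|s0] := leP (sup V) 0.
  by exists z0 => // w /ub h; have := nc_ge0 (Gam z0); lra.
have e0 : 0 < sup V / 2 by apply: divr_gt0.
have [_ [z Ez <-] hz] := sup_adherent e0 hs.
by exists z => // w /ub h; lra.
Qed.

Lemma cell_center : exists zc : (bool * bool) -> nat -> nat -> C, forall q N b,
  (exists z, cell q N b z) -> cell q N b (zc q N b) /\
    forall w, cell q N b w -> normc (Gam w) <= 2 * normc (Gam (zc q N b)).
Proof.
have H (i : (bool * bool) * nat * nat) : exists z, (exists z, cell i.1.1 i.1.2 i.2 z) ->
    cell i.1.1 i.1.2 i.2 z /\ forall w, cell i.1.1 i.1.2 i.2 w -> normc (Gam w) <= 2 * normc (Gam z).
  case: i => -[q N] b /=; have [ne|ne] := pselect (exists z, cell q N b z); last by exists 0.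
  have /andP[h0 _] := hf_half N.
  have r1 : 1 - hf N.+1 / 2 < 1 by lra.
  have hG : holo Gam by exact: holo_holo hg.
  have [B HB] := cont_disk_bounded (holo_cont hG) r1.
  have [z zE zM] := near_max ne (fun z (Ez : cell q N b z) => HB z (ltW (elimTF andP (let: And4 _ _ h _ := Ez in h)).2)).
  by exists z.
have [f Hf] := choice H; exists (fun q N b => f (q, N, b)) => q N b; exact: (Hf (q, N, b)).
Qed.

Lemma necessity_besov : besov p (n - k) g.
Proof.
split=> //; rewrite /disk_integral.
apply: lte_mul_pinfty => //; first by rewrite lee_fin invr_ge0 pi_ge0.
have [zc Hzc] := cell_center.
have [m [M2 [A1 [m1 M22 HA1]]]] := sparse_sum.
have hG : holo Gam by exact: holo_holo hg.
have h21 : 1 / 2 < 1 :> R by lra.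
have [B HB] := cont_disk_bounded (holo_cont hG) h21.
have B0 : 0 <= B by apply: le_trans (HB 0 _); rewrite ?nc_ge0 ?nc0.
pose ne q N b : bool := `[< exists z, cell q N b z >].
pose W q N b := normc (Gam (zc q N b)) * hf N.+1 ^+ (n - k).
have W0 q N b : 0 <= W q N b by rewrite mulr_ge0 ?nc_ge0 ?exprn_ge0 ?invr_ge0.
pose Wp q N b := if ne q N b then W q N b `^ p else 0.
have Wp0 q N b : 0 <= Wp q N b by rewrite /Wp; case: ifP => // _; exact: powR_ge0.
(* Block 0 is a single square covering the disk of radius 1/2, where the integrand is bounded; block
   N' + 1 lists the cells of level N'. *)
pose Q N := if N is N'.+1 then [seq (q, b) | q <- enum {: bool * bool}, b <- iota 0 (2 ^ N'.+2)]
  else [:: ((true, true), 0%N)].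
pose c0 := 4 * 2 `^ p : R.
have c00 : 0 <= c0 by rewrite mulr_ge0 ?powR_ge0.
pose c N (i : bool * bool * nat) := if N is N'.+1 then c0 * Wp i.1 N' i.2 / hf N'.+1 ^+ 2 else 4 * B `^ p.
pose x N (i : bool * bool * nat) := if N is N'.+1 then complex.Re (zc i.1 N' i.2) else 0.
pose y N (i : bool * bool * nat) := if N is N'.+1 then complex.Im (zc i.1 N' i.2) else 0.
pose r N := if N is N'.+1 then 5 * hf N'.+1 else 1.
(* On a cell 1 - |z| lies between b/2 and b, so the positive power is taken at b and the negative
   one at b/2, whence the factor 4. *)
have PsiE (z : C) (a b : R) : 0 <= a -> 0 < b <= 1 -> normc (Gam z) <= a -> b / 2 <= 1 - normc z <= b ->
    normc (Gam z) `^ p * (1 - normc z) `^ ((n - k)%:R * p) / (1 - normc z) ^+ 2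
      <= (a * b ^+ (n - k)) `^ p * 4 / b ^+ 2.
  move=> a0 /andP[b0 b1] za /andP[d1 d2]; set d := 1 - normc z in d1 d2 *.
  have d0 : 0 < d by lra.
  rewrite powRrM powR_mulrn ?(ltW d0)// -powRM ?nc_ge0 ?exprn_ge0 ?(ltW d0)// -mulrA.
  apply: ler_pM; rewrite ?powR_ge0 ?invr_ge0 ?sqr_ge0//.
    apply: (le_powR p0); first by rewrite mulr_ge0 ?nc_ge0 ?exprn_ge0 ?(ltW d0).
    by apply: ler_pM; rewrite ?nc_ge0 ?exprn_ge0 ?(ltW d0)//; apply: lerXn2r; rewrite ?nnegrE ?(ltW d0) ?(ltW b0).
  rewrite -[d ^- 2]mul1r ler_pdivrMr ?exprn_gt0// mulrAC ler_pdivlMr ?exprn_gt0//; nra.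
apply: (@majorant_integral R _ Q x y c r _ _ (16 * B `^ p + 100 * c0 * (4 * ((2 * m)%:R * (M2%:R * A1))))).
- move=> w _; rewrite lee_fin !mulr_ge0 ?powR_ge0 ?invr_ge0 ?sqr_ge0//.
- move=> [a b]; rewrite /unit_disk /=; set z := a +i* b => z1.
  have [z2|z2] := ltP (normc z) (1 / 2).
    exists 0%N, ((true, true), 0%N); split; first by rewrite inE.
      have := nc_Re z; have := nc_Im z; rewrite /= !ler_norml => /andP[u1 u2] /andP[u3 u4].
      by split; rewrite /= in_itv /=; apply/andP; split; lra.
    rewrite lee_fin; have := PsiE z B 1 B0 _ (HB z (ltW z2)) _.
    rewrite expr1n mulr1 expr1n divr1 [_ * 4]mulrC; apply; apply/andP; split=> //; have := nc_ge0 z; lra.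
  have [|N [q [bb [bbN zC]]]] := @cell_cover z; first by rewrite z2.
  have nez : exists z, cell q N bb z by exists z.
  have [cz cm] := Hzc q N bb nez.
  exists N.+1, (q, bb); split.
  - by apply/allpairsP; exists (q, bb); split; rewrite ?mem_enum ?mem_iota.
  - have [X1 Y1] := cell_diam zC cz.
    have [R1 I1] : `|complex.Re z - complex.Re (zc q N bb)| <= 5 * hf N.+1 /\
        `|complex.Im z - complex.Im (zc q N bb)| <= 5 * hf N.+1.
      by move: X1 Y1; rewrite /Xc /Yc; case: (q.1).
    move: R1 I1; rewrite /= !ler_norml => /andP[u1 u2] /andP[u3 u4].
    by split; rewrite /= in_itv /=; apply/andP; split; lra.
  - rewrite lee_fin /c /= /Wp /ne asboolT//.
    have /andP[h0 h2] := hf_half N; have [_ _ /andP[l1 l2] _] := zC.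
    have a0 : 0 <= 2 * normc (Gam (zc q N bb)) by rewrite mulr_ge0 ?nc_ge0.
    have b01 : 0 < hf N.+1 <= 1 by apply/andP; split=> //; lra.
    have d1 : hf N.+1 / 2 <= 1 - normc z <= hf N.+1 by apply/andP; split; lra.
    have H := PsiE z _ _ a0 b01 (cm z zC) d1.
    apply: le_trans H _; have -> : 2 * normc (Gam (zc q N bb)) * hf N.+1 ^+ (n - k) = 2 * W q N bb.
      by rewrite /W mulrA.
    rewrite powRM//.
    by rewrite le_eqVlt; apply/orP; left; apply/eqP; rewrite /c0; ring.
- case=> [|N] i /=; first by rewrite mulr_ge0 ?powR_ge0.
  by rewrite mulr_ge0 ?invr_ge0 ?sqr_ge0// mulr_ge0.
- by case=> [//|N] /=; rewrite mulr_ge0 ?exprn_ge0 ?invr_ge0.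
move=> K; apply: (@le_trans _ _ (\sum_(N < K.+1) \sum_(q <- Q N) c N q * (2 * r N) ^+ 2)).
  rewrite [leRHS]big_ord_recr /= lerDl; apply: sumr_ge0 => i _; rewrite mulr_ge0 ?sqr_ge0//.
  by case: (K) => [|N] /=; rewrite ?mulr_ge0 ?powR_ge0 ?invr_ge0 ?sqr_ge0.
rewrite big_ord_recl /= big_seq1 lerD//.
  by rewrite mulr1 le_eqVlt; apply/orP; left; apply/eqP; rewrite /c expr2; ring.
have E (N : 'I_K) : \sum_(q <- Q N.+1) c N.+1 q * (2 * r N.+1) ^+ 2 =
    100 * c0 * \sum_(q : bool * bool) \sum_(b < 2 ^ N.+2) Wp q N b.
  rewrite mulr_sumr /Q big_allpairs big_enum /=; apply: eq_bigr => q _.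
  have -> : iota 0 (2 ^ N.+2) = index_iota 0 (2 ^ N.+2) by rewrite /index_iota subn0.
  rewrite big_mkord mulr_sumr.
  apply: eq_bigr => b _ /=; have /andP[h0 _] := hf_half N.
  move: h0; set h := hf N.+1 => h0; field; by rewrite gt_eqF.
rewrite [leLHS](eq_bigr _ (fun N _ => E N)).
rewrite -mulr_sumr ler_wpM2l//; first by rewrite mulr_ge0.
rewrite exchange_big /=.
apply: (@le_trans _ _ (\sum_(q : bool * bool) ((2 * m)%:R * (M2%:R * A1)))); last first.
  by rewrite sumr_const card_prod card_bool -[leLHS]mulr_natl; exact: lexx.
apply: ler_sum => q _; pose BB := (2 ^ K.+2)%N.
apply: (@le_trans _ _ (\sum_(N < K) \sum_(b < BB) Wp q N b)).
  apply: ler_sum => N _; have le : (2 ^ N.+2 <= BB)%N by rewrite leq_exp2l// !ltnS ltnW.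
  by rewrite -(subnKC le) [leRHS]big_split_ord /= lerDl sumr_ge0.
(* Levels are split modulo 2 m and strips modulo [M2]; each pair of residues in each sector is one
   sparse family, with a bound independent of the truncation [K]. *)
have d0 : (0 < 2 * m)%N by rewrite muln_gt0.
have M0 : (0 < M2)%N := ltnW M22.
apply: le_trans (@sum_residues R (fun N => \sum_(b < BB) Wp q N b) (2 * m) K d0 _) _.
  by move=> N; exact: sumr_ge0.
rewrite mulr_natl -[X in _ *+ X]card_ord -sumr_const; apply: ler_sum => v _.
apply: (@le_trans _ _ (\sum_(u < K) \sum_(b0 < M2) \sum_(t < BB) Wp q (v + 2 * m * u)%N (b0 + M2 * t)%N)).
  by apply: ler_sum => u _; exact: sum_residues.
rewrite exchange_big /= mulr_natl -[X in _ *+ X]card_ord -sumr_const; apply: ler_sum => b0 _.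
pose F : {set 'I_K * 'I_BB} := finset (fun i : 'I_K * 'I_BB => ne q (v + 2 * m * i.1)%N (b0 + M2 * i.2)%N).
pose z (i : 'I_K * 'I_BB) := zc q (v + 2 * m * i.1)%N (b0 + M2 * i.2)%N.
have hz i : i \in F -> cell q (v + 2 * m * i.1) (b0 + M2 * i.2) (z i).
  by rewrite inE => /asboolP /Hzc[].
(* The base level is v + 1 because cells of level N have height 2^-(N+1); it is thereby at least 1,
   as required. *)
have fam : sparse_family m M2 v.+1 b0 F z.
  exists (Yc q); split; first exact: Yc_lip.
    by move=> i /hz[].
  by move=> i /hz[].
have H1 := HA1 K BB v.+1 b0 F z (ltn0Sn v) fam; apply: le_trans H1.
rewrite pair_bigA /= [leRHS]big_mkcond le_eqVlt; apply/orP; left; apply/eqP; apply: eq_bigr => i _.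
by rewrite /Wp [in RHS]inE.
Qed.

End NecessityBesov.

(** * Bessel inequalities and orthogonalisation *)

Section FiniteFrames.
Variables (R : realType) (V : lmodType R[i]) (H : set V) (ip : V -> V -> R[i]).
Local Notation C := R[i].
Hypothesis HS : inner_product_space H ip.
Local Notation nrm := (ipnorm ip).

(** Dual to [bessel_synthesis]: f is tested against the sum of <f, v_a> v_a, whose inner product
    with f is the left-hand side. *)
Lemma bessel_analysis (I : finType) (v : I -> V) (C1 : R) : 0 <= C1 -> (forall a, H (v a)) ->
  (forall a, \sum_b normc (ip (v a) (v b)) <= C1) ->
  forall f, H f -> \sum_a normc (ip f (v a)) ^+ 2 <= C1 * nrm f ^+ 2.
Proof.
move=> C10 hv gram f hf.
pose l (a : 'I_#|I|) := v (enum_val a).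
have hl a : H (l a) by exact: hv.
have reid (F : I -> R) : \sum_a F a = \sum_(a : 'I_#|I|) F (enum_val a).
  by rewrite (reindex _ (onW_bij _ (@enum_val_bij I))).
have gl a : \sum_b normc (ip (l a) (l b)) <= C1 by rewrite -(reid (fun b => normc (ip (l a) (v b)))); exact: gram.
rewrite reid; pose c a := ip f (l a); pose P := \sum_a normc (c a) ^+ 2.
rewrite -/P; set w := \sum_a c a *: l a.
have hw : H w by apply: (Hsum HS) => a; exact: (HZ HS).
have E : ip f w = P%:C.
  rewrite (ip_sumr HS) => [|a|//]; last exact: (HZ HS).
  rewrite rmorph_sum; apply: eq_bigr => a _.
  by rewrite (ipZr HS _ (hl a) hf) mulJc.
have P0 : 0 <= P by apply: sumr_ge0 => a _; exact: sqr_ge0.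
have := ip_CS HS hf hw; rewrite E nc_real ger0_norm// => h1.
have h2 := bessel_synthesis HS hl gl c; rewrite -/w -/P in h2.
have h3 : P ^+ 2 <= C1 * nrm f ^+ 2 * P.
  apply: le_trans (_ : (nrm f * nrm w) ^+ 2 <= _).
    by apply: lerXn2r; rewrite ?nnegrE ?mulr_ge0 ?nrm_ge0.
  have -> : C1 * nrm f ^+ 2 * P = nrm f ^+ 2 * (C1 * P) by ring.
  by rewrite exprMn ler_wpM2l ?sqr_ge0.
have [P1|P1] := eqVneq P 0; first by rewrite P1 mulr_ge0 ?sqr_ge0.
have Pp : 0 < P by rewrite lt_def P1.
by rewrite expr2 ler_pM2r in h3.
Qed.

Definition deflate (es : seq V) f := f - \sum_(e <- es) ip f e *: e.

(** Serves to turn a bound valid on the orthogonal complement of finitely many vectors into a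
    decomposition of an arbitrary vector. *)
Lemma gram_schmidt (vs : seq V) : (forall v, v \in vs -> H v) ->
  exists es : seq V, [/\ forall e, e \in es -> H e,
    forall f e, H f -> e \in es -> ip (deflate es f) e = 0
    & forall f v, H f -> v \in vs -> ip (deflate es f) v = 0].
Proof.
elim: vs => [|v vs ih] hvs; first by exists [::].
have [u uv|es [hes ortho kill]] := ih; first by apply: hvs; rewrite inE uv orbT.
have hv : H v by apply: hvs; rewrite inE eqxx.
have hsm f (e : V) : H f -> e \in es -> H (ip f e *: e) by move=> _ /hes; exact: (HZ HS).
have hsum f : H f -> H (\sum_(e <- es) ip f e *: e).
  by move=> hf; rewrite big_seq; elim/big_ind: _ => [|a b|e]; [exact: ips_0 HS|exact: (HD HS)|exact: hsm].
have hP f : H f -> H (deflate es f) by move=> hf; apply: (HB HS) => //; exact: hsum.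
have ipsum f u : H f -> H u -> ip (\sum_(e <- es) ip f e *: e) u = \sum_(e <- es) ip f e * ip e u.
  move=> hf hu; clear -HS hes hf hu; elim: es hes => [|e es ih] hes.
    by rewrite !big_nil (ip0l HS).
  have he : H e by apply: hes; rewrite inE eqxx.
  have hes' x : x \in es -> H x by move=> xe; apply: hes; rewrite inE xe orbT.
  have hs : H (\sum_(e <- es) ip f e *: e).
    rewrite big_seq; elim/big_ind: _ => [|a b|x xs]; [exact: ips_0 HS|exact: (HD HS)|exact/(HZ HS)/hes'].
  by rewrite !big_cons (ipDl HS (HZ HS _ he) hs hu) (ipZl HS _ he hu) ih.
have sym f u : H f -> H u -> ip (deflate es f) u = ip f (deflate es u).
  move=> hf hu; rewrite (ipBl HS hf (hsum _ hf) hu) (ipsum _ _ hf hu).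
  rewrite (ips_conj HS (hP _ hu) hf) (ipBl HS hu (hsum _ hu) hf) (ipsum _ _ hu hf) rmorphB /=.
  rewrite -(ips_conj HS hu hf) rmorph_sum; congr (_ - _); apply: eq_big_seq => e ee.
  by rewrite rmorphM /= -(ips_conj HS hu (hes _ ee)) -(ips_conj HS (hes _ ee) hf) mulrC.
set v' := deflate es v; have hv' : H v' := hP _ hv.
(* If [v] already lies in the span, its deflation is zero and nothing is added. *)
have [z|nz] := eqVneq (nrm v') 0.
  exists es; split=> // f u hf; rewrite inE => /orP[/eqP->|]; last exact: kill.
  by rewrite (sym _ _ hf hv) -/v' (nrm_eq0 HS hv' z) (ips_conj HS (ips_0 HS) hf) (ip0l HS hf) conjC0.
pose e' := (nrm v')^-1%:C *: v'; have he' : H e' by exact: (HZ HS).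
exists (e' :: es).
have dE f : deflate (e' :: es) f = deflate es f - ip f e' *: e'.
  by rewrite /deflate big_cons [X in _ - X]addrC opprD addrA.
have e'e e : e \in es -> ip e' e = 0.
  by move=> ee; rewrite (ipZl HS _ hv' (hes _ ee)) (ortho _ _ hv ee) mulr0.
have Pe' : deflate es e' = e'.
  rewrite /deflate big1_seq ?subr0// => e /andP[_ ee]; by rewrite e'e// scale0r.
have v'v : ip v' v = (nrm v' ^+ 2)%:C.
  have vE : v = v' + \sum_(e <- es) ip v e *: e by rewrite /v' /deflate subrK.
  rewrite [X in ip _ X]vE -(ip_self HS hv').
  rewrite (ips_conj HS (HD HS hv' (hsum _ hv)) hv') (ipDl HS hv' (hsum _ hv) hv') (ipsum _ _ hv hv').
  rewrite big1_seq ?addr0 -?(ips_conj HS hv' hv')//.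
  by move=> e /andP[_ ee]; rewrite (ips_conj HS hv' (hes _ ee)) (ortho _ _ hv ee) conjC0 mulr0.
have nC : (nrm v')%:C != 0 :> C by apply: contraNneq nz => /eqP; rewrite -(rmorph0 (real_complex R)) => /eqP/complexI ->.
have e'e' : ip e' e' = 1.
  rewrite (ipZl HS _ hv' he') (ips_conj HS he' hv') (ipZl HS _ hv' hv') (ip_self HS hv').
  rewrite rmorphM /= !conj_real rmorphXn /= fmorphV; by field.
have ipB f u : H f -> H u -> ip (deflate (e' :: es) f) u = ip (deflate es f) u - ip f e' * ip e' u.
  by move=> hf hu; rewrite dE (ipBl HS (hP _ hf) (HZ HS _ he') hu) (ipZl HS _ he' hu).
split.
- by move=> e; rewrite inE => /orP[/eqP->//|]; exact: hes.
- move=> f e hf; rewrite inE => /orP[/eqP->|ee].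
    by rewrite (ipB _ _ hf he') e'e' mulr1 (sym _ _ hf he') Pe' subrr.
  by rewrite (ipB _ _ hf (hes _ ee)) (ortho _ _ hf ee) e'e// mulr0 subrr.
- move=> f u hf; rewrite inE => /orP[/eqP->|uv]; last first.
    have hu : H u by apply: hvs; rewrite inE uv orbT.
    by rewrite (ipB _ _ hf hu) (kill _ _ hf uv) (ipZl HS _ hv' hu) (kill _ _ hv uv) !mulr0 subrr.
  rewrite (ipB _ _ hf hv) (sym _ _ hf hv) -/v' (ipZl HS _ hv' hv) v'v.
  rewrite (ipZr HS _ hv' hf) conj_real rmorphXn /= fmorphV; apply/eqP; rewrite subr_eq0; apply/eqP; by field.
Qed.

Lemma gram_schmidt_family m (v : 'I_m -> V) : (forall i, H (v i)) ->
  exists m' (e : 'I_m' -> V), (forall i, H (e i)) /\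
    forall f, H f -> forall i, ip (f - \sum_j ip f (e j) *: e j) (v i) = 0.
Proof.
move=> hv; have [|es [hes _ kill]] := @gram_schmidt [seq v i | i <- enum 'I_m].
  by move=> u /mapP[i _ ->].
exists (size es), (fun i => es`_i); split=> [i|f hf i]; first by apply: hes; exact: mem_nth.
have := kill f (v i) hf (map_f _ (mem_enum _ i)).
by rewrite /deflate (big_nth 0) big_mkord.
Qed.

Lemma nrm_sum_family (m : nat) (x : 'I_m -> V) : (forall i, H (x i)) -> nrm (\sum_i x i) <= \sum_i nrm (x i).
Proof.
move=> hx; suff [] : H (\sum_i x i) /\ nrm (\sum_i x i) <= \sum_i nrm (x i) by [].
elim/big_ind2: _ => [|a b c d [h1 h2] [h3 h4]|i _]; first by rewrite (nrm0 HS); split=> //; exact: ips_0 HS.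
  split; first exact: (HD HS).
  by apply: le_trans (nrmD HS h1 h3) _; exact: lerD.
by split.
Qed.

End FiniteFrames.

(** * Compactness and adjoints on the Hardy space *)

Section HardyOperators.
Variable R : realType.
Local Notation C := R[i].
Local Notation H2 := (@hardy2 R).
Local Notation ip := (@hardy2_ip R).
Local Notation nrm := (ipnorm ip).
Local Notation HS := (hardy2_ips R).
Local Notation tc := (@taylor_coef R).
Implicit Types f h : C -> C.

Definition trunc N f : C -> C := pfun (fun j => if (j < N)%N then tc f j else 0).

Lemma nrm_sum_ge f N : H2 f -> \sum_(j < N) normc (tc f j) ^+ 2 <= nrm f ^+ 2.
Proof. by move=> hf; rewrite (nrm_sq HS hf); exact: ip_sq_ge. Qed.

Lemma nrm_sum_le f (B : R) : H2 f -> (forall N, \sum_(j < N) normc (tc f j) ^+ 2 <= B) -> nrm f ^+ 2 <= B.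
Proof. by move=> hf hB; rewrite (nrm_sq HS hf); exact: ip_sq_le. Qed.

Lemma sum_if_le (x : nat -> R) N K : (forall j, 0 <= x j) ->
  \sum_(j < K) (if (j < N)%N then x j else 0) <= \sum_(j < N) x j.
Proof.
move=> x0; rewrite -big_mkcond /=; have [KN|/ltnW NK] := leqP K N.
  rewrite (eq_bigl xpredT) => [|j]; last by rewrite (leq_trans (ltn_ord j)).
  by rewrite -(subnKC KN) [leRHS]big_split_ord /= lerDl sumr_ge0.
by rewrite -(big_ord_widen K x NK).
Qed.

Lemma finite_coef (c : nat -> C) N :
  H2 (pfun (fun j => if (j < N)%N then c j else 0)) /\
  forall j, tc (pfun (fun j => if (j < N)%N then c j else 0)) j = if (j < N)%N then c j else 0.
Proof.
have B K : \sum_(j < K) normc (if (j < N)%N then c j else 0) ^+ 2 <= \sum_(j < N) normc (c j) ^+ 2.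
  rewrite (eq_bigr (fun j : 'I_K => if (j < N)%N then normc (c j) ^+ 2 else 0)).
    by apply: (@sum_if_le (fun j => normc (c j) ^+ 2)) => j; exact: sqr_ge0.
  by move=> j _; case: ifP => // _; rewrite nc0 expr0n.
by have [a b _] := @hardy2_pfun R (fun j => if (j < N)%N then c j else 0) _ B.
Qed.

Lemma trunc_H2 N f : H2 (trunc N f) /\ forall j, tc (trunc N f) j = if (j < N)%N then tc f j else 0.
Proof. exact: finite_coef. Qed.

Lemma tcB f h j : H2 f -> H2 h -> tc (f - h) j = tc f j - tc h j.
Proof.
move=> hf hh; have := tc_lin (-1) j hh hf.
by rewrite scaleN1r mulN1r addrC [in RHS]addrC.
Qed.

Lemma trunc_cvg f (e : R) : H2 f -> 0 < e -> exists N0, forall N, (N0 <= N)%N -> nrm (f - trunc N f) <= e.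
Proof.
move=> hf e0; have e2 : 0 < e ^+ 2 by rewrite exprn_gt0.
pose V := [set \sum_(j < N) normc (tc f j) ^+ 2 | N in [set: nat]].
have hs : has_sup V.
  by split; [exists (\sum_(j < 0) normc (tc f j) ^+ 2), 0%N|exists (nrm f ^+ 2) => _ [N _ <-]; exact: nrm_sum_ge].
have [_ [N0 _ <-] hN0] := sup_adherent e2 hs; exists N0 => N NN.
have [hT tT] := trunc_H2 N f.
have hB : H2 (f - trunc N f) by exact: (HB HS).
rewrite -(ler_pXn2r (ltn0Sn 1)) ?nnegrE ?nrm_ge0 ?(ltW e0)//.
apply: nrm_sum_le => // K.
have sup_ub M : \sum_(j < M) normc (tc f j) ^+ 2 <= sup V by apply: sup_ubound; [exact: hs.2|exists M].
have := sup_ub (N0 + K)%N; rewrite big_split_ord /= => h1.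
suff : \sum_(j < K) normc (tc (f - trunc N f) j) ^+ 2 <= \sum_(i < K) normc (tc f (N0 + i)) ^+ 2 by lra.
have T j : normc (tc (f - trunc N f) j) ^+ 2 <= if (N0 <= j)%N then normc (tc f j) ^+ 2 else 0.
  rewrite (tcB _ hf hT) tT; case: ltnP => jN; first by rewrite subrr nc0 expr0n /=; case: ifP => // _; exact: sqr_ge0.
  by rewrite (leq_trans NN jN) subr0.
apply: (@le_trans _ _ (\sum_(j < K) (if (N0 <= j)%N then normc (tc f j) ^+ 2 else 0))).
  by apply: ler_sum => j _; exact: T.
apply: (@le_trans _ _ (\sum_(j < K + N0) (if (N0 <= j)%N then normc (tc f j) ^+ 2 else 0))).
  rewrite [leRHS]big_split_ord /= lerDl.
  by apply: sumr_ge0 => j _; case: ifP => // _; exact: sqr_ge0.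
rewrite (addnC K N0).
rewrite big_split_ord /= big1 ?add0r; last by move=> j _; rewrite leqNgt ltn_ord.
by apply: ler_sum => j _; rewrite leq_addr.
Qed.

Lemma ip_trunc f h N : H2 f -> H2 h -> ip (trunc N f) h = \sum_(j < N) tc f j * (tc h j)^*.
Proof.
move=> hf hh; have [hT tT] := trunc_H2 N f.
apply: (cconv_uniq (ip_csum hT hh)); apply/cconvP => e e0; exists N => K NK.
rewrite -(subnKC NK) big_split_ord /= [X in _ + X - _]big1; last first.
  by move=> j _; rewrite tT ltnNge leq_addr mul0r.
rewrite addr0 (eq_bigr (fun j : 'I_N => tc f j * (tc h j)^*)) ?subrr ?nc0 ?(ltW e0)// => j _.
by rewrite tT ltn_ord.
Qed.

(** The tail of h is small in norm against a bounded sequence; its head involves finitely many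
    coefficients, each tending to zero. *)
Lemma weak_null (x : nat -> C -> C) (M : R) : (forall n, H2 (x n)) -> (forall n, nrm (x n) <= M) ->
  (forall j (e : R), 0 < e -> exists n0, forall n, (n0 <= n)%N -> normc (tc (x n) j) <= e) ->
  forall h (e : R), H2 h -> 0 < e -> exists n0, forall n, (n0 <= n)%N -> normc (ip (x n) h) <= e.
Proof.
move=> hx xM x0 h e hh e0.
have M0 : 0 <= M := le_trans (nrm_ge0 ip (x 0%N)) (xM 0%N).
have e1 : 0 < e / 2 / (M + 1) by rewrite !divr_gt0// ltr_wpDl.
have [N HN] := trunc_cvg hh e1; have [hT tT] := trunc_H2 N h.
have fin K : forall d : R, 0 < d -> exists n0, forall n, (n0 <= n)%N -> \sum_(j < K) normc (tc (x n) j) * normc (tc h j) <= d.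
  elim: K => [|K ih] d d0; first by exists 0%N => n _; rewrite big_ord0 ltW.
  have d2 : 0 < d / 2 by rewrite divr_gt0.
  have [n1 H1] := ih _ d2.
  have d3 : 0 < d / 2 / (normc (tc h K) + 1) by rewrite divr_gt0// ltr_wpDl ?nc_ge0.
  have [n2 Hn2] := x0 K _ d3; exists (maxn n1 n2) => n; rewrite geq_max => /andP[l1 l2].
  rewrite big_ord_recr /=.
  have := H1 n l1; have := Hn2 n l2; rewrite ler_pdivlMr ?ltr_wpDl ?nc_ge0// => h1 h2.
  have := nc_ge0 (tc (x n) K); have := nc_ge0 (tc h K); nra.
have e2 : 0 < e / 2 by rewrite divr_gt0.
have [n0 Hn0] := fin N _ e2; exists n0 => n ln.
have -> : ip (x n) h = ip (x n) (h - trunc N h) + ip (x n) (trunc N h).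
  by rewrite -(ipDr HS) ?subrK//; exact: (HB HS).
apply: le_trans (ncD _ _) _; have -> : e = e / 2 + e / 2 by lra.
apply: lerD.
  apply: le_trans (ip_CS HS (hx n) (HB HS hh hT)) _.
  have := HN N (leqnn N); rewrite ler_pdivlMr ?ltr_wpDl// => h1.
  have := xM n; have := nrm_ge0 ip (x n); have := nrm_ge0 ip (h - trunc N h); nra.
apply: le_trans (Hn0 n ln); rewrite (ips_conj HS hT (hx n)) nc_conj (ip_trunc N hh (hx n)).
apply: le_trans (nc_sum _ _ _) _; apply: ler_sum => j _.
by rewrite ncM nc_conj mulrC.
Qed.

(** A bounded sequence has a subsequence converging coefficientwise, the limit lies in the space,
    and the differences x_n are weakly null. Their projection onto a finite span tends to zero in
    norm, and on the rest [T] is at most tau. *)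
Lemma compact_criterion (T : (C -> C) -> C -> C) : bounded_operator H2 ip T ->
  (forall tau : R, 0 < tau -> exists m (v : 'I_m -> C -> C), (forall i, H2 (v i)) /\
    forall h, H2 h -> (forall i, ip h (v i) = 0) -> nrm (T h) <= tau * nrm h) ->
  compact_operator H2 ip T.
Proof.
move=> Tb crit; split=> // u hu [M uM].
have M0 : 0 <= M := le_trans (nrm_ge0 ip (u 0%N)) (uM 0%N).
have ub n j : normc (tc (u n) j) <= M.
  rewrite -(ler_pXn2r (ltn0Sn 1)) ?nnegrE ?nc_ge0//.
  apply: le_trans (_ : nrm (u n) ^+ 2 <= _); last by apply: lerXn2r; rewrite ?nnegrE ?nrm_ge0.
  apply: le_trans (nrm_sum_ge j.+1 (hu n)); rewrite big_ord_recr /= lerDr; apply: sumr_ge0 => *; exact: sqr_ge0.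
have [f [l [fm fl]]] := coef_subseq ub.
have fl' j (e : R) : 0 < e -> exists n0, forall n, (n0 <= n)%N -> normc (tc (u (f n)) j - l j) <= e.
  exact: ((cconvP (fun n => tc (u (f n)) j) (l j)).1 (fl j)).
have fin K (d : R) : 0 < d -> exists n, \sum_(j < K) normc (tc (u (f n)) j - l j) ^+ 2 <= d.
  suff H (d' : R) : 0 < d' -> exists n0, forall n, (n0 <= n)%N -> \sum_(j < K) normc (tc (u (f n)) j - l j) ^+ 2 <= d'.
    by move=> /H[n0 Hn]; exists n0; exact: Hn.
  elim: K d' => [|K ih] d' d0; first by exists 0%N => n _; rewrite big_ord0 ltW.
  have d2 : 0 < d' / 2 by rewrite divr_gt0.
  have [n1 H1] := ih _ d2.
  have d3 : 0 < Num.min 1 (d' / 2) by rewrite lt_min ltr01.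
  have [n2 Hn2] := fl' K _ d3; exists (maxn n1 n2) => n; rewrite geq_max => /andP[l1 l2].
  rewrite big_ord_recr /=; have := H1 n l1; have := Hn2 n l2; rewrite le_min => /andP[h1 h2] h3.
  have := nc_ge0 (tc (u (f n)) K - l K); nra.
have lB N : \sum_(j < N) normc (l j) ^+ 2 <= 2 * M ^+ 2 + 2.
  have [n Hn] := fin N 1 ltr01.
  have hM : \sum_(j < N) normc (tc (u (f n)) j) ^+ 2 <= M ^+ 2.
    apply: le_trans (nrm_sum_ge N (hu _)) _; apply: lerXn2r; rewrite ?nnegrE ?nrm_ge0//.
  apply: le_trans (_ : 2 * (\sum_(j < N) normc (tc (u (f n)) j) ^+ 2) + 2 * (\sum_(j < N) normc (tc (u (f n)) j - l j) ^+ 2) <= _); last by lra.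
  rewrite !mulr_sumr -big_split; apply: ler_sum => j _ /=.
  have := nc_sub_ge (l j) (tc (u (f n)) j); rewrite ncBC.
  have := nc_ge0 (l j); have := nc_ge0 (tc (u (f n)) j).
  set x := normc _; set y := normc _; set z := normc _ => x0 y0 h; have z0 : 0 <= z by exact: nc_ge0.
  by have := sqr_ge0 (x - z); nra.
have [hh th _] := hardy2_pfun lB; set h := pfun l in hh th.
exists f, (T h); split=> //; first exact: (op_H Tb hh).
pose x n := u (f n) - h; have hx n : H2 (x n) by exact: (HB HS).
have xM n : nrm (x n) <= M + nrm h.
  by apply: le_trans (nrmB HS (hu _) hh) _; rewrite lerD2r.
have x0 j (e : R) : 0 < e -> exists n0, forall n, (n0 <= n)%N -> normc (tc (x n) j) <= e.
  by move=> /(fl' j)[n0 Hn]; exists n0 => n ln; rewrite (tcB _ (hu _) hh) th Hn.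
have wk := weak_null hx xM x0.
set M' := M + nrm h in xM; have M'0 : 0 <= M' by rewrite addr_ge0 ?nrm_ge0.
apply/cvgrPdist_le => e e0.
pose tau := e / 4 / (M' + 1); have tau0 : 0 < tau by rewrite !divr_gt0// ltr_wpDl.
have [m0 [v [hv Hv]]] := crit _ tau0.
have [m [b [hb kill]]] := gram_schmidt_family HS hv.
(* [A] collects what one unit of every coefficient <x_n, b_i> costs: once through T of the
   projection and once through the remainder. *)
pose A := \sum_i (tau * nrm (b i) + nrm (T (b i))).
have A0 : 0 <= A.
  by apply: sumr_ge0 => a _; apply: addr_ge0; [apply: mulr_ge0; [exact: ltW|exact: nrm_ge0]|exact: nrm_ge0].
have d0 : 0 < e / 2 / (A + 1) by rewrite !divr_gt0// ltr_wpDl.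
set d := e / 2 / (A + 1) in d0.
have [N0 HN0] := choice (fun i => wk (b i) d (hb i) d0).
exists (\max_i N0 i)%N => // n /= ln; rewrite sub0r normrN ger0_norm ?nrm_ge0//.
have sm i : normc (ip (x n) (b i)) <= d.
  by apply: HN0; apply: leq_trans ln; exact: leq_bigmax.
have hbZ i : H2 (ip (x n) (b i) *: b i) by exact: (HZ HS).
have hs : H2 (\sum_i ip (x n) (b i) *: b i) by exact: (Hsum HS).
set sm' := \sum_i _ in hs.
have hP : H2 (x n - sm') by exact: (HB HS).
rewrite -(op_B HS Tb (hu _) hh) -/(x n).
have -> : x n = (x n - sm') + sm' by rewrite subrK.
rewrite (op_D Tb hP hs); apply: le_trans (nrmD HS (op_H Tb hP) (op_H Tb hs)) _.
have bP : nrm (T (x n - sm')) <= tau * nrm (x n - sm').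
  by apply: Hv => // i; exact: (kill _ (hx n) i).
have b1 : nrm sm' <= d * \sum_i nrm (b i).
  apply: le_trans (nrm_sum_family HS hbZ) _; rewrite mulr_sumr; apply: ler_sum => i _.
  by rewrite (nrmZ HS)// ler_wpM2r ?nrm_ge0.
have b2 : nrm (T sm') <= d * \sum_i nrm (T (b i)).
  rewrite /sm' (op_sum HS _ Tb)//; apply: le_trans (nrm_sum_family HS _) _; first by move=> i; exact: (op_H Tb).
  rewrite mulr_sumr; apply: ler_sum => i _.
  by rewrite (op_Z HS _ Tb (hb i)) (nrmZ HS) ?ler_wpM2r ?nrm_ge0//; exact: (op_H Tb).
have b3 : nrm (x n - sm') <= M' + d * (\sum_i nrm (b i)).
  by apply: le_trans (nrmB HS (hx n) hs) _; apply: lerD.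
have b4 : tau * nrm (x n - sm') <= tau * (M' + d * (\sum_i nrm (b i))).
  by rewrite ler_wpM2l// ltW.
have AE : A = tau * (\sum_i nrm (b i)) + \sum_i nrm (T (b i)) by rewrite mulr_sumr -big_split.
have t1 : tau * M' <= e / 4.
  have M1 : 0 < M' + 1 by rewrite ltr_wpDl.
  rewrite /tau mulrAC ler_pdivrMr// ler_wpM2l ?divr_ge0 ?(ltW e0)//; lra.
have t2 : d * A <= e / 2.
  have A1 : 0 < A + 1 by rewrite ltr_wpDl.
  rewrite /d mulrAC ler_pdivrMr// ler_wpM2l ?divr_ge0 ?(ltW e0)//; lra.
apply: le_trans (_ : tau * M' + d * A <= _); last by lra.
apply: le_trans (lerD (le_trans bP b4) b2) _; rewrite AE le_eqVlt; apply/orP; left; apply/eqP; ring.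
Qed.

Definition monom j : C -> C := pfun (fun i => (i == j)%:R).

Lemma monom_H2 j : H2 (monom j) /\ forall i, tc (monom j) i = (i == j)%:R.
Proof.
have B N : \sum_(i < N) normc ((i == j :> nat)%:R : C) ^+ 2 <= 1.
  have [jN|Nj] := ltnP j N.
    rewrite (bigD1 (Ordinal jN))//= eqxx nc1 expr1n big1 ?addr0// => i ij.
    by rewrite (_ : (i == j :> nat) = false) ?nc0 ?expr0n//; apply/negP => /eqP ii; case/eqP: ij; apply: val_inj.
  rewrite big1 ?ler01// => i _.
  by rewrite ltn_eqF ?nc0 ?expr0n// (leq_trans (ltn_ord i)).
by have [a b _] := @hardy2_pfun R (fun i => (i == j)%:R) _ B.
Qed.

Lemma tc0 i : tc 0 i = 0.
Proof. by have := tcB i (hardy2_0 R) (hardy2_0 R); rewrite !subrr. Qed.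

Lemma tc_sum_monom (c : nat -> C) N : H2 (\sum_(j < N) c j *: monom j) /\
  forall i, tc (\sum_(j < N) c j *: monom j) i = if (i < N)%N then c i else 0.
Proof.
have hm j : H2 (monom j) := (monom_H2 j).1.
have hs K : H2 (\sum_(j < K) c j *: monom j) by apply: (Hsum HS) => j; exact: (HZ HS).
split=> // i; elim: N => [|N ih]; first by rewrite big_ord0 tc0.
rewrite big_ord_recr /= addrC (tc_lin _ _ (hm N) (hs N)) ih (monom_H2 N).2 ltnS [(i <= N)%N]leq_eqVlt.
case: eqVneq => [->|ne] /=; first by rewrite ltnn mulr1 addr0.
by rewrite mulr0 add0r.
Qed.

Lemma trunc_monom N f : trunc N f = \sum_(j < N) tc f j *: monom j.
Proof.
have [hT tT] := trunc_H2 N f; have [hs ts] := tc_sum_monom (tc f) N.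
by apply: analytic_ext; [exact: hT.1|exact: hs.1|move=> i; rewrite tT ts].
Qed.

(** S h is defined by its Taylor coefficients <h, T e_j> for the monomials e_j; the identity holds
    on polynomials and extends by truncation. *)
Lemma adjoint_exists (T : (C -> C) -> C -> C) : bounded_operator H2 ip T ->
  exists S, adjoint_operator H2 ip T S.
Proof.
move=> Tb; have [TH _ [M0 HM0]] := Tb; pose M := `|M0|.
have HM f : H2 f -> nrm (T f) <= M * nrm f.
  by move=> hf; apply: le_trans (HM0 f hf) _; rewrite ler_wpM2r ?nrm_ge0 ?ler_norm.
have M_ge0 : 0 <= M by exact: normr_ge0.
have hm j : H2 (monom j) := (monom_H2 j).1.
have hTm j : H2 (T (monom j)) by exact: TH.
pose b h j : C := ip h (T (monom j)).
have Tsum (c : nat -> C) h N : H2 h -> ip (T (\sum_(j < N) c j *: monom j)) h = \sum_(j < N) c j * (b h j)^*.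
  move=> hh; rewrite (op_sum HS _ Tb) => [|j]; last exact: (HZ HS).
  rewrite (ip_suml HS) => [|j|//]; last by apply: (op_H Tb); exact: (HZ HS).
  apply: eq_bigr => j _; rewrite (op_Z HS _ Tb (hm j)) (ipZl HS _ (hTm j) hh); congr (_ * _).
  by rewrite /b -(ips_conj HS hh (hTm j)).
(* For q the sum of b_j e_j over j < N, the sum P equals <T q, h>, and |q|^2 <= P; so P <= M |h|
   sqrt P. *)
have bB h N : H2 h -> \sum_(j < N) normc (b h j) ^+ 2 <= (M * nrm h) ^+ 2.
  move=> hh; have [hq tq] := tc_sum_monom (b h) N; set q := \sum_(j < N) _ in hq tq.
  set P := \sum_(j < N) _.
  have P0 : 0 <= P by apply: sumr_ge0 => j _; exact: sqr_ge0.
  have E : ip (T q) h = P%:C.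
    by rewrite Tsum// rmorph_sum; apply: eq_bigr => j _; rewrite mulcJ.
  have qP : nrm q ^+ 2 <= P.
    apply: nrm_sum_le => // K; rewrite (eq_bigr (fun j : 'I_K => if (j < N)%N then normc (b h j) ^+ 2 else 0)).
      by apply: (@sum_if_le (fun j => normc (b h j) ^+ 2)) => j; exact: sqr_ge0.
    by move=> j _; rewrite tq; case: ifP => // _; rewrite nc0 expr0n.
  have := ip_CS HS (TH _ hq) hh; rewrite E nc_real ger0_norm// => h1.
  have h2 : P <= M * nrm h * nrm q.
    by apply: le_trans h1 _; rewrite mulrAC ler_wpM2r ?nrm_ge0// HM.
  have h3 : P ^+ 2 <= (M * nrm h) ^+ 2 * P.
    apply: le_trans (_ : (M * nrm h * nrm q) ^+ 2 <= _).
      by apply: lerXn2r; rewrite ?nnegrE ?mulr_ge0 ?nrm_ge0.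
    by rewrite exprMn ler_wpM2l ?sqr_ge0.
  have [->|Pn] := eqVneq P 0; first exact: sqr_ge0.
  by rewrite expr2 ler_pM2r in h3; rewrite ?lt_def ?Pn.
pose S h := pfun (b h).
have hS h : H2 h -> H2 (S h) /\ forall j, tc (S h) j = b h j.
  by move=> hh; have [] := hardy2_pfun (fun N => bB h N hh).
have Slin (a : C) f h : H2 f -> H2 h -> S (a *: f + h) = a *: S f + S h.
  move=> hf hh; have hl := hardy2_lin a hf hh; have hl' := hardy2_lin a (hS f hf).1 (hS h hh).1.
  apply: analytic_ext; [exact: (hS _ hl).1.1|exact: hl'.1|move=> j].
  by rewrite (hS _ hl).2 (tc_lin _ _ (hS f hf).1 (hS h hh).1) (hS f hf).2 (hS h hh).2 /b (ips_linl HS).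
exists S; split; first split=> //.
- by move=> h hh; exact: (hS h hh).1.
- exists M => h hh; have [h1 h2] := hS h hh.
  rewrite -(ler_pXn2r (ltn0Sn 1)) ?nnegrE ?mulr_ge0 ?nrm_ge0//.
  apply: nrm_sum_le => // N; rewrite (eq_bigr (fun j : 'I_N => normc (b h j) ^+ 2)); first exact: bB.
  by move=> j _; rewrite h2.
- move=> f h hf hh; have [h1 h2] := hS h hh; apply/eqP; rewrite -subr_eq0 -nc_eq0 eq_le nc_ge0 andbT.
  apply/ler_addgt0Pr => e e0; rewrite add0r.
  pose A := M * nrm h + nrm (S h); have A0 : 0 <= A by rewrite addr_ge0 ?mulr_ge0 ?nrm_ge0.
  have e1 : 0 < e / (A + 1) by rewrite divr_gt0// ltr_wpDl.
  have [N HN] := trunc_cvg hf e1; have [hT _] := trunc_H2 N f.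
  have hd : H2 (f - trunc N f) by exact: (HB HS).
  have E : ip (T (trunc N f)) h = ip (trunc N f) (S h).
    rewrite (ip_trunc N hf h1) trunc_monom Tsum//; by apply: eq_bigr => j _; rewrite h2.
  have -> : ip (T f) h - ip f (S h) = ip (T (f - trunc N f)) h - ip (f - trunc N f) (S h).
    rewrite (op_B HS Tb hf hT) (ipBl HS (TH _ hf) (TH _ hT) hh) (ipBl HS hf hT h1) E; ring.
  apply: le_trans (ncB _ _) _.
  have c1 := ip_CS HS (TH _ hd) hh; have c2 := ip_CS HS hd h1; have c3 := HM _ hd.
  have c4 := HN N (leqnn N); rewrite ler_pdivlMr ?ltr_wpDl// in c4.
  have c5 : nrm (T (f - trunc N f)) * nrm h <= M * nrm (f - trunc N f) * nrm h by rewrite ler_wpM2r ?nrm_ge0.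
  have := nrm_ge0 ip (f - trunc N f); rewrite /A in c4; nra.
Qed.

End HardyOperators.

(** * Lipschitz estimates for kernels *)

Section KernelLipschitz.
Variable R : realType.
Local Notation C := R[i].
Implicit Types (x y z w s : C).

Lemma pgrow_step (u : nat -> R) x s : has_csum (fun l => (u l)%:C * x ^+ l) s ->
  exists2 s1, has_csum (fun l => (u l.+1 - u l)%:C * x ^+ l) s1 & s * (1 - x) = (u 0%N)%:C + x * s1.
Proof.
move=> H; have [x0|x0] := eqVneq x 0.
  exists (u 1%N - u 0%N)%:C.
    rewrite x0; exact: (@subexp_csum0 R (fun l => (u l.+1 - u l)%:C)).
  have -> : s = (u 0%N)%:C.
    apply: cconv_uniq H _; rewrite x0; exact: (@subexp_csum0 R (fun l => (u l)%:C)).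
  by rewrite x0 subr0 mulr1 mul0r addr0.
have Hs := has_csum_shift 1 H; rewrite big_ord1 expr0 mulr1 in Hs.
exists (x^-1 * (s - (u 0%N)%:C + - x * s)).
  apply: (cconv_eq _ (has_csumZ x^-1 (has_csumD Hs (has_csumZ (-x) H)))) => n.
  by apply: eq_bigr => l _; rewrite addn1 exprS raddfB /=; field.
by field.
Qed.

(** Same induction as in [pgrow_bound]: clearing the factors 1 - x and 1 - y from s - s' leaves (x -
    y) times a bounded-growth term plus the difference for the difference sequence. *)
Lemma pgrow_lip d (u : nat -> R) : pgrow d u -> exists2 B : R, 0 <= B & forall x y s s' (m : R),
  normc x < 1 -> normc y < 1 -> has_csum (fun l => (u l)%:C * x ^+ l) s ->
  has_csum (fun l => (u l)%:C * y ^+ l) s' -> 0 < m -> m <= normc (1 - x) -> m <= normc (1 - y) ->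
  normc (s - s') * m ^+ d.+1 <= B * normc (x - y).
Proof.
elim: d u => [|d ih] u hu.
  exists 0 => // x y s s' m x1 y1 H H' _ _ _.
  have z (t q : C) : has_csum (fun l => (u l)%:C * q ^+ l) t -> t = 0.
    move=> Ht; apply: cconv_uniq Ht _; apply: (cconv_eq _ (cconv_cst 0)) => n.
    by rewrite big1// => l _; rewrite hu mul0r.
  by rewrite (z _ _ H) (z _ _ H') subrr nc0 !mul0r.
have [B1 B10 HB1] := pgrow_bound (hu : pgrow d (fun l => u l.+1 - u l)).
have [B2 B20 HB2] := ih _ hu.
exists (`|u 0%N| * 2 ^+ d + B1 + B2) => [|x y s s' m x1 y1 H H' m0 mx my].
  by rewrite !addr_ge0 ?mulr_ge0 ?exprn_ge0.
have [s1 H1 E1] := pgrow_step H; have [s2 H2 E2] := pgrow_step H'.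
have b1 := HB1 _ _ x1 H1; have b2 := HB2 _ _ _ _ _ x1 y1 H1 H2 m0 mx my.
have E : (s - s') * (1 - x) * (1 - y) = (x - y) * ((u 0%N)%:C + s1) + y * (1 - x) * (s1 - s2).
  have -> : (s - s') * (1 - x) * (1 - y) = (s * (1 - x)) * (1 - y) - (s' * (1 - y)) * (1 - x) by ring.
  by rewrite E1 E2; ring.
have m2 : m <= 2.
  by apply: le_trans mx _; apply: le_trans (ncB _ _) _; rewrite nc1; have : (2 : R) = 1 + 1 by []; lra.
have x0 : 0 < normc (1 - x) := lt_le_trans m0 mx.
set X := normc (1 - x) in mx b1 x0 *; set Y := normc (1 - y) in my *.
set N := normc (s - s'); set a := normc (x - y); set q := normc (s1 - s2) in b2.
have nE : N * X * Y <= a * (`|u 0%N| + normc s1) + X * q.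
  rewrite -!ncM E; apply: le_trans (ncD _ _) _; apply: lerD.
    by rewrite ncM ler_wpM2l ?nc_ge0//; apply: le_trans (ncD _ _) _; rewrite nc_real.
  rewrite !ncM ler_wpM2r ?nc_ge0// ler_piMl ?nc_ge0// ltW//.
have [N0 a0 q0 s0] : [/\ 0 <= N, 0 <= a, 0 <= q & 0 <= normc s1] by split; exact: nc_ge0.
have t1 : N * m * X <= a * (`|u 0%N| + normc s1) + X * q.
  apply: le_trans nE; rewrite [X in _ <= X]mulrAC ler_wpM2r ?(ltW x0)// ler_wpM2l//.
have t2 : N * m * m <= a * (`|u 0%N| + normc s1) + m * q.
  have u0 := normr_ge0 (u 0%N); have au : 0 <= a * (`|u 0%N| + normc s1) by rewrite mulr_ge0 ?addr_ge0.
  have [le|gt] := leP (N * m) q.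
    by apply: le_trans (_ : m * q <= _); [rewrite mulrC ler_wpM2l// ltW|lra].
  have := ler_wpM2r (_ : 0 <= N * m - q) mx; rewrite subr_ge0 => /(_ (ltW gt)); nra.
have md : 0 <= m ^+ d by rewrite exprn_ge0 ?(ltW m0).
rewrite !exprS !mulrA; apply: le_trans (ler_wpM2r md t2) _.
have -> : (a * (`|u 0%N| + normc s1) + m * q) * m ^+ d =
  (`|u 0%N| * m ^+ d + normc s1 * m ^+ d) * a + q * m ^+ d.+1 by rewrite exprS; ring.
have c1 : `|u 0%N| * m ^+ d <= `|u 0%N| * 2 ^+ d.
  by rewrite ler_wpM2l// lerXn2r ?nnegrE ?(ltW m0).
have c2 : normc s1 * m ^+ d <= B1.
  by apply: le_trans b1; rewrite ler_wpM2l ?nc_ge0// lerXn2r ?nnegrE ?(ltW m0) ?(ltW x0).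
rewrite [X in _ <= X]mulrDl lerD// ler_wpM2r//; lra.
Qed.

Lemma pgrow_kernel m : pgrow (m + m).+1 (fun l => ((l + m) ^_ m * (l + m) ^_ m)%:R : R).
Proof.
have h1 : pgrow 1 (fun=> 1 : R) by move=> l /=; rewrite subrr.
have h2 := pgrow_ffact (leqnn m) (pgrow_ffact (leqnn m) h1).
by rewrite add1n addSn in h2; apply: pgrow_ext h2 => l; rewrite natrM mulr1.
Qed.

Lemma kernel_lip m : exists2 B : R, 0 <= B & forall z z' w (mu : R),
  normc z < 1 -> normc z' < 1 -> normc w < 1 -> 0 < mu ->
  mu <= normc (1 - z^* * w) -> mu <= normc (1 - z'^* * w) ->
  normc (cderiv m (hker m z) w - cderiv m (hker m z') w) * mu ^+ (m + m).+2 <= B * normc (z - z').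
Proof.
have [B B0 HB] := pgrow_lip (pgrow_kernel m); exists B => // z z' w mu z1 z'1 w1 mu0 h1 h2.
have [s Hs E1] := cderiv_hker (leqnn m) z1 w1; have [s' Hs' E2] := cderiv_hker (leqnn m) z'1 w1.
rewrite subnn expr0 mul1r in E1; rewrite subnn expr0 mul1r in E2.
have -> : cderiv m (hker m z) w - cderiv m (hker m z') w = s - s' by congr (_ - _).
have cv q t : has_csum (fun l => ((l + m) ^_ m * (l + m) ^_ m)%:R * q ^+ l : C) t ->
    has_csum (fun l => (((l + m) ^_ m * (l + m) ^_ m)%:R : R)%:C * q ^+ l) t.
  by move=> Ht; apply: (cconv_eq _ Ht) => N; apply: eq_bigr => l _; rewrite rmorph_nat.
have dz q : normc q < 1 -> normc (q^* * w) < 1.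
  by move=> q1; rewrite ncM nc_conj; have := nc_ge0 q; have := nc_ge0 w; nra.
apply: le_trans (HB _ _ _ _ mu (dz _ z1) (dz _ z'1) (cv _ _ Hs) (cv _ _ Hs') mu0 h1 h2) _.
rewrite -mulrBl -rmorphB ncM nc_conj ler_wpM2l// ler_piMr ?nc_ge0// ltW//.
Qed.

End KernelLipschitz.

(** * Parseval identity and row sums over roots of unity *)

Section RootsOfUnity.
Variable R : realType.
Local Notation C := R[i].

(** The powers x^j sum to zero, so M is the modulus of the sum of 1 - x^j, at most the sum of j |x -
    1|, that is at most (M^2 / 2) |x - 1|. *)
Lemma om_dist M s : (0 < s < M)%N -> 2 / M%:R <= normc (om R M ^+ s - 1).
Proof.
move=> sM; set x := om R M ^+ s; set d := normc (x - 1).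
have M0 : (0 < M)%N by case/andP: sM => ? ?; exact: leq_trans (leq_ltn_trans (leq0n s) _) _ || lia.
have nx : normc x = 1 by rewrite nc_omX.
have step j : normc (1 - x ^+ j) <= j%:R * d.
  elim: j => [|j ih]; first by rewrite expr0 subrr nc0 mul0r.
  have -> : 1 - x ^+ j.+1 = (1 - x ^+ j) + x ^+ j * (1 - x) by rewrite exprS; ring.
  apply: le_trans (ncD _ _) _; rewrite ncM ncX nx expr1n mul1r (ncBC 1 x) -natr1 mulrDl mul1r.
  by rewrite lerD2r.
have S := om_sum R sM; rewrite -/x in S.
have : M%:R <= \sum_(j < M) j%:R * d.
  have -> : (M%:R : R) = normc (\sum_(j < M) (1 - x ^+ j)).
    by rewrite sumrB S subr0 sumr_const card_ord nc_nat.
  by apply: le_trans (nc_sum _ _ _) _; apply: ler_sum => j _; exact: step.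
rewrite -mulr_suml => h.
have sumle : \sum_(j < M) (j%:R : R) <= M%:R ^+ 2 / 2.
  elim: (M) => [|m ih]; first by rewrite big_ord0 expr0n mul0r.
  by rewrite big_ord_recr /= -natr1; have := ler0n R m; nra.
have Mp : (0 : R) < M%:R by rewrite ltr0n.
have d0 : 0 <= d := nc_ge0 _.
rewrite ler_pdivrMr// -(ler_pM2l Mp).
have : M%:R <= M%:R ^+ 2 / 2 * d by apply: le_trans h _; rewrite ler_wpM2r.
by lra.
Qed.

Lemma parseval (c : nat -> C) M J : (J <= M)%N ->
  \sum_(l < M) normc (\sum_(j < J) c j * (om R M ^+ l) ^+ j) ^+ 2 = M%:R * \sum_(j < J) normc (c j) ^+ 2.
Proof.
move=> JM; apply: (@complexI R).
have E (l : 'I_M) : (normc (\sum_(j < J) c j * (om R M ^+ l) ^+ j) ^+ 2)%:C =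
    \sum_(j < J) \sum_(i < J) c j * (c i)^* * ((om R M ^+ l) ^+ j * ((om R M ^+ l) ^+ i)^*).
  rewrite -mulcJ rmorph_sum mulr_suml; apply: eq_bigr => j _; rewrite mulr_sumr; apply: eq_bigr => i _.
  by rewrite rmorphM /=; ring.
rewrite rmorph_sum (eq_bigr _ (fun l _ => E l)) exchange_big /= rmorphM rmorph_nat rmorph_sum mulr_sumr.
apply: eq_bigr => j _; rewrite exchange_big /= (bigD1 j)//= [X in _ + X]big1 ?addr0; last first.
  move=> i ij; rewrite -mulr_sumr.
  have unit l q : (om R M ^+ l) ^+ q * ((om R M ^+ l) ^+ q)^* = 1 :> C.
    by rewrite mulcJ ncX nc_omX !expr1n.
  have [lt|gt|eq] := ltngtP i j; last by case/eqP: ij; exact: val_inj.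
  - rewrite (eq_bigr (fun l : 'I_M => (om R M ^+ (j - i)) ^+ l)); last first.
      move=> l _; rewrite -{1}(subnK (ltnW lt)) exprD -mulrA unit mulr1 -!exprM mulnC//.
    by rewrite om_sum ?mulr0// subn_gt0 lt /= (leq_ltn_trans (leq_subr _ _))// (leq_trans (ltn_ord j)).
  - rewrite (eq_bigr (fun l : 'I_M => ((om R M ^+ (i - j)) ^+ l)^*)); last first.
      move=> l _; rewrite -{1}(subnK (ltnW gt)) exprD rmorphM /= mulrCA unit mulr1 -!exprM mulnC//.
    have cond : (0 < i - j < M)%N.
      by rewrite subn_gt0 gt /= (leq_ltn_trans (leq_subr _ _))// (leq_trans (ltn_ord i)).
    have := om_sum R cond => /(congr1 (fun t => t^*)); rewrite rmorph_sum => ->.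
    by rewrite rmorph0 mulr0.
rewrite (eq_bigr (fun=> c j * (c j)^*)); last first.
  by move=> l _; rewrite mulcJ [X in _ * X]mulcJ ncX nc_omX !expr1n mulr1.
by rewrite sumr_const card_ord mulcJ mulr_natl.
Qed.

Lemma bernoulli (h : R) M : 0 <= h -> 1 + M%:R * h <= (1 + h) ^+ M.
Proof.
move=> h0; elim: M => [|M ih]; first by rewrite expr0 mul0r addr0.
rewrite exprS -natr1; have := ler0n R M; nra.
Qed.

Lemma pow_le_half (h : R) M : 0 <= h <= 1 -> 1 <= M%:R * h -> (1 - h) ^+ M <= 1 / 2.
Proof.
move=> /andP[h0 h1] Mh; have b := bernoulli M h0.
have : (1 - h) ^+ M * (1 + h) ^+ M <= 1.
  by rewrite -exprMn exprn_ile1//; nra.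
have : 0 <= (1 - h) ^+ M by rewrite exprn_ge0// subr_ge0.
by nra.
Qed.

(** With y = x w^l one has y^M = x^M for every l, so 1 / (1 - y) is a finite geometric sum over a
    common denominator 1 - x^M of modulus at least 1/2. Parseval then sums the squares exactly. *)
Lemma roots_row_sum (a : C) (rho : R) M : normc a <= 1 -> 0 <= rho < 1 -> rho ^+ M <= 1 / 2 -> (0 < M)%N ->
  \sum_(l < M) (normc (1 - a^* * (rho%:C * om R M ^+ l)) ^+ 2)^-1 <= 4 * M%:R / (1 - normc a * rho).
Proof.
move=> a1 /andP[r0 r1] rM M0.
pose x := a^* * rho%:C; have nx : normc x = normc a * rho by rewrite ncM nc_conj nc_real ger0_norm.
have E0 l : a^* * (rho%:C * om R M ^+ l) = x * om R M ^+ l by rewrite mulrA.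
clearbody x.
have a0 := nc_ge0 a; have x1 : normc x < 1 by rewrite nx; nra.
have x0 := nc_ge0 x.
have xM : normc x ^+ M <= 1 / 2.
  by apply: le_trans rM; apply: lerXn2r; rewrite ?nnegrE// nx; nra.
have nM : 1 / 2 <= normc (1 - x ^+ M) by have := nc_sub_ge 1 (x ^+ M); rewrite nc1 ncX; lra.
have E (l : 'I_M) : (normc (1 - a^* * (rho%:C * om R M ^+ l)) ^+ 2)^-1 =
    normc (\sum_(j < M) x ^+ j * (om R M ^+ l) ^+ j) ^+ 2 / normc (1 - x ^+ M) ^+ 2.
  rewrite E0.
  set y := x * _; have y1 : normc y < 1 by rewrite ncM nc_omX mulr1.
  have y0 : 0 < normc (1 - y) by have := nc_sub_ge 1 y; rewrite nc1; lra.
  have G : (1 - y) * \sum_(j < M) x ^+ j * (om R M ^+ l) ^+ j = 1 - x ^+ M.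
    rewrite (eq_bigr (fun j : 'I_M => y ^+ j)); last by move=> j _; rewrite /y exprMn.
    rewrite -opprB mulNr -subrX1 opprB /y exprMn -exprM mulnC exprM omM// expr1n mulr1//.
  have := congr1 (@normc R) G; rewrite ncM.
  set s := normc (\sum_(j < M) _); set t := normc (1 - y) in y0 *; set q := normc (1 - x ^+ M) => nG.
  have q0 : 0 < q by rewrite /q; lra.
  have s0 : 0 < s by rewrite -(pmulr_rgt0 _ y0) nG.
  by rewrite -nG; field; rewrite !gt_eqF.
rewrite (eq_bigr _ (fun l _ => E l)) -mulr_suml (parseval (fun j => x ^+ j) (leqnn M)).
have geo : \sum_(j < M) normc (x ^+ j) ^+ 2 <= (1 - normc x)^-1.
  apply: le_trans (_ : \sum_(j < M) normc x ^+ j <= _); last by apply: geo_sum_le; rewrite x0.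
  apply: ler_sum => j _; rewrite ncX -exprM; apply: ler_wiXn2l => //; [exact: ltW|exact: leq_pmulr].
have x1' : 0 < 1 - normc x by rewrite subr_gt0.
have nM2 : 1 / 4 <= normc (1 - x ^+ M) ^+ 2 by have := nc_ge0 (1 - x ^+ M); nra.
rewrite -nx ler_pdivrMr; last by apply: lt_le_trans nM2; lra.
apply: le_trans (_ : M%:R * (1 - normc x)^-1 <= _); first by rewrite ler_wpM2l.
rewrite -[leRHS]mulrA mulrAC -[X in _ <= X]mulrA; set i := (1 - normc x)^-1.
have i0 : 0 <= i by rewrite invr_ge0 ltW.
have : 0 <= M%:R * i by rewrite mulr_ge0.
by nra.
Qed.

End RootsOfUnity.

(** * The polar grid and its Bessel inequalities *)

Section Grid.
Variable R : realType.
Local Notation C := R[i].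
Local Notation H2 := (@hardy2 R).
Local Notation ip := (@hardy2_ip R).
Local Notation nrm := (ipnorm ip).
Local Notation HS := (hardy2_ips R).
Implicit Types (z : C) (v l K : nat).

Definition gh v : R := (2^-1) ^+ v.+1.
Definition gM K v : nat := (K * 2 ^ v)%N.
Definition gw K v l : C := (1 - gh v)%:C * om R (gM K v) ^+ l.
Definition gr : R := Num.sqrt 2^-1.
Definition gsq v : R := gr ^+ v.+1.
(** The part of the Gram majorant that depends on levels only; [gsq v] is the square root of [gh v].
    The minimum makes it symmetric. *)
Definition gk v v' : R := gsq v * gsq v' * Num.min (gh v) (gh v').

Lemma gr_sq : gr ^+ 2 = 2^-1. Proof. by rewrite sqr_sqrtr// invr_ge0. Qed.
Lemma gr_gt0 : 0 < gr. Proof. by rewrite sqrtr_gt0 invr_gt0. Qed.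
Lemma gr_le : gr <= 3 / 4.
Proof.
rewrite -(ler_pXn2r (ltn0Sn 1)) ?nnegrE ?(ltW gr_gt0) ?divr_ge0 ?ler0n//.
by rewrite gr_sq expr2; lra.
Qed.
Lemma gh_gt0 v : 0 < gh v. Proof. by rewrite exprn_gt0// invr_gt0. Qed.
Lemma gh_le v : gh v <= 1 / 2.
Proof. by rewrite /gh exprS mul1r ler_piMr ?invr_ge0// exprn_ile1 ?invr_ge0// invf_le1// ler1n. Qed.
Lemma gsq_gt0 v : 0 < gsq v. Proof. exact/exprn_gt0/gr_gt0. Qed.
Lemma ghE v : gh v = gsq v ^+ 2. Proof. by rewrite /gsq -exprM mulnC exprM gr_sq. Qed.
Lemma ghD v d : gh (v + d) = gh v * (2^-1) ^+ d. Proof. by rewrite /gh -exprD addSn. Qed.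
Lemma gsqD v d : gsq (v + d) = gsq v * gr ^+ d. Proof. by rewrite /gsq -exprD addSn. Qed.
Lemma gh_mono v d : gh (v + d) <= gh v.
Proof. by rewrite ghD ler_piMr ?(ltW (gh_gt0 v))// exprn_ile1 ?invr_ge0// invf_le1// ler1n. Qed.

Lemma gMh K v : (gM K v)%:R * gh v = K%:R / 2.
Proof.
have : (2 : R) ^+ v != 0 by rewrite expf_neq0// pnatr_eq0.
rewrite /gM natrM natrX /gh exprS exprVn; set q := 2 ^+ v; move: q => q q0.
by field.
Qed.

Lemma gM_gt0 K v : (2 <= K)%N -> (0 < gM K v)%N.
Proof. by move=> K2; rewrite muln_gt0 expn_gt0 andbT ltnW. Qed.

Lemma nc_gw K v l : normc (gw K v l) = 1 - gh v.
Proof. by rewrite ncM nc_omX mulr1 nc_real ger0_norm//; have := gh_le v; lra. Qed.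

Lemma grho_pow K v : (2 <= K)%N -> (1 - gh v) ^+ gM K v <= 1 / 2.
Proof.
move=> K2; have := gh_le v; have h0 := gh_gt0 v; move=> h2; apply: pow_le_half.
  by apply/andP; split; lra.
by rewrite gMh; have : (2 : R) <= K%:R by [rewrite ler_nat]; lra.
Qed.

(** The sum over one level is of order 1 / (h' max(h, h')); against [gk] this leaves at most one
    factor 2^(-1/2) for each level of separation. *)
Lemma level_sum K v l v' : (2 <= K)%N ->
  \sum_(l' < gM K v') gk v v' / normc (1 - (gw K v l)^* * gw K v' l') ^+ 2
    <= 2 * K%:R * gr ^+ (maxn v' v - minn v' v).
Proof.
move=> K2; have h0 := gh_gt0 v; have h0' := gh_gt0 v'; have h2 := gh_le v; have h2' := gh_le v'.
have M0 := gM_gt0 v' K2; have k0 : 0 <= gk v v'.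
  by rewrite !mulr_ge0 ?(ltW (gsq_gt0 _))// le_min !ltW.
have wl : normc (gw K v l) <= 1 by rewrite nc_gw; lra.
have rr : 0 <= 1 - gh v' < 1 by apply/andP; split; lra.
have := roots_row_sum wl rr (grho_pow v' K2) M0; rewrite nc_gw => L.
rewrite -mulr_sumr; apply: le_trans (ler_wpM2l k0 L) _.
have mx : Num.max (gh v) (gh v') <= 1 - (1 - gh v) * (1 - gh v').
  by rewrite ge_max; apply/andP; split; nra.
have mx0 : 0 < Num.max (gh v) (gh v') by rewrite lt_max h0.
have -> : 4 * (gM K v')%:R = 2 * K%:R / gh v'.
  by apply: (mulIf (lt0r_neq0 h0')); rewrite divfK ?lt0r_neq0// -mulrA gMh; field.
apply: le_trans (_ : gk v v' * (2 * K%:R / gh v' / Num.max (gh v) (gh v')) <= _).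
  rewrite ler_wpM2l// ler_wpM2l ?mulr_ge0 ?invr_ge0 ?(ltW h0')// lef_pV2// posrE.
  exact: lt_le_trans mx.
have -> : gk v v' * (2 * K%:R / gh v' / Num.max (gh v) (gh v')) =
  2 * K%:R * (gk v v' / (gh v' * Num.max (gh v) (gh v'))).
  by move: mx0; set m := Num.max _ _ => mx0; field; rewrite !gt_eqF.
rewrite ler_wpM2l ?mulr_ge0// /gk.
have g1 : gr <= 1 by have := gr_le; lra.
have [le|/ltnW le] := leqP v' v.
  move: le h0 h0' h2 h2' {L wl mx mx0 rr k0} => /subnKC <-.
  move: (v - v')%N => d h0 h0' h2 h2'; rewrite addKn.
  have le := gh_mono v' d; rewrite (min_idPl le) (max_idPr le) ghE.
  rewrite !gsqD (ghE v'); have s0 := gsq_gt0 v'; set s := gsq v' in s0 *; set q := gr ^+ d.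
  have q0 : 0 < q by exact/exprn_gt0/gr_gt0.
  have q1 : q <= 1 by rewrite exprn_ile1// ltW// gr_gt0.
  have -> : s * q * s * (s * q) ^+ 2 / (s ^+ 2 * s ^+ 2) = q ^+ 3 by field; rewrite gt_eqF.
  by rewrite exprS ler_piMr ?(ltW q0)// exprn_ile1// ltW.
move: le h0 h0' h2 h2' {L wl mx mx0 rr k0 M0} => /subnKC <-.
move: (v' - v)%N => d h0 h0' h2 h2'; rewrite addKn.
have le := gh_mono v d; rewrite (min_idPr le) (max_idPl le) (ghE (v + d)).
rewrite !gsqD (ghE v); have s0 := gsq_gt0 v; set s := gsq v in s0 *; set q := gr ^+ d.
have q0 : 0 < q by exact/exprn_gt0/gr_gt0.
by rewrite le_eqVlt; apply/orP; left; apply/eqP; field; rewrite !gt_eqF.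
Qed.

Lemma geo_two_sided (q : R) v V : 0 <= q <= 3 / 4 ->
  \sum_(v' < V) q ^+ (maxn v' v - minn v' v) <= 8.
Proof.
move=> /andP[q0 q1]; have q01 : 0 <= q < 1 by apply/andP; split; lra.
have g N : \sum_(d < N) q ^+ d <= 4.
  apply: le_trans (geo_sum_le N q01) _.
  by rewrite -[leRHS]invrK lef_pV2 ?posrE ?invr_gt0//; lra.
apply: (@le_trans _ _ (\sum_(v' < v + V) q ^+ (maxn v' v - minn v' v))).
  rewrite addnC [leRHS]big_split_ord /= lerDl; apply: sumr_ge0 => *; exact: exprn_ge0.
rewrite big_split_ord /=; have -> : (8 : R) = 4 + 4 by rewrite -natrD.
apply: lerD.
  rewrite (reindex_inj rev_ord_inj) /=; apply: le_trans (g v).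
  apply: ler_sum => i _; have lt : (v - i.+1 <= v)%N by exact: leq_subr.
  rewrite (maxn_idPr lt) (minn_idPl lt) subKn// exprS ler_piMl ?exprn_ge0//.
  exact: ltW (andP q01).2.
apply: le_trans (g V); apply: ler_sum => i _.
by rewrite (maxn_idPl (leq_addr _ _)) (minn_idPr (leq_addr _ _)) addKn.
Qed.

Lemma grid_row K v l V : (2 <= K)%N ->
  \sum_(v' < V) \sum_(l' < gM K v') gk v v' / normc (1 - (gw K v l)^* * gw K v' l') ^+ 2 <= 16 * K%:R.
Proof.
move=> K2; apply: (@le_trans _ _ (\sum_(v' < V) 2 * K%:R * gr ^+ (maxn v' v - minn v' v))).
  by apply: ler_sum => v' _; exact: level_sum.
rewrite -mulr_sumr; have q : 0 <= gr <= 3 / 4 by rewrite (ltW gr_gt0) gr_le.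
have := geo_two_sided v V q; have : 0 <= (K%:R : R) by [].
by nra.
Qed.

Lemma sum_level (F : nat -> R) K v V : (v <= V)%N ->
  \sum_(l < gM K V) (if (l < gM K v)%N then F l else 0) = \sum_(l < gM K v) F l.
Proof.
move=> vV; have le : (gM K v <= gM K V)%N by rewrite leq_mul2l leq_exp2l// vV orbT.
by rewrite (big_ord_widen _ F le) -big_mkcond.
Qed.

Lemma grid_bessel K (E : R) (x : nat -> nat -> C -> C) V : (2 <= K)%N -> 0 <= E ->
  (forall v l, (l < gM K v)%N -> H2 (x v l)) ->
  (forall v l v' l', (l < gM K v)%N -> (l' < gM K v')%N ->
    normc (ip (x v l) (x v' l')) <= E * (gk v v' / normc (1 - (gw K v l)^* * gw K v' l') ^+ 2)) ->
  forall f, H2 f -> \sum_(v < V) \sum_(l < gM K v) normc (ip f (x v l)) ^+ 2 <= E * (16 * K%:R) * nrm f ^+ 2.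
Proof.
move=> K2 E0 hx entry f hf.
(* Levels have different lengths; padding by the zero vector gives a rectangular index set without
   changing the sums. *)
pose y (i : 'I_V * 'I_(gM K V)) : C -> C := if (i.2 < gM K i.1)%N then x i.1 i.2 else 0.
have hy i : H2 (y i) by rewrite /y; case: ifP => [/hx//|_]; exact: hardy2_0.
have C0 : 0 <= E * (16 * K%:R) by rewrite !mulr_ge0.
have pairE (F : nat -> nat -> R) : \sum_(i : 'I_V * 'I_(gM K V)) (if (i.2 < gM K i.1)%N then F i.1 i.2 else 0)
    = \sum_(v < V) \sum_(l < gM K v) F v l.
  rewrite -(pair_bigA _ (fun (v : 'I_V) (l : 'I_(gM K V)) => if (l < gM K v)%N then F v l else 0)) /=.
  by apply: eq_bigr => v _; rewrite (sum_level (F v)) ?(ltnW (ltn_ord v)).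
have gram i : \sum_j normc (ip (y i) (y j)) <= E * (16 * K%:R).
  rewrite {1}/y; case: ifP => il; last first.
    by rewrite big1 ?mulr_ge0// => j _; rewrite (ip0l HS) ?nc0.
  apply: le_trans (ler_wpM2l E0 (grid_row i.1 i.2 V K2)).
  rewrite -(pairE (fun v' l' => gk i.1 v' / normc (1 - (gw K i.1 i.2)^* * gw K v' l') ^+ 2)) mulr_sumr.
  apply: ler_sum => j _; rewrite /y; case: ifP => jl; first exact: entry.
  by rewrite mulr0 (ips_conj HS (hardy2_0 R) (hx _ _ il)) (ip0l HS (hx _ _ il)) conjC0 nc0.
apply: le_trans (bessel_analysis HS C0 hy gram hf).
rewrite -(pairE (fun v l => normc (ip f (x v l)) ^+ 2)); apply: ler_sum => i _.
by rewrite /y; case: ifP => // _; exact: sqr_ge0.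
Qed.

Definition near_node K (A : R) z v l := gh v / 2 <= 1 - normc z /\ normc (z - gw K v l) <= A * gh v.

Lemma near_disk K A z v l : near_node K A z v l -> normc z < 1.
Proof. by move=> [h _]; have := gh_gt0 v; lra. Qed.

(** Moving both points to their nodes changes the quantity by at most A (h + h'), and each height is
    at most twice |1 - conj(z) z'|; hence 1 + 4 A. *)
Lemma near_dist K A z v l z' v' l' : 0 <= A -> near_node K A z v l -> near_node K A z' v' l' ->
  normc (1 - (gw K v l)^* * gw K v' l') / (1 + 4 * A) <= normc (1 - z^* * z').
Proof.
move=> A0 n n'; have z1 := near_disk n; have z1' := near_disk n'.
move: n n' => [a b] [a' b']; have [d1 d2 _] := disk_dist z1 z1'.
rewrite ler_pdivrMr; last by lra.
have -> : 1 - (gw K v l)^* * gw K v' l' =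
  (1 - z^* * z') + (z^* * (z' - gw K v' l') + (z - gw K v l)^* * gw K v' l').
  by rewrite rmorphB /=; ring.
apply: le_trans (ncD _ _) _; set D := normc (1 - _) in d1 d2 *.
have e1 : normc (z^* * (z' - gw K v' l')) <= A * gh v'.
  by rewrite ncM nc_conj; apply: le_trans b'; rewrite ler_piMl ?nc_ge0// ltW.
have e2 : normc ((z - gw K v l)^* * gw K v' l') <= A * gh v.
  rewrite ncM nc_conj; apply: le_trans b; rewrite ler_piMr ?nc_ge0// nc_gw; have := gh_gt0 v'; lra.
have := ncD (z^* * (z' - gw K v' l')) ((z - gw K v l)^* * gw K v' l').
nra.
Qed.

Lemma gw_dist K v l v' l' : Num.max (gh v) (gh v') <= normc (1 - (gw K v l)^* * gw K v' l').
Proof.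
have w1 u i : normc (gw K u i) < 1 by rewrite nc_gw; have := gh_gt0 u; lra.
have [a b _] := disk_dist (w1 v l) (w1 v' l'); rewrite !nc_gw in a b.
by rewrite ge_max; apply/andP; split; lra.
Qed.

Lemma weight_sq m v (t : R) : (gsq v * gh v ^+ m * t) ^+ 2 = gh v ^+ (2 * m).+1 * t ^+ 2.
Proof. by rewrite exprMn [(gsq v * _) ^+ 2]exprMn -ghE -exprM mulnC -exprS. Qed.

Lemma gk_sym v v' : gk v v' = gk v' v.
Proof. by rewrite /gk minC [gsq v * _]mulrC. Qed.

(** For m > 0 the weights contain a factor h h', which provides both the minimum in [gk] and one
    power of decay; at m = 0 the entries would decay only like 1 / D. *)
Lemma plain_bessel m A : (0 < m)%N -> 0 <= A -> exists2 E : R, 0 <= E &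
  forall K V (z : nat -> nat -> C), (2 <= K)%N -> (forall v l, (l < gM K v)%N -> near_node K A (z v l) v l) ->
  forall f, H2 f -> \sum_(v < V) \sum_(l < gM K v) gh v ^+ (2 * m).+1 * normc (cderiv m f (z v l)) ^+ 2
    <= E * K%:R * nrm f ^+ 2.
Proof.
move=> m0 A0; have [B B0 hB] := @kernel_bound R m m (leqnn m).
pose a := 1 + 4 * A; have a0 : 0 < a by rewrite /a; lra.
exists (B * a ^+ (m + m).+1 * 16) => [|K V z K2 hz f hf]; first by rewrite !mulr_ge0 ?exprn_ge0 ?(ltW a0)//.
pose x v l := (gsq v * gh v ^+ m)%:C *: hker m (z v l).
have hk v l : (l < gM K v)%N -> H2 (hker m (z v l)) by move=> /hz/near_disk; exact: hker_H2.
have hx v l : (l < gM K v)%N -> H2 (x v l) by move=> /hk; exact: (HZ HS).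
have c0 v : 0 <= gsq v * gh v ^+ m by apply: mulr_ge0; [exact/ltW/gsq_gt0|exact/exprn_ge0/ltW/gh_gt0].
have ipx f' v l : H2 f' -> (l < gM K v)%N -> normc (ip f' (x v l)) = gsq v * gh v ^+ m * normc (cderiv m f' (z v l)).
  move=> hf' lM; rewrite (ipZr HS _ (hk _ _ lM) hf') conj_real (ip_hker m hf' (near_disk (hz _ _ lM))).
  by rewrite ncM nc_real ger0_norm.
have E : 0 <= B * a ^+ (m + m).+1 by rewrite mulr_ge0 ?exprn_ge0 ?(ltW a0)//.
have entry v l v' l' : (l < gM K v)%N -> (l' < gM K v')%N ->
    normc (ip (x v l) (x v' l')) <= B * a ^+ (m + m).+1 * (gk v v' / normc (1 - (gw K v l)^* * gw K v' l') ^+ 2).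
  move=> lM lM'; have z1 := near_disk (hz _ _ lM); have z1' := near_disk (hz _ _ lM').
  rewrite (ipx _ _ _ (hx _ _ lM) lM').
  have -> : normc (cderiv m (x v l) (z v' l')) = gsq v * gh v ^+ m * normc (cderiv m (hker m (z v l)) (z v' l')).
    rewrite -(ip_hker m (hx _ _ lM) z1') (ipZl HS _ (hk _ _ lM) (hker_H2 m z1')) (ip_hker m (hk _ _ lM) z1').
    by rewrite ncM nc_real ger0_norm.
  have Kb := hB _ _ z1 z1'; have Db := near_dist A0 (hz _ _ lM) (hz _ _ lM').
  have W := gw_dist K v l v' l'.
  set D := normc (1 - (z v l)^* * _) in Kb Db; set D0 := normc (1 - (gw K v l)^* * _) in Db W *.
  set k := normc (cderiv m _ _) in Kb *.
  have h0 := gh_gt0 v; have h0' := gh_gt0 v'.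
  move: W; rewrite ge_max => /andP[W1 W2].
  have D00 : 0 < D0 by lra.
  have k0 : 0 <= k := nc_ge0 _.
  have Dp : (D0 / a) ^+ (m + m).+1 <= D ^+ (m + m).+1.
    by apply: lerXn2r; rewrite ?nnegrE ?divr_ge0 ?nc_ge0 ?(ltW D00) ?(ltW a0).
  have kD : k * D0 ^+ (m + m).+1 <= B * a ^+ (m + m).+1.
    rewrite -ler_pdivrMr ?exprn_gt0// -mulrA -expr_div_n; apply: le_trans Kb.
    by rewrite ler_wpM2l.
  have mh : gh v * gh v' <= Num.min (gh v) (gh v') * D0.
    by rewrite /Num.min; case: ifP => _; [rewrite ler_wpM2l ?(ltW h0)|rewrite mulrC ler_wpM2l ?(ltW h0')].
  have pw : (gh v * gh v') ^+ m.-1 <= (D0 ^+ 2) ^+ m.-1.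
    by apply: lerXn2r; rewrite ?nnegrE ?mulr_ge0 ?sqr_ge0 ?(ltW h0) ?(ltW h0')//; nra.
  have key : gh v ^+ m * gh v' ^+ m <= Num.min (gh v) (gh v') * D0 ^+ (m + m).-1.
    rewrite -exprMn -(prednK m0) exprS prednK//.
    have -> : D0 ^+ (m + m).-1 = D0 * (D0 ^+ 2) ^+ m.-1.
      by rewrite -exprM -exprS; congr (_ ^+ _); clear -m0; lia.
    by rewrite mulrA; apply: ler_pM; rewrite ?exprn_ge0 ?mulr_ge0 ?(ltW h0) ?(ltW h0').
  have s0 : 0 <= gsq v * gsq v' by rewrite mulr_ge0 ?(ltW (gsq_gt0 _)).
  have -> : gsq v' * gh v' ^+ m * (gsq v * gh v ^+ m * k) = gsq v * gsq v' * (gh v ^+ m * gh v' ^+ m * k) by ring.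
  rewrite /gk [leRHS]mulrA ler_pdivlMr ?exprn_gt0//.
  have -> : gsq v * gsq v' * (gh v ^+ m * gh v' ^+ m * k) * D0 ^+ 2 =
    gsq v * gsq v' * (gh v ^+ m * gh v' ^+ m * (k * D0 ^+ 2)) by ring.
  rewrite [leRHS](_ : _ = gsq v * gsq v' * (Num.min (gh v) (gh v') * (B * a ^+ (m + m).+1))); last by ring.
  rewrite ler_wpM2l//; have kD2 : 0 <= k * D0 ^+ 2 by rewrite mulr_ge0 ?sqr_ge0.
  apply: le_trans (ler_wpM2r kD2 key) _; rewrite -mulrA ler_wpM2l ?le_min ?(ltW h0) ?(ltW h0')//.
  rewrite mulrCA -exprD (_ : (m + m).-1 + 2 = (m + m).+1)%N//; by clear -m0; lia.
have := grid_bessel V K2 E hx entry hf; rewrite mulrA => H; apply: le_trans H.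
by apply: ler_sum => v _; apply: ler_sum => l _; rewrite (ipx _ _ _ hf (ltn_ord l)) weight_sq.
Qed.

(** The Lipschitz estimate in one variable gains dl h / D over the plain kernel. This restores the
    decay at m = 0, and the bound is linear in [dl], which the sampling theorem exploits. *)
Lemma diff_bessel m A : 0 <= A -> exists2 E : R, 0 <= E &
  forall K V (dl : R) (z z' : nat -> nat -> C), (2 <= K)%N -> 0 <= dl ->
  (forall v l, (l < gM K v)%N -> [/\ near_node K A (z v l) v l, near_node K A (z' v l) v l
     & normc (z v l - z' v l) <= dl * gh v]) ->
  forall f, H2 f -> \sum_(v < V) \sum_(l < gM K v) gh v ^+ (2 * m).+1 *
     normc (cderiv m f (z v l) - cderiv m f (z' v l)) ^+ 2 <= E * (dl * K%:R) * nrm f ^+ 2.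
Proof.
move=> A0; have [B B0 hB] := @kernel_lip R m.
pose a := 1 + 4 * A; have a0 : 0 < a by rewrite /a; lra.
exists (2 * B * a ^+ (m + m).+2 * 16) => [|K V dl z z' K2 dl0 hz f hf].
  by apply: mulr_ge0 => //; apply: mulr_ge0; [exact: mulr_ge0|apply: exprn_ge0; exact: ltW].
pose x v l := (gsq v * gh v ^+ m)%:C *: (hker m (z v l) - hker m (z' v l)).
have zd v l : (l < gM K v)%N -> normc (z v l) < 1 /\ normc (z' v l) < 1.
  by move=> /hz[/near_disk ? /near_disk ? _].
have hk v l : (l < gM K v)%N -> H2 (hker m (z v l)) by move=> /zd[? _]; exact: hker_H2.
have hk' v l : (l < gM K v)%N -> H2 (hker m (z' v l)) by move=> /zd[_ ?]; exact: hker_H2.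
have hd v l : (l < gM K v)%N -> H2 (hker m (z v l) - hker m (z' v l)).
  by move=> lM; exact: (HB HS (hk _ _ lM) (hk' _ _ lM)).
have hx v l : (l < gM K v)%N -> H2 (x v l) by move=> /hd; exact: (HZ HS).
have c0 v : 0 <= gsq v * gh v ^+ m by apply: mulr_ge0; [exact/ltW/gsq_gt0|exact/exprn_ge0/ltW/gh_gt0].
have ipx f' v l : H2 f' -> (l < gM K v)%N -> normc (ip f' (x v l)) =
    gsq v * gh v ^+ m * normc (cderiv m f' (z v l) - cderiv m f' (z' v l)).
  move=> hf' lM; have [z1 z1'] := zd _ _ lM.
  rewrite (ipZr HS _ (hd _ _ lM) hf') conj_real (ipBr HS (hk _ _ lM) (hk' _ _ lM) hf').
  have -> : ip f' (hker m (z v l)) - ip f' (hker m (z' v l)) = cderiv m f' (z v l) - cderiv m f' (z' v l).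
    by congr (_ - _); [exact: (ip_hker m hf' z1)|exact: (ip_hker m hf' z1')].
  by rewrite ncM nc_real ger0_norm.
have side v l v' l' : (l < gM K v)%N -> (l' < gM K v')%N ->
    normc (ip (x v l) (x v' l')) <= 2 * B * a ^+ (m + m).+2 * dl *
      (gsq v * gsq v' * gh v / normc (1 - (gw K v l)^* * gw K v' l') ^+ 2).
  move=> lM lM'; have [n1 n2 nd] := hz _ _ lM; have [n1' n2' _] := hz _ _ lM'.
  have [z1 z2] := zd _ _ lM; have [z1' z2'] := zd _ _ lM'.
  rewrite (ipx _ _ _ (hx _ _ lM) lM').
  have W := gw_dist K v l v' l'.
  set D0 := normc (1 - (gw K v l)^* * _) in W *.
  have h0 := gh_gt0 v; have h0' := gh_gt0 v'.
  move: W; rewrite ge_max => /andP[W1 W2].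
  have D00 : 0 < D0 by lra.
  have mu0 : 0 < D0 / a by rewrite divr_gt0.
  have cdx w : normc w < 1 -> cderiv m (x v l) w =
      (gsq v * gh v ^+ m)%:C * (cderiv m (hker m (z v l)) w - cderiv m (hker m (z' v l)) w).
    move=> w1; rewrite -(ip_hker m (hx _ _ lM) w1) (ipZl HS _ (hd _ _ lM) (hker_H2 m w1)).
    rewrite (ipBl HS (hk _ _ lM) (hk' _ _ lM) (hker_H2 m w1)); congr (_ * (_ - _)).
      exact: (ip_hker m (hk _ _ lM) w1).
    exact: (ip_hker m (hk' _ _ lM) w1).
  have est w : normc w < 1 -> near_node K A w v' l' ->
      normc (cderiv m (x v l) w) <= gsq v * gh v ^+ m * (B * a ^+ (m + m).+2 * (dl * gh v) / D0 ^+ (m + m).+2).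
    move=> w1 nw; rewrite (cdx _ w1) ncM nc_real ger0_norm// ler_wpM2l//.
    have := hB _ _ _ _ z1 z2 w1 mu0 (near_dist A0 n1 nw) (near_dist A0 n2 nw).
    rewrite expr_div_n => H.
    rewrite ler_pdivlMr ?exprn_gt0//.
    have ap : 0 < a ^+ (m + m).+2 by rewrite exprn_gt0.
    have H2 : normc (cderiv m (hker m (z v l)) w - cderiv m (hker m (z' v l)) w) * D0 ^+ (m + m).+2
       <= B * normc (z v l - z' v l) * a ^+ (m + m).+2.
      by rewrite -ler_pdivrMr// -mulrA.
    apply: le_trans H2 _; rewrite [leRHS]mulrAC ler_wpM2r ?(ltW ap)// ler_wpM2l//.
  set Q := B * a ^+ (m + m).+2 * (dl * gh v) / D0 ^+ (m + m).+2 in est.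
  have e1 := est _ z1' n1'; have e2 := est _ z2' n2'.
  have := ncB (cderiv m (x v l) (z v' l')) (cderiv m (x v l) (z' v' l')).
  set X := normc (_ - _) => X2.
  have X3 : X <= 2 * (gsq v * gh v ^+ m * Q) by lra.
  apply: le_trans (ler_wpM2l (c0 v') X3) _.
  have pw : (gh v * gh v') ^+ m <= (D0 ^+ 2) ^+ m.
    by apply: lerXn2r; rewrite ?nnegrE ?mulr_ge0 ?sqr_ge0 ?(ltW h0) ?(ltW h0')//; nra.
  have -> : gsq v' * gh v' ^+ m * (2 * (gsq v * gh v ^+ m * Q)) =
     2 * B * a ^+ (m + m).+2 * dl * (gsq v * gsq v' * gh v) * ((gh v * gh v') ^+ m / D0 ^+ (m + m).+2).
    by rewrite /Q exprMn; ring.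
  rewrite -[leRHS]mulrA [leRHS]mulrA -[leRHS]mulrA || idtac.
  have pos : 0 <= 2 * B * a ^+ (m + m).+2 * dl * (gsq v * gsq v' * gh v).
    apply: mulr_ge0; last by apply: mulr_ge0; [apply: mulr_ge0; exact/ltW/gsq_gt0|exact: ltW].
    by apply: mulr_ge0 => //; apply: mulr_ge0; [exact: mulr_ge0|apply: exprn_ge0; exact: ltW].
  apply: le_trans (_ : 2 * B * a ^+ (m + m).+2 * dl * (gsq v * gsq v' * gh v) * (D0 ^+ 2)^-1 <= _).
    rewrite ler_wpM2l// ler_pdivrMr ?exprn_gt0//; apply: le_trans pw _.
    rewrite -exprM (_ : (m + m).+2 = 2 + 2 * m)%N; last by clear; lia.
    by rewrite exprD mulKf// gt_eqF// exprn_gt0.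
  by rewrite le_eqVlt; apply/orP; left; apply/eqP; ring.
have E : 0 <= 2 * B * a ^+ (m + m).+2 * dl.
  by apply: mulr_ge0 => //; apply: mulr_ge0; [exact: mulr_ge0|apply: exprn_ge0; exact: ltW].
(* The gain can be taken in either variable; using the one of smaller height turns the one-sided
   bound into the symmetric [gk]. *)
have entry v l v' l' : (l < gM K v)%N -> (l' < gM K v')%N ->
    normc (ip (x v l) (x v' l')) <= 2 * B * a ^+ (m + m).+2 * dl * (gk v v' / normc (1 - (gw K v l)^* * gw K v' l') ^+ 2).
  move=> lM lM'; have s1 := side _ _ _ _ lM lM'; have s2 := side _ _ _ _ lM' lM.
  rewrite /gk /Num.min; case: ifP => _; first exact: s1.
  rewrite (ips_conj HS (hx _ _ lM') (hx _ _ lM)) nc_conj; apply: le_trans s2 _.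
  rewrite [gsq v' * _]mulrC -(nc_conj (1 - (gw K v' l')^* * _)).
  by rewrite rmorphB rmorph1 rmorphM /= conjCK [gw K v' l' * _]mulrC.
have := grid_bessel V K2 E hx entry hf => H; apply: le_trans (le_trans _ H) _.
  by apply: ler_sum => v _; apply: ler_sum => l _; rewrite (ipx _ _ _ hf (ltn_ord l)) weight_sq.
by rewrite le_eqVlt; apply/orP; left; apply/eqP; ring.
Qed.

End Grid.

Lemma sum_blocks (R : nmodType) (F : nat -> R) M D :
  \sum_(j < M * D) F j = \sum_(l < M) \sum_(e < D) F (l * D + e)%N.
Proof.
elim: M => [|M ih]; first by rewrite mul0n !big_ord0.
by rewrite mulSnr big_split_ord /= ih big_ord_recr.
Qed.

Lemma ffact_ge_succ l n k : (k <= n)%N -> (l.+1 ^ k <= (l + n) ^_ k)%N.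
Proof.
elim: k => [|k ih] kn; first by rewrite expn0 ffactn0.
rewrite expnSr ffactnSr leq_mul ?ih ?(ltnW kn)//.
by rewrite -addnBA ?(ltnW kn)// -addn1 leq_add2l subn_gt0.
Qed.

Lemma large_nat (R : realType) (x c : R) : 0 < c -> exists K, (2 <= K)%N /\ x <= K%:R / 2 * c.
Proof.
move=> c0; exists (Num.trunc (x * 2 / c)).+2; split=> //.
have := truncnS_gt (x * 2 / c); rewrite ltr_pdivrMr// -[(Num.trunc _).+2%:R]natr1.
by set T := (Num.trunc _).+1%:R => h; lra.
Qed.

(** * The sampling theorem *)

Section Sampling.
Variable R : realType.
Local Notation C := R[i].
Local Notation H2 := (@hardy2 R).
Local Notation ip := (@hardy2_ip R).
Local Notation nrm := (ipnorm ip).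
Local Notation HS := (hardy2_ips R).
Local Notation tc := (@taylor_coef R).
Local Notation gh := (@gh R).

Lemma om_pow a b : (0 < a)%N -> (0 < b)%N -> om R (b * a) ^+ a = om R b.
Proof.
move=> a0 b0; rewrite /om cexpX; congr cexp; rewrite natrM; field.
by rewrite !pnatr_eq0 -!lt0n a0 b0.
Qed.

Lemma om_small a b s : (0 < a)%N -> (0 < b)%N -> (s < a)%N -> normc (om R (b * a) ^+ s - 1) <= 4 * pi / b%:R.
Proof.
move=> a0 b0 sa.
have step j : normc (om R (b * a) ^+ j - 1) <= j%:R * (4 * pi / (b * a)%:R).
  elim: j => [|j ih]; first by rewrite expr0 subrr nc0 mul0r.
  have -> : om R (b * a) ^+ j.+1 - 1 = (om R (b * a) ^+ j - 1) + om R (b * a) ^+ j * (om R (b * a) - 1).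
    by rewrite exprS; ring.
  apply: le_trans (ncD _ _) _; rewrite ncM nc_omX mul1r -natr1 mulrDl mul1r lerD//.
  exact: om_sub1.
apply: le_trans (step s) _; have pi0 : 0 <= pi :> R := pi_ge0 R.
apply: le_trans (_ : a%:R * (4 * pi / (b * a)%:R) <= _).
  by rewrite ler_wpM2r ?ler_nat ?(ltnW sa)// divr_ge0 ?mulr_ge0.
rewrite natrM le_eqVlt; apply/orP; left; apply/eqP; field.
by rewrite !pnatr_eq0 -!lt0n a0 b0.
Qed.

Lemma cderivB m f h z : H2 f -> H2 h -> normc z < 1 -> cderiv m (f - h) z = cderiv m f z - cderiv m h z.
Proof.
move=> hf hh z1; have hk := hker_H2 m z1.
rewrite -(ip_hker m (HB HS hf hh) z1) (ipBl HS hf hh hk).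
by congr (_ - _); exact: ip_hker.
Qed.

Lemma sq_split (a b : C) : normc a ^+ 2 <= 2 * normc b ^+ 2 + 2 * normc (a - b) ^+ 2.
Proof.
have := ncD (a - b) b; rewrite subrK; have := nc_ge0 a; have := nc_ge0 b; have := nc_ge0 (a - b).
set x := normc a; set y := normc b; set t := normc (a - b) => t0 y0 x0 h.
by have := sqr_ge0 (y - t); nra.
Qed.

(** The degree j is seen by the level whose height is comparable to 1 / (j + 1): there h (j + 1) >=
    1/2, and (1 - h)^(2 j) >= (1/4)^2. *)
Lemma level_weight n j : exists2 v, (v <= j)%N & 4^-1 ^+ n / 16 <= gh v ^+ (2 * n) * (1 - gh v) ^+ (2 * j) * (j.+1 ^ n)%:R ^+ 2.
Proof.
have /andP[t1 t2] := @trunc_log_bounds 2 j.+1 isT isT; set v := trunc_log 2 j.+1 in t1 t2.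
exists v; first by rewrite -ltnS; apply: leq_trans t1; exact: ltn_expl.
have h0 : 0 < gh v by exact: gh_gt0.
have hj : 1 / 2 <= gh v * j.+1%:R.
  have e : gh v * (2 ^ v)%:R = 1 / 2.
    have : (2 : R) ^+ v != 0 by rewrite expf_neq0// pnatr_eq0.
    by rewrite /gh natrX exprS exprVn; set q := 2 ^+ v; move: q => q q0; field.
  by rewrite -e ler_pM2l// ler_nat.
have p : 1 / 4 <= (1 - gh v) ^+ (2 ^ v.+1) by exact: (@hf_pow R v.+1).
have h2 := gh_le R v.
have pw : 1 / 16 <= (1 - gh v) ^+ (2 * j).
  apply: le_trans (_ : ((1 - gh v) ^+ (2 ^ v.+1)) ^+ 2 <= _); first by rewrite expr2; nra.
  rewrite -exprM; apply: ler_wiXn2l; [lra|lra|].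
  by rewrite mulnC leq_mul2r /=; exact: leq_trans (leqnSn _) (ltnW t2) || exact: ltnW (ltnW t2).
have -> : gh v ^+ (2 * n) * (1 - gh v) ^+ (2 * j) * (j.+1 ^ n)%:R ^+ 2 =
  ((gh v * j.+1%:R) ^+ 2) ^+ n * (1 - gh v) ^+ (2 * j).
  by rewrite natrX -(exprM (gh v * _)) exprMn -[(_ ^+ n) ^+ 2]exprM (mulnC n 2) mulrAC.
apply: ler_pM; rewrite ?exprn_ge0 ?invr_ge0//; last by rewrite -[16^-1]mul1r.
apply: lerXn2r; rewrite ?nnegrE ?sqr_ge0 ?invr_ge0//.
by rewrite expr2; nra.
Qed.

Section PolynomialSampling.
Variables (n K J : nat) (u : C -> C).
Hypotheses (K2 : (2 <= K)%N) (hu : H2 u) (u0 : forall j, (j < n)%N -> tc u j = 0) (uJ : forall j, (J <= j)%N -> tc u j = 0).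
Let a j : C := ((j + n) ^_ n)%:R * tc u (j + n)%N.

Lemma poly_cderiv z : normc z < 1 -> cderiv n u z = \sum_(j < J) a j * z ^+ j.
Proof.
move=> z1; apply: cconv_uniq (cderiv_csum n (hardy2_holo hu) z1) _.
apply/cconvP => e e0; exists J => N JN; rewrite -(subnKC JN) big_split_ord /=.
rewrite [X in _ + X - _]big1 ?addr0 ?subrr ?nc0 ?(ltW e0)// => j _.
by rewrite uJ ?mulr0 ?mul0r// -addnA leq_addr.
Qed.

Lemma poly_norm : nrm u ^+ 2 <= \sum_(j < J) normc (tc u (j + n)) ^+ 2.
Proof.
apply: nrm_sum_le => // N; apply: (@le_trans _ _ (\sum_(j < n + (J + N)) normc (tc u j) ^+ 2)).
  rewrite addnCA addnC addnA -addnA addnC [leRHS]big_split_ord /= || idtac.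
  by rewrite [(n + _)%N]addnCA addnA [(J + n + N)%N]addnC [leRHS]big_split_ord /= lerDl; apply: sumr_ge0 => *; exact: sqr_ge0.
rewrite big_split_ord /= big1 ?add0r => [|j _]; last by rewrite u0// nc0 expr0n.
rewrite big_split_ord /= [X in _ + X]big1 ?addr0 => [|j _].
  by rewrite le_eqVlt; apply/orP; left; apply/eqP; apply: eq_bigr => j _; rewrite addnC.
by rewrite uJ ?nc0 ?expr0n//; rewrite addnCA leq_addr.
Qed.

(** The 2^t rotated copies of a level together form all roots of unity of order 2^t times the level
    size, fine enough for an exact Parseval identity in degree below J. The factor K/2 is the level
    size times the height. *)
Lemma poly_mean V t : (J <= V)%N -> (J <= 2 ^ t)%N ->
  (2 ^ t)%:R * (K%:R / 2 * (4^-1 ^+ n / 16) * nrm u ^+ 2) <=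
  \sum_(s < 2 ^ t) \sum_(v < V) \sum_(l < gM K v) gh v ^+ (2 * n).+1 *
     normc (cderiv n u (gw R K v l * om R (gM K v * 2 ^ t) ^+ s)) ^+ 2.
Proof.
move=> JV Jt; have t0 : (0 < 2 ^ t)%N by rewrite expn_gt0.
rewrite exchange_big /=.
have lev v : \sum_(s < 2 ^ t) \sum_(l < gM K v) gh v ^+ (2 * n).+1 *
     normc (cderiv n u (gw R K v l * om R (gM K v * 2 ^ t) ^+ s)) ^+ 2 =
   (2 ^ t)%:R * (K%:R / 2 * (gh v ^+ (2 * n) * \sum_(j < J) normc (a j) ^+ 2 * (1 - gh v) ^+ (2 * j))).
  have M0 := gM_gt0 v K2; have h2 := gh_le R v; have h0 := gh_gt0 R v.
  rewrite exchange_big /=.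
  rewrite (eq_bigr (fun l : 'I_(gM K v) => \sum_(s < 2 ^ t) gh v ^+ (2 * n).+1 *
     normc (\sum_(j < J) (a j * (1 - gh v)%:C ^+ j) * (om R (gM K v * 2 ^ t) ^+ (l * 2 ^ t + s)%N) ^+ j) ^+ 2)); last first.
    move=> l _; apply: eq_bigr => s _; congr (_ * _ ^+ 2).
    have E : gw R K v l * om R (gM K v * 2 ^ t) ^+ s = (1 - gh v)%:C * om R (gM K v * 2 ^ t) ^+ (l * 2 ^ t + s).
      by rewrite /gw -mulrA -{1}(om_pow t0 M0) -exprM exprD [(2 ^ t * _)%N]mulnC.
    rewrite E poly_cderiv; last by rewrite ncM nc_omX mulr1 nc_real ger0_norm; lra.
    by congr normc; apply: eq_bigr => j _; rewrite exprMn mulrA.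
  rewrite -(sum_blocks (fun i => gh v ^+ (2 * n).+1 *
     normc (\sum_(j < J) (a j * (1 - gh v)%:C ^+ j) * (om R (gM K v * 2 ^ t) ^+ i) ^+ j) ^+ 2)).
  rewrite -mulr_sumr (parseval (fun j => a j * (1 - gh v)%:C ^+ j)); last first.
    by apply: leq_trans Jt _; exact: leq_pmull.
  have -> : \sum_(j < J) normc (a j * (1 - gh v)%:C ^+ j) ^+ 2 = \sum_(j < J) normc (a j) ^+ 2 * (1 - gh v) ^+ (2 * j).
    apply: eq_bigr => j _; rewrite ncM ncX nc_real ger0_norm; last by lra.
    by rewrite exprMn -exprM mulnC.
  rewrite natrM exprSr; have MH := gMh R K v; set S := \sum_(j < J) _.
  have -> : gh v ^+ (2 * n) * gh v * ((gM K v)%:R * (2 ^ t)%:R * S) =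
    (2 ^ t)%:R * (((gM K v)%:R * gh v) * (gh v ^+ (2 * n) * S)) by ring.
  by rewrite MH.
rewrite [leRHS](eq_bigr (fun v : 'I_V => (2 ^ t)%:R * (K%:R / 2 * (gh v ^+ (2 * n) *
    \sum_(j < J) normc (a j) ^+ 2 * (1 - gh v) ^+ (2 * j))))); last by move=> v _; exact: lev.
rewrite -mulr_sumr ler_wpM2l// -mulr_sumr -mulrA ler_wpM2l ?divr_ge0//.
under eq_bigr do rewrite mulr_sumr.
rewrite exchange_big /=; apply: le_trans (ler_wpM2l _ poly_norm) _.
  by rewrite divr_ge0 ?exprn_ge0 ?invr_ge0.
rewrite mulr_sumr; apply: ler_sum => j _.
have [v vj W] := level_weight n j.
have vV : (v < V)%N by apply: leq_ltn_trans vj _; exact: leq_trans JV.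
apply: (@le_trans _ _ (gh v ^+ (2 * n) * (normc (a j) ^+ 2 * (1 - gh v) ^+ (2 * j)))); last first.
  rewrite (bigD1 (Ordinal vV))//= lerDl; apply: sumr_ge0 => i _.
  have := gh_gt0 R i; have := gh_le R i => h2 h0.
  by rewrite mulr_ge0 ?exprn_ge0 ?(ltW h0)// mulr_ge0 ?sqr_ge0// exprn_ge0//; lra.
have h2 := gh_le R v; have h0 := gh_gt0 R v.
rewrite /a ncM nc_nat exprMn.
apply: le_trans (ler_wpM2r (sqr_ge0 _) W) _.
have -> : gh v ^+ (2 * n) * (((j + n) ^_ n)%:R ^+ 2 * normc (tc u (j + n)) ^+ 2 * (1 - gh v) ^+ (2 * j)) =
  gh v ^+ (2 * n) * (1 - gh v) ^+ (2 * j) * ((j + n) ^_ n)%:R ^+ 2 * normc (tc u (j + n)) ^+ 2 by ring.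
rewrite ler_wpM2r ?sqr_ge0// ler_wpM2l//.
  by rewrite mulr_ge0 ?exprn_ge0 ?(ltW h0)//; lra.
by apply: lerXn2r; rewrite ?nnegrE// ler_nat ffact_ge_succ.
Qed.

End PolynomialSampling.

Definition close_grid K (z : nat -> nat -> C) := forall v l, (l < gM K v)%N -> normc (z v l - gw R K v l) <= gh v / K%:R.

Lemma close_near K A z v l : (2 <= K)%N -> 1 <= A -> close_grid K z -> (l < gM K v)%N -> near_node K A (z v l) v l.
Proof.
move=> K2 A1 cz lM; have h := cz v l lM; have h0 := gh_gt0 R v.
have hK : gh v / K%:R <= gh v / 2.
  by rewrite ler_wpM2l ?(ltW h0)// lef_pV2 ?posrE ?ltr0n// ?ler_nat// ltnW.
split; last by apply: le_trans h _; nra.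
have := nc_sub_ge (z v l) (gw R K v l); rewrite nc_gw; lra.
Qed.

(** For polynomials the rotated grids have mean at least K c |u|^2 / 2. Passing from a rotated grid
    to [z] moves nodes by O(h / K), which by [diff_bessel] costs only C2 |u|^2 with [C2] independent
    of K. A large K makes the mean prevail. *)
Theorem sampling n : (0 < n)%N -> exists2 K, (2 <= K)%N & forall z, close_grid K z ->
  forall u, H2 u -> (forall j, (j < n)%N -> tc u j = 0) ->
  forall E : R, (forall V, \sum_(v < V) \sum_(l < gM K v) gh v ^+ (2 * n).+1 * normc (cderiv n u (z v l)) ^+ 2 <= E) ->
  nrm u ^+ 2 <= 4 * E.
Proof.
move=> n0; pose P : R := 4 * pi; have P0 : 0 <= P by rewrite mulr_ge0 ?pi_ge0.
pose A := P + 1; have A0 : 0 <= A by rewrite addr_ge0. have A1 : 1 <= A by rewrite lerDr.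
have [E0 E00 HE0] := @diff_bessel R n A A0; have [E1 E10 HE1] := @plain_bessel R n A n0 A0.
pose C2 := E0 * (1 + 2 * P); have C20 : 0 <= C2 by rewrite mulr_ge0// addr_ge0// mulr_ge0.
pose c : R := 4^-1 ^+ n / 16; have c0 : 0 < c by rewrite divr_gt0 ?exprn_gt0 ?invr_gt0 ?ltr0n.
(* The comparison reads K c |u|^2 / 2 <= 2 Nz + 2 C2 |u|^2, so this K yields |u|^2 <= Nz. *)
have [K [K2 Kc]] := large_nat (2 * C2 + 2) c0.
exists K => // z cz.
have Kp : (0 : R) < K%:R by rewrite ltr0n ltnW.
have K2' : (2 : R) <= K%:R by rewrite ler_nat.
have nz v l : (l < gM K v)%N -> near_node K A (z v l) v l by exact: close_near.
have poly u J V : H2 u -> (forall j, (j < n)%N -> tc u j = 0) -> (forall j, (J <= j)%N -> tc u j = 0) -> (J <= V)%N ->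
    nrm u ^+ 2 <= \sum_(v < V) \sum_(l < gM K v) gh v ^+ (2 * n).+1 * normc (cderiv n u (z v l)) ^+ 2.
  move=> hu u0 uJ JV; have := poly_mean K2 hu u0 uJ JV (ltnW (ltn_expl J (ltnSn 1))).
  set Nz := \sum_(v < V) _; set t := J => mean.
  have t0 : (0 < 2 ^ t)%N by rewrite expn_gt0.
  have each (s : 'I_(2 ^ t)) : \sum_(v < V) \sum_(l < gM K v) gh v ^+ (2 * n).+1 *
     normc (cderiv n u (gw R K v l * om R (gM K v * 2 ^ t) ^+ s)) ^+ 2 <= 2 * Nz + 2 * (C2 * nrm u ^+ 2).
    pose zt v l := gw R K v l * om R (gM K v * 2 ^ t) ^+ s.
    have Pm v : P / (gM K v)%:R = 2 * P / K%:R * gh v.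
      have M0 : (0 : R) < (gM K v)%:R by rewrite ltr0n gM_gt0.
      have e := gMh R K v; apply: (mulIf (lt0r_neq0 M0)); rewrite divfK ?lt0r_neq0//.
      have -> : 2 * P / K%:R * gh v * (gM K v)%:R = 2 * P / K%:R * ((gM K v)%:R * gh v) by ring.
      by rewrite e; field; rewrite gt_eqF.
    have zw v l : normc (zt v l - gw R K v l) <= 2 * P / K%:R * gh v.
      have -> : zt v l - gw R K v l = gw R K v l * (om R (gM K v * 2 ^ t) ^+ s - 1) by rewrite mulrBr mulr1.
      rewrite ncM -Pm; apply: le_trans (_ : 1 * (P / (gM K v)%:R) <= _); last by rewrite mul1r.
      apply: ler_pM; rewrite ?nc_ge0//; first by rewrite nc_gw; have := gh_gt0 R v; lra.
      by apply: om_small => //; exact: gM_gt0.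
    have nzt v l : (l < gM K v)%N -> near_node K A (zt v l) v l.
      move=> _; have h0 := gh_gt0 R v; split.
        by rewrite ncM nc_omX mulr1 nc_gw; lra.
      apply: le_trans (zw v l) _; rewrite ler_wpM2r ?(ltW h0)// ler_pdivrMr//.
      by rewrite /A; nra.
    have D0 : 0 <= (1 + 2 * P) / K%:R by rewrite divr_ge0// addr_ge0// mulr_ge0.
    have H3 v l : (l < gM K v)%N -> [/\ near_node K A (zt v l) v l, near_node K A (z v l) v l & normc (zt v l - z v l) <= (1 + 2 * P) / K%:R * gh v].
      move=> lM; split; [exact: nzt|exact: nz|].
      apply: le_trans (nc_dist _ (gw R K v l) _) _; rewrite (ncBC (gw R K v l)).
      have := zw v l; have := cz v l lM.
      have -> : (1 + 2 * P) / K%:R * gh v = 2 * P / K%:R * gh v + gh v / K%:R by field; rewrite gt_eqF.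
      lra.
    have := HE0 K V _ zt z K2 D0 H3 u hu; rewrite divfK ?gt_eqF// -/C2 => HD.
    apply: (@le_trans _ _ (2 * Nz + 2 * (\sum_(v < V) \sum_(l < gM K v) gh v ^+ (2 * n).+1 *
       normc (cderiv n u (zt v l) - cderiv n u (z v l)) ^+ 2))); last by lra.
    rewrite !mulr_sumr -big_split; apply: ler_sum => v _ /=; rewrite !mulr_sumr -big_split; apply: ler_sum => l _ /=.
    have g0 : 0 <= gh v ^+ (2 * n).+1 by rewrite exprn_ge0// ltW// gh_gt0.
    have := ler_wpM2l g0 (sq_split (cderiv n u (zt v l)) (cderiv n u (z v l))).
    lra.
  have tot := le_trans mean (ler_sum _ (fun s _ => each s)).
  rewrite sumr_const card_ord -[leRHS]mulr_natl ler_pM2l ?ltr0n// in tot.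
  have := ler_wpM2r (sqr_ge0 (nrm u)) Kc; rewrite -/c in tot.
  lra.
move=> u hu u0 E HE; apply/ler_addgt0Pr => e e0.
(* Two applications of (a + b)^2 <= 2 a^2 + 2 b^2, one for the norm and one for the samples, give
   the factor 4 on E and [Q] on the squared truncation error. *)
pose Q := 4 * (E1 * K%:R) + 2; have Q0 : 0 < Q by rewrite ltr_wpDl// !mulr_ge0.
pose d := Num.min 1 (e / Q); have d0 : 0 < d by rewrite lt_min ltr01 divr_gt0.
have [N HN] := trunc_cvg hu d0; have dN := HN N (leqnn N).
have [hT tT] := trunc_H2 N u; have hD : H2 (u - trunc N u) by exact: (HB HS).
have T0 j : (j < n)%N -> tc (trunc N u) j = 0 by move=> jn; rewrite tT u0//; case: ifP.
have TN j : (N <= j)%N -> tc (trunc N u) j = 0 by move=> Nj; rewrite tT ltnNge Nj.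
have pT := poly _ N N hT T0 TN (leqnn N).
have B1 := HE1 K N z K2 nz _ hD.
have pT2 : nrm (trunc N u) ^+ 2 <= 2 * E + 2 * (E1 * K%:R * nrm (u - trunc N u) ^+ 2).
  apply: le_trans pT _.
  apply: (@le_trans _ _ (2 * (\sum_(v < N) \sum_(l < gM K v) gh v ^+ (2 * n).+1 * normc (cderiv n u (z v l)) ^+ 2) +
    2 * (\sum_(v < N) \sum_(l < gM K v) gh v ^+ (2 * n).+1 * normc (cderiv n (u - trunc N u) (z v l)) ^+ 2))).
    rewrite !mulr_sumr -big_split; apply: ler_sum => v _ /=; rewrite !mulr_sumr -big_split; apply: ler_sum => l _ /=.
    have g0 : 0 <= gh v ^+ (2 * n).+1 by rewrite exprn_ge0// ltW// gh_gt0.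
    have z1 := near_disk (nz v l (ltn_ord l)).
    rewrite (cderivB n hu hT z1) (ncBC (cderiv n u _)).
    have := ler_wpM2l g0 (sq_split (cderiv n (trunc N u) (z v l)) (cderiv n u (z v l))).
    lra.
  have := HE N; lra.
have tri : nrm u <= nrm (trunc N u) + nrm (u - trunc N u).
  by have := nrmD HS hT hD; rewrite addrC subrK.
have d2 : nrm (u - trunc N u) ^+ 2 <= e / Q.
  have x0 := nrm_ge0 ip (u - trunc N u); move: dN; rewrite le_min => /andP[y1 y2]; nra.
have eQ : Q * (e / Q) = e by rewrite mulrC divfK// gt_eqF.
have := nrm_ge0 ip u; have := nrm_ge0 ip (trunc N u); have := nrm_ge0 ip (u - trunc N u).
set x := nrm (u - _) in d2 tri pT2 *; set y := nrm (trunc N u) in tri pT2 *; set w := nrm u in tri * => x0 y0 w0.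
have w2 : w ^+ 2 <= 2 * y ^+ 2 + 2 * x ^+ 2 by have := sqr_ge0 (y - x); nra.
have Qx : Q * x ^+ 2 <= e by rewrite -eQ ler_wpM2l// ltW.
by rewrite /Q in Qx; lra.
Qed.

End Sampling.

(** * From p-th power sums to square sums on the tree *)

Section TreeSums.
Variable R : realType.

Lemma sum_p_le (x : R) (p : R) : 0 < p -> p <= 2 -> 0 <= x <= 1 -> x ^+ 2 <= x `^ p.
Proof.
move=> p0 p2 /andP[x0 x1]; rewrite -powR_mulrn//.
have [->|xn] := eqVneq x 0; first by rewrite powR0// powR_ge0.
by apply: ger_powR => //; rewrite x1 andbT lt_def xn.
Qed.

Lemma sq_le_one_powR (x p : R) : 2 < p -> 0 <= x -> x ^+ 2 <= 1 + x `^ p.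
Proof.
move=> p2 x0; have [x1|x1] := leP x 1.
  by apply: le_trans (_ : 1 <= _); [rewrite expr_le1|rewrite lerDl powR_ge0].
rewrite -powR_mulrn//; apply: le_trans (_ : x `^ p <= _); last by rewrite lerDr.
by apply: ler_powR; exact: ltW.
Qed.

Lemma powRX (x p : R) d : 0 <= x -> (x ^+ d) `^ p = (x `^ p) ^+ d.
Proof.
move=> x0; elim: d => [|d ih]; first by rewrite !expr0 powR1.
by rewrite !exprS powRM ?exprn_ge0// ih.
Qed.

(** A node has 2^d descendants at depth d. The discount q^d is chosen so that their square sum stays
    below 2^d by the geometric factor th^(2 d), which makes the tree operator summable over depths
    for every p. *)
Lemma family_power (p : R) : 0 < p -> exists q th : R, [/\ 0 < q < 1, 0 < th < 1 &
  forall d (x : nat -> R) (tau : R), (forall i, 0 <= x i) -> 0 < tau ->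
    q ^+ d * (\sum_(e < 2 ^ d) x e `^ p) <= tau `^ p ->
    \sum_(e < 2 ^ d) x e ^+ 2 <= 2 * tau ^+ 2 * (2 * th ^+ 2) ^+ d].
Proof.
move=> p0; have [p2|p2] := leP p 2.
  (* For p <= 2, with q = k^-p, the p-sum is at most y^p for y = tau k^d, hence the square sum at
     most y^2; 15/16 is admissible since (5/4)^2 <= 2 (15/16)^2. *)
  pose k : R := 5 / 4; have k0 : 0 < k by rewrite divr_gt0.
  have k1 : 1 < k by rewrite /k; lra.
  have kp : 1 < k `^ p.
    have : 1 `^ p < k `^ p by apply: (gt0_ltr_powR p0) => //; rewrite nnegrE// ltW.
    by rewrite powR1.
  exists (k `^ p)^-1, (15 / 16); split.
  - by apply/andP; split; [rewrite invr_gt0 powR_gt0|rewrite invf_lt1 ?powR_gt0].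
  - by apply/andP; split; lra.
  move=> d x tau x0 tau0 H; pose y := tau * k ^+ d.
  have y0 : 0 < y by rewrite mulr_gt0// exprn_gt0.
  have kd : 0 < (k `^ p) ^+ d by rewrite exprn_gt0// powR_gt0.
  have yp : y `^ p = tau `^ p * (k `^ p) ^+ d by rewrite powRM ?exprn_ge0 ?(ltW tau0) ?(ltW k0)// powRX// ltW.
  have S : \sum_(e < 2 ^ d) x e `^ p <= y `^ p.
    by rewrite yp -ler_pdivrMr// mulrC -exprVn.
  have xy (e : 'I_(2 ^ d)) : x e <= y.
    rewrite leNgt; apply/negP => lt; have : y `^ p < x e `^ p.
      by apply: (gt0_ltr_powR p0) => //; rewrite nnegrE ?x0 ?ltW.
    rewrite ltNge => /negP; apply; apply: le_trans S.
    by rewrite (bigD1 e)//= lerDl; apply: sumr_ge0 => i _; exact: powR_ge0.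
  have y2 : y ^+ 2 <= 2 * tau ^+ 2 * (2 * (15 / 16) ^+ 2) ^+ d.
    rewrite exprMn -exprM mulnC exprM -mulrA [leRHS]mulrCA ler_wpM2l ?sqr_ge0//.
    apply: le_trans (_ : (2 * (15 / 16) ^+ 2) ^+ d <= _).
      have a2 : k ^+ 2 <= 2 * (15 / 16) ^+ 2 by rewrite /k !expr2; lra.
      have a1 := le_trans (sqr_ge0 k) a2.
      by apply: lerXn2r => //; rewrite nnegrE ?sqr_ge0.
    by rewrite ler_peMl ?exprn_ge0 ?mulr_ge0 ?sqr_ge0// ler1n.
  apply: le_trans y2; apply: (@le_trans _ _ (\sum_(e < 2 ^ d) y ^+ 2 * (x e `^ p / y `^ p))).
    apply: ler_sum => e _; have xe : 0 <= x e / y <= 1.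
      by rewrite divr_ge0 ?(ltW y0)//= ler_pdivrMr// mul1r.
    have := sum_p_le p0 p2 xe; rewrite expr_div_n powRM ?invr_ge0 ?(ltW y0)// => h.
    have yi : (y^-1) `^ p = (y `^ p)^-1.
      by apply: (mulIf (lt0r_neq0 (powR_gt0 p y0))); rewrite -powRM ?invr_ge0 ?(ltW y0)// !mulVf ?gt_eqF ?powR_gt0// powR1.
    by rewrite yi ler_pdivrMr ?exprn_gt0// mulrC in h.
  rewrite -mulr_sumr -mulr_suml ler_piMr ?sqr_ge0// ler_pdivrMr ?powR_gt0// mul1r//.
(* For p > 2 the inequality x^2 <= 1 + x^p is applied to x / y. The choice k^p = 2/3 with q = 3/4
   bounds the p-sum by 2^d y^p, so both terms contribute at most 2^d y^2. *)
pose k : R := (2 / 3) `^ p^-1; have k0 : 0 < k by rewrite powR_gt0// divr_gt0.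
have kp : k `^ p = 2 / 3 by rewrite -powRrM mulVf ?gt_eqF// powRr1// divr_ge0.
have k1 : k < 1.
  rewrite ltNge; apply/negP => h; have : 1 `^ p <= k `^ p by apply: (le_powR p0).
  by rewrite powR1 kp; lra.
exists (3 / 4), k; split; [by apply/andP; split; lra|by rewrite k0|].
move=> d x tau x0 tau0 H; pose y := tau * k ^+ d.
have y0 : 0 < y by rewrite mulr_gt0// exprn_gt0.
have yp : y `^ p = tau `^ p * (2 / 3) ^+ d.
  by rewrite powRM ?exprn_ge0 ?(ltW tau0) ?(ltW k0)// powRX ?(ltW k0)// kp.
have tp : 0 < tau `^ p by rewrite powR_gt0.
have S : \sum_(e < 2 ^ d) x e `^ p <= y `^ p * 2 ^+ d.
  rewrite yp -mulrA -exprMn (_ : 2 / 3 * 2 = (3 / 4)^-1); last by field.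
  by rewrite exprVn ler_pdivlMr ?exprn_gt0 ?divr_gt0// mulrC.
have -> : 2 * tau ^+ 2 * (2 * k ^+ 2) ^+ d = y ^+ 2 * (2 ^+ d + 2 ^+ d).
  by rewrite [(2 * _) ^+ d]exprMn /y [(tau * _) ^+ 2]exprMn -(exprM k 2 d) -(exprM k d 2) (mulnC 2 d); ring.
apply: (@le_trans _ _ (\sum_(e < 2 ^ d) y ^+ 2 * (1 + x e `^ p / y `^ p))).
  apply: ler_sum => e _; have xe : 0 <= x e / y by rewrite divr_ge0 ?(ltW y0).
  have := sq_le_one_powR p2 xe; rewrite expr_div_n powRM ?invr_ge0 ?(ltW y0)// => h.
  have yi : (y^-1) `^ p = (y `^ p)^-1.
    by apply: (mulIf (lt0r_neq0 (powR_gt0 p y0))); rewrite -powRM ?invr_ge0 ?(ltW y0)// !mulVf ?gt_eqF ?powR_gt0// powR1.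
  by rewrite yi ler_pdivrMr ?exprn_gt0// mulrC in h.
rewrite -mulr_sumr ler_wpM2l ?sqr_ge0// big_split /= sumr_const card_ord natrX lerD//.
by rewrite -mulr_suml ler_pdivrMr ?powR_gt0// mulrC.
Qed.

End TreeSums.

(** * The weighted tree operator *)

Section Tree.
Variable R : realType.
Local Notation C := R[i].
Local Notation gh := (@gh R).

Lemma sum_shift_le (f : nat -> R) d V : (forall v, 0 <= f v) ->
  \sum_(v < V) (if (d <= v)%N then f v else 0) <= \sum_(v < V) f (v + d)%N.
Proof.
move=> f0; apply: (@le_trans _ _ (\sum_(v < V + d) (if (d <= v)%N then f v else 0))).
  by rewrite [leRHS]big_split_ord /= lerDl; apply: sumr_ge0 => i _; case: ifP.
rewrite addnC big_split_ord /= big1 ?add0r; last by move=> i _; rewrite leqNgt ltn_ord.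
by apply: ler_sum => i _; rewrite leq_addr addnC.
Qed.

Lemma triangle_sum (f : nat -> nat -> R) V : (forall v d, 0 <= f v d) ->
  \sum_(v < V) \sum_(d < v.+1) f v d <= \sum_(v < V) \sum_(d < V) f (v + d)%N d.
Proof.
move=> f0; rewrite [leRHS]exchange_big /=.
rewrite (eq_bigr (fun v : 'I_V => \sum_(d < V) if (d <= v)%N then f v d else 0)); last first.
  by move=> v _; rewrite (big_ord_widen V (f v) (ltn_ord v)) big_mkcond.
rewrite exchange_big /=; apply: ler_sum => d _.
exact: (@sum_shift_le (fun v => f v d)).
Qed.

(** Cauchy-Schwarz with the geometric weights th^d, whose sum is at most 1 / (1 - th). *)
Lemma weighted_square (th : R) (x : nat -> R) N : 0 < th < 1 ->
  (\sum_(d < N) x d) ^+ 2 <= (1 - th)^-1 * \sum_(d < N) th ^- d * x d ^+ 2.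
Proof.
move=> /andP[t0 t1]; have s0 : 0 < 1 - th by rewrite subr_gt0.
elim: N x => [|N ih] x; first by rewrite !big_ord0 expr0n mulr0.
rewrite !big_ord_recl /= expr0 invr1 mul1r.
have key (a b : R) : (a + b) ^+ 2 <= (1 - th)^-1 * a ^+ 2 + th^-1 * b ^+ 2.
  rewrite -subr_ge0.
  have -> : (1 - th)^-1 * a ^+ 2 + th^-1 * b ^+ 2 - (a + b) ^+ 2 = (th * a - (1 - th) * b) ^+ 2 / ((1 - th) * th).
    by field; rewrite !gt_eqF.
  by rewrite divr_ge0 ?sqr_ge0// mulr_ge0 ?ltW.
apply: le_trans (key _ _) _; rewrite mulrDr lerD2l.
have := ih (fun d => x d.+1) => h.
apply: le_trans (_ : th^-1 * ((1 - th)^-1 * \sum_(d < N) th ^- d * x d.+1 ^+ 2) <= _).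
  by rewrite ler_wpM2l ?invr_ge0 ?(ltW t0).
rewrite mulrCA ler_wpM2l ?invr_ge0 ?(ltW s0)// mulr_sumr; apply: ler_sum => d _.
by rewrite mulrA -invfM -exprS.
Qed.

Lemma gMD K v d : gM K (v + d) = (gM K v * 2 ^ d)%N.
Proof. by rewrite /gM expnD mulnA. Qed.

Variables (K : nat) (p q th A : R) (G : nat -> nat -> R).
Hypotheses (p0 : 0 < p) (q01 : 0 < q < 1) (th01 : 0 < th < 1).
Hypothesis fam : forall d (x : nat -> R) (tau : R), (forall i, 0 <= x i) -> 0 < tau ->
    q ^+ d * (\sum_(e < 2 ^ d) x e `^ p) <= tau `^ p ->
    \sum_(e < 2 ^ d) x e ^+ 2 <= 2 * tau ^+ 2 * (2 * th ^+ 2) ^+ d.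
Hypothesis G0 : forall v l, 0 <= G v l.
Hypothesis GA : forall V, \sum_(v < V) \sum_(l < gM K v) G v l `^ p <= A.

(** Discounted p-th powers of the weights of the node and its descendants to depth less than V. *)
Definition dsum V v l : R := \sum_(d < V) q ^+ d * \sum_(e < 2 ^ d) G (v + d) (l * 2 ^ d + e) `^ p.

Lemma dterm_ge0 v l d : 0 <= q ^+ d * \sum_(e < 2 ^ d) G (v + d) (l * 2 ^ d + e) `^ p.
Proof.
by rewrite mulr_ge0 ?exprn_ge0 ?(ltW (andP q01).1)//; apply: sumr_ge0 => *; exact: powR_ge0.
Qed.

Lemma dsum_ge0 V v l : 0 <= dsum V v l.
Proof. by apply: sumr_ge0 => d _; exact: dterm_ge0. Qed.

Lemma dsum_mono V V' v l : (V <= V')%N -> dsum V v l <= dsum V' v l.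
Proof.
move=> le; rewrite /dsum -(subnKC le) [leRHS]big_split_ord /= lerDl; apply: sumr_ge0 => d _; exact: dterm_ge0.
Qed.

(** Each weight is counted once for each of its ancestors, with the factor q^d at distance d. *)
Lemma dsum_total V V' : \sum_(v < V) \sum_(l < gM K v) dsum V' v l <= A / (1 - q).
Proof.
have A0 : 0 <= A by apply: le_trans (GA 0); rewrite big_ord0.
have -> : \sum_(v < V) \sum_(l < gM K v) dsum V' v l =
   \sum_(d < V') q ^+ d * \sum_(v < V) \sum_(l < gM K (v + d)) G (v + d)%N l `^ p.
  rewrite /dsum; under eq_bigr do rewrite exchange_big /=.
  rewrite exchange_big /=; apply: eq_bigr => d _; rewrite mulr_sumr; apply: eq_bigr => v _.
  by rewrite -mulr_sumr gMD (sum_blocks (fun l => G (v + d)%N l `^ p)).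
apply: (@le_trans _ _ (\sum_(d < V') q ^+ d * A)).
  apply: ler_sum => d _; rewrite ler_wpM2l ?exprn_ge0 ?(ltW (andP q01).1)//.
  apply: le_trans (GA (V + d)); rewrite [in leRHS]addnC [leRHS]big_split_ord /=.
  rewrite [X in X <= _](eq_bigr (fun v : 'I_V => \sum_(l < gM K (d + v)) G (d + v)%N l `^ p)); last by move=> v _; rewrite addnC.
  by rewrite lerDr; apply: sumr_ge0 => v _; apply: sumr_ge0 => *; exact: powR_ge0.
rewrite -mulr_suml mulrC ler_wpM2l//; apply: geo_sum_le.
by case/andP: q01 => q0 ->; rewrite ltW.
Qed.

Definition box V : seq (nat * nat) := [seq (v, l) | v <- iota 0 V, l <- iota 0 (gM K v)].
Definition bad (tau : R) V := [seq i <- box V | tau `^ p < dsum V i.1 i.2].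

Lemma mem_box V v l : ((v, l) \in box V) = ((v < V) && (l < gM K v))%N.
Proof.
apply/allpairsPdep/andP => [[v' [l' [h1 h2 [-> ->]]]]|[h1 h2]].
  by move: h1 h2; rewrite !mem_iota.
by exists v, l; rewrite !mem_iota.
Qed.

Lemma uniq_box V : uniq (box V).
Proof.
apply: allpairs_uniq_dep => [|v _|[v l] [v' l'] _ _ [-> ->]//]; exact: iota_uniq.
Qed.

Lemma sum_box V (f : nat -> nat -> R) : \sum_(i <- box V) f i.1 i.2 = \sum_(v < V) \sum_(l < gM K v) f v l.
Proof.
rewrite big_allpairs_dep; have E m : iota 0 m = index_iota 0 m by rewrite /index_iota subn0.
rewrite E big_mkord; apply: eq_bigr => v _; by rewrite E big_mkord.
Qed.

Lemma bad_mono tau V V' : (V <= V')%N -> {subset bad tau V <= bad tau V'}.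
Proof.
move=> le [v l]; rewrite !mem_filter /= !mem_box => /andP[h1 /andP[h2 h3]].
by rewrite (lt_le_trans h1 (dsum_mono _ _ le)) (leq_trans h2 le) h3.
Qed.

Lemma bad_size tau V : 0 < tau -> (size (bad tau V))%:R * tau `^ p <= A / (1 - q).
Proof.
move=> t0; apply: le_trans (dsum_total V V); rewrite -(sum_box V (dsum V)).
rewrite /bad; elim: (box V) => [|i s ih] /=; first by rewrite big_nil mul0r.
rewrite big_cons; case: ifP => h /=.
  by rewrite -natr1 mulrDl mul1r addrC lerD// ltW.
by apply: le_trans ih _; rewrite lerDr; exact: dsum_ge0.
Qed.

(** The bad sets increase with V and their sizes are bounded by [bad_size]; a V0 of maximal size
    already contains every node that is bad for some V. *)
Lemma bad_stable tau : 0 < tau -> exists V0, forall v l, (l < gM K v)%N -> (v, l) \notin bad tau V0 ->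
  forall V, dsum V v l <= tau `^ p.
Proof.
move=> t0; have tp : 0 < tau `^ p by rewrite powR_gt0.
pose P m : bool := `[< exists V, size (bad tau V) = m >].
have exP : exists m, P m by exists (size (bad tau 0)); apply/asboolP; exists 0%N.
have ubP m : P m -> (m <= Num.trunc (A / (1 - q) / tau `^ p))%N.
  move=> /asboolP[V <-]; have := bad_size V t0; rewrite -ler_pdivlMr// => h.
  by rewrite -ltnS -(ltr_nat R); apply: le_lt_trans h (truncnS_gt _).
case: (ex_maxnP exP ubP) => m /asboolP[V0 <-] mx; exists V0 => v l lM nb V.
rewrite leNgt; apply/negP => gt; pose V1 := maxn V0 (maxn V v.+1).
have b1 : (v, l) \in bad tau V1.
  rewrite mem_filter mem_box lM andbT /=; apply/andP; split.
    by apply: lt_le_trans gt (dsum_mono _ _ _); rewrite !leq_max leqnn orbT.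
  by rewrite !leq_max leqnn !orbT.
have u : uniq ((v, l) :: bad tau V0) by rewrite /= nb filter_uniq ?uniq_box.
have sub : {subset (v, l) :: bad tau V0 <= bad tau V1}.
  by move=> i; rewrite inE => /orP[/eqP->//|]; apply: bad_mono; rewrite leq_max leqnn.
have := uniq_leq_size u sub; rewrite /= ltnNge => /negP; apply; apply: mx; apply/asboolP; by exists V1.
Qed.

(** A weighted square of the sum over ancestors is turned, by exchanging sums, into a sum over
    descendants of the node carrying the increment. Bad nodes have increment 0; at good nodes
    [family_power] bounds the square sum of the weights. *)
Lemma tree_schur k tau (D : nat -> nat -> C) V : 0 < tau ->
  (forall v l, (l < gM K v)%N -> D v l = 0 \/ forall V, dsum V v l <= tau `^ p) ->
  \sum_(v < V) \sum_(l < gM K v) gh v ^+ (2 * k).+1 * (G v l ^+ 2 * normc (\sum_(d < v.+1) D (v - d)%N (l %/ 2 ^ d)%N) ^+ 2)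
  <= 2 / (1 - th) ^+ 2 * tau ^+ 2 * \sum_(v < V) \sum_(l < gM K v) gh v ^+ (2 * k).+1 * normc (D v l) ^+ 2.
Proof.
move=> t0 good; have /andP[th0 th1] := th01; have s0 : 0 < 1 - th by rewrite subr_gt0.
pose f v d := \sum_(l < gM K v) gh v ^+ (2 * k).+1 * (G v l ^+ 2 * (th ^- d * normc (D (v - d)%N (l %/ 2 ^ d)%N) ^+ 2)).
have g0 v : 0 <= gh v ^+ (2 * k).+1 by rewrite exprn_ge0// ltW// gh_gt0.
have f0 v d : 0 <= f v d.
  apply: sumr_ge0 => l _; apply: mulr_ge0 => //; apply: mulr_ge0; first exact: sqr_ge0.
  by apply: mulr_ge0; [rewrite invr_ge0 exprn_ge0 ?(ltW th0)|exact: sqr_ge0].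
apply: (@le_trans _ _ ((1 - th)^-1 * \sum_(v < V) \sum_(d < v.+1) f v d)).
  rewrite mulr_sumr; apply: ler_sum => v _; rewrite /f exchange_big mulr_sumr; apply: ler_sum => l _ /=.
  pose X d := th ^- d * normc (D (v - d)%N (l %/ 2 ^ d)%N) ^+ 2.
  have -> : \sum_(d < v.+1) gh v ^+ (2 * k).+1 * (G v l ^+ 2 * X d) = gh v ^+ (2 * k).+1 * (G v l ^+ 2 * \sum_(d < v.+1) X d).
    by rewrite !mulr_sumr.
  have EE (a b c S : R) : 0 <= a -> 0 <= b -> c <= (1 - th)^-1 * S -> a * (b * c) <= (1 - th)^-1 * (a * (b * S)).
    move=> a0 b0 h; have -> : (1 - th)^-1 * (a * (b * S)) = a * (b * ((1 - th)^-1 * S)) by ring.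
    by apply: ler_wpM2l => //; exact: ler_wpM2l.
  apply: EE; [exact: g0|exact: sqr_ge0|].
  apply: le_trans (weighted_square (fun d => normc (D (v - d)%N (l %/ 2 ^ d)%N)) v.+1 th01).
  by apply: lerXn2r; rewrite ?nnegrE ?nc_ge0 ?nc_sum//; apply: sumr_ge0 => *; exact: nc_ge0.
have -> : 2 / (1 - th) ^+ 2 = (1 - th)^-1 * (2 * (1 - th)^-1) by rewrite expr2 invfM mulrCA.
rewrite -2!mulrA ler_wpM2l ?invr_ge0 ?(ltW s0)//.
apply: le_trans (triangle_sum _ f0) _; rewrite [leRHS]mulrA mulr_sumr; apply: ler_sum => v _.
pose w d := \sum_(l < gM K v) gh v ^+ (2 * k).+1 * normc (D v l) ^+ 2 *
    ((2 * th) ^- d * \sum_(e < 2 ^ d) G (v + d)%N (l * 2 ^ d + e)%N ^+ 2).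
have fE d : f (v + d)%N d <= w d.
  rewrite /w /f gMD (sum_blocks (fun l => gh (v + d) ^+ (2 * k).+1 *
     (G (v + d)%N l ^+ 2 * (th ^- d * normc (D (v + d - d)%N (l %/ 2 ^ d)%N) ^+ 2)))).
  apply: ler_sum => l _; rewrite mulr_sumr mulr_sumr; apply: ler_sum => e _.
  rewrite addnK divnMDl ?expn_gt0// divn_small ?ltn_ord// addn0.
  (* One factor of the height supplies 2^-d, which pays for the 2^d descendants; for k = 0 it is the
     only one. *)
  have gd : gh (v + d) ^+ (2 * k).+1 <= gh v ^+ (2 * k).+1 * 2 ^- d.
    rewrite ghD exprMn ler_wpM2l// -exprVn exprS ler_piMr ?exprn_ge0 ?invr_ge0//.
    by rewrite exprn_ile1 ?exprn_ge0 ?invr_ge0// exprn_ile1 ?invr_ge0// invf_le1// ler1n.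
  rewrite exprMn invfM.
  apply: (@le_trans _ _ (gh v ^+ (2 * k).+1 * 2 ^- d * (G (v + d)%N (l * 2 ^ d + e)%N ^+ 2 * (th ^- d * normc (D v l) ^+ 2)))).
    rewrite ler_wpM2r//; apply: mulr_ge0; first exact: sqr_ge0.
    by apply: mulr_ge0; [rewrite invr_ge0 exprn_ge0 ?(ltW th0)|exact: sqr_ge0].
  by rewrite le_eqVlt; apply/orP; left; apply/eqP; ring.
apply: (@le_trans _ _ (\sum_(d < V) w d)); first by apply: ler_sum => d _; exact: fE.
rewrite /w exchange_big /= mulr_sumr; apply: ler_sum => l _.
rewrite -mulr_sumr mulrC; have [->|gd] := good v l (ltn_ord l).
  by rewrite nc0 expr2 !mulr0.
apply: ler_wpM2r; first by apply: mulr_ge0 => //; exact: sqr_ge0.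
(* (2 th^2)^d from the descendants against (2 th)^-d from the weights leaves th^d, summable over the
   depth. *)
apply: (@le_trans _ _ (\sum_(d < V) 2 * tau ^+ 2 * th ^+ d)).
  apply: ler_sum => d _.
  have dq : q ^+ d * (\sum_(e < 2 ^ d) G (v + d)%N (l * 2 ^ d + e)%N `^ p) <= tau `^ p.
    apply: le_trans (gd d.+1); rewrite /dsum big_ord_recr /= lerDr.
    by apply: sumr_ge0 => i _; exact: dterm_ge0.
  have H := fam (x := fun e => G (v + d)%N (l * 2 ^ d + e)%N) (fun e => G0 _ _) t0 dq.
  have t2 : 0 < (2 * th) ^+ d by rewrite exprn_gt0// mulr_gt0.
  rewrite mulrC ler_pdivrMr//; apply: le_trans H _; rewrite -[leRHS]mulrA -exprMn.
  by rewrite le_eqVlt; apply/orP; left; apply/eqP; congr (_ * _ ^+ _); ring.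
rewrite -mulr_sumr mulrAC ler_wpM2r ?sqr_ge0// ler_wpM2l//.
by apply: geo_sum_le; rewrite (ltW th0).
Qed.

End Tree.

(** * Choice of sample points from the Besov integral *)

Section Selection.
Variable R : realType.
Local Notation C := R[i].
Local Notation gh := (@gh R).
Local Notation mu := (@lebesgue_measure R \x @lebesgue_measure R)%E.

(** Different levels are separated by their radii, and one level by [om_dist]. This makes the
    squares [Q] of half-side h / (4 K) disjoint. *)
Lemma gw_separated K v l v' l' : (2 <= K)%N -> (l < gM K v)%N -> (l' < gM K v')%N -> (v, l) != (v', l') ->
  (gh v + gh v') / (2 * K%:R) < normc (gw R K v l - gw R K v' l').
Proof.
move=> K2; wlog vv : v l v' l' / (v <= v')%N.
  move=> W; have [le|/ltnW le] := leqP v v'; first exact: W.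
  by move=> h1 h2 ne; rewrite addrC ncBC; apply: W => //; rewrite eq_sym.
move=> h1 h2 ne; have K2' : (2 : R) <= K%:R by rewrite ler_nat.
have Kp : (0 : R) < K%:R by apply: lt_le_trans K2'.
have g0 := gh_gt0 R v; have g0' := gh_gt0 R v'; have g2 := gh_le R v.
move: vv; rewrite leq_eqVlt => /orP[/eqP e|lt]; last first.
  have half : gh v' <= gh v / 2.
    rewrite -(subnKC lt) -addSnnS || idtac.
    have := gh_mono R v.+1 (v' - v.+1); rewrite subnKC// => h; apply: le_trans h _.
    by rewrite -[v.+1]addn1 ghD expr1.
  apply: lt_le_trans (_ : gh v / 2 <= _).
    rewrite ltr_pdivrMr ?mulr_gt0//; nra.
  have := nc_sub_ge (gw R K v' l') (gw R K v l); rewrite !nc_gw ncBC; lra.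
subst v'; have M0 : (0 : R) < (gM K v)%:R by rewrite ltr0n gM_gt0.
have MH := gMh R K v.
have gK : gh v / K%:R = 1 / 2 / (gM K v)%:R.
  by apply: (mulIf (lt0r_neq0 M0)); rewrite divfK ?lt0r_neq0// mulrAC [gh v * _]mulrC MH; field; rewrite gt_eqF.
have -> : (gh v + gh v) / (2 * K%:R) = gh v / K%:R by field; rewrite gt_eqF.
have key a b : (a < b)%N -> (b < gM K v)%N -> gh v / K%:R < normc (gw R K v a - gw R K v b).
  move=> ab bM; have -> : gw R K v a - gw R K v b = (1 - gh v)%:C * om R (gM K v) ^+ a * (1 - om R (gM K v) ^+ (b - a)).
    by rewrite /gw -{1}(subnKC (ltnW ab)) exprD; ring.
  rewrite !ncM nc_omX mulr1 nc_real ger0_norm; last by lra.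
  have cond : (0 < b - a < gM K v)%N by rewrite subn_gt0 ab (leq_ltn_trans (leq_subr _ _) bM).
  have := om_dist R cond; rewrite ncBC => d; rewrite gK.
  have i0 : 0 < (gM K v)%:R^-1 :> R by rewrite invr_gt0.
  by nra.
have [lt|gt|eq] := ltngtP l l'; [exact: key|by rewrite ncBC; exact: key|].
by move: ne; rewrite eq eqxx.
Qed.

Variables (g : C -> C) (m K : nat) (p : R).
Hypotheses (p0 : 0 < p) (K2 : (2 <= K)%N) (hb : besov p m g).
Local Notation Gam := (cderiv m g).
Let Psi (z : C) : R := normc (Gam z) `^ p * (1 - normc z) `^ (m%:R * p) / (1 - normc z) ^+ 2.
Let rr v : R := gh v / (4 * K%:R).
Let Q v l : set (R * R) := square (complex.Re (gw R K v l)) (complex.Im (gw R K v l)) (rr v).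

Lemma rr_gt0 v : 0 < rr v.
Proof. by rewrite divr_gt0 ?gh_gt0// mulr_gt0// ltr0n ltnW. Qed.

Lemma Q_close v l w : Q v l w -> normc (w.1 +i* w.2 - gw R K v l) <= 2 * rr v.
Proof.
case: w => x y [/=]; rewrite !in_itv /= => /andP[a1 a2] /andP[b1 b2].
apply: le_trans (nc_ReIm _) _; case: (gw R K v l) a1 a2 b1 b2 => a b /= a1 a2 b1 b2.
have -> : 2 * rr v = rr v + rr v by lra.
by apply: lerD; rewrite ler_norml; apply/andP; split; lra.
Qed.

Lemma rr2 v : 2 * rr v = gh v / K%:R / 2.
Proof. by rewrite /rr; field; rewrite pnatr_eq0 -lt0n ltnW. Qed.

Lemma Q_disk v l w : Q v l w -> gh v / 2 <= 1 - normc (w.1 +i* w.2) <= 2 * gh v.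
Proof.
move=> /Q_close; rewrite rr2 => h; set z := _ +i* _ in h *.
have K2' : (2 : R) <= K%:R by rewrite ler_nat.
have g0 := gh_gt0 R v.
have hK : gh v / K%:R <= gh v / 2.
  have Kp : (0 : R) < K%:R by apply: lt_le_trans K2'.
  by rewrite ler_wpM2l ?(ltW g0)// lef_pV2 ?posrE.
have h1 := nc_sub_ge z (gw R K v l); have h2 := nc_sub_ge (gw R K v l) z.
rewrite (ncBC (gw R K v l)) in h2; rewrite !nc_gw in h1 h2.
by apply/andP; split; lra.
Qed.

Lemma Q_disjoint v l v' l' w : (l < gM K v)%N -> (l' < gM K v')%N -> Q v l w -> Q v' l' w -> (v, l) = (v', l').
Proof.
move=> h1 h2 /Q_close a /Q_close b; apply/eqP; apply: contraT => ne.
have := gw_separated K2 h1 h2 ne; rewrite ltNge => /negP[].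
apply: le_trans (nc_dist _ (w.1 +i* w.2) _) _; rewrite ncBC; apply: le_trans (lerD a b) _.
by rewrite le_eqVlt; apply/orP; left; apply/eqP; rewrite /rr; field; rewrite pnatr_eq0 -lt0n ltnW.
Qed.

Let Low v l z := forall w, Q v l w -> normc (Gam z) <= 2 * normc (Gam (w.1 +i* w.2)).
(** Threshold with p-th power 4^-v: over the K 2^v nodes of level v these powers sum to K 2^-v,
    hence to at most 2 K in total. *)
Let dl v : R := (4^-1 ^+ v) `^ p^-1.

(** The infimum over a square may be 0, where no point comes within a factor 2 of it; the summable
    threshold [dl] takes care of that case. *)
Lemma near_min : exists z : nat -> nat -> C, forall v l,
  (exists2 w, Q v l w & z v l = w.1 +i* w.2) /\ (Low v l (z v l) \/ normc (Gam (z v l)) <= dl v).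
Proof.
have ctr v l : Q v l (complex.Re (gw R K v l), complex.Im (gw R K v l)).
  by have r0 := rr_gt0 v; split; rewrite /= in_itv /=; apply/andP; split; lra.
have H (i : nat * nat) : exists z : C, (exists2 w, Q i.1 i.2 w & z = w.1 +i* w.2) /\
    (Low i.1 i.2 z \/ normc (Gam z) <= dl i.1).
  case: i => v l /=; have [[w [Qw sm]]|no] := pselect (exists w, Q v l w /\ normc (Gam (w.1 +i* w.2)) <= dl v).
    by exists (w.1 +i* w.2); split; [exists w|right].
  have d0 : 0 < dl v by rewrite powR_gt0// exprn_gt0// invr_gt0.
  pose V := [set normc (Gam (w.1 +i* w.2)) | w in Q v l].
  have hi : has_inf V.
    split; first by exists (normc (Gam ((complex.Re (gw R K v l)) +i* (complex.Im (gw R K v l))))); exists (complex.Re (gw R K v l), complex.Im (gw R K v l)).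
    by exists 0 => _ [w _ <-]; exact: nc_ge0.
  have lb w : Q v l w -> inf V <= normc (Gam (w.1 +i* w.2)) by move=> Qw; apply: ge_inf; [exact: hi.2|exists w].
  have i0 : dl v <= inf V.
    apply: lb_le_inf; first exact: hi.1.
    by move=> _ [w Qw <-]; rewrite leNgt; apply/negP => lt; apply: no; exists w; split=> //; exact: ltW.
  have ip : 0 < inf V by apply: lt_le_trans i0.
  have [_ [w Qw <-] hw] := inf_adherent ip hi.
  exists (w.1 +i* w.2); split; first by exists w.
  by left => w' /lb h; apply: le_trans (ltW hw) _; lra.
by have [f Hf] := choice H; exists (fun v l => f (v, l)) => v l; exact: (Hf (v, l)).
Qed.

(** At a near minimum the p-th power of the weight is, up to a constant, at most the integral over
    the square; the squares are disjoint, so these add up to at most the Besov integral. *)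
Theorem selection : exists2 z, close_grid K z & exists A : R, forall V,
  \sum_(v < V) \sum_(l < gM K v) (normc (Gam (z v l)) * gh v ^+ m) `^ p <= A.
Proof.
have [z Hz] := near_min; exists z.
  move=> v l lM; have [[w Qw ->] _] := Hz v l; have := Q_close Qw; rewrite rr2.
  have : 0 <= gh v / K%:R by rewrite divr_ge0 ?(ltW (gh_gt0 R v)).
  by lra.
pose D := [set w : R * R | @unit_disk R (w.1 +i* w.2)].
pose I := (\int[mu]_(w in D) (Psi (w.1 +i* w.2))%:E)%E.
have Psi0 w : 0 <= Psi w by rewrite /Psi !mulr_ge0 ?powR_ge0 ?invr_ge0 ?sqr_ge0.
have I0 : (0 <= I)%E by apply: integral_ge0 => w _; rewrite lee_fin.
have Ifin : (I < +oo)%E.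
  have := hb.2; rewrite /disk_integral -/Psi -/D; rewrite -/I.
  case: I I0 => [r _ _|_|//]; first exact: ltry.
  by rewrite gt0_muley// lte_fin invr_gt0 pi_gt0.
have [B IB] : exists B : R, (I <= B%:E)%E.
  by exists (fine I); rewrite fineK// ge0_fin_numE.
pose low v l : bool := `[< Low v l (z v l) >].
pose G v l := normc (Gam (z v l)) * gh v ^+ m.
have G0 v l : 0 <= G v l by rewrite mulr_ge0 ?nc_ge0 ?exprn_ge0 ?(ltW (gh_gt0 R v)).
(* One factor 2 is lost at the near minimum and 2^m by h <= 2 (1 - |w|) on the square; the 4 h^2
   below comes from 1 - |w| <= 2 h. *)
pose b0 : R := (2 ^+ m.+1) `^ p; have b00 : 0 < b0 by rewrite powR_gt0// exprn_gt0.
pose c (i : nat * nat) := if low i.1 i.2 && (i.2 < gM K i.1)%N then G i.1 i.2 `^ p / b0 / (4 * gh i.1 ^+ 2) else 0.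
have c0 i : 0 <= c i.
  rewrite /c; case: ifP => // _; apply: divr_ge0; last by rewrite mulr_ge0 ?sqr_ge0.
  by rewrite divr_ge0 ?powR_ge0// ltW.
have cPsi i w : Q i.1 i.2 w -> c i <= Psi (w.1 +i* w.2).
  move=> Qw; rewrite /c; case: ifP => [/andP[/asboolP Lw _]|_]; last exact: Psi0.
  have /andP[d1 d2] := Q_disk Qw; have := Lw w Qw; rewrite /Psi.
  set d := 1 - normc _ in d1 d2 *; set x := normc (Gam (w.1 +i* w.2)) => xl.
  have g0 := gh_gt0 R i.1; have d0 : 0 < d by lra.
  have x0 : 0 <= x by exact: nc_ge0.
  rewrite powRrM powR_mulrn ?(ltW d0)// -powRM ?exprn_ge0 ?(ltW d0)//.
  have e1 : G i.1 i.2 `^ p / b0 <= (x * d ^+ m) `^ p.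
    rewrite ler_pdivrMr// -powRM ?mulr_ge0 ?exprn_ge0 ?(ltW d0)//; apply: (le_powR p0) => //.
    have dm : gh i.1 ^+ m <= (2 * d) ^+ m by apply: lerXn2r; rewrite ?nnegrE ?mulr_ge0 ?(ltW d0) ?(ltW g0)//; lra.
    apply: le_trans (_ : 2 * x * (2 * d) ^+ m <= _).
      by apply: ler_pM => //; [exact: nc_ge0|apply: exprn_ge0; exact: ltW].
    by rewrite exprMn exprS le_eqVlt; apply/orP; left; apply/eqP; ring.
  have e2 : (4 * gh i.1 ^+ 2)^-1 <= (d ^+ 2)^-1.
    rewrite lef_pV2 ?posrE; [nra|by rewrite mulr_gt0// exprn_gt0|exact: exprn_gt0].
  apply: ler_pM => //; first by apply: divr_ge0; [exact: powR_ge0|exact: ltW].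
  by rewrite invr_ge0 mulr_ge0 ?sqr_ge0.
have cover V : \sum_(i <- box K V) c i * (2 * rr i.1) ^+ 2 <= B.
  have [_ E] := integral_squares (box K V) (fun i => complex.Re (gw R K i.1 i.2))
    (fun i => complex.Im (gw R K i.1 i.2)) c0 (fun i => ltW (rr_gt0 i.1)).
  rewrite -lee_fin -E; apply: le_trans IB; rewrite /I [leRHS]integral_mkcond; apply: integral_mono => w.
    by rewrite lee_fin; apply: sumr_ge0 => i _; rewrite mulr_ge0.
  have [[i [iB Qi]]|no] := pselect (exists i, i \in box K V /\ Q i.1 i.2 w); last first.
    rewrite big1_seq; first by rewrite /patch; case: ifP => // _; rewrite lee_fin.
    move=> i /andP[_ iB]; rewrite indicE memNset ?mulr0// => Qi; apply: no; by exists i.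
  have Dw : D w.
    suff : normc (w.1 +i* w.2) < 1 by [].
    by have /andP[h _] := Q_disk Qi; have := gh_gt0 R i.1; lra.
  rewrite /patch mem_set// lee_fin (bigD1_seq i)/= ?uniq_box// [X in _ + X]big1_seq ?addr0.
    by rewrite indicE mem_set// mulr1; exact: cPsi.
  move=> j /andP[ji jB]; rewrite indicE memNset ?mulr0// => Qj.
  move: iB jB ji; case: i j Qi Qj => [v l] [v' l'] Qi Qj; rewrite !mem_box => /andP[_ h1] /andP[_ h2].
  by rewrite (Q_disjoint h2 h1 Qj Qi) eqxx.
(* Inverts the constants of [c]: the square has area (2 rr)^2 = h^2 / (4 K^2). *)
pose k0 : R := b0 * (16 * K%:R ^+ 2).
have Kp : (0 : R) < K%:R by rewrite ltr0n ltnW.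
have k00 : 0 <= k0.
  by apply: mulr_ge0; [exact: ltW|apply: mulr_ge0 => //; exact: sqr_ge0].
exists (k0 * B + 2 * K%:R) => V.
have term v l : (l < gM K v)%N -> G v l `^ p <= k0 * (c (v, l) * (2 * rr v) ^+ 2) + 4^-1 ^+ v.
  move=> lM; have [lw|nl] := boolP (low v l).
    apply: le_trans (_ : k0 * (c (v, l) * (2 * rr v) ^+ 2) <= _); last by rewrite lerDl exprn_ge0// invr_ge0.
    rewrite /c /= lw lM /= rr2 /k0 le_eqVlt; apply/orP; left; apply/eqP.
    by have g0 := gh_gt0 R v; field; rewrite !gt_eqF.
  have [_ [L|sm]] := Hz v l; first by case/negP: nl; apply/asboolP.
  apply: le_trans (_ : 4^-1 ^+ v <= _); last first.
    rewrite lerDr; apply: mulr_ge0 => //; apply: mulr_ge0 => //; exact: sqr_ge0.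
  apply: le_trans (_ : dl v `^ p <= _).
    apply: (le_powR p0); first exact: G0.
    apply: le_trans sm; rewrite /G ler_piMr ?nc_ge0// exprn_ile1 ?(ltW (gh_gt0 R v))//.
    by have := gh_le R v; lra.
  by rewrite /dl -powRrM mulVf ?gt_eqF// powRr1// exprn_ge0// invr_ge0.
apply: (@le_trans _ _ (\sum_(v < V) \sum_(l < gM K v) (k0 * (c (v : nat, l : nat) * (2 * rr v) ^+ 2) + 4^-1 ^+ v))).
  by apply: ler_sum => v _; apply: ler_sum => l _; exact: term.
rewrite (eq_bigr (fun v : 'I_V => \sum_(l < gM K v) k0 * (c (v : nat, l : nat) * (2 * rr v) ^+ 2) + K%:R * 2^-1 ^+ v)); last first.
  move=> v _; rewrite big_split /= sumr_const card_ord; congr (_ + _).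
  rewrite -[LHS]mulr_natl /gM natrM -mulrA; congr (_ * _).
  by rewrite natrX -exprMn; congr (_ ^+ _); lra.
rewrite big_split /=; apply: lerD.
  have -> : \sum_(v < V) \sum_(l < gM K v) k0 * (c (v : nat, l : nat) * (2 * rr v) ^+ 2) =
      k0 * \sum_(i <- box K V) c i * (2 * rr i.1) ^+ 2.
    rewrite -(sum_box K V (fun v l => k0 * (c (v, l) * (2 * rr v) ^+ 2))) mulr_sumr.
    by apply: eq_bigr => -[v l] _.
  by apply: ler_wpM2l => //; exact: cover.
rewrite -mulr_sumr mulrC ler_wpM2r ?(ltW Kp)//.
have h : 0 <= (2^-1 : R) < 1 by apply/andP; split; lra.
apply: le_trans (geo_sum_le V h) _.
by have -> : (1 - 2^-1 : R) = 2^-1; [lra|rewrite invrK].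
Qed.

End Selection.

Lemma nth_sort_count (R : realType) (y : seq R) (tau : R) r :
  (r < count (>= tau) y)%N -> tau <= nth 0 (sort >=%R y) r.
Proof.
set v := sort _ y => lt.
have vy : perm_eq v y by exact: permEl (perm_sort _ _).
have sv : sorted >=%R v by apply: sort_sorted => a b; exact: le_total.
rewrite leNgt; apply/negP => gt; move: lt; rewrite -(permP vy) ltnNge => /negP; apply.
rewrite -{1}[v](cat_take_drop r) count_cat.
have -> : count (>= tau) (drop r v) = 0%N; last first.
  rewrite addn0; apply: leq_trans (count_size _ _) _; rewrite size_take; case: ltnP => //.
apply/eqP; rewrite -leqn0 leqNgt -has_count; apply/hasPn => a /(nthP (0 : R)) [i iv <-].
move: iv; rewrite size_drop ltn_subRL nth_drop => iv; rewrite -ltNge; apply: le_lt_trans gt.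
have tr : transitive (>=%R : rel R) by move=> b c d ba cb; exact: le_trans cb ba.
have rv : (r < size v)%N := leq_ltn_trans (leq_addr i r) iv.
by have := sorted_leq_nth tr (@lexx _ R) 0 sv r (r + i)%N rv iv (leq_addr i r).
Qed.

Lemma sum_nth_sort (R : realType) (y : seq R) (p : R) N : 0 < p ->
  \sum_(r < N) (nth 0 (sort >=%R y) r) `^ p <= \sum_(a <- y) a `^ p.
Proof.
move=> p0; set v := sort _ y.
have vy : perm_eq v y by exact: permEl (perm_sort _ _).
rewrite -(perm_big _ vy) /= (big_nth 0) big_mkord.
apply: le_trans (@sum_if_le R (fun r => v`_r `^ p) (size v) N _); last by move=> j; exact: powR_ge0.
apply: ler_sum => r _; case: ltnP => // le.
by rewrite nth_default// powR0 // gt_eqF.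
Qed.

(** * Sufficiency: codimension counts and the Schatten sum *)

Section Sufficiency.
Variable R : realType.
Local Notation C := R[i].
Local Notation H2 := (@hardy2 R).
Local Notation ip := (@hardy2_ip R).
Local Notation nrm := (ipnorm ip).
Local Notation HS := (hardy2_ips R).
Local Notation tc := (@taylor_coef R).
Local Notation gh := (@gh R).
Variables (g : C -> C) (n k K : nat) (p A : R) (z : nat -> nat -> C).
Local Notation T := (volterra g n k).
Local Notation Gam := (cderiv (n - k) g).
Hypotheses (hg : holo g) (kn : (k < n)%N) (p0 : 0 < p) (K2 : (2 <= K)%N) (cz : close_grid K z).
Hypothesis Tb : bounded_operator H2 ip T.
Hypothesis samp : forall u, H2 u -> (forall j, (j < n)%N -> tc u j = 0) ->
  forall E : R, (forall V, \sum_(v < V) \sum_(l < gM K v) gh v ^+ (2 * n).+1 * normc (cderiv n u (z v l)) ^+ 2 <= E) ->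
  nrm u ^+ 2 <= 4 * E.
Let G v l : R := normc (Gam (z v l)) * gh v ^+ (n - k).
Hypothesis GA : forall V, \sum_(v < V) \sum_(l < gM K v) G v l `^ p <= A.

(** The sample point of the parent node; nodes of level 0 have the origin as parent. *)
Let zp v l : C := if v is v'.+1 then z v' (l %/ 2)%N else 0.

Lemma parent_lt v l : (l < gM K v.+1)%N -> (l %/ 2 < gM K v)%N.
Proof. by have -> : gM K v.+1 = (gM K v * 2)%N; [rewrite -[v.+1]addn1 gMD expn1|rewrite ltn_divLR]. Qed.

Lemma parent_near : exists2 B : R, 0 <= B & forall v l, (l < gM K v)%N ->
  [/\ near_node K B (z v l) v l, near_node K B (zp v l) v l & normc (z v l - zp v l) <= (1 + B) * gh v].
Proof.
pose P : R := 4 * pi; have P0 : 0 <= P by rewrite mulr_ge0 ?pi_ge0.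
have K2' : (2 : R) <= K%:R by rewrite ler_nat.
have Kp : (0 : R) < K%:R by apply: lt_le_trans K2'.
have hK v : gh v / K%:R <= gh v / 2.
  by rewrite ler_wpM2l ?(ltW (gh_gt0 R v))// lef_pV2 ?posrE.
exists (P + 4) => [|v l lM]; first by rewrite addr_ge0.
have n1 : near_node K (P + 4) (z v l) v l.
  apply: close_near => //; have : (1 : R) <= 4 by rewrite ler1n.
  by move=> ?; lra.
have zw := @cz v l lM; have g0 := gh_gt0 R v; have g2 := gh_le R v.
have n2 : near_node K (P + 4) (zp v l) v l.
  case: v lM {n1} zw g0 g2 => [|v] lM zw g0 g2 /=.
    split; first by rewrite nc0 subr0; lra.
    rewrite sub0r ncN nc_gw; have -> : gh 0 = 1 / 2 by rewrite /gh expr1 mul1r.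
    lra.
  have lM' := parent_lt lM; have zw' := @cz v (l %/ 2)%N lM'; have hK' := hK v.
  have gv : gh v.+1 = gh v / 2 by rewrite -[v.+1]addn1 ghD expr1.
  have gv0 := gh_gt0 R v.
  have zn := nc_sub_ge (z v (l %/ 2)%N) (gw R K v (l %/ 2)); rewrite nc_gw in zn.
  split; first by lra.
  have ww : normc (gw R K v (l %/ 2) - gw R K v.+1 l) <= (P + 1) * gh v.+1.
    have M0 := gM_gt0 v K2.
    pose W := om R (gM K v.+1).
    have E1 : gw R K v (l %/ 2) = (1 - gh v)%:C * W ^+ (l %/ 2 * 2).
      have MM : gM K v.+1 = (gM K v * 2)%N by rewrite -[v.+1]addn1 gMD expn1.
      by rewrite /W MM /gw -(@om_pow R 2 (gM K v) isT M0) -exprM [(2 * _)%N]mulnC.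
    have lE : l = (l %/ 2 * 2 + l %% 2)%N by exact: divn_eq.
    have E2 : gw R K v (l %/ 2) - gw R K v.+1 l =
      - (gh v.+1)%:C * W ^+ (l %/ 2 * 2) - (1 - gh v.+1)%:C * W ^+ (l %/ 2 * 2) * (W ^+ (l %% 2) - 1).
      rewrite E1 /gw -/W [in X in _ - X]lE exprD.
      have -> : (1 - gh v)%:C = (1 - gh v.+1)%:C - (gh v.+1)%:C :> C.
        by rewrite -raddfB /=; congr (_%:C); rewrite gv; lra.
      by ring.
    have W1 : normc (W ^+ (l %% 2) - 1) <= P / (gM K v.+1)%:R.
      have : (l %% 2 < 2)%N by rewrite ltn_mod.
      case: (l %% 2)%N => [|[|//]] _; last by rewrite expr1; exact: om_sub1.
      by rewrite expr0 subrr nc0 divr_ge0.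
    have PM : P / (gM K v.+1)%:R <= P * gh v.+1.
      have M1 : (0 : R) < (gM K v.+1)%:R by rewrite ltr0n gM_gt0.
      rewrite ler_pdivrMr// -mulrA; have e := gMh R K v.+1; rewrite [gh v.+1 * _]mulrC e.
      by rewrite ler_peMr//; lra.
    rewrite E2; apply: le_trans (ncB _ _) _; rewrite !ncM !nc_omX ncN !nc_real !mulr1.
    rewrite ger0_norm ?(ltW g0)// ger0_norm; last by lra.
    have := nc_ge0 (W ^+ (l %% 2) - 1); nra.
  apply: le_trans (nc_dist _ (gw R K v (l %/ 2)) _) _; lra.
split=> //; apply: le_trans (nc_dist _ (gw R K v l) _) _.
rewrite (ncBC (gw R K v l)); have [_ h2] := n2.
have := hK v; lra.
Qed.

Let D (h : C -> C) v l : C := cderiv k h (z v l) - cderiv k h (zp v l).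

(** The d-th ancestor of (v, l) is (v - d, l / 2^d), so the increments add up along the branch from
    the origin. *)
Lemma telescope h v l : \sum_(d < v.+1) D h (v - d) (l %/ 2 ^ d) = cderiv k h (z v l) - cderiv k h 0.
Proof.
elim: v l => [|v ih] l; first by rewrite big_ord1 expn0 divn1.
rewrite big_ord_recl /= subn0 expn0 divn1.
rewrite (eq_bigr (fun d : 'I_v.+1 => D h (v - d) ((l %/ 2) %/ 2 ^ d))); last first.
  by move=> d _; rewrite /bump /= add1n subSS expnS divnMA.
by rewrite ih /D /= addrCA subrK addrC || (rewrite ih /D /=; ring).
Qed.

Variables (q th : R).
Hypotheses (q01 : 0 < q < 1) (th01 : 0 < th < 1).
Hypothesis fam : forall d (x : nat -> R) (tau : R), (forall i, 0 <= x i) -> 0 < tau ->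
    q ^+ d * (\sum_(e < 2 ^ d) x e `^ p) <= tau `^ p ->
    \sum_(e < 2 ^ d) x e ^+ 2 <= 2 * tau ^+ 2 * (2 * th ^+ 2) ^+ d.
Local Notation bad := (bad K p q G).
Local Notation dsum := (dsum p q G).

Lemma G_ge0 v l : 0 <= G v l.
Proof. by rewrite mulr_ge0 ?nc_ge0 ?exprn_ge0 ?(ltW (gh_gt0 R v)). Qed.

(** Orthogonality to differences of kernels kills the increments at bad nodes. The remaining
    increments are square-summable by [diff_bessel], pass through [tree_schur] with norm of order
    tau, and [sampling] converts the samples of (T h)^(n) into the norm of T h. *)
Lemma good_subspace : exists2 c1 : R, 0 < c1 & forall tau, 0 < tau -> exists V0,
  exists v : 'I_(size (bad tau V0)).+1 -> C -> C, (forall i, H2 (v i)) /\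
    forall h, H2 h -> (forall i, ip h (v i) = 0) -> nrm (T h) <= c1 * tau * nrm h.
Proof.
have [B B0 nB] := parent_near; have [E E0 HE] := @diff_bessel R k B B0.
have s0 : 0 < 1 - th by rewrite subr_gt0; case/andP: th01.
pose CK := E * ((1 + B) * K%:R); have CK0 : 0 <= CK by rewrite !mulr_ge0// addr_ge0.
pose c1 := Num.sqrt (4 * (2 / (1 - th) ^+ 2 * (CK + 1))).
have c1p : 0 < 4 * (2 / (1 - th) ^+ 2 * (CK + 1)).
  have : 0 < CK + 1 by rewrite ltr_wpDl.
  by move=> ?; rewrite !mulr_gt0// invr_gt0 exprn_gt0.
exists c1 => [|tau t0]; first by rewrite sqrtr_gt0.
have [V0 st] := bad_stable q01 GA t0; exists V0.
pose bi (i : nat) := nth (0%N, 0%N) (bad tau V0) i.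
(* The additional condition, by the kernel at 0, removes the constant h^(k)(0) left over in
   [telescope]. *)
pose v (i : 'I_(size (bad tau V0)).+1) : C -> C :=
  if i is Ordinal j.+1 _ then hker k (z (bi j).1 (bi j).2) - hker k (zp (bi j).1 (bi j).2) else hker k 0.
have zd v' l : (l < gM K v')%N -> normc (z v' l) < 1 /\ normc (zp v' l) < 1.
  by move=> lM; have [/near_disk ? /near_disk ? _] := nB _ _ lM.
have o1 : normc (0 : C) < 1 by rewrite nc0.
have bval i : i \in bad tau V0 -> (i.2 < gM K i.1)%N.
  by case: i => v' l; rewrite mem_filter mem_box => /andP[_ /andP[]].
have biv j : (j.+1 < (size (bad tau V0)).+1)%N -> ((bi j).2 < gM K (bi j).1)%N.
  by move=> js; apply: bval; exact: mem_nth.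
exists v; split.
  case=> -[|j] lt /=; first exact: hker_H2.
  by have [d1 d2] := zd _ _ (biv j lt); exact: (HB HS (hker_H2 k d1) (hker_H2 k d2)).
move=> h hh hv.
have F0 : cderiv k h 0 = 0 by rewrite -(ip_hker k hh o1); exact: (hv ord0).
have Dbad v' l : (v', l) \in bad tau V0 -> D h v' l = 0.
  move=> vb; pose j := index (v', l) (bad tau V0).
  have jlt : (j.+1 < (size (bad tau V0)).+1)%N by rewrite ltnS index_mem.
  have := hv (Ordinal jlt); rewrite /v /=; have -> : bi j = (v', l) by exact: nth_index.
  have [d1 d2] := zd _ _ (bval _ vb).
  rewrite (ipBr HS (hker_H2 k d1) (hker_H2 k d2) hh) => <-; rewrite /D.
  by congr (_ - _); [rewrite -(ip_hker k hh d1)|rewrite -(ip_hker k hh d2)].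
have good v' l : (l < gM K v')%N -> D h v' l = 0 \/ forall V, dsum V v' l <= tau `^ p.
  move=> lM; have [vb|nb] := boolP ((v', l) \in bad tau V0); [left; exact: Dbad|right; exact: st].
have hT := op_H Tb hh.
have dl0 : 0 <= 1 + B by rewrite addr_ge0.
have H3 v' l : (l < gM K v')%N -> [/\ near_node K B (z v' l) v' l, near_node K B (zp v' l) v' l
     & normc (z v' l - zp v' l) <= (1 + B) * gh v'] by exact: nB.
have main V : \sum_(v < V) \sum_(l < gM K v) gh v ^+ (2 * n).+1 * normc (cderiv n (T h) (z v l)) ^+ 2
    <= 2 / (1 - th) ^+ 2 * tau ^+ 2 * ((CK + 1) * nrm h ^+ 2).
  apply: le_trans (_ : 2 / (1 - th) ^+ 2 * tau ^+ 2 *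
     \sum_(v < V) \sum_(l < gM K v) gh v ^+ (2 * k).+1 * normc (D h v l) ^+ 2 <= _); last first.
    apply: ler_wpM2l; first by apply: mulr_ge0; [apply: mulr_ge0; [exact: ler0n|rewrite invr_ge0 sqr_ge0]|exact: sqr_ge0].
    apply: (@le_trans _ _ (CK * nrm h ^+ 2)); first exact: (HE K V (1 + B) z zp K2 dl0 H3 h hh).
    by rewrite ler_wpM2r ?sqr_ge0// lerDl.
  apply: le_trans (tree_schur q01 th01 fam G_ge0 k V t0 good).
  apply: ler_sum => v' _; apply: ler_sum => l _; rewrite telescope F0 subr0.
  have [d1 _] := zd v' l (ltn_ord l).
  rewrite (@cderiv_volterra_n R g n k hg _ _ (hardy2_holo hh) d1) ncM /G.
  rewrite le_eqVlt; apply/orP; left; apply/eqP.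
  have -> : (2 * n).+1 = ((2 * k).+1 + ((n - k) + (n - k)))%N by rewrite addSn addnn -mul2n -mulnDr subnKC// ltnW.
  by rewrite !exprD; ring.
have tc0' j : (j < n)%N -> tc (T h) j = 0 
  by move=> jn; exact: (@tc_volterra R g n k hg h j (hardy2_holo hh) jn).
have := samp hT tc0' main => S.
have nn f : 0 <= nrm f by exact: sqrtr_ge0.
have nT := nn (T h).
have rhs0 : 0 <= c1 * tau * nrm h.
  by apply: mulr_ge0; [apply: mulr_ge0; [exact: sqrtr_ge0|exact: ltW]|exact: nn].
rewrite -(ler_pXn2r (isT : (0 < 2)%N)) ?nnegrE//; apply: le_trans S _.
have c1E := sqr_sqrtr (ltW c1p).
rewrite (exprMn 2 (c1 * tau)) (exprMn 2 c1 tau) [c1 ^+ 2]c1E.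
by rewrite le_eqVlt; apply/orP; left; apply/eqP; ring.
Qed.

Lemma sufficiency_schatten : schatten_class H2 ip p T.
Proof.
have [c1 c10 key] := good_subspace.
have Tc : compact_operator H2 ip T.
  apply: compact_criterion => // tau t0.
  have tc0 : 0 < tau / c1 by rewrite divr_gt0.
  have [V0 [v [hv Hv]]] := key _ tc0; exists (size (bad (tau / c1) V0)).+1, v; split=> // h hh h0.
  by have := Hv h hh h0; rewrite mulrCA mulfV ?mulr1// gt_eqF.
have [S TS] := adjoint_exists Tb.
have [s sv s_codim] : exists2 s, singular_value_sequence H2 ip T s &
    forall (t : R) m (L : 'I_m -> (C -> C) -> C),
      (forall j (c : C) f f', H2 f -> H2 f' -> L j (c *: f + f') = c * L j f + L j f') ->
      0 <= t -> (forall h, H2 h -> (forall j, L j h = 0) -> nrm (T h) <= t * nrm h) -> s m <= t.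
  by eexists; [exact: (sval_singular HS Tc TS)|move=> t m L; exact: (sval_le_codim HS Tc TS)].
have [s_ge0 s_dec _] := sv; split=> //; exists s => //.
(* If only r nodes were bad for this tau, the r + 1 conditions of [good_subspace] would give s_(r+1)
   <= c1 tau = s_(r+1) / 2. So more than r nodes are bad, which compares [tau r] with the r-th
   largest discounted sum. *)
pose tau r := s r.+1 / (2 * c1).
have tau_ge0 r : 0 <= tau r by rewrite divr_ge0// mulr_ge0// ltW.
have step r : exists V, 0 < tau r -> (r < size (bad (tau r) V))%N.
  have [t0|t0] := ltP 0 (tau r); last by exists 0%N.
  have [V0 [v [hv Hv]]] := key _ t0; exists V0 => _; rewrite ltnNge; apply/negP => le.
  have le1 : s (size (bad (tau r) V0)).+1 <= c1 * tau r.
    apply: (s_codim _ _ (fun i f => ip f (v i))).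
    - by move=> j c f f' hf hf'; exact: (ips_linl HS).
    - by rewrite mulr_ge0// ltW.
    - by move=> h hh h0; exact: Hv.
  have : s r.+1 <= c1 * tau r by apply: le_trans le1; apply: s_dec.
  have -> : c1 * tau r = s r.+1 / 2 by rewrite /tau; field; rewrite gt_eqF.
  have : 0 < s r.+1 by move: t0; rewrite /tau pmulr_lgt0// invr_gt0 mulr_gt0.
  lra.
have [Vr HVr] := choice step.
have bound N : \sum_(r < N) tau r `^ p <= A / (1 - q).
  (* One depth serving all r < N, so that a single sorted list dominates all of the values
     [tau r]. *)
  pose Vs := (\max_(r < N) Vr r)%N.
  pose y := [seq dsum Vs i.1 i.2 `^ p^-1 | i <- box K Vs].
  have yE : \sum_(a <- y) a `^ p = \sum_(i <- box K Vs) dsum Vs i.1 i.2.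
    rewrite big_map; apply: eq_bigr => i _.
    have d0 : 0 <= dsum Vs i.1 i.2 by apply: dsum_ge0.
    by rewrite -powRrM (mulVf (lt0r_neq0 p0)) powRr1.
  apply: (le_trans _ (dsum_total q01 GA Vs Vs)); rewrite -(sum_box K Vs (dsum Vs)) -yE.
  apply: (le_trans _ (sum_nth_sort y N p0)); apply: ler_sum => r _.
  apply: (le_powR p0); first exact: tau_ge0.
  have [t0|t0] := ltP 0 (tau r); last first.
    apply: le_trans t0 _; have [lt|ge] := ltnP r (size (sort >=%R y)); last by rewrite nth_default.
    have := mem_nth 0 lt; rewrite mem_sort => /mapP[i _ ->]; exact: powR_ge0.
  apply: nth_sort_count; apply: leq_trans (HVr r t0) _.
  have VV : (Vr r <= Vs)%N by exact: (leq_bigmax r).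
  have ub : uniq (bad (tau r) (Vr r)) by apply: filter_uniq; exact: uniq_box.
  apply: (@leq_trans (size (bad (tau r) Vs))).
    by apply: uniq_leq_size => //; apply: bad_mono.
  rewrite size_filter count_map; apply: sub_count => i /= lt.
  have h1 : (tau r `^ p) `^ p^-1 <= dsum Vs i.1 i.2 `^ p^-1.
    by apply: le_powR; [rewrite invr_gt0|exact: powR_ge0|exact: ltW].
  by move: h1; rewrite -powRrM (mulfV (lt0r_neq0 p0)) powRr1 ?tau_ge0.
apply/series_ltyP; first by move=> j; exact: powR_ge0.
(* The term s_0 is paid separately, since the comparison starts at s_1. *)
exists (s 0%N `^ p + (2 * c1) `^ p * (A / (1 - q))) => N.
apply: (@le_trans _ _ (\sum_(j < N.+1) s j `^ p)).
  by rewrite [leRHS]big_ord_recr /= lerDl powR_ge0.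
rewrite big_ord_recl lerD2l.
apply: (le_trans _ (ler_wpM2l (powR_ge0 _ _) (bound N))); rewrite mulr_sumr; apply: ler_sum => r _.
have c20 : 0 <= 2 * c1 by rewrite mulr_ge0// ltW.
have -> : s (lift ord0 r) = 2 * c1 * tau r by rewrite lift0 /tau; field; rewrite gt_eqF.
by rewrite powRM ?tau_ge0.
Qed.

End Sufficiency.

Theorem corollary2 (R : realType) (p : R) (hp : 0 < p) (k n : nat)
    (hkn : (k < n)%N) (g : R[i] -> R[i]) (hg : analytic_disk g)
    (hT : bounded_operator (@hardy2 R) (@hardy2_ip R) (volterra g n k)) :
  schatten_class (@hardy2 R) (@hardy2_ip R) p (volterra g n k) <->
  besov p (n - k) g.
Proof.
have n0 : (0 < n)%N by exact: leq_ltn_trans (leq0n k) hkn.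
split.
- move=> [Tc [s [s0 sd [S TS sdim]] hs]].
  have [A sA] := (series_ltyP (fun j => powR_ge0 (s j) p)).1 hs.
  exact: (necessity_besov hg hkn Tc TS s0 sd sdim hp sA).
(* The order matters: K depends on n only and must be fixed first; the points are then selected on
   the grid of that density, and sampling holds for any points close to it. *)
- move=> hb; have [K K2 samp] := @sampling R n n0.
  have [z cz [A GA]] := @selection R g (n - k) K p hp K2 hb.
  have [q [th [q01 th01 fam]]] := family_power hp.
  exact: (sufficiency_schatten (analytic_holo hg) hkn hp K2 cz hT (samp z cz) GA q01 th01 fam).
Qed.
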